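(* Let $\Omega\subset\mathbb{R}^d$, $k\in\mathbb{N}$, and let $a,b,q,p(\nabla),P,V$ be as described in the context (in particular $C_*I\le a(\mathbf{x})\le C^*I$ for a.e. $\mathbf{x}\in\Omega$ with $0<C_*\le C^*$). Suppose that $f\in H^1_{\rm loc}(\mathbb{R},L^2(\Omega)^k)$ and that $f$ is causal, i.e. $f=0$ for $t<0$. Then there exists a unique causal $u\in C^1(\mathbb{R},L^2(\Omega)^k)\cap C^0(\mathbb{R},V)$ satisfying $$a\frac{\partial u}{\partial t}+p(\nabla)u+bu+q*u=f$$ a.e. in $\Omega$ for each $t\in\mathbb{R}$. Moreover, there exists an increasing function $C:\mathbb{R}_+\to\mathbb{R}_+$, depending on $C_*$, $C^*$ and bounds for $b,q$, such that for every $t\ge 0$ $$\left\|\frac{\partial u}{\partial t}(\cdot,t)\right\|^2_{L^2(\Omega)^k}+\|u(\cdot,t)\|_V^2\le C(t)\int_0^t\left[\|f(\cdot,\tau)\|^2_{L^2(\Omega)^k}+\left\|\frac{\partial f}{\partial t}(\cdot,\tau)\right\|^2_{L^2(\Omega)^k}\right]d\tau .$$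
   Context: All functions are real-valued; $\mathbb{R}_+=[0,\infty)$. $\Omega\subset\mathbb{R}^d$ is a domain with interior $\Omega^{\rm int}$. The coefficients are: $a\in L^\infty(\Omega,\mathbb{R}^{k\times k}_{\rm symm})$ with $C_*I\le a(\mathbf{x})\le C^*I$ for a.e. $\mathbf{x}\in\Omega$, where $0<C_*\le C^*$; $b\in L^\infty(\Omega,\mathbb{R}^{k\times k})$; $q\in L^1(\mathbb{R},L^\infty(\Omega,\mathbb{R}^{k\times k}_{\rm symm}))$ with $q(\cdot,t)=0$ for $t<0$. Here $(q*u)(\mathbf{x},t)=\int q(\mathbf{x},t-s)u(\mathbf{x},s)\,ds$. $p(\nabla)u=\sum_{j=1}^d p_j\,\partial u/\partial x_j$ with constant symmetric matrices $p_j\in\mathbb{R}^{k\times k}$. It is viewed initially as a densely defined skew-symmetric operator on $L^2(\Omega)^k$ whose domain is a subset of $C^\infty(\Omega^{\rm int})^k$ containing $C_0^\infty(\Omega^{\rm int})^k$. It is assumed that $p(\nabla)$ extends to a skew-adjoint operator $P$ with dense domain $V\subset L^2(\Omega)^k$, and $V$ carries the graph norm of $P$ or an equivalent norm, denoted $\|\cdot\|_V$. $P$, $V$ and $\|\cdot\|_V$ are fixed. For $u(\cdot,t)\in V$, $p(\nabla)u$ means $Pu$. A function of $t$ is causal if it vanishes for $t<0$. *)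

(* Defs.v *)
From HB Require Import structures.
From mathcomp Require Import all_boot all_order all_algebra.
From mathcomp Require Import all_classical all_reals all_analysis ess_sup_inf.
Set Implicit Arguments.
Unset Strict Implicit.
Unset Printing Implicit Defensive.
Import Order.TTheory GRing.Theory Num.Theory.
Import numFieldNormedType.Exports.
Local Open Scope classical_set_scope.
Local Open Scope ring_scope.

Section measurable_matrix.
Context (R : realType) (m n : nat).

(* The sigma-algebra generated by the entries, i.e. the Borel sigma-algebra of
   the finite-dimensional space of matrices. *)
Definition mx_cylinder : set (set 'M[R]_(m, n)) :=
  [set A | exists i j B,
     measurable B /\ A = (fun M : 'M[R]_(m, n) => M i j) @^-1` B].

Let mx_set0 : <<s mx_cylinder >> set0.
Proof. exact: sigma_algebra0. Qed.

Let mx_setC A : <<s mx_cylinder >> A -> <<s mx_cylinder >> (~` A).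
Proof. exact: sigma_algebraC. Qed.

Let mx_bigcup (F : _^nat) : (forall i, <<s mx_cylinder >> (F i)) ->
  <<s mx_cylinder >> (\bigcup_i (F i)).
Proof. exact: sigma_algebra_bigcup. Qed.

HB.instance Definition _ := @isMeasurable.Build default_measure_display
  'M[R]_(m, n) <<s mx_cylinder >> mx_set0 mx_setC mx_bigcup.

Lemma measurable_mxP d (T : measurableType d) (D : set T)
    (f : T -> 'M[R]_(m, n)) :
  measurable D ->
  measurable_fun D f <-> forall i j, measurable_fun D (fun x => f x i j).
Proof.
move=> mD; split=> [mf i j|mf].
  move=> _ B mB; apply: (mf mD ((fun M : 'M[R]_(m, n) => M i j) @^-1` B)).
  by apply: sub_sigma_algebra; exists i, j, B.
apply: (@measurability _ _ _ _ _ _ mx_cylinder) => // _ [_ [i [j [B [mB ->]]]] <-].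
exact: mf.
Qed.

End measurable_matrix.

Section lebesgue_rV.
Context (R : realType).

Definition consrV n (z : R * 'rV[R]_n) : 'rV[R]_n.+1 :=
  \row_j oapp (z.2 0) z.1 (unlift ord0 j).

Definition unconsrV n (x : 'rV[R]_n.+1) : R * 'rV[R]_n :=
  (x 0 0, \row_j x 0 (lift ord0 j)).

Lemma consrVK n : cancel (@consrV n) (@unconsrV n).
Proof.
case=> a x; rewrite /unconsrV mxE unlift_none; congr pair.
by apply/rowP => j; rewrite !mxE liftK.
Qed.

Lemma measurable_consrV n : measurable_fun setT (@consrV n).
Proof.
apply/measurable_mxP => // i j; under eq_fun do rewrite mxE.
case: (unlift ord0 j) => [k|] /=; last exact: measurable_fst.
apply: (measurableT_comp (f := fun x : 'rV[R]_n => x 0 k)) => //.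
by have /measurable_mxP := @measurable_id _ 'rV[R]_n setT; apply.
Qed.

Lemma measurable_unconsrV n : measurable_fun setT (@unconsrV n).
Proof.
have h i : measurable_fun setT (fun x : 'rV[R]_n.+1 => x 0 i).
  by have /measurable_mxP := @measurable_id _ 'rV[R]_n.+1 setT; apply.
apply/measurable_fun_pairP; split; first exact: h.
by apply/measurable_mxP => // i j; under eq_fun do rewrite mxE; exact: h.
Qed.

Section cons.
Context n (mu : {sigma_finite_measure set 'rV[R]_n -> \bar R}).

Definition lebesgue_cons : set 'rV[R]_n.+1 -> \bar R :=
  pushforward (@lebesgue_measure R \x mu)%E (@consrV n).

Let lebesgue_cons0 : lebesgue_cons set0 = 0%E.
Proof. by rewrite /lebesgue_cons /pushforward preimage_set0 measure0. Qed.

Let lebesgue_cons_ge0 A : (0 <= lebesgue_cons A)%E.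
Proof. by rewrite /lebesgue_cons /pushforward measure_ge0. Qed.

Let lebesgue_cons_sigma_additive : semi_sigma_additive lebesgue_cons.
Proof.
have mpre A : measurable A -> measurable (@consrV n @^-1` A).
  by move=> mA; rewrite -[X in measurable X]setTI; exact: measurable_consrV.
move=> F mF tF mUF; rewrite /lebesgue_cons /pushforward preimage_bigcup.
apply: measure_semi_sigma_additive.
- by move=> k; exact: mpre.
- apply/trivIsetP => i j _ _ ij; rewrite -preimage_setI.
  by move/trivIsetP : tF => /(_ _ _ _ _ ij) ->//; rewrite preimage_set0.
- by rewrite -preimage_bigcup; exact: mpre.
Qed.

HB.instance Definition _ := isMeasure.Build _ _ _ lebesgue_cons
  lebesgue_cons0 lebesgue_cons_ge0 lebesgue_cons_sigma_additive.

Let lebesgue_cons_sigma_finite : sigma_finite setT lebesgue_cons.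
Proof.
have /sigma_finiteP[F [TF ndF Foo]] :=
  sigma_finiteT (@lebesgue_measure R : {sigma_finite_measure set _ -> \bar R}).
have /sigma_finiteP[G [TG ndG Goo]] := sigma_finiteT mu.
exists (fun k => @unconsrV n @^-1` (F k `*` G k)).
  apply/esym; rewrite -subTset => x _.
  have [i _ Fi] : (\bigcup_k F k) (unconsrV x).1 by rewrite -TF.
  have [j _ Gj] : (\bigcup_k G k) (unconsrV x).2 by rewrite -TG.
  exists (maxn i j) => //; split => /=.
  - by move: Fi; apply/subsetPset/ndF/leq_maxl.
  - by move: Gj; apply/subsetPset/ndG/leq_maxr.
move=> k; have [mF Fk] := Foo k; have [mG Gk] := Goo k; split.
  rewrite -[X in measurable X]setTI.
  by apply: measurable_unconsrV => //; exact: measurableX.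
rewrite /lebesgue_cons /pushforward -comp_preimage.
rewrite (_ : _ \o _ = id); last by apply/funext => z /=; rewrite consrVK.
by rewrite preimage_id product_measure1E// lte_mul_pinfty// ge0_fin_numE.
Qed.

HB.instance Definition _ := Measure_isSigmaFinite.Build _ _ _ lebesgue_cons
  lebesgue_cons_sigma_finite.

End cons.

(* Lebesgue measure on R^n, as the iterated product of the Lebesgue measure on
   the line (a Dirac mass on the one-point space R^0). *)
Fixpoint lebesgue_rV n : {sigma_finite_measure set 'rV[R]_n -> \bar R} :=
  match n with
  | 0 => \d_(0 : 'rV[R]_0)
  | n'.+1 => lebesgue_cons (lebesgue_rV n')
  end.

Lemma lebesgue_rV_box n (A : 'I_n -> set R) :
  (forall i, measurable (A i)) ->
  lebesgue_rV n [set x | forall i, A i (x 0 i)] =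
  (\prod_(i < n) @lebesgue_measure R (A i))%E.
Proof.
elim: n A => [|n IHn] A mA.
  by rewrite big_ord0 /= diracE mem_set // => -[].
pose B (i : 'I_n) := A (lift ord0 i).
have mB i : measurable (B i) by exact: mA.
have mbox : measurable [set x : 'rV[R]_n | forall i, B i (x 0 i)].
  have -> : [set x : 'rV[R]_n | forall i, B i (x 0 i)] =
      \bigcap_(i in [set: 'I_n]) (fun x : 'rV[R]_n => x 0 i) @^-1` B i.
    by apply/seteqP; split => x h i; [move=> _|]; apply: h.
  apply: fin_bigcap_measurable => // i _; rewrite -[X in measurable X]setTI.
  have /measurable_mxP h := @measurable_id _ 'rV[R]_n setT.
  by apply: (h measurableT 0 i).
rewrite big_ord_recl -(IHn B)// -product_measure1E//; last exact: mA.
rewrite /= /lebesgue_cons /pushforward.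
apply: (congr1 (fun X => (lebesgue_measure \x lebesgue_rV n)%E X)).
apply/seteqP; split => -[a x] /=.
  move=> h; split; first by have := h 0; rewrite mxE unlift_none.
  by move=> i; have := h (lift ord0 i); rewrite mxE liftK.
move=> [Aa Ax] i; rewrite mxE.
case: unliftP => [j|] -> ; [exact: Ax j|exact: Aa].
Qed.

End lebesgue_rV.

Section setting.
Context {R : realType} {d k : nat}.

Notation mu := (lebesgue_rV R d).
Notation leb := (@lebesgue_measure R).
Notation vfield := ('rV[R]_d -> 'cV[R]_k).
Notation mfield := ('rV[R]_d -> 'M[R]_k).

Implicit Types (W : set 'rV[R]_d) (u v w : vfield) (D V : set vfield).

(* A domain may contain part of its boundary. *)
Definition is_domain W :=
  [/\ measurable W, W° !=set0, connected W° & W `<=` closure W°].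

(* Elements of L^2(W)^k are represented by functions on R^d, of which only the
   values almost everywhere in W matter. *)

Definition dot (x y : 'cV[R]_k) : R := \sum_(i < k) x i 0 * y i 0.

Definition L2sqnorm W u : \bar R := (\int[mu]_(x in W) (dot (u x) (u x))%:E)%E.

Definition inL2 W u := measurable_fun W u /\ (L2sqnorm W u < +oo)%E.

Definition L2norm W u : R := Num.sqrt (fine (L2sqnorm W u)).

Definition L2dot W u v : R := \int[mu]_(x in W) dot (u x) (v x).

Definition dense_in_L2 W D :=
  forall w, inL2 W w ->
    forall e : R, 0 < e -> exists2 v, D v & L2norm W (w \- v) < e.

Definition linear_subspace D :=
  D (cst 0) /\ forall (c : R) u v, D u -> D v -> D (c \*: u \+ v).

Definition pderivs (s : seq 'I_d) u : vfield :=
  foldr (fun j w => 'D_(delta_mx 0 j : 'rV[R]_d) w) u s.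

Definition smooth_on W u :=
  forall (s : seq 'I_d) x, W x ->
    {for x, continuous (pderivs s u)} /\
    forall j, derivable (pderivs s u) x (delta_mx 0 j : 'rV[R]_d).

Definition test_field W u :=
  smooth_on setT u /\
  exists K, [/\ compact K, K `<=` W & forall x, ~ K x -> u x = 0].

(* A smooth function on the interior of W is completed by 0 on the rest of W,
   whose measure is not assumed to vanish. *)
Definition pnabla W (p : 'I_d -> 'M[R]_k) u : vfield := fun x =>
  if `[< W° x >] then \sum_(j < d) p j *m 'D_(delta_mx 0 j : 'rV[R]_d) u x else 0.

(* [D] is an admissible domain for p(nabla) as a densely defined skew-symmetric
   operator on L^2(W)^k. *)
Record initial_domain W (p : 'I_d -> 'M[R]_k) D : Prop := {
  initial_L2 : forall u, D u -> inL2 W u /\ inL2 W (pnabla W p u);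
  initial_smooth : forall u, D u -> smooth_on W° u;
  initial_test : forall u, test_field W° u -> D u;
  initial_subspace : linear_subspace D;
  initial_dense : dense_in_L2 W D;
  initial_skew : forall u v, D u -> D v ->
    L2dot W (pnabla W p u) v = - L2dot W u (pnabla W p v) }.

(* (v, w) belongs to the graph of the adjoint of the operator P of domain V. *)
Definition adjoint_graph W V (P : vfield -> vfield) v w :=
  forall u, V u -> L2dot W (P u) v = L2dot W u w.

(* [skew_adjointE] says that the adjoint of P is -P, domains included. *)
Record skew_adjoint W V (P : vfield -> vfield) : Prop := {
  skew_adjoint_L2 : forall u, V u -> inL2 W u /\ inL2 W (P u);
  skew_adjoint_ae : forall u v, V u -> measurable_fun W v ->
    u = v %[ae mu in W] -> V v /\ P u = P v %[ae mu in W];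
  skew_adjoint_subspace : linear_subspace V;
  skew_adjoint_linear : forall (c : R) u v, V u -> V v ->
    P (c \*: u \+ v) = c \*: P u \+ P v %[ae mu in W];
  skew_adjoint_dense : dense_in_L2 W V;
  skew_adjointE : forall v w, inL2 W v -> inL2 W w ->
    adjoint_graph W V P v w <-> V v /\ w = \- P v %[ae mu in W] }.

Definition extends_pnabla W (p : 'I_d -> 'M[R]_k) D V (P : vfield -> vfield) :=
  forall u, D u -> V u /\ P u = pnabla W p u %[ae mu in W].

Definition graph_norm W (P : vfield -> vfield) u : R :=
  Num.sqrt (L2norm W u ^+ 2 + L2norm W (P u) ^+ 2).

(* [N] is a norm on V equivalent to the graph norm of P. *)
Record V_norm W V (P : vfield -> vfield) (N : vfield -> R) : Prop := {
  V_normD : forall u v, V u -> V v -> N (u \+ v) <= N u + N v;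
  V_normZ : forall (c : R) u, V u -> N (c \*: u) = `|c| * N u;
  V_norm_equiv : exists c1 c2 : R, [/\ 0 < c1, 0 < c2 &
    forall u, V u ->
      c1 * graph_norm W P u <= N u /\ N u <= c2 * graph_norm W P u] }.

(* [`|A x|] is the largest absolute value of an entry of [A x]; the indicator
   restricts the essential supremum to W. *)

Definition Linfnorm W (A : mfield) : \bar R :=
  ess_sup mu (fun x => (`|A x| * \1_W x)%:E).

Definition inLinf W (A : mfield) :=
  measurable_fun W A /\ (Linfnorm W A < +oo)%E.

Definition symmetric_ae W (A : mfield) :=
  {ae mu, forall x, W x -> (A x)^T = A x}.

Definition coercive_bounds W (Cl Cu : R) (a : mfield) :=
  {ae mu, forall x, W x -> forall xi : 'cV[R]_k,
    Cl * dot xi xi <= dot xi (a x *m xi) /\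
    dot xi (a x *m xi) <= Cu * dot xi xi}.

Definition simple_Linf W (s : R -> mfield) :=
  exists (m : nat) (E : 'I_m -> set R) (A : 'I_m -> mfield),
    [/\ forall j, measurable (E j), forall j, inLinf W (A j) &
        s = fun t x => \sum_(j < m) \1_(E j) t *: A j x].

Definition L1Linfnorm W (q : R -> mfield) : \bar R :=
  (\int[leb]_t Linfnorm W (q t))%E.

(* L^1(R, L^oo(W)) in the sense of Bochner: [q] is an almost everywhere limit of
   simple functions with values in L^oo(W), and its norm is integrable. [q] is
   moreover a jointly measurable representative of its class, so that the
   convolution can be written pointwise. *)
Record inL1Linf W (q : R -> mfield) : Prop := {
  L1Linf_joint : measurable_fun ([set: R] `*` W)
    (fun z : R * 'rV[R]_d => q z.1 z.2);
  L1Linf_strong : exists s : nat -> R -> mfield,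
    (forall n, simple_Linf W (s n)) /\
    {ae leb, forall t, Linfnorm W (s n t \- q t) @[n --> \oo] --> 0%E};
  L1Linf_norm : (L1Linfnorm W q < +oo)%E }.

(* Every continuous curve in L^2(W)^k, and every class in L^2_loc(R, L^2(W)^k),
   has a jointly measurable representative; all curves below are given by such
   representatives. *)

Definition joint_measurable W (u : R -> vfield) :=
  measurable_fun ([set: R] `*` W) (fun z : R * 'rV[R]_d => u z.1 z.2).

Definition is_C0 W (u : R -> vfield) :=
  [/\ joint_measurable W u, forall t, inL2 W (u t) &
      forall t, L2norm W (u s \- u t) @[s --> t] --> (0 : R)].

Definition is_time_derivative W (u u' : R -> vfield) :=
  forall t, L2norm W (h^-1 \*: (u (t + h) \- u t) \- u' t) @[h --> 0^'] -->
    (0 : R).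

(* [u'] is the time derivative of [u]. *)
Definition is_C1 W (u u' : R -> vfield) :=
  [/\ is_C0 W u, is_C0 W u' & is_time_derivative W u u'].

Definition is_causal W (u : R -> vfield) :=
  forall t, t < 0 -> u t = cst 0 %[ae mu in W].

(* The componentwise integral over the line. *)
Definition vint (F : R -> 'cV[R]_k) : 'cV[R]_k :=
  \col_i \int[leb]_t F t i 0.

Definition inL2loc W (f : R -> vfield) :=
  joint_measurable W f /\
  forall T : R, (\int[leb]_(t in `[(- T)%R, T]) L2sqnorm W (f t) < +oo)%E.

Definition test_function (phi : R -> R) :=
  (forall n t, derivable (derive1n n phi) t 1) /\
  exists M : R, forall t, M < `|t| -> phi t = 0.

Definition is_weak_time_derivative W (f f' : R -> vfield) :=
  forall phi, test_function phi -> {ae mu, forall x, W x ->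
    vint (fun t => derive1 phi t *: f t x) = - vint (fun t => phi t *: f' t x)}.

(* [f'] is the weak derivative; [f] is the continuous representative of its
   class, so that its value at each time is meaningful. *)
Definition inH1loc W (f f' : R -> vfield) :=
  [/\ inL2loc W f, inL2loc W f', is_weak_time_derivative W f f' & is_C0 W f].

Definition time_conv (q : R -> mfield) (u : R -> vfield) (t : R) : vfield :=
  fun x => vint (fun s => q (t - s) x *m u s x).

Record causal_solution W V (P : vfield -> vfield) (N : vfield -> R)
    (a b : mfield) (q : R -> mfield) (f u u' : R -> vfield) : Prop := {
  solution_C1 : is_C1 W u u';
  solution_V : forall t, V (u t);
  solution_C0V : forall t, N (u s \- u t) @[s --> t] --> (0 : R);
  solution_causal : is_causal W u;
  solution_eq : forall t, {ae mu, forall x, W x ->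
    a x *m u' t x + P (u t) x + b x *m u t x + time_conv q u t x = f t x} }.

End setting.

(* Main.v *)
(* Write the equation as [A u' + P u + B u + K u = f] in the Hilbert space H of
   classes of square integrable fields on W.  Replacing P by its bounded Yosida
   approximation P (1 + e P)^-1, which is still monotone, gives an equation that
   Picard iteration solves.  Integrating 2 <A w', w> controls |w|^2 by the
   integral of |f|^2, uniformly in e; since K commutes with time shifts, the
   same estimate applies to the difference quotients of u, hence bounds u' by
   f'.  With u' bounded, the approximations are Cauchy as e tends to 0; the
   difference quotients of the limit are Cauchy as well, because those of f
   converge in L^2, and the limit equation holds weakly against the domain of P,
   hence strongly as P is skew-adjoint.  The difference quotients of f are
   averages of f', which converge by Lebesgue differentiation, and in norm
   because averaging does not increase the L^2 norm. *)

Require Import Defs.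
From HB Require Import structures.
From mathcomp Require Import all_boot all_order all_algebra.
From mathcomp Require Import all_classical all_reals all_analysis.
From mathcomp Require Import measurable_realfun ess_sup_inf ring lra.
Set Implicit Arguments.
Unset Strict Implicit.
Unset Printing Implicit Defensive.
Import Order.TTheory GRing.Theory Num.Theory.
Import numFieldNormedType.Exports.
Local Open Scope classical_set_scope.
Local Open Scope ring_scope.

(** * Inner products and derivatives of curves *)

(** No integral of H-valued functions is used. Curves are compared by derivative inequalities on a
    segment, primitives of continuous causal curves come from Riesz's theorem applied to scalar
    primitives, and vector statements are tested against one vector, often the error itself. The
    memory term rules out a pointwise Gronwall argument, since [K u t] is controlled only by the
    supremum of |u| over the past; hence an exponential weight and evaluation at a maximum point. It
    also dictates backward difference quotients: K commutes with delays, and a delayed causal curve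
    is causal. The second obstacle is measure theoretic. The abstract part works with classes, while
    the equation convolves functions of (t, x) at each x. Jointly measurable representatives of
    continuous curves link the two, and q, bounded only almost everywhere, is replaced by a kernel
    with an everywhere bound. Finally f' is given only through scalar test functions of time, so
    smooth approximations of indicators of intervals are built before increments of f become
    integrals of f'. *)

Section curves.
Context {R : realType} {H : normedModType R}.
Implicit Types u v : R -> H.

Lemma is_derive_cvgP u t du :
  is_derive (t : R) 1 u du <-> h^-1 *: (u (t + h) - u t) @[h --> 0^'] --> du.
Proof.
have e : (fun h : R => h^-1 *: ((u \o shift t) (h *: (1 : R)) - u t)) =
         (fun h => h^-1 *: (u (t + h) - u t)).
  by apply/funext => h; rewrite /= /shift /= scaler1 [h + t]addrC.
split=> [du_|c].
  have [d dE] := du_; rewrite -dE.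
  by rewrite -e; exact: d.
have d : derivable u t 1 by apply/cvg_ex; exists du; rewrite e.
by apply: DeriveDef => //; apply: cvg_lim => //; rewrite e.
Qed.

Lemma is_derive_continuous u t du : is_derive (t : R) 1 u du ->
  {for t, continuous u}.
Proof. by move=> [d _]; apply: differentiable_continuous; apply/derivable1_diffP. Qed.

(** Compactness of the segment in near-covering form. Only s is confined to the segment; t may leave
    it, which later removes any care at the end points. *)
Lemma uniform_continuity_segment u (a b e : R) : continuous u -> 0 < e ->
  exists2 d, 0 < d & forall s t, a <= s <= b -> `|t - s| <= d -> `|u t - u s| <= e.
Proof.
move=> cu e0.
have := @segment_compact R a b; rewrite compact_near_coveringP.
move=> /(_ _ (0^'+) (fun d s => forall t, `|t - s| <= d -> `|u t - u s| <= e)).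
case=> [|d /= d0 dP].
  move=> s sab.
  have /cvgrPdist_lt/(_ (e / 2)) : u r @[r --> s] --> u s by exact: cu.
  rewrite divr_gt0// => /(_ isT)/nbhs_ballP[r/= r0 rP].
  exists (ball s (r / 2), [set d | 0 < d < r / 2]) => /=.
    split; first by apply: nbhsx_ballx; rewrite divr_gt0.
    near=> d => /=; apply/andP; split; near: d.
    - exact: nbhs_right_gt.
    - by apply: nbhs_right_lt; rewrite divr_gt0.
  move=> [x d]/= [xs /andP[d0 dr]] t td.
  have us y : `|s - y| < r -> `|u s - u y| < e / 2 by move=> ?; exact: rP.
  have h1 : `|u s - u x| < e / 2.
    by apply: us; apply: (lt_trans xs); rewrite ltr_pdivrMr// ltr_pMr// ltr1n.
  have h2 : `|u s - u t| < e / 2.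
    apply: us; rewrite (_ : s - t = (s - x) - (t - x)); last by ring.
    apply: (le_lt_trans (ler_normB _ _)).
    by rewrite (splitr r); apply: ltrD => //; exact: le_lt_trans dr.
  rewrite (_ : u t - u x = (u s - u x) - (u s - u t)); last first.
    by rewrite opprB [RHS]addrC addrA subrK.
  by apply: (le_trans (ler_normB _ _)); rewrite (splitr e) lerD// ltW.
exists (d / 2); first by rewrite divr_gt0.
move=> s t sab ts.
apply: (dP (d / 2)) ts => //=; last by rewrite divr_gt0.
by rewrite sub0r normrN gtr0_norm ?divr_gt0// ltr_pdivrMr// ltr_pMr// ltr1n.
Unshelve. all: by end_near. Qed.

End curves.

(** The mean value theorem for [phi \- g]. Every time integration of an inequality goes through this
    lemma or its two norm versions. *)
Lemma le_increment {R : realType} (g phi dg dphi : R -> R) (a b : R) : a <= b ->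
  (forall t : R, is_derive t 1 g (dg t)) ->
  (forall t : R, is_derive t 1 phi (dphi t)) ->
  (forall t, a <= t <= b -> dg t <= dphi t) -> g b - g a <= phi b - phi a.
Proof.
move=> ab dgP dphiP le.
have hd t : is_derive (t : R) 1 (phi \- g) (dphi t - dg t).
  by apply: is_deriveB.
have [|c + E] := MVT_segment ab (fun t _ => hd t).
  apply: continuous_subspaceT => t; exact: is_derive_continuous (hd t).
rewrite in_itv/= => /le; rewrite -subr_ge0 => c0.
rewrite -subr_ge0 (_ : _ - _ = (phi \- g) b - (phi \- g) a); last first.
  by rewrite /=; ring.
by rewrite E mulr_ge0// subr_ge0.
Qed.

(** Stated for semidefinite forms, since it serves the inner product, the form <A x, y>, the
    Euclidean [dot], and the L^2 pairing before its norm exists. *)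
Lemma cauchy_schwarz_form {R : realType} {E : lmodType R} (q : E -> E -> R)
    (qC : forall x y, q x y = q y x)
    (qD : forall x y z, q (x + y) z = q x z + q y z)
    (qZ : forall c x y, q (c *: x) y = c * q x y) (q0 : forall x, 0 <= q x x) x y :
  q x y ^+ 2 <= q x x * q y y.
Proof.
have qE t : q (x + t *: y) (x + t *: y) = q x x + 2 * t * q x y + t ^+ 2 * q y y.
  rewrite qD qZ !(qC _ (x + _)) !qD !qZ !(qC y x); ring.
have [y0|y0] := eqVneq (q y y) 0.
  rewrite y0 mulr0 exprn_even_le0//=; have [//|xy0] := eqVneq (q x y) 0.
  (* With [q y y = 0] the form is affine along x + t y, and this t gives it the value -1. *)
  have := q0 (x + (- ((q x x + 1) / (2 * q x y))) *: y).
  rewrite qE y0 mulr0 addr0.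
  rewrite (_ : 2 * _ * _ = - (q x x + 1)); last by field.
  lra.
have yp : 0 < q y y by rewrite lt_def y0 q0.
have := q0 (x + (- (q x y / q y y)) *: y); rewrite qE.
rewrite -(pmulr_lge0 _ yp) (_ : (_ + _ + _) * q y y = q x x * q y y - q x y ^+ 2).
  by rewrite subr_ge0.
by field.
Qed.

Section hilbert.
Context {R : realType} {H : normedModType R}.

Record inner_product (ip : H -> H -> R) : Prop := {
  ipC : forall x y, ip x y = ip y x;
  ipDl : forall x y z, ip (x + y) z = ip x z + ip y z;
  ipZl : forall c x y, ip (c *: x) y = c * ip x y;
  ipxx : forall x, ip x x = `|x| ^+ 2 }.

Context (ip : H -> H -> R) (ipP : inner_product ip).
Implicit Types x y z : H.

Lemma ipDr x y z : ip x (y + z) = ip x y + ip x z.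
Proof. by rewrite (ipC ipP) (ipDl ipP) !(ipC ipP x). Qed.

Lemma ipZr c x y : ip x (c *: y) = c * ip x y.
Proof. by rewrite (ipC ipP) (ipZl ipP) (ipC ipP x). Qed.

Lemma ip0l y : ip 0 y = 0.
Proof. by rewrite -(scale0r 0) (ipZl ipP) mul0r. Qed.

Lemma ip0r y : ip y 0 = 0.
Proof. by rewrite (ipC ipP) ip0l. Qed.

Lemma ipNl x y : ip (- x) y = - ip x y.
Proof. by rewrite -scaleN1r (ipZl ipP) mulN1r. Qed.

Lemma ipNr x y : ip x (- y) = - ip x y.
Proof. by rewrite (ipC ipP) ipNl (ipC ipP). Qed.

Lemma ipBl x y z : ip (x - y) z = ip x z - ip y z.
Proof. by rewrite (ipDl ipP) ipNl. Qed.

Lemma ipBr x y z : ip x (y - z) = ip x y - ip x z.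
Proof. by rewrite ipDr ipNr. Qed.

Lemma cauchy_schwarz x y : `|ip x y| <= `|x| * `|y|.
Proof.
rewrite -ler_sqr ?nnegrE ?mulr_ge0// real_normK ?num_real// exprMn -!(ipxx ipP).
apply: cauchy_schwarz_form => [? ?|? ? ?|? ? ?|?].
- exact: (ipC ipP).
- exact: (ipDl ipP).
- exact: (ipZl ipP).
- by rewrite (ipxx ipP) exprn_ge0.
Qed.

Lemma ip_le x y : ip x y <= `|x| * `|y|.
Proof. exact: le_trans (ler_norm _) (cauchy_schwarz _ _). Qed.

Lemma ip_inj x : (forall y, ip x y = 0) -> x = 0.
Proof.
move=> /(_ x) h; apply: normr0_eq0; apply/eqP.
by rewrite -sqrf_eq0 -(ipxx ipP) h.
Qed.

Lemma parallelogram x y : `|x + y| ^+ 2 + `|x - y| ^+ 2 = 2 * (`|x| ^+ 2 + `|y| ^+ 2).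
Proof. rewrite -!(ipxx ipP) !(ipBl, ipBr, ipDl ipP, ipDr). ring. Qed.

Lemma normD2 x y : `|x + y| ^+ 2 = `|x| ^+ 2 + 2 * ip x y + `|y| ^+ 2.
Proof. rewrite -!(ipxx ipP) !(ipDl ipP, ipDr) (ipC ipP y x); ring. Qed.

Lemma cvg_ipl {I} (F : set_system I) (FF : Filter F) (f : I -> H) x y :
  f i @[i --> F] --> x -> ip (f i) y @[i --> F] --> ip x y.
Proof.
move=> fx; apply/cvgrPdist_le => e e0.
have d0 : 0 < e / (`|y| + 1) by rewrite divr_gt0// ltr_wpDl.
move/cvgrPdist_le : fx => /(_ _ d0); apply: filterS => i fi.
rewrite -ipBl; apply: (le_trans (cauchy_schwarz _ _)).
apply: (@le_trans _ _ (e / (`|y| + 1) * `|y|)); first by rewrite ler_wpM2r.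
by rewrite mulrAC ler_pdivrMr ?ltr_wpDl// ler_pM2l// lerDl.
Qed.

Lemma cvg_ip {I} (F : set_system I) (FF : Filter F) (f g : I -> H) x y :
  f i @[i --> F] --> x -> g i @[i --> F] --> y ->
  ip (f i) (g i) @[i --> F] --> ip x y.
Proof.
move=> fx gy.
rewrite (_ : (fun i => ip (f i) (g i)) = (fun i => ip (f i) y + ip (f i) (g i - y))).
  rewrite -[X in _ --> X]addr0; apply: cvgD; first exact: cvg_ipl.
  apply/norm_cvg0P.
  apply: (@squeeze_cvgr _ _ _ _ (cst 0) (fun i => `|f i| * `|g i - y|)).
  - by apply: nearW => i; rewrite normr_ge0/= cauchy_schwarz.
  - exact: cvg_cst.
  - rewrite -(mulr0 `|x|); apply: cvgM; first exact: cvg_norm.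
    by rewrite -(normr0 H) -(subrr y); apply: cvg_norm; apply: cvgB => //; exact: cvg_cst.
by apply/funext => i; rewrite -ipDr addrC subrK.
Qed.

Lemma is_derive_ip (u v : R -> H) t du dv : is_derive (t : R) 1 u du ->
  is_derive (t : R) 1 v dv ->
  is_derive (t : R) 1 (fun s => ip (u s) (v s)) (ip du (v t) + ip (u t) dv).
Proof.
move=> du_ dv_; apply/is_derive_cvgP.
have uc := is_derive_continuous du_; have vc := is_derive_continuous dv_.
move/is_derive_cvgP : du_ => du_; move/is_derive_cvgP : dv_ => dv_.
rewrite (_ : (fun h => _) = (fun h => ip (h^-1 *: (u (t + h) - u t)) (v (t + h)) +
   ip (u t) (h^-1 *: (v (t + h) - v t)))); last first.
  apply/funext => h; rewrite (ipZl ipP) ipZr -mulrDr /GRing.scale/=.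
  by congr (_ * _); rewrite ipBl ipBr addrA subrK.
apply: cvgD; last by apply: cvg_ip dv_; exact: cvg_cst.
apply: cvg_ip => //.
have : t + h @[h --> 0^'] --> t.
  rewrite -[X in _ --> X]addr0; apply: cvgD; first exact: cvg_cst.
  exact: nbhs_dnbhs.
by move=> th; exact: (cvg_comp _ _ th vc).
Qed.

Lemma is_derive_ipl (u : R -> H) t du y : is_derive (t : R) 1 u du ->
  is_derive (t : R) 1 (fun s => ip (u s) y) (ip du y).
Proof.
move=> du_; have := is_derive_ip du_ (is_derive_cst y t 1).
by rewrite ip0r addr0.
Qed.

(** Pairing with the increment [z = u b - u a] itself reduces the claim to [le_increment]: <u', z>
    is at most |z| times phi'. *)
Lemma le_norm_increment (u du : R -> H) (phi dphi : R -> R) a b : a <= b ->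
  (forall t : R, is_derive t 1 u (du t)) ->
  (forall t : R, is_derive t 1 phi (dphi t)) ->
  (forall t, a <= t <= b -> `|du t| <= dphi t) ->
  `|u b - u a| <= phi b - phi a.
Proof.
move=> ab uP phiP le; set z := u b - u a.
have [->|z0] := eqVneq z 0.
  rewrite normr0; have := @le_increment R (cst 0) phi (cst 0) dphi a b ab.
  rewrite subrr; apply => //.
  by move=> t /le; apply: le_trans.
have zp : 0 < `|z| by rewrite normr_gt0.
have := @le_increment R (fun s => ip (u s) z) (`|z| \*: phi)
  (fun s => ip (du s) z) (fun s => `|z| * dphi s) a b ab.
rewrite -ipBl -/z (ipxx ipP) expr2 /GRing.scale/= -mulrBr ler_pM2l//; apply.
- by move=> t; exact: is_derive_ipl.
- by move=> t /le tle; rewrite mulrC; apply: (le_trans (ip_le _ _)); rewrite ler_pM2r.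
Qed.

End hilbert.

(** * Riesz representation and coercive operators *)

Section complete_hilbert.
Context {R : realType} {H : completeNormedModType R}.
Context (ip : H -> H -> R) (ipP : inner_product ip).
Implicit Types x y z : H.

Lemma cauchy_seq_cvg (v : nat -> H) :
  (forall e : R, 0 < e -> exists N, forall n m, (N <= n)%N -> (N <= m)%N ->
     `|v n - v m| <= e) -> exists l : H, v n @[n --> \oo] --> l.
Proof.
move=> vC; suff : cvgn v by move=> /cvg_ex.
apply/cauchy_cvgP/cauchy_exP => e e0.
have [N NP] := vC (e / 2) (divr_gt0 e0 (ltr0Sn _ _)).
exists (v N); exists N => // n /= Nn; rewrite -ball_normE/=.
by apply: (le_lt_trans (NP _ _ (leqnn N) Nn)); rewrite ltr_pdivrMr// ltr_pMr// ltr1n.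
Qed.

(** The projection theorem: a minimising sequence for the distance from g to S is Cauchy, its limit
    l lies in S, and g - l is orthogonal to S, hence zero. *)
Lemma closed_subspace_full (S : set H) : S 0 ->
  (forall c x y, S x -> S y -> S (c *: x + y)) ->
  (forall (s : nat -> H) (l : H), (forall n, S (s n)) -> s n @[n --> \oo] --> l -> S l) ->
  (forall w, (forall x, S x -> ip x w = 0) -> w = 0) -> forall x, S x.
Proof.
move=> S0 Slin Scl Sperp g.
pose E := [set `|g - x| ^+ 2 | x in S].
have E0 : has_inf E.
  split; first by exists (`|g - 0| ^+ 2), 0.
  by exists 0 => _ [x _ <-]; rewrite exprn_ge0.
pose d := inf E.
have dP x : S x -> d <= `|g - x| ^+ 2 by move=> Sx; apply: inf_lbound; [exact: E0.2|exists x].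
have /choice[s sP] (n : nat) : exists x, S x /\ `|g - x| ^+ 2 <= d + n.+1%:R^-1.
  have [|_ [x Sx <-] xd] := @inf_adherent _ E n.+1%:R^-1 _ E0; first by rewrite invr_gt0.
  by exists x; split => //; exact: ltW.
(* The midpoint of [s n] and [s m] lies in S, so its squared distance to g is at least d; the
   parallelogram identity turns this into closeness of the two points. *)
have sB n m : `|s n - s m| ^+ 2 <= 2 * (n.+1%:R^-1 + m.+1%:R^-1).
  have := parallelogram ipP (g - s n) (g - s m).
  rewrite (_ : g - s n + (g - s m) = 2 *: (g - (2^-1 *: s n + 2^-1 *: s m))); last first.
    by rewrite scalerBr scalerDr !scalerA divff ?pnatr_eq0// !scale1r scaler_nat mulr2n opprD addrACA.
  rewrite (_ : g - s n - (g - s m) = - (s n - s m)); last first.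
    by rewrite !opprB [LHS]addrC addrA subrK.
  rewrite normrN normrZ exprMn ger0_norm// => pE.
  have := dP (2^-1 *: s n + 2^-1 *: s m).
  rewrite -[_ *: s m]addr0.
  have Sh k : S (2^-1 *: s k + 0) by apply: Slin => //; exact: (sP k).1.
  move=> /(_ (Slin _ _ _ (sP n).1 (Sh m))); rewrite addr0.
  have aux (X Y a b e p q : R) : 2 ^+ 2 * X + Y = 2 * (a + b) ->
      a <= e + p -> b <= e + q -> e <= X -> Y <= 2 * (p + q) by lra.
  exact: (aux _ _ _ _ _ _ _ pE (sP n).2 (sP m).2).
have [l sl] : exists l : H, s n @[n --> \oo] --> l.
  apply: cauchy_seq_cvg => e e0.
  pose N := Num.truncn (4 / e ^+ 2).
  exists N => n m Nn Nm.
  have h k : (N <= k)%N -> k.+1%:R^-1 <= e ^+ 2 / 4.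
    move=> Nk; rewrite -[leRHS]invrK lef_pV2 ?posrE ?invr_gt0 ?divr_gt0 ?exprn_gt0//.
    rewrite invf_div; apply: (le_trans (ltW (truncnS_gt _))).
    by rewrite ler_nat ltnS.
  rewrite -ler_sqr ?nnegrE ?(ltW e0)//; apply: (le_trans (sB n m)).
  have aux (p q r : R) : p <= r / 4 -> q <= r / 4 -> 2 * (p + q) <= r by lra.
  exact: aux (h _ Nn) (h _ Nm).
have dl : `|g - l| ^+ 2 <= d.
  have c : `|g - s n| @[n --> \oo] --> `|g - l|.
    by apply: cvg_norm; apply: cvgB => //; exact: cvg_cst.
  have c1 : `|g - s n| ^+ 2 @[n --> \oo] --> `|g - l| ^+ 2 by exact: cvgM.
  have c2 : d + n.+1%:R^-1 @[n --> \oo] --> d.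
    by rewrite -[X in _ --> X]addr0; apply: cvgD; [exact: cvg_cst|exact: cvg_harmonic].
  apply: (ler_cvg_to c1 c2); apply: nearW => n; exact: (sP n).2.
have Sl : S l by apply: (Scl s) => // n; have [] := sP n.
suff : g - l = 0 by move/eqP; rewrite subr_eq0 => /eqP ->.
apply: Sperp => x Sx; rewrite (ipC ipP).
have [->|x0] := eqVneq x 0; first by rewrite (ip0r ipP).
have xp : 0 < `|x| ^+ 2 by rewrite exprn_gt0// normr_gt0.
(* The minimiser of t |-> |g - l - t x|^2; moving from l to l + t x would shorten the distance
   unless <g - l, x> = 0. *)
pose t := ip (g - l) x / `|x| ^+ 2.
have := dP (t *: x + l) (Slin _ _ _ Sx Sl).
move=> /(le_trans dl).
rewrite (_ : g - (t *: x + l) = (g - l) + (- t) *: x); last first.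
  by rewrite scaleNr opprD addrA addrAC.
rewrite (normD2 ipP (g - l)) (ipZr ipP) normrZ exprMn real_normK ?num_real// sqrrN.
rewrite (_ : _ + t ^+ 2 * _ = `|g - l| ^+ 2 - (ip (g - l) x) ^+ 2 / `|x| ^+ 2); last first.
  by rewrite /t; field; rewrite normr_eq0.
rewrite lerBrDr gerDl pmulr_lle0 ?invr_gt0// => h.
by apply/eqP; rewrite -sqrf_eq0 eq_le h exprn_even_ge0.
Qed.

(** If some nonzero w is orthogonal to the kernel of phi, a multiple of w represents phi. Otherwise
    the kernel, closed because phi is bounded, is the whole space and 0 represents phi. *)
Lemma riesz (phi : H -> R) C : (forall c x y, phi (c *: x + y) = c * phi x + phi y) ->
  (forall x, `|phi x| <= C * `|x|) -> exists z, forall x, phi x = ip x z.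
Proof.
move=> phiL phiC.
have phi0 : phi 0 = 0 by have := phiL 1 0 0; rewrite scaler0 addr0 mul1r; lra.
have phiZ c x : phi (c *: x) = c * phi x by rewrite -[c *: x]addr0 phiL phi0 addr0.
have phiD x y : phi (x + y) = phi x + phi y by rewrite -[x]scale1r phiL mul1r scale1r.
have phiB x y : phi (x - y) = phi x - phi y by rewrite phiD -scaleN1r phiZ mulN1r.
have [[w [wP w0]]|nw] := pselect (exists w, (forall x, phi x = 0 -> ip x w = 0) /\ w <> 0).
  have wp : 0 < `|w| by rewrite normr_gt0; apply/eqP.
  exists (phi w / `|w| ^+ 2 *: w) => x; rewrite (ipZr ipP).
  have [pw|pw] := eqVneq (phi w) 0.
    by have := wP _ pw; rewrite (ipxx ipP) => /eqP; rewrite sqrf_eq0 normr_eq0 => /eqP.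
  have : ip (x - (phi x / phi w) *: w) w = 0.
    by apply: wP; rewrite phiB phiZ mulfVK// subrr.
  rewrite (ipBl ipP) (ipZl ipP) (ipxx ipP) => /eqP; rewrite subr_eq0 => /eqP ->.
  by field; rewrite pw gt_eqF.
exists 0 => x; rewrite (ip0r ipP).
apply: (@closed_subspace_full [set x | phi x = 0]) => //=.
- by move=> c a b /= ha hb; rewrite phiL ha hb mulr0 addr0.
- move=> s l /= s0 sl; apply/eqP; rewrite -normr_le0.
  have : C * `|l - s n| @[n --> \oo] --> C * `|l - l|.
    apply: cvgM; first exact: cvg_cst.
    by apply: cvg_norm; apply: cvgB => //; exact: cvg_cst.
  rewrite subrr normr0 mulr0 => c0.
  apply: (ler_cvg_to (cvg_cst `|phi l|) c0).
  by apply: nearW => n; rewrite (le_trans _ (phiC _))// phiB s0 subr0.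
- move=> w wP; apply: contrapT => w0; apply: nw; exists w; split=> //.
Qed.

(* Lax-Milgram for a possibly unbounded operator T with domain V. *)
Lemma closed_coercive_surj (V : set H) (T : H -> H) c : 0 < c -> V 0 ->
  (forall a x y, V x -> V y -> V (a *: x + y) /\ T (a *: x + y) = a *: T x + T y) ->
  (forall (s : nat -> H) (x y : H), (forall n, V (s n)) -> s n @[n --> \oo] --> x ->
     T (s n) @[n --> \oo] --> y -> V x /\ T x = y) ->
  (forall x, V x -> c * `|x| <= `|T x|) ->
  (forall w, (forall x, V x -> ip (T x) w = 0) -> w = 0) ->
  forall y, exists2 x, V x & T x = y.
Proof.
move=> c0 V0 Tlin Tcl Tc Tperp.
have T0 : T 0 = 0.
  have [_] := Tlin 1 0 0 V0 V0; rewrite scaler0 addr0 scale1r.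
  by move=> /eqP; rewrite -subr_eq0 opprD addrA subrr sub0r oppr_eq0 => /eqP.
apply: (@closed_subspace_full [set y | exists2 x, V x & T x = y]).
- by exists 0.
- move=> a _ _ [x Vx <-] [y Vy <-]; have [] := Tlin a x y Vx Vy.
  by move=> ? ?; exists (a *: x + y).
- move=> s l sP sl.
  have /choice[x xP] n : exists x, V x /\ T x = s n.
    by have [x ? ?] := sP n; exists x.
  (* Coercivity transfers the Cauchy property from the images to the preimages; closedness of T then
     identifies the limit. So the range is closed. *)
  have [z xz] : exists z : H, x n @[n --> \oo] --> z.
    apply: cauchy_seq_cvg => e e0.
    move/cvgrPdist_le : (sl) => /(_ (c * e / 2)).
    rewrite divr_gt0 ?mulr_gt0// => /(_ isT)[N _ NP].
    exists N => n m /NP/= hn /NP/= hm.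
    have [] := Tlin (-1) (x m) (x n) (xP m).1 (xP n).1.
    rewrite !scaleN1r ![- _ + _]addrC => /Tc h E.
    rewrite -(ler_pM2l c0); apply: (le_trans h); rewrite E (xP n).2 (xP m).2.
    rewrite (_ : s n - s m = (l - s m) - (l - s n)); last first.
      by rewrite opprB [RHS]addrC addrA subrK.
    by apply: (le_trans (ler_normB _ _)); lra.
  exists z; [apply: (Tcl x z l _ _ _).1|apply: (Tcl x z l _ _ _).2] => //.
  + by move=> n; have [] := xP n.
  + by rewrite (_ : (fun n => T (x n)) = s)//; apply/funext => n; have [] := xP n.
  + by move=> n; have [] := xP n.
  + by rewrite (_ : (fun n => T (x n)) = s)//; apply/funext => n; have [] := xP n.
- by move=> w wP; apply: Tperp => x Vx; apply: wP; exists x.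
Qed.

End complete_hilbert.

(** * Causal curves *)

(** Time 0 is included: for a continuous curve this follows from vanishing before 0, and it supplies
    the zero initial value for every integration. *)
Definition causal_curve {R : realType} {H : normedModType R} (u : R -> H) :=
  continuous u /\ forall t, t <= 0 -> u t = 0.

(** * Primitives of scalar causal functions *)

Section scalar_primitive.
Context {R : realType}.
Notation leb := (@lebesgue_measure R).
Implicit Types g : R -> R.

(** Starting at -oo costs nothing for causal g, and gives a primitive differentiable at every real
    t, with no case distinction on the sign of t. *)
Definition prim g t := \int[leb]_(s in `]-oo, t]) g s.

Lemma causal_integrable g t : causal_curve g ->
  leb.-integrable `]-oo, t] (EFin \o g).
Proof.
move=> [cg g0]; apply/integrable_mkcond => //.
rewrite (_ : _ \_ _ = (EFin \o g) \_ `[0, t]); last first.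
  apply/funext => s; rewrite !patchE.
  rewrite !mem_setE !in_itv/=.
  have [s0|s0] := leP 0 s; first by [].
  by rewrite /= g0 ?(ltW s0)//; case: ifP.
have gi : leb.-integrable `[0, t] (EFin \o g).
  apply: continuous_compact_integrable; first exact: segment_compact.
  exact: continuous_subspaceT.
by move/integrable_mkcond : gi; apply.
Qed.

Lemma prim_derive g t : causal_curve g -> is_derive (t : R) 1 (prim g) (g t).
Proof.
move=> gc; have tu : t < t + 1 by rewrite ltrDl.
have := @continuous_FTC1 R g -oo%O t (t + 1) tu (causal_integrable _ gc).
move=> /(_ (ltNyr _) (gc.1 t)) [d dE].
by apply: DeriveDef; rewrite -?derive1E.
Qed.

Lemma prim_causal g t : causal_curve g -> t <= 0 -> prim g t = 0.
Proof.
move=> gc t0; rewrite /prim (@eq_Rintegral _ _ _ _ _ (cst 0)).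
  by rewrite Rintegral_cst//= mul0r.
by move=> s; rewrite inE/= in_itv/= => st; rewrite gc.2// (le_trans st).
Qed.

Lemma prim_linear c g h t : causal_curve g -> causal_curve h ->
  prim (fun s => c * g s + h s) t = c * prim g t + prim h t.
Proof.
move=> gc hc; have gi := causal_integrable t gc; have hi := causal_integrable t hc.
rewrite /prim RintegralD//; first by rewrite RintegralZl.
exact: (@integrableZl _ _ _ leb _ (measurable_itv _) c _ gi).
Qed.

Lemma prim_ge0 g t : (forall s, s <= t -> 0 <= g s) -> 0 <= prim g t.
Proof. by move=> g0; apply: Rintegral_ge0 => s /=; rewrite in_itv/=; exact: g0. Qed.

Lemma is_derive_scaled_expR (c l t : R) :
  is_derive t 1 (fun s => c * expR (l * s)) (c * (l * expR (l * t))).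
Proof.
have d1 : is_derive t 1 (fun s : R => l * s) (l * 1).
  exact: (is_deriveZ l (is_derive_id t 1)).
have := is_derive1_comp (is_derive_expR (l * t)) d1; rewrite mulr1 mulrC => d2.
exact: (is_deriveZ c d2).
Qed.

(** The bound on the derivative is asked on both sides of a, so that the order of a and b does not
    matter to the user, as for difference quotients with steps of either sign. *)
Lemma le_norm_increment_real g dg (a b M : R) :
  (forall t : R, is_derive t 1 g (dg t)) ->
  (forall s, `|s - a| <= `|b - a| -> `|dg s| <= M) -> `|g b - g a| <= M * `|b - a|.
Proof.
move=> gP le.
have dl (c t : R) : is_derive t 1 (fun s : R => c * s) c.
  by have := is_deriveZ c (is_derive_id t 1); rewrite /GRing.scale/= mulr1.
have key (x y : R) : x <= y -> (forall s, x <= s <= y -> `|dg s| <= M) ->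
    `|g y - g x| <= M * (y - x).
  move=> xy h; rewrite ler_norml; apply/andP; split.
    have := le_increment xy (dl (- M)) gP; rewrite -mulrBr mulNr; apply.
    by move=> s /h; rewrite ler_norml => /andP[].
  have := le_increment xy gP (dl M); rewrite -mulrBr; apply.
  by move=> s /h; rewrite ler_norml => /andP[].
have [ab|ba] := leP a b.
  rewrite [in leRHS]ger0_norm ?subr_ge0//; apply: key => // s /andP[sa sb].
  by apply: le; rewrite !ger0_norm ?subr_ge0// lerD2r.
rewrite distrC [in leRHS]distrC [in leRHS]gtr0_norm ?subr_gt0//.
apply: key; first exact: ltW.
move=> s /andP[bs sa]; apply: le.
by rewrite distrC [leRHS]distrC !ger0_norm ?subr_ge0 ?(ltW ba)// lerD2l lerN2.
Qed.

End scalar_primitive.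

Section causal_curves.
Context {R : realType} {H : completeNormedModType R}.
Implicit Types u v : R -> H.

Lemma causal_curve_cst0 : causal_curve (fun _ : R => 0 : H).
Proof. by split => // t; exact: cvg_cst. Qed.

Lemma causal_curveZD c u v : causal_curve u -> causal_curve v ->
  causal_curve (fun t => c *: u t + v t).
Proof.
move=> [cu u0] [cv v0]; split=> [t|t t0]; last by rewrite u0// v0// scaler0 addr0.
by apply: cvgD; [apply: cvgZr; exact: cu|exact: cv].
Qed.

Lemma causal_curveD u v : causal_curve u -> causal_curve v ->
  causal_curve (fun t => u t + v t).
Proof.
move=> cu cv; have := causal_curveZD 1 cu cv.
by under eq_fun do rewrite scale1r.
Qed.

Lemma causal_curveB u v : causal_curve u -> causal_curve v ->
  causal_curve (fun t => u t - v t).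
Proof.
move=> cu cv; have := causal_curveZD (-1) cv cu.
by under eq_fun do rewrite scaleN1r addrC.
Qed.

Lemma causal_curveZ c u : causal_curve u -> causal_curve (fun t => c *: u t).
Proof.
move=> cu; have := causal_curveZD c cu causal_curve_cst0.
by under eq_fun do rewrite addr0.
Qed.

Lemma causal_curve_shift u e : 0 <= e -> causal_curve u ->
  causal_curve (fun t => u (t - e)).
Proof.
move=> e0 [cu u0]; split=> [t|t t0]; last by rewrite u0// subr_le0 (le_trans t0).
apply: (@continuous_comp _ _ _ (fun t => t - e) u); last exact: cu.
by apply: cvgB; [exact: cvg_id|exact: cvg_cst].
Qed.

Lemma causal_curve_lipschitz u (T : H -> H) C : (forall x y, `|T x - T y| <= C * `|x - y|) ->
  T 0 = 0 -> causal_curve u -> causal_curve (fun t => T (u t)).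
Proof.
move=> TL T0 [cu u0]; split=> [t|t t0]; last by rewrite u0.
apply/cvgrPdist_le => e e0.
have C0 : 0 < `|C| + 1 by rewrite ltr_wpDl.
move/cvgrPdist_le : (cu t) => /(_ (e / (`|C| + 1))); rewrite divr_gt0// => /(_ isT).
apply: filterS => s h; apply: (le_trans (TL _ _)).
apply: (@le_trans _ _ ((`|C| + 1) * `|u t - u s|)).
  by rewrite ler_wpM2r// (le_trans (ler_norm _))// lerDl.
by rewrite mulrC -ler_pdivlMr.
Qed.

Lemma causal_curve_norm2 u : causal_curve u -> causal_curve (fun t => `|u t| ^+ 2 : R).
Proof.
move=> [cu u0]; split=> [t|t t0]; last by rewrite u0// normr0 expr0n.
by apply: cvgM; apply: cvg_norm; exact: cu.
Qed.

Lemma causal_curve_bounded u T :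
  causal_curve u -> exists2 M : R, 0 <= M & forall t, t <= T -> `|u t| <= M.
Proof.
move=> [cu u0].
have T0 : 0 <= Num.max 0 T by rewrite le_max lexx.
have [|c _ cP] := @EVT_max R (fun t => `|u t|) _ _ T0.
  apply: continuous_subspaceT => t; apply: cvg_norm; exact: cu.
exists `|u c| => // t tT; have [t0|t0] := leP t 0; first by rewrite u0// normr0.
by apply: cP; rewrite in_itv/= ltW//= le_max tT orbT.
Qed.

Lemma causal_curve_uniform u T (e : R) : causal_curve u -> 0 < e ->
  exists2 d : R, 0 < d & forall s r, s <= T -> `|r - s| <= d -> `|u r - u s| <= e.
Proof.
move=> [cu u0] e0.
(* The segment starts at -1 and the step is capped at 1: for s < -1 both points are then at most 0,
   where the curve vanishes. *)
have [d d0 dP] := uniform_continuity_segment (-1) T cu e0.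
exists (Num.min d 1); first by rewrite lt_min d0/=.
move=> s r sT; rewrite le_min => /andP[rd r1].
have [s1|s1] := leP (-1) s; first by apply: dP => //; rewrite s1.
rewrite (u0 s); last by rewrite (le_trans (ltW s1)).
rewrite (u0 r) ?subrr ?normr0 ?ltW//.
by move: r1; rewrite ler_norml => /andP[_]; lra.
Qed.

(** Completeness for uniform convergence on half-lines. The pointwise limit inherits the uniform
    rate by continuity of the norm; continuity follows by an e/3 argument run up to t + 1, to have
    room around t. *)
Lemma uniform_cauchy_causal (un : nat -> R -> H) : (forall n, causal_curve (un n)) ->
  (forall T (e : R), 0 < e -> exists N, forall n m, (N <= n)%N -> (N <= m)%N ->
     forall t, t <= T -> `|un n t - un m t| <= e) ->
  exists2 u, causal_curve u & forall T (e : R), 0 < e ->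
    exists N, forall n, (N <= n)%N -> forall t, t <= T -> `|un n t - u t| <= e.
Proof.
move=> unc unC.
have /choice[u uP] (t : R) : exists l : H, un n t @[n --> \oo] --> l.
  apply: cauchy_seq_cvg => e e0; have [N NP] := unC t e e0.
  by exists N => n m Nn Nm; exact: NP.
have uL T (e : R) : 0 < e ->
    exists N, forall n, (N <= n)%N -> forall t, t <= T -> `|un n t - u t| <= e.
  move=> e0; have [N NP] := unC T e e0; exists N => n Nn t tT.
  have c : `|un n t - un m t| @[m --> \oo] --> `|un n t - u t|.
    by apply: cvg_norm; apply: cvgB; [exact: cvg_cst|exact: uP].
  by apply: (ler_cvg_to c (cvg_cst e)); exists N => // m Nm; exact: NP.
exists u => //; split=> [t|t t0]; last first.
  apply: (cvg_unique _ (uP t)) => //.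
  rewrite (_ : (fun n => un n t) = cst 0); first exact: cvg_cst.
  by apply/funext => n; rewrite (unc n).2.
apply/cvgrPdist_le => e e0; have e3 : 0 < e / 3 by rewrite divr_gt0.
have [N NP] := uL (t + 1) (e / 3) e3.
have [d d0 dP] := causal_curve_uniform (t + 1) (unc N) e3.
near=> s.
have st : s <= t + 1 by near: s; apply/nbhs_ballP; exists 1 => //= s; rewrite /ball/= ltr_distlC => /andP[_ /ltW].
have tt : t <= t + 1 by rewrite lerDl.
have h1 := NP N (leqnn N) t tt; have h2 := NP N (leqnn N) s st.
have h3 : `|un N s - un N t| <= e / 3.
  by apply: dP => //; near: s; exact: cvgr_distC_le.
apply: (le_trans (ler_distD (un N t) _ _)).
rewrite (_ : e = e / 3 + (e / 3 + e / 3)); last by field.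
apply: lerD; first by rewrite distrC.
by apply: (le_trans (ler_distD (un N s) _ _)); apply: lerD; rewrite // distrC.
Unshelve. all: by end_near. Qed.

End causal_curves.

(** * Primitives, Picard iteration and the energy bound *)

Section vector_ode.
Context {R : realType} {H : completeNormedModType R}.
Context (ip : H -> H -> R) (ipP : inner_product ip).
Implicit Types u v : R -> H.

Lemma causal_curve_ipl u x : causal_curve u -> causal_curve (fun t => ip (u t) x : R).
Proof.
move=> [cu u0]; split=> [t|t t0]; last by rewrite u0// (ip0l ipP).
by apply: (cvg_ipl ipP); exact: cu.
Qed.

(** The weak integral: x |-> [prim] of <u, x> is a bounded linear functional, and Riesz gives the
    vector U t. Differentiability of U is in norm, because the modulus of continuity of u at t
    controls the error uniformly over test vectors. *)
Lemma vector_primitive u : causal_curve u ->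
  exists2 U, causal_curve U & forall t : R, is_derive t 1 U (u t).
Proof.
move=> uc.
have ipuc x : causal_curve (fun s => ip (u s) x : R) by exact: causal_curve_ipl.
have /choice[U UP] (t : R) : exists z, forall x, prim (fun s => ip (u s) x) t = ip x z.
  have [M M0 MP] := causal_curve_bounded t uc.
  apply: (@riesz _ _ _ ipP _ (M * `|t|)).
    move=> c x y; rewrite -prim_linear//; congr prim; apply/funext => s.
    by rewrite (ipDr ipP) (ipZr ipP).
  move=> x; have [t0|t0] := leP t 0.
    by rewrite prim_causal// normr0 !mulr_ge0.
  have := @le_norm_increment_real R (prim (fun s => ip (u s) x)) _ 0 t (M * `|x|)
    (fun t => prim_derive t (ipuc x)).
  rewrite (prim_causal (ipuc x) (lexx 0)) !subr0 mulrAC; apply.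
  move=> s; rewrite subr0 => st; apply: (le_trans (cauchy_schwarz ipP _ _)).
  rewrite ler_wpM2r// MP// (le_trans (ler_norm _))// (le_trans st)//.
  by rewrite gtr0_norm.
have UD (t : R) : is_derive t 1 U (u t).
  apply/is_derive_cvgP/cvgrPdist_le => e e0.
  have /cvgrPdist_le/(_ _ e0)/nbhs_ballP[d /= d0 dP] := uc.1 t.
  near=> h.
  have h0 : h != 0 by near: h; exact: nbhs_dnbhs_neq.
  have hd : `|h| < d by near: h; exact: dnbhs0_lt.
  pose z := U (t + h) - U t - h *: u t.
  suff zh : `|z| <= e * `|h|.
    rewrite (_ : u t - _ = - (h^-1 *: z)); last first.
      by rewrite /z [in RHS]scalerBr scalerA mulVf// scale1r opprB.
    by rewrite normrN normrZ normfV mulrC ler_pdivrMr ?normr_gt0.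
  have [->|z0] := eqVneq z 0; first by rewrite normr0 mulr_ge0// ltW.
  have zp : 0 < `|z| by rewrite normr_gt0.
  (* The remainder z is tested against itself: the increment of g from t to t + h is |z|^2, while
     its derivative is at most e |z| near t. *)
  pose g s := prim (fun s => ip (u s) z) s - ip (u t) z * s.
  have gD (s : R) : is_derive s 1 g (ip (u s) z - ip (u t) z).
    have d1 := prim_derive s (ipuc z).
    have d2 : is_derive s 1 (fun r : R => ip (u t) z * r) (ip (u t) z).
      by have := is_deriveZ (ip (u t) z) (is_derive_id s 1); rewrite /GRing.scale/= mulr1.
    exact: is_deriveB.
  have := @le_norm_increment_real R g _ t (t + h) (e * `|z|) gD.
  rewrite {1}/g !UP addrAC subrr add0r.
  rewrite (_ : _ - g t = `|z| ^+ 2); last first.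
    have -> : `|z| ^+ 2 = ip (U (t + h)) z - ip (U t) z - h * ip (u t) z.
      by rewrite -(ipxx ipP) -(ipZl ipP) -!(ipBl ipP).
    by rewrite /g !UP (ipC ipP z (U t)) (ipC ipP z (U (t + h))); ring.
  rewrite normrX normr_id expr2 mulrAC ler_pM2r//; apply => s st.
  rewrite -(ipBl ipP); apply: (le_trans (cauchy_schwarz ipP _ _)).
  by rewrite ler_wpM2r// distrC; apply: dP; rewrite /ball/= distrC (le_lt_trans st).
exists U => //; split=> [t|t t0]; first exact: is_derive_continuous (UD t).
by apply: (ip_inj ipP) => x; rewrite (ipC ipP) -UP prim_causal.
Unshelve. all: by end_near. Qed.

Lemma causal_primitive_le u U (phi dphi : R -> R) T : causal_curve U ->
  (forall t : R, is_derive t 1 U (u t)) -> (forall t : R, is_derive t 1 phi (dphi t)) ->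
  0 <= phi 0 -> (forall t, 0 <= t <= T -> `|u t| <= dphi t) ->
  forall t, 0 <= t <= T -> `|U t| <= phi t.
Proof.
move=> Uc UD phiD phi0 le t /andP[t0 tT].
have := le_norm_increment ipP t0 UD phiD; rewrite (Uc.2 0)// subr0 => h.
apply: (le_trans (h _)); last by rewrite gerBl.
by move=> s /andP[s0 st]; apply: le; rewrite s0 (le_trans st).
Qed.

(* In the norms [sup e^{-2Lt} |u t|] the Picard map contracts by a factor 2. *)
Lemma causal_picard (G : (R -> H) -> R -> H) (L : R) : 0 < L ->
  (forall u, causal_curve u -> causal_curve (G u)) ->
  (forall u v (t m : R), causal_curve u -> causal_curve v ->
    (forall s, s <= t -> `|u s - v s| <= m) -> `|G u t - G v t| <= L * m) ->
  exists2 u, causal_curve u & forall t : R, is_derive t 1 u (G u t).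
Proof.
move=> L0 Gc GL.
(* Iterates live in the type of causal curves, since a primitive is available only for these. *)
pose Q (u : {u : R -> H | causal_curve u}) (v : {u : R -> H | causal_curve u}) :=
  forall t : R, is_derive t 1 (sval v) (G (sval u) t).
have /choice[F FP] (u : {u : R -> H | causal_curve u}) : exists z, Q u z.
  have [v vc vP] := vector_primitive (Gc _ (svalP u)).
  by exists (@exist (R -> H) (@causal_curve R H) v vc).
pose w n : {u : R -> H | causal_curve u} :=
  iter n F (exist _ (fun=> 0) (causal_curve_cst0 : causal_curve (fun=> 0 : H))).
pose un n : R -> H := sval (w n).
have unc n : causal_curve (un n) by exact: (svalP (w n)).
have unD n (t : R) : is_derive t 1 (un n.+1) (G (un n) t) by exact: FP.
have step T M : 0 <= M -> (forall t, t <= T -> `|un 1%N t - un 0%N t| <= M) ->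
    forall n t, 0 <= t <= T -> `|un n.+1 t - un n t| <= M * 2^-1 ^+ n * expR (2 * L * t).
  move=> M0 MP; elim=> [|n IH] t /andP[t0 tT].
    rewrite expr0 mulr1; apply: (le_trans (MP _ tT)).
    by rewrite ler_peMr// -expR0 ler_expR !mulr_ge0// ltW.
  apply: (@causal_primitive_le (fun t => G (un n.+1) t - G (un n) t) (fun t => un n.+2 t - un n.+1 t)
     (fun t => M * 2^-1 ^+ n.+1 * expR (2 * L * t))
     (fun t => M * 2^-1 ^+ n.+1 * (2 * L * expR (2 * L * t))) T).
  - exact: causal_curveB.
  - by move=> s; exact: is_derive_scaled_expR.
  - by rewrite mulr_ge0 ?expR_ge0// mulr_ge0// exprn_ge0// invr_ge0.
  - move=> s /andP[s0 sT].
    rewrite (_ : _ * (2 * _ * _) = L * (M * 2^-1 ^+ n * expR (2 * L * s))); last first.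
      by rewrite exprS; field.
    apply: GL => // r rs; have [r0|r0] := leP r 0.
      rewrite !(unc _).2// subrr normr0 mulr_ge0 ?expR_ge0// mulr_ge0//.
    apply: (le_trans (IH r _)); first by rewrite (ltW r0) (le_trans rs).
    rewrite ler_wpM2l ?mulr_ge0 ?exprn_ge0 ?invr_ge0//.
    by rewrite ler_expR ler_pM2l// mulr_gt0.
  - by rewrite t0.
have steps T M : 0 <= M -> (forall t, t <= T -> `|un 1%N t - un 0%N t| <= M) ->
    forall n k t, 0 <= t <= T ->
    `|un (n + k)%N t - un n t| <= 2 * M * 2^-1 ^+ n * (1 - 2^-1 ^+ k) * expR (2 * L * t).
  move=> M0 MP n; elim=> [|k IH] t tT.
    by rewrite addn0 subrr normr0 expr0 subrr mulr0 mul0r.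
  rewrite addnS; apply: (le_trans (ler_distD (un (n + k)%N t) _ _)).
  apply: (le_trans (lerD (step T M M0 MP _ _ tT) (IH _ tT))).
  by rewrite -mulrDl ler_wpM2r ?expR_ge0// exprD exprS le_eqVlt; apply/orP; left; apply/eqP; field.
have uC T (e : R) : 0 < e -> exists N, forall n m, (N <= n)%N -> (N <= m)%N ->
    forall t, t <= T -> `|un n t - un m t| <= e.
  move=> e0.
  have [M M0 MP] := causal_curve_bounded T (causal_curveB (unc 1%N) (unc 0%N)).
  pose E := 2 * M * expR (2 * L * `|T|) + 1.
  have E0 : 0 < E by rewrite ltr_wpDl// mulr_ge0 ?expR_ge0// mulr_ge0.
  have [N NP] : exists N, 2^-1 ^+ N * E <= e / 2.
    have c : @GRing.exp R 2^-1 n @[n --> \oo] --> 0.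
      by apply: cvg_expr; rewrite ger0_norm ?invr_ge0// invf_lt1// ltr1n.
    have /cvgrPdist_le/(_ (e / 2 / E)) := c.
    rewrite !divr_gt0// => /(_ isT)[N _ /(_ N (leqnn N))].
    rewrite sub0r normrN ger0_norm ?exprn_ge0 ?invr_ge0// ler_pdivlMr// => h.
    by exists N.
  have h n t : (N <= n)%N -> t <= T -> `|un n t - un N t| <= e / 2.
    move=> Nn tT; have [t0|t0] := leP t 0.
      by rewrite !(unc _).2// subrr normr0 divr_ge0// ltW.
    rewrite -(subnKC Nn); apply: (le_trans (steps T M M0 MP _ _ _ _)).
      by rewrite (ltW t0).
    apply: le_trans NP; rewrite /E.
    rewrite [_ * 2^-1 ^+ N]mulrC -!mulrA ler_pM2l ?exprn_gt0 ?invr_gt0//.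
    rewrite !mulrA.
    apply: (@le_trans _ _ (2 * M * expR (2 * L * `|T|))); last by rewrite lerDl.
    rewrite ler_pM ?expR_ge0 ?mulr_ge0//.
    - by rewrite subr_ge0 exprn_ile1 ?invr_ge0// invf_le1// ler1n.
    - by rewrite ler_piMr ?mulr_ge0// gerBl exprn_ge0// invr_ge0.
    - by rewrite ler_expR ler_pM2l ?mulr_gt0// (le_trans tT)// ler_norm.
  exists N => n m Nn Nm t tT; rewrite (splitr e).
  apply: (le_trans (ler_distD (un N t) _ _)).
  by rewrite lerD ?h// distrC h.
have [u uc uP] := uniform_cauchy_causal unc uC.
exists u => //.
have [v vc vP] := vector_primitive (Gc _ uc).
suff uv : u = v by move=> t; rewrite {1}uv; exact: vP.
apply/funext => t.
have [t0|t0] := leP t 0; first by rewrite (uc.2 _ t0) (vc.2 _ t0).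
apply/eqP; rewrite -subr_eq0 -normr_le0; apply/ler_addgt0Pl => e e0; rewrite addr0.
(* One such share bounds |u_{N+1} - u|; L times the share, integrated up to t, bounds |u_{N+1} - v|.
   The two add up to e. *)
have d0 : 0 < e / (1 + L * t) by rewrite divr_gt0// ltr_wpDr// mulr_ge0// ltW.
have [N NP] := uP t _ d0.
apply: (le_trans (ler_distD (un N.+1 t) _ _)).
rewrite (_ : e = e / (1 + L * t) + L * (e / (1 + L * t)) * t); last first.
  by field; rewrite gt_eqF// ltr_wpDr// mulr_ge0// ltW.
apply: lerD; first by rewrite distrC; apply: NP.
apply: (@causal_primitive_le (fun s => G (un N) s - G u s) (fun s => un N.+1 s - v s)
   (fun s => L * (e / (1 + L * t)) * s) (fun s => L * (e / (1 + L * t))) t).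
- exact: causal_curveB.
- move=> s; have := is_deriveZ (L * (e / (1 + L * t))) (is_derive_id s 1).
  by rewrite /GRing.scale/= mulr1.
- by rewrite mulr0.
- move=> s /andP[s0 st]; apply: GL => // r rs; apply: NP => //.
  exact: le_trans st.
- by rewrite (ltW t0) lexx.
Qed.

(* Bound [w] by the maximum [M] of [e^{-l t} |w t|]: integrating the
   differential inequality gives [Cl |w t|^2 <= G + Cl M^2 e^{2 l t} / 2], and
   evaluating at the maximum point absorbs the last term. *)
Lemma energy_bound (A : H -> H) (Cl c : R) (w dw : R -> H) (G dG : R -> R) T GT :
  0 < Cl -> 0 <= c -> 0 <= T ->
  (forall x y, ip (A x) y = ip x (A y)) ->
  (forall x, Cl * `|x| ^+ 2 <= ip (A x) x) ->
  (forall t : R, is_derive t 1 (fun s => A (w s)) (A (dw t))) ->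
  causal_curve w -> (forall t : R, is_derive t 1 w (dw t)) ->
  G 0 = 0 -> (forall t : R, is_derive t 1 G (dG t)) ->
  (forall t, 0 <= t <= T -> G t <= GT) ->
  (forall t m, 0 <= t <= T -> 0 <= m -> (forall s, s <= t -> `|w s| <= m) ->
     2 * ip (A (dw t)) (w t) <= dG t + c * m ^+ 2) ->
  forall t, t <= T -> `|w t| ^+ 2 <= 2 / Cl * expR (2 * (c / Cl + 1) * `|t|) * GT.
Proof.
move=> Cl0 c0 T0 AS AC AwD wc wD G0 GD GGT wP.
have GT0 : 0 <= GT by rewrite -G0 GGT// lexx.
(* The rate makes c / (2 l) at most Cl / 2, so that half of the coercive term survives the
   absorption; the summand 1 keeps l positive when c = 0. *)
pose l := c / Cl + 1.
have l0 : 0 < l by rewrite ltr_wpDl// divr_ge0// ltW.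
have [|s0 s0T s0P] := @EVT_max R (fun s => expR (- l * s) * `|w s|) _ _ T0.
  apply: continuous_subspaceT => s; apply: cvgM; last by apply: cvg_norm; exact: wc.1.
  apply: (@continuous_comp _ _ _ (fun r => - l * r) expR); last exact: continuous_expR.
  exact: mulrl_continuous.
have [M ME] : exists M, M = expR (- l * s0) * `|w s0| by exists (expR (- l * s0) * `|w s0|).
have M0 : 0 <= M by rewrite ME mulr_ge0 ?expR_ge0.
have wM s : s <= T -> `|w s| <= M * expR (l * s).
  move=> sT; have [sn|sn] := leP s 0.
    by rewrite wc.2// normr0 mulr_ge0 ?expR_ge0.
  have : s \in `[0, T] by rewrite in_itv/= (ltW sn) sT.
  by move=> /s0P; rewrite -ME mulNr expRN ler_pdivrMl ?expR_gt0// mulrC.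
have eD (t : R) : is_derive t 1 (fun s => ip (A (w s)) (w s)) (2 * ip (A (dw t)) (w t)).
  have := is_derive_ip ipP (AwD t) (wD t).
  by rewrite [ip (A (w t)) _]AS [ip (w t) _](ipC ipP) mulr2n mulrDl !mul1r.
have key t : 0 <= t <= T ->
    Cl * `|w t| ^+ 2 <= GT + c * M ^+ 2 / (2 * l) * expR (2 * l * t).
  move=> /andP[t0 tT]; apply: (le_trans (AC _)).
  pose phi s := G s + c * M ^+ 2 / (2 * l) * expR (2 * l * s).
  have phiD (s : R) : is_derive s 1 phi (dG s + c * M ^+ 2 / (2 * l) * (2 * l * expR (2 * l * s))).
    by apply: is_deriveD; exact: is_derive_scaled_expR.
  have := le_increment t0 eD phiD.
  rewrite (wc.2 0)// (ip0r ipP) subr0 => h.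
  have {}h : ip (A (w t)) (w t) <= phi t - phi 0.
    apply: h => s /andP[sn st].
    rewrite (_ : c * M ^+ 2 / _ * _ = c * (M * expR (l * s)) ^+ 2); last first.
      rewrite exprMn [expR _ ^+ 2]expr2 -expRD (_ : l * s + l * s = 2 * l * s); last by ring.
      by field; rewrite gt_eqF.
    apply: wP; first by rewrite sn (le_trans st).
      by rewrite mulr_ge0 ?expR_ge0.
    move=> r rs; apply: (le_trans (wM _ _)); first by rewrite (le_trans rs)// (le_trans st).
    by rewrite ler_wpM2l// ler_expR ler_pM2l.
  apply: (le_trans h); rewrite /phi G0 add0r.
  rewrite -addrA lerD ?GGT ?t0// gerBl.
  by rewrite mulr_ge0 ?expR_ge0// divr_ge0 ?mulr_ge0 ?exprn_ge0// ltW.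
have M2 : M ^+ 2 <= 2 / Cl * GT.
  move: s0T; rewrite in_itv/= => /[dup] /andP[s00 _] /key.
  have -> : `|w s0| ^+ 2 = M ^+ 2 * expR (2 * l * s0).
    rewrite ME exprMn [expR _ ^+ 2]expr2 -expRD mulrAC -expRD.
    by rewrite (_ : - l * s0 + - l * s0 + 2 * l * s0 = 0) ?expR0 ?mul1r//; ring.
  have E0 : 1 <= expR (2 * l * s0) by rewrite -expR0 ler_expR !mulr_ge0// ltW.
  have cl : c / (2 * l) <= Cl / 2.
    rewrite ler_pdivrMr ?mulr_gt0// (_ : Cl / 2 * (2 * l) = c + Cl).
      by rewrite lerDl ltW.
    by rewrite /l; field; rewrite gt_eqF.
  move=> h.
  have K0 : 0 <= M ^+ 2 * expR (2 * l * s0) by rewrite mulr_ge0 ?exprn_ge0 ?expR_ge0.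
  have h1 : c * M ^+ 2 / (2 * l) * expR (2 * l * s0) <= Cl / 2 * (M ^+ 2 * expR (2 * l * s0)).
    rewrite (_ : c * M ^+ 2 / (2 * l) * _ = c / (2 * l) * (M ^+ 2 * expR (2 * l * s0))).
      by rewrite ler_wpM2r.
    by field; rewrite gt_eqF.
  have h2 : Cl / 2 * (M ^+ 2 * expR (2 * l * s0)) <= GT.
    by move: h h1; set K := M ^+ 2 * _; set X := _ * expR _; clearbody X K; lra.
  rewrite (_ : 2 / Cl * GT = (Cl / 2)^-1 * GT); last by rewrite invf_div.
  rewrite ler_pdivlMl ?divr_gt0//; apply: le_trans h2.
  by rewrite ler_wpM2l ?divr_ge0 ?(ltW Cl0)// ler_peMr// exprn_ge0.
move=> t tT; have [tn|tn] := leP t 0.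
  by rewrite wc.2// normr0 expr0n !mulr_ge0 ?expR_ge0 ?invr_ge0// ltW.
apply: (@le_trans _ _ ((M * expR (l * t)) ^+ 2)).
  by rewrite ler_sqr ?nnegrE ?wM// mulr_ge0 ?expR_ge0.
rewrite exprMn [expR _ ^+ 2]expr2 -expRD (_ : l * t + l * t = 2 * l * `|t|); last first.
  by rewrite gtr0_norm//; ring.

by rewrite [leRHS]mulrAC ler_wpM2r ?expR_ge0.
Qed.

End vector_ode.

(** * The abstract evolution equation *)

(** Backward, so that the quotient of a causal curve is causal and only delays occur. For e = 0 the
    inverse is 0 and the quotient is the zero curve, a convention used to deduce the bound on one
    quotient from the bound on a difference of two. *)
Definition diff_quot {R : realType} {H : normedModType R} (e : R) (u : R -> H) : R -> H :=
  fun t => e^-1 *: (u t - u (t - e)).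

Section bounded_maps.
Context {R : realType} {H : completeNormedModType R}.
Implicit Types u v : R -> H.

Lemma is_derive_bounded_linear (T : H -> H) (C : R) u t du :
  (forall c x y, T (c *: x + y) = c *: T x + T y) -> (forall x, `|T x| <= C * `|x|) ->
  is_derive (t : R) 1 u du -> is_derive (t : R) 1 (fun s => T (u s)) (T du).
Proof.
move=> Tl TC /is_derive_cvgP uD; apply/is_derive_cvgP.
have TB x y : T (x - y) = T x - T y.
  by have := Tl (-1) y x; rewrite !scaleN1r ![- _ + _]addrC.
have T0 : T 0 = 0 by have := TB 0 0; rewrite !subrr.
have TZ c x : T (c *: x) = c *: T x by rewrite -[c *: x]addr0 Tl T0 addr0.
apply/cvgrPdist_le => e e0.
have C0 : 0 < `|C| + 1 by rewrite ltr_wpDl.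
move/cvgrPdist_le : uD => /(_ (e / (`|C| + 1))); rewrite divr_gt0// => /(_ isT).
apply: filterS => h hP; rewrite -TB -TZ -TB.
apply: (le_trans (TC _)).
apply: (@le_trans _ _ ((`|C| + 1) * `|du - h^-1 *: (u (t + h) - u t)|)).
  by rewrite ler_wpM2r// (le_trans (ler_norm _))// lerDl.
by rewrite mulrC -ler_pdivlMr.
Qed.

Lemma is_derive_shift u e t du : is_derive (t - e : R) 1 u du ->
  is_derive (t : R) 1 (fun s => u (s - e)) du.
Proof.
move=> /is_derive_cvgP uD; apply/is_derive_cvgP.
by under eq_fun do rewrite addrAC.
Qed.

Lemma diff_quot_cvg (E : normedModType R) (u : R -> E) t du : is_derive (t : R) 1 u du ->
  diff_quot n.+1%:R^-1 u t @[n --> \oo] --> du.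
Proof.
move=> /is_derive_cvgP uD.
apply/cvgrPdist_le => e e0.
move/cvgrPdist_le : uD => /(_ e e0)[d /= d0 dP].
have := near_infty_natSinv_lt (PosNum d0); apply: filterS => n /= nd.
have := dP (- n.+1%:R^-1); rewrite /= sub0r opprK ger0_norm ?invr_ge0// => /(_ nd).
rewrite oppr_eq0 invr_eq0 pnatr_eq0 => /(_ isT).
by rewrite /diff_quot invrN scaleNr -scalerN opprB.
Qed.

Lemma causal_curve_diff_quot u e : 0 <= e -> causal_curve u -> causal_curve (diff_quot e u).
Proof.
by move=> e0 uc; apply: causal_curveZ; apply: causal_curveB => //; exact: causal_curve_shift.
Qed.

End bounded_maps.

(** * Skew-adjoint operators and their resolvents *)

Section resolvent.
Context {R : realType} {H : completeNormedModType R}.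
Context (ip : H -> H -> R) (ipP : inner_product ip).
Context (V : set H) (P : H -> H).

(** The single equivalence [sa_adjoint] carries both properties used below: read from right to left
    it is skew-symmetry, and from left to right it gives closedness, since a limit of points of the
    graph satisfies its left-hand side. *)
Record skew_adjoint_op : Prop := {
  sa0 : V 0;
  sa_linear : forall c x y, V x -> V y -> V (c *: x + y) /\ P (c *: x + y) = c *: P x + P y;
  sa_adjoint : forall v w, (forall u, V u -> ip (P u) v = ip u w) <-> V v /\ w = - P v;
  sa_dense : forall w, (forall u, V u -> ip u w = 0) -> w = 0 }.

Hypothesis PP : skew_adjoint_op.

Lemma sa_skew u v : V u -> V v -> ip (P u) v = - ip u (P v).
Proof.
move=> Vu Vv; rewrite -(ipNr ipP).
by have [_ /(_ (conj Vv erefl)) ->] := sa_adjoint PP v (- P v).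
Qed.

Lemma sa_skew0 u : V u -> ip (P u) u = 0.
Proof. by move=> Vu; have := sa_skew Vu Vu; rewrite [ip u _](ipC ipP); lra. Qed.

Lemma saB u v : V u -> V v -> V (u - v) /\ P (u - v) = P u - P v.
Proof.
by move=> Vu Vv; have := sa_linear PP (-1) Vv Vu; rewrite !scaleN1r ![- _ + _]addrC.
Qed.

(** The cross term vanishes because <P u, u> = 0. Injectivity of 1 + e P and contractivity of its
    inverse are both read off from this identity. *)
Lemma sa_norm e u : V u -> `|u + e *: P u| ^+ 2 = `|u| ^+ 2 + e ^+ 2 * `|P u| ^+ 2.
Proof.
move=> Vu; rewrite (normD2 ipP) (ipZr ipP) (ipC ipP) sa_skew0// !mulr0 addr0.
by rewrite normrZ exprMn real_normK ?num_real.
Qed.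

(** 1 + e P is closed and bounded below. A vector w orthogonal to its range satisfies the adjoint
    relation, so w lies in V with P w = w / e; testing with w itself then gives 2 |w|^2 = 0. *)
Lemma resolvent_exists e : 0 < e -> forall y, exists2 x, V x & x + e *: P x = y.
Proof.
move=> e0; apply: (@closed_coercive_surj _ _ _ ipP V (fun x => x + e *: P x) 1) => //.
- exact: sa0.
- move=> a x y Vx Vy; have [? ->] := sa_linear PP a Vx Vy; split=> //.
  by rewrite scalerDr !scalerA [e * a]mulrC -scalerA addrACA -scalerDr.
- move=> s x y Vs sx Tsy.
  have Psc : P (s n) @[n --> \oo] --> e^-1 *: (y - x).
    rewrite (_ : (fun n => _) = fun n => e^-1 *: (s n + e *: P (s n) - s n)).
      by apply: cvgZr; apply: cvgB.
    by apply/funext => n; rewrite addrAC subrr add0r scalerA mulVf ?gt_eqF// scale1r.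
  have [/(_ _)[] ] := sa_adjoint PP x (- (e^-1 *: (y - x))).
    move=> u Vu.
    have c1 : ip (P u) (s n) @[n --> \oo] --> ip (P u) x.
      by apply: (cvg_ip ipP) => //; exact: cvg_cst.
    have c2 : ip (P u) (s n) @[n --> \oo] --> ip u (- (e^-1 *: (y - x))).
      under eq_fun do rewrite sa_skew// -(ipNr ipP).
      by apply: (cvg_ip ipP); [exact: cvg_cst|exact: cvgN].
    exact: (cvg_unique _ c1 c2).
  move=> Vx /oppr_inj <- _; split=> //.
  by rewrite scalerA mulfV ?gt_eqF// scale1r addrC subrK.
- move=> x Vx; rewrite mul1r -ler_sqr ?nnegrE// sa_norm// lerDl.
  by rewrite mulr_ge0 ?exprn_ge0// ltW.
- move=> w wP.
  have [/(_ _)[] ] := sa_adjoint PP w (- (e^-1 *: w)).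
    move=> u Vu; have := wP u Vu; rewrite (ipDl ipP) (ipZl ipP) (ipNr ipP) (ipZr ipP).
    by move=> /eqP; rewrite addrC addr_eq0 => /eqP h; apply: (mulfI (lt0r_neq0 e0)); rewrite h; field; rewrite gt_eqF.
  move=> Vw /oppr_inj Pw _; have := wP w Vw.
  rewrite -Pw scalerA mulfV ?gt_eqF// scale1r (ipDl ipP) (ipxx ipP) => /eqP.
  by rewrite -mulr2n mulrn_eq0/= sqrf_eq0 normr_eq0 => /eqP.
Qed.

Lemma resolvent e : 0 < e -> exists J : H -> H, [/\
  forall x, V (J x), forall x, J x + e *: P (J x) = x,
  forall c x y, J (c *: x + y) = c *: J x + J y & forall x, `|J x| <= `|x|].
Proof.
move=> e0.
have /choice[J JP] (y : H) : exists x, V x /\ x + e *: P x = y.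
  by have [x] := resolvent_exists e0 y; exists x.
have inj x : V x -> x + e *: P x = 0 -> x = 0.
  move=> Vx h; have := sa_norm e Vx; rewrite h normr0 expr0n/= => /esym/eqP.
  rewrite paddr_eq0 ?exprn_ge0//; last by rewrite mulr_ge0 ?exprn_ge0// ltW.
  by rewrite sqrf_eq0 normr_eq0 => /andP[/eqP].
exists J; split=> [x|x|c x y|x]; [exact: (JP x).1|exact: (JP x).2| |].
  have [V1 E1] := sa_linear PP c (JP x).1 (JP y).1.
  have [V2 E2] := saB (JP (c *: x + y)).1 V1.
  apply/eqP; rewrite -subr_eq0; apply/eqP/inj => //.
  rewrite E2 E1 scalerBr addrACA -opprD (JP _).2.
  rewrite scalerDr !scalerA [e * c]mulrC -scalerA addrACA -scalerDr !(JP _).2.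
  exact: subrr.
rewrite -ler_sqr ?nnegrE// -[in leRHS](JP x).2 sa_norm ?lerDl; last exact: (JP x).1.
by rewrite mulr_ge0 ?exprn_ge0// ltW.
Qed.

End resolvent.

(* An identity between linear combinations is checked after pairing both sides
   with an arbitrary vector, which turns it into an identity in R. *)
Ltac vector_ring ipP :=
  apply/eqP; rewrite -subr_eq0; apply/eqP/(ip_inj ipP) => ?;
  rewrite ?(ipDl ipP, ipNl ipP, ipZl ipP, ip0l ipP); ring.

(** * Energy estimates and existence for the abstract equation *)

Section abstract_evolution.
Context {R : realType} {H : completeNormedModType R}.
Context (ip : H -> H -> R) (ipP : inner_product ip).
Context (V : set H) (P : H -> H) (PP : skew_adjoint_op ip V P).
Context (A B : H -> H) (K : (R -> H) -> R -> H) (Cl Cu beta kap : R).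

(** Continuity of [K u] is not among the axioms: it follows from the bound over the past and from
    invariance under delays, see [K_causal]. *)
Record evolution_coefficients : Prop := {
  ec_Cl : 0 < Cl;
  ec_beta : 0 <= beta;
  ec_kap : 0 <= kap;
  ec_A_linear : forall c x y, A (c *: x + y) = c *: A x + A y;
  ec_A_sym : forall x y, ip (A x) y = ip x (A y);
  ec_A_coercive : forall x, Cl * `|x| ^+ 2 <= ip (A x) x;
  ec_A_upper : forall x, ip (A x) x <= Cu * `|x| ^+ 2;
  ec_B_linear : forall c x y, B (c *: x + y) = c *: B x + B y;
  ec_B_bound : forall x, `|B x| <= beta * `|x|;
  ec_K_linear : forall c u v t, causal_curve u -> causal_curve v ->
    K (fun s => c *: u s + v s) t = c *: K u t + K v t;
  ec_K_bound : forall u t m, causal_curve u -> (forall s, s <= t -> `|u s| <= m) ->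
    `|K u t| <= kap * m;
  ec_K_shift : forall u e t, causal_curve u -> 0 <= e ->
    K (fun s => u (s - e)) t = K u (t - e) }.

Hypothesis EC : evolution_coefficients.

Lemma A0 : A 0 = 0.
Proof.
have := ec_A_linear EC (-1) 0 0; rewrite scaler0 addr0 => ->.
by rewrite scaleN1r addNr.
Qed.

Lemma AZ c x : A (c *: x) = c *: A x.
Proof. by rewrite -[c *: x]addr0 (ec_A_linear EC) A0 addr0. Qed.

Lemma AB x y : A (x - y) = A x - A y.
Proof. by have := ec_A_linear EC (-1) y x; rewrite !scaleN1r ![- _ + _]addrC. Qed.

Lemma A_ge0 x : 0 <= ip (A x) x.
Proof.
apply: le_trans (ec_A_coercive EC x).
by rewrite mulr_ge0 ?exprn_ge0// ltW// (ec_Cl EC).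
Qed.

(** Cauchy-Schwarz for the form <A x, y>, applied to x and A x: |A x|^4 is at most <A x, x> <A A x,
    A x>, hence at most Cu^2 |x|^2 |A x|^2. Thus the norm of A is controlled by the quadratic form
    bound alone. *)
Lemma A_bound x : `|A x| <= Cu * `|x|.
Proof.
have [->|Ax] := eqVneq (A x) 0.
  rewrite normr0; have [->|x0] := eqVneq x 0; first by rewrite normr0 mulr0.
  have : 0 < `|x| by rewrite normr_gt0.
  have := le_trans (A_ge0 x) (ec_A_upper EC x).
  by rewrite expr2 mulrA => + xp; rewrite pmulr_lge0.
have Ap : 0 < `|A x| by rewrite normr_gt0.
have := @cauchy_schwarz_form R H (fun x y => ip (A x) y) _ _ _ _ x (A x).
rewrite (ipxx ipP) => /(_ _ _ _ A_ge0) h.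
have {}h : (`|A x| ^+ 2) ^+ 2 <= ip (A x) x * ip (A (A x)) (A x).
  apply: h => [y z|y z w|c y z]; first by rewrite (ec_A_sym EC) (ipC ipP).
    by rewrite -{1}[y]scale1r (ec_A_linear EC) scale1r (ipDl ipP).
  by rewrite AZ (ipZl ipP).
have h2 : ip (A x) x * ip (A (A x)) (A x) <= (Cu * `|x| ^+ 2) * (Cu * `|A x| ^+ 2).
  by apply: ler_pM; rewrite ?A_ge0 ?(ec_A_upper EC).
have Cu0 : 0 <= Cu.
  have := le_trans (A_ge0 (A x)) (ec_A_upper EC (A x)).
  by rewrite pmulr_lge0// exprn_gt0.
rewrite -ler_sqr ?nnegrE ?mulr_ge0// -(ler_pM2r (exprn_gt0 2 Ap)).
by rewrite -expr2 (le_trans h)// (le_trans h2)// le_eqVlt; apply/orP; left; apply/eqP; ring.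
Qed.

(** The coercive surjectivity lemma with the whole space as domain. Symmetry of A moves limits to
    the other factor, which gives closedness of the graph. *)
Lemma A_inverse : exists Ai : H -> H, [/\ forall y, A (Ai y) = y, Ai 0 = 0 &
  forall x y, `|Ai x - Ai y| <= Cl^-1 * `|x - y|].
Proof.
have Cl0 := ec_Cl EC.
have Alow x : Cl * `|x| <= `|A x|.
  have [->|x0] := eqVneq x 0; first by rewrite normr0 mulr0.
  have xp : 0 < `|x| by rewrite normr_gt0.
  rewrite -(ler_pM2r xp) -mulrA -expr2; apply: (le_trans (ec_A_coercive EC x)).
  exact: ip_le.
have surj : forall y, exists2 x, [set: H] x & A x = y.
  apply: (@closed_coercive_surj _ _ _ ipP setT A Cl) => //.
  - by move=> a x y _ _; split=> //; exact: (ec_A_linear EC).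
  - move=> s x y _ sx Asy; split=> //.
    apply/eqP; rewrite -subr_eq0; apply/eqP/(ip_inj ipP) => z; rewrite (ipBl ipP).
    have c1 : ip (A (s n)) z @[n --> \oo] --> ip y z by exact: (cvg_ipl ipP).
    have c2 : ip (A (s n)) z @[n --> \oo] --> ip (A x) z.
      under eq_fun do rewrite (ec_A_sym EC); rewrite (ec_A_sym EC).
      exact: (cvg_ipl ipP).
    by rewrite (cvg_unique _ c1 c2) ?subrr.
  - by move=> w wP; apply/eqP; rewrite -normr_eq0 -sqrf_eq0 eq_le exprn_ge0// andbT;
      have := ec_A_coercive EC w; rewrite wP// -ler_pdivlMl// mulr0.
have /choice[Ai AiP] (y : H) : exists x, A x = y by have [x _] := surj y; exists x.
have AiL x y : `|Ai x - Ai y| <= Cl^-1 * `|x - y|.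
  by rewrite ler_pdivlMl// (le_trans (Alow _))// AB !AiP.
exists Ai; split=> //.
by have := Alow (Ai 0); rewrite AiP normr0 pmulr_rle0// normr_le0 => /eqP.
Qed.

Lemma BB x y : B (x - y) = B x - B y.
Proof. by have := ec_B_linear EC (-1) y x; rewrite !scaleN1r ![- _ + _]addrC. Qed.

Lemma B0 : B 0 = 0.
Proof. by have := BB 0 0; rewrite !subrr. Qed.

Lemma BZ c x : B (c *: x) = c *: B x.
Proof. by rewrite -[c *: x]addr0 (ec_B_linear EC) B0 addr0. Qed.

Lemma K0 t : K (fun=> 0) t = 0.
Proof.
have c := @causal_curve_cst0 R H.
have := @ec_K_bound EC _ t 0 c; rewrite normr0 mulr0 => /(_ (fun _ _ => lexx _)).
by rewrite normr_le0 => /eqP.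
Qed.

Lemma KZ c u t : causal_curve u -> K (fun s => c *: u s) t = c *: K u t.
Proof.
move=> uc; have := ec_K_linear EC c t uc (@causal_curve_cst0 R H).
by rewrite K0 addr0; under eq_fun do rewrite addr0.
Qed.

Lemma KB u v t : causal_curve u -> causal_curve v ->
  K (fun s => u s - v s) t = K u t - K v t.
Proof.
move=> uc vc; have := ec_K_linear EC (-1) t vc uc.
by rewrite scaleN1r addrC; under eq_fun do rewrite scaleN1r addrC.
Qed.

(** K u (s) - K u (s - r) is K applied to u - u(. - r), at time s; so the uniform modulus of
    continuity of u, multiplied by kap, is one for K u. *)
Lemma K_causal u : causal_curve u -> causal_curve (K u).
Proof.
move=> uc; split=> [t|t t0]; last first.
  apply/eqP; rewrite -normr_le0 -(mulr0 kap); apply: (ec_K_bound EC uc) => s st.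
  by rewrite uc.2 ?normr0// (le_trans st).
have key T (e : R) : 0 < e ->
    exists2 d : R, 0 < d & forall s r, s <= T -> 0 <= r <= d -> `|K u s - K u (s - r)| <= e.
  move=> e0; have k1 : 0 < kap + 1 by rewrite ltr_wpDl// (ec_kap EC).
  have [d d0 dP] := causal_curve_uniform T uc (divr_gt0 e0 k1).
  exists d => // s r sT /andP[r0 rd].
  rewrite -(ec_K_shift EC _ uc r0) -KB//; last exact: causal_curve_shift.
  apply: (@le_trans _ _ (kap * (e / (kap + 1)))).
    apply: (ec_K_bound EC) => [|q qs].
      by apply: causal_curveB => //; exact: causal_curve_shift.
    rewrite distrC; apply: dP; first exact: le_trans sT.
    by rewrite addrAC subrr sub0r normrN ger0_norm.
  rewrite mulrCA ler_piMr ?(ltW e0)// ler_pdivrMr// mul1r lerDl//.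
apply/cvgrPdist_le => e e0.
have [d d0 dP] := key (t + 1) e e0.
near=> s.
have sd : `|t - s| < d by near: s; exact: cvgr_dist_lt.
have s1 : s <= t + 1.
  by near: s; apply/nbhs_ballP; exists 1 => //= s; rewrite /ball/= ltr_distlC => /andP[_ /ltW].
have [st|ts] := leP s t.
  rewrite (_ : s = t - (t - s)); last by ring.
  by apply: dP; rewrite ?lerDl// subr_ge0 st/= ltW// (le_lt_trans _ sd)// ler_norm.
rewrite distrC; have := dP s (s - t) s1; rewrite subKr; apply.
rewrite subr_ge0 (ltW ts)/= ltW// (le_lt_trans _ sd)//.
by rewrite distrC ler_norm.
Unshelve. all: by end_near. Qed.

(** The constant of [energy_bound] for c = 1 + 2 (beta + kap): the 1 comes from 2 <g, u> <= |g|^2 +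
    m^2, the rest from twice the lower order terms. *)
Definition growth (t : R) : R := 2 / Cl * expR (2 * ((1 + 2 * (beta + kap)) / Cl + 1) * `|t|).

Lemma growth_ge0 t : 0 <= growth t.
Proof. by rewrite mulr_ge0 ?expR_ge0// divr_ge0// ltW// (ec_Cl EC). Qed.

Lemma is_derive_A u t du : is_derive (t : R) 1 u du ->
  is_derive (t : R) 1 (fun s => A (u s)) (A du).
Proof. exact: is_derive_bounded_linear (ec_A_linear EC) A_bound. Qed.

Lemma lower_order_bound u t m : causal_curve u -> 0 <= m ->
  (forall s, s <= t -> `|u s| <= m) -> `|B (u t) + K u t| <= (beta + kap) * m.
Proof.
move=> uc m0 um; apply: (le_trans (ler_normD _ _)); rewrite mulrDl; apply: lerD.
  by apply: (le_trans (ec_B_bound EC _)); rewrite ler_wpM2l ?(ec_beta EC)// um.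
exact: (ec_K_bound EC).
Qed.

(** The principal part enters only as a curve q with <q, u> >= 0. This covers the Yosida
    approximations, their difference quotients, and P itself in the uniqueness proof. *)
Lemma energy_estimate u du g (q : R -> H) T : causal_curve u -> causal_curve g ->
  (forall t : R, is_derive t 1 u (du t)) ->
  (forall t, 0 <= ip (q t) (u t)) ->
  (forall t, A (du t) + q t + B (u t) + K u t = g t) ->
  forall t, t <= T -> `|u t| ^+ 2 <= growth t * prim (fun s => `|g s| ^+ 2) T.
Proof.
move=> uc gc uD q0 eq t tT.
have g2 := causal_curve_norm2 gc.
have [T0|T0] := leP 0 T; last first.
  rewrite uc.2 ?(le_trans tT (ltW T0))// normr0 expr0n/= mulr_ge0 ?growth_ge0//.
  by apply: prim_ge0 => s _; rewrite exprn_ge0.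
have bk : 0 <= beta + kap by rewrite addr_ge0 ?(ec_beta EC) ?(ec_kap EC).
apply: (@energy_bound _ _ _ ipP A Cl (1 + 2 * (beta + kap)) u du (prim (fun s => `|g s| ^+ 2))
  (fun s => `|g s| ^+ 2) T) => //.
- exact: (ec_Cl EC).
- by rewrite addr_ge0// mulr_ge0.
- exact: (ec_A_sym EC).
- exact: (ec_A_coercive EC).
- by move=> s; exact: is_derive_A.
- exact: prim_causal.
- by move=> s; exact: prim_derive.
- move=> s /andP[s0 sT].
  have := le_increment sT (fun r => is_derive_cst 0 r 1) (fun r => prim_derive r g2).
  by rewrite subrr subr_ge0; apply => r _; rewrite exprn_ge0.
- move=> s m /andP[s0 sT] m0 um.
  have -> : A (du s) = g s - q s - (B (u s) + K u s).
    apply/eqP; rewrite eq_sym subr_eq subr_eq -eq.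
    by rewrite -!addrA [q s + _]addrC -!addrA.
  rewrite !(ipBl ipP).
  have h1 : 2 * ip (g s) (u s) <= `|g s| ^+ 2 + m ^+ 2.
    have h : ip (g s) (u s) <= `|g s| * m.
      by apply: (le_trans (ip_le ipP _ _)); rewrite ler_wpM2l// um.
    have := sqr_ge0 (`|g s| - m); move: h; set X := ip _ _; set Y := `|g s|; clearbody X Y.
    by move=> *; nra.
  have h2 : - ip (B (u s) + K u s) (u s) <= (beta + kap) * m ^+ 2.
    rewrite -(ipNl ipP); apply: (le_trans (ip_le ipP _ _)); rewrite normrN expr2 mulrA.
    by apply: ler_pM => //; [exact: lower_order_bound|exact: um].
  have := q0 s; move: h1 h2.
  set X := ip (g s) _; set Y := ip (B _ + _) _; set Z := ip (q s) _; clearbody X Y Z.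
  by move=> *; lra.
Qed.

Lemma approximate_solution f e : 0 < e -> causal_curve f ->
  forall Pe : H -> H, (forall x y, `|Pe x - Pe y| <= 2 / e * `|x - y|) -> Pe 0 = 0 ->
  exists u du, [/\ causal_curve u, forall t : R, is_derive t 1 u (du t) &
    forall t, A (du t) + Pe (u t) + B (u t) + K u t = f t].
Proof.
move=> e0 fc Pe PeL Pe0.
have [Ai [AiK Ai0 AiL]] := A_inverse.
(* The equation solved for u'; its right-hand side depends on u in a Lipschitz way over the past, as
   Picard iteration requires. *)
pose G u t := Ai (f t - (Pe (u t) + (B (u t) + K u t))).
have Cl0 := ec_Cl EC.
pose L := Cl^-1 * (2 / e + (beta + kap)).
have bk : 0 <= beta + kap by rewrite addr_ge0 ?(ec_beta EC) ?(ec_kap EC).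
have L0 : 0 < L by rewrite mulr_gt0 ?invr_gt0// ltr_wpDr// divr_gt0.
have Gc u : causal_curve u -> causal_curve (G u).
  move=> uc; apply: (causal_curve_lipschitz AiL Ai0).
  apply: causal_curveB => //; apply: causal_curveD.
    exact: (causal_curve_lipschitz PeL Pe0).
  apply: causal_curveD; last exact: K_causal.
  apply: (@causal_curve_lipschitz _ _ _ _ beta) => //; last exact: B0.
  by move=> x y; rewrite -BB; exact: (ec_B_bound EC).
have GL u v (t m : R) : causal_curve u -> causal_curve v ->
    (forall s, s <= t -> `|u s - v s| <= m) -> `|G u t - G v t| <= L * m.
  move=> uc vc uv; apply: (le_trans (AiL _ _)).
  rewrite /L -mulrA ler_wpM2l ?invr_ge0 ?(ltW Cl0)//.
  rewrite (_ : _ - _ - _ = (Pe (v t) - Pe (u t)) + (B (v t - u t) + K (fun s => v s - u s) t)).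
    have m0 : 0 <= m by apply: le_trans (uv t (lexx t)).
    rewrite mulrDl; apply: (le_trans (ler_normD _ _)); apply: lerD.
      by apply: (le_trans (PeL _ _)); rewrite distrC ler_wpM2l ?divr_ge0 ?(ltW e0)// uv.
    apply: (@lower_order_bound (fun s => v s - u s)) => //; first exact: causal_curveB.
    by move=> s st; rewrite distrC uv.
  by rewrite BB KB//; vector_ring ipP.
have [u uc uD] := causal_picard ipP L0 Gc GL.
exists u, (G u); split=> // t; rewrite /G AiK.
by rewrite -[in LHS]addrA -[in LHS]addrA subrK.
Qed.

(** Since all operators are linear and commute with delays, a difference of two quotients solves the
    same equation with the corresponding data. Taking e' = 0 bounds one quotient; two small steps
    give the Cauchy property. *)
Lemma energy_estimate_diff_quot u du f (Pe : H -> H) e e' T :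
  causal_curve u -> causal_curve f -> (forall t : R, is_derive t 1 u (du t)) ->
  (forall c x y, Pe (c *: x + y) = c *: Pe x + Pe y) -> (forall x, 0 <= ip (Pe x) x) ->
  (forall t, A (du t) + Pe (u t) + B (u t) + K u t = f t) -> 0 <= e -> 0 <= e' ->
  forall t, t <= T -> `|diff_quot e u t - diff_quot e' u t| ^+ 2 <=
    growth t * prim (fun s => `|diff_quot e f s - diff_quot e' f s| ^+ 2) T.
Proof.
move=> uc fc uD Pel Pe0 eq e0 e'0.
have dqc (w : R -> H) d : 0 <= d -> causal_curve w -> causal_curve (diff_quot d w).
  exact: causal_curve_diff_quot.
have dqD d (t : R) : is_derive t 1 (diff_quot d u) (diff_quot d du t).
  apply: is_deriveZ; apply: is_deriveB => //; exact: is_derive_shift.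
have PeB x y : Pe (x - y) = Pe x - Pe y.
  by have := Pel (-1) y x; rewrite !scaleN1r ![- _ + _]addrC.
have PeZ c x : Pe (c *: x) = c *: Pe x.
  by have := PeB 0 0; rewrite !subrr => z; rewrite -[c *: x]addr0 Pel z addr0.
have Kdq d t : 0 <= d -> K (diff_quot d u) t = diff_quot d (K u) t.
  move=> d0; rewrite /diff_quot KZ; last first.
    by apply: causal_curveB => //; exact: causal_curve_shift.
  by rewrite KB ?(ec_K_shift EC)//; exact: causal_curve_shift.
have eqd d t : 0 <= d -> A (diff_quot d du t) + Pe (diff_quot d u t) + B (diff_quot d u t) +
    K (diff_quot d u) t = diff_quot d f t.
  move=> d0; rewrite Kdq// /diff_quot -!eq AZ PeZ BZ AB PeB BB -!scalerDr.
  by congr (_ *: _); vector_ring ipP.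
apply: (@energy_estimate _ (fun t => diff_quot e du t - diff_quot e' du t) _
   (fun t => Pe (diff_quot e u t - diff_quot e' u t))) => //.
- by apply: causal_curveB; exact: dqc.
- by apply: causal_curveB; exact: dqc.
- move=> t; rewrite KB ?AB ?BB ?PeB; [|exact: dqc|exact: dqc].
  by rewrite -!eqd//; vector_ring ipP.
Qed.

(* The term with the Yosida approximations is nonnegative up to e + e':
   u = J u + e P J u and P is skew. *)
Lemma yosida_difference_bound (J J' : H -> H) e e' x y M : 0 <= e -> 0 <= e' ->
  (forall x, V (J x)) -> (forall x, J x + e *: P (J x) = x) ->
  (forall x, V (J' x)) -> (forall x, J' x + e' *: P (J' x) = x) ->
  `|P (J x)| <= M -> `|P (J' y)| <= M ->
  - (2 * (e + e') * M ^+ 2) <= ip (P (J x) - P (J' y)) (x - y).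
Proof.
move=> e0 e'0 VJ JE VJ' JE' xM yM.
have M0 : 0 <= M by apply: le_trans xM.
have [Vd Pd] := saB PP (VJ x) (VJ' y).
rewrite -{2}(JE x) -{2}(JE' y).
rewrite (_ : J x + e *: P (J x) - (J' y + e' *: P (J' y)) = (J x - J' y) + (e *: P (J x) - e' *: P (J' y))); last by vector_ring ipP.
rewrite (ipDr ipP) -{1}Pd (sa_skew0 ipP PP Vd) add0r lerNl -(ipNl ipP).
apply: (le_trans (ip_le ipP _ _)); rewrite normrN.
apply: (@le_trans _ _ ((M + M) * (e * M + e' * M))).
  apply: ler_pM => //; first by apply: (le_trans (ler_normB _ _)); apply: lerD.
  apply: (le_trans (ler_normB _ _)); rewrite !normrZ !ger0_norm//.
  by apply: lerD; rewrite ler_wpM2l.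
by rewrite le_eqVlt; apply/orP; left; apply/eqP; ring.
Qed.

(** The data enter only through their difference quotients: bounded by Phi in square mean, and
    Cauchy there along the steps 1 / (n + 1). No derivative of f as a curve in H is involved. *)
Theorem abstract_existence f (Phi : R -> R) : causal_curve f ->
  (forall T e, 0 <= T -> 0 < e -> prim (fun s => `|diff_quot e f s| ^+ 2) T <= Phi T) ->
  (forall T (e : R), 0 < e -> exists N, forall n m, (N <= n)%N -> (N <= m)%N ->
    prim (fun s => `|diff_quot n.+1%:R^-1 f s - diff_quot m.+1%:R^-1 f s| ^+ 2) T <= e) ->
  exists u du, [/\ causal_curve u, causal_curve du, forall t : R, is_derive t 1 u (du t),
    forall t, V (u t) /\ A (du t) + P (u t) + B (u t) + K u t = f t &
    forall t, 0 <= t -> `|u t| ^+ 2 <= growth t * prim (fun s => `|f s| ^+ 2) t /\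
      `|du t| ^+ 2 <= growth t * Phi t].
Proof.
move=> fc fPhi fC.
have Cl0 := ec_Cl EC.
pose e n : R := n.+1%:R^-1.
have e0 n : 0 < e n by rewrite invr_gt0.
have f2 := causal_curve_norm2 fc.
have growth_le t T : t <= T -> 0 <= t -> growth t <= growth T.
  move=> tT t0; rewrite ler_wpM2l ?divr_ge0 ?(ltW Cl0)// ler_expR ler_wpM2l//.
    by rewrite mulr_ge0// addr_ge0// divr_ge0 ?(ltW Cl0)// addr_ge0// mulr_ge0//
      addr_ge0 ?(ec_beta EC) ?(ec_kap EC).
  by rewrite !ger0_norm// (le_trans t0).
have /choice[J JP] (n : nat) : exists J : H -> H, [/\
    forall x, V (J x), forall x, J x + e n *: P (J x) = x,
    forall c x y, J (c *: x + y) = c *: J x + J y & forall x, `|J x| <= `|x|].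
  exact: (resolvent ipP PP (e0 n)).
have JV n x : V (J n x) by case: (JP n).
have JE n x : J n x + e n *: P (J n x) = x by case: (JP n).
have PJ n x : P (J n x) = (e n)^-1 *: (x - J n x).
  by rewrite -{2}(JE n x) addrAC subrr add0r scalerA mulVf ?gt_eqF// scale1r.
have PJl n c x y : P (J n (c *: x + y)) = c *: P (J n x) + P (J n y).
  have [_ _ -> _] := JP n.
  by have [] := sa_linear PP c (JV n x) (JV n y).
have PJ0 n x : 0 <= ip (P (J n x)) x.
  rewrite -{2}(JE n x) (ipDr ipP) (sa_skew0 ipP PP (JV n x)) add0r (ipZr ipP) (ipxx ipP).
  by rewrite mulr_ge0 ?exprn_ge0// ltW.
have PJB n x y : P (J n (x - y)) = P (J n x) - P (J n y).
  by have := PJl n (-1) y x; rewrite !scaleN1r ![- _ + _]addrC.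
have /choice[ud udP] (n : nat) : exists ud : (R -> H) * (R -> H), [/\ causal_curve ud.1,
    forall t : R, is_derive t 1 ud.1 (ud.2 t) &
    forall t, A (ud.2 t) + P (J n (ud.1 t)) + B (ud.1 t) + K ud.1 t = f t].
  have [||u [du [? ? ?]]] := @approximate_solution f (e n) (e0 n) fc (fun x => P (J n x)).
  - move=> x y; rewrite -PJB PJ normrZ ger0_norm ?invr_ge0 ?(ltW (e0 n))//.
    rewrite [2 / _]mulrC -mulrA ler_wpM2l ?invr_ge0 ?(ltW (e0 n))//.
    apply: (le_trans (ler_normB _ _)); rewrite mulr2n mulrDl mul1r lerD2l.
    by have [_ _ _ ->] := JP n.
  - by have := PJB n 0 0; rewrite !subrr.
  by exists (u, du).
pose u n := (ud n).1; pose du n := (ud n).2.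
have uc n : causal_curve (u n) by case: (udP n).
have uD n (t : R) : is_derive t 1 (u n) (du n t) by case: (udP n).
have uE n t : A (du n t) + P (J n (u n t)) + B (u n t) + K (u n) t = f t
  by have [_ _ ->] := udP n.
have u_bound n t T : t <= T -> `|u n t| ^+ 2 <= growth t * prim (fun s => `|f s| ^+ 2) T.
  by move=> tT; apply: (@energy_estimate _ (du n) _ (fun t => P (J n (u n t)))).
(* The inverse of 0 is 0, so the quotient of step 0 vanishes and the estimate for two quotients
   specialises to one. *)
have dq0 (w : R -> H) t : diff_quot 0 w t = 0 by rewrite /diff_quot subr0 subrr scaler0.
have dqu_bound n d t T : t <= T -> 0 <= T -> 0 < d ->
    `|diff_quot d (u n) t| ^+ 2 <= growth t * Phi T.
  move=> tT T0 d0.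
  have := @energy_estimate_diff_quot (u n) (du n) f (fun x => P (J n x)) d 0 T (uc n) fc
    (uD n) (PJl n) (PJ0 n) (uE n) (ltW d0) (lexx 0) t tT.
  rewrite dq0 subr0 => /le_trans; apply; rewrite ler_wpM2l ?growth_ge0//.
  by under eq_fun do rewrite dq0 subr0; exact: fPhi.
have sq_cvg (v : nat -> H) l : v n @[n --> \oo] --> l -> `|v n| ^+ 2 @[n --> \oo] --> `|l| ^+ 2.
  move=> vl; have c : `|v n| @[n --> \oo] --> `|l| by exact: cvg_norm.
  exact: cvgM.
have du_bound n t T : t <= T -> 0 <= T -> `|du n t| ^+ 2 <= growth t * Phi T.
  move=> tT T0.
  have c2 := sq_cvg _ _ (diff_quot_cvg (uD n t)).
  apply: (ler_cvg_to c2 (cvg_cst _)); apply: nearW => m.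
  by apply: dqu_bound => //; rewrite invr_gt0.
have Phi0 T : 0 <= T -> 0 <= Phi T.
  by move=> T0; apply: le_trans (fPhi T 1 T0 ltr01); apply: prim_ge0 => s _; rewrite exprn_ge0.
(* The equation expresses P J u_n through f, A u_n' and the lower order terms, all bounded
   independently of n. This is what makes the error u_n - J u_n = e_n P J u_n small. *)
have PJ_bound T : exists2 M, 0 <= M & forall n t, 0 <= t <= T -> `|P (J n (u n t))| <= M.
  have [Mf Mf0 fM] := causal_curve_bounded T fc.
  pose M1 := Num.sqrt (growth T * Phi T).
  pose M2 := Num.sqrt (growth T * prim (fun s => `|f s| ^+ 2) T).
  exists (Mf + `|Cu| * M1 + (beta + kap) * M2).
    by rewrite !addr_ge0// mulr_ge0 ?sqrtr_ge0// addr_ge0 ?(ec_beta EC) ?(ec_kap EC).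
  move=> n t /andP[t0 tT].
  have -> : P (J n (u n t)) = (f t - A (du n t)) - (B (u n t) + K (u n) t).
    by rewrite -(uE n); vector_ring ipP.
  have uM s : s <= t -> `|u n s| <= M2.
    move=> st; have [s0|s0] := leP s 0; first by rewrite (uc n).2// normr0 sqrtr_ge0.
    rewrite -[leLHS](ger0_norm (normr_ge0 _)) -sqrtr_sqr ler_wsqrtr//.
    apply: (le_trans (u_bound n s T _)); first exact: le_trans tT.
    rewrite ler_wpM2r ?growth_le//; [|exact: le_trans tT|exact: ltW].
    by apply: prim_ge0 => r _; rewrite exprn_ge0.
  apply: (le_trans (ler_normB _ _)); apply: lerD; last first.
    by apply: lower_order_bound => //; rewrite sqrtr_ge0.
  apply: (le_trans (ler_normB _ _)); apply: lerD; first exact: fM.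
  apply: (le_trans (A_bound _)); apply: (@le_trans _ _ (`|Cu| * `|du n t|)).
    by rewrite ler_wpM2r// ler_norm.
  rewrite ler_wpM2l// -[leLHS](ger0_norm (normr_ge0 _)) -sqrtr_sqr ler_wsqrtr//.
  apply: (le_trans (du_bound n t T tT (le_trans t0 tT))).
  by rewrite ler_wpM2r ?growth_le// Phi0// (le_trans t0).
have uC T (d : R) : 0 < d -> exists N, forall n m, (N <= n)%N -> (N <= m)%N ->
    forall t, t <= T -> `|u n t - u m t| <= d.
  move=> d0; have [T0|T0] := leP T 0.
    exists 0%N => n m _ _ t tT.
    by rewrite !(uc _).2 ?(le_trans tT)// subrr normr0 ltW.
  have [M M0 MP] := PJ_bound T.
  pose C := growth T * (4 * M ^+ 2 * T).
  have C0 : 0 <= C by rewrite mulr_ge0 ?growth_ge0// mulr_ge0 ?(ltW T0)// mulr_ge0 ?exprn_ge0.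
  have [N NP] : exists N, forall n, (N <= n)%N -> (C + 1) * e n <= d ^+ 2 / 2.
    have p0 : 0 < d ^+ 2 / 2 / (C + 1) by rewrite !divr_gt0 ?exprn_gt0// ltr_wpDl.
    have [N _ NP] := near_infty_natSinv_lt (PosNum p0).
    exists N => n Nn; rewrite mulrC -ler_pdivlMr ?ltr_wpDl//.
    by apply: ltW; exact: NP.
  exists N => n m Nn Nm t tT.
  rewrite -ler_sqr ?nnegrE ?(ltW d0)//.
  have [t0|t0] := leP t 0.
    by rewrite !(uc _).2// subrr normr0 expr0n/= exprn_ge0// ltW.
  have bk : 0 <= beta + kap by rewrite addr_ge0 ?(ec_beta EC) ?(ec_kap EC).
  have lin (s : R) : is_derive s 1 (fun r => 4 * M ^+ 2 * (e n + e m) * r) (4 * M ^+ 2 * (e n + e m)).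
    by have := is_deriveZ (4 * M ^+ 2 * (e n + e m)) (is_derive_id s 1); rewrite /GRing.scale/= mulr1.
  have k0 : 0 <= 4 * M ^+ 2 * (e n + e m).
    by rewrite mulr_ge0 ?addr_ge0 ?(ltW (e0 _))// mulr_ge0 ?exprn_ge0.
  (* The derivative of |A^{1/2} (u_n - u_m)|^2 contains twice the Yosida term, which
     [yosida_difference_bound] bounds by 2 (e_n + e_m) M^2; hence the factor 4. *)
  have := @energy_bound _ _ _ ipP A Cl (1 + 2 * (beta + kap)) (fun s => u n s - u m s)
    (fun s => du n s - du m s) (fun s => 4 * M ^+ 2 * (e n + e m) * s)
    (fun=> 4 * M ^+ 2 * (e n + e m)) T (4 * M ^+ 2 * (e n + e m) * T).
  move=> /(_ Cl0 _ (ltW T0) (ec_A_sym EC) (ec_A_coercive EC)) h.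
  have {}h : `|u n t - u m t| ^+ 2 <= growth t * (4 * M ^+ 2 * (e n + e m) * T).
    apply: h => //.
    - by rewrite addr_ge0// mulr_ge0.
    - by move=> s; apply: is_derive_A; exact: (is_deriveB (uD n s) (uD m s)).
    - exact: causal_curveB.
    - by rewrite mulr0.
    - by move=> s /andP[s0 sT]; rewrite ler_wpM2l.
    - move=> s r /andP[s0 sT] r0 ur.
      have -> : A (du n s - du m s) = - (P (J n (u n s)) - P (J m (u m s))) -
          (B (u n s - u m s) + K (fun q => u n q - u m q) s).
        rewrite AB BB KB// -[A (du n s)](addrK (P (J n (u n s)) + B (u n s) + K (u n) s)).
        rewrite -[A (du m s)](addrK (P (J m (u m s)) + B (u m s) + K (u m) s)).
        by rewrite ![A _ + (_ + _ + _)]addrA ![A _ + (_ + _)]addrA !uE; vector_ring ipP.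
      have h1 := @yosida_difference_bound (J n) (J m) (e n) (e m) (u n s) (u m s) M
        (ltW (e0 n)) (ltW (e0 m)) (JV n) (JE n) (JV m) (JE m).
      have {h1} := h1 (MP n s _) (MP m s _); rewrite s0 sT => /(_ isT isT) h1.
      have h2 := @lower_order_bound (fun q => u n q - u m q) s r (causal_curveB (uc n) (uc m)) r0 ur.
      have h3 : - ip (B (u n s - u m s) + K (fun q => u n q - u m q) s) (u n s - u m s) <=
          (beta + kap) * r ^+ 2.
        rewrite -(ipNl ipP); apply: (le_trans (ip_le ipP _ _)); rewrite normrN expr2 mulrA.
        by apply: ler_pM => //; exact: ur.
      rewrite (ipBl ipP) (ipNl ipP).
      move: h1 h3; set X := ip _ _; set Y := ip _ _; have := sqr_ge0 r; clearbody X Y.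
      by move: (M ^+ 2) (r ^+ 2) => M2 r2 *; lra.
  apply: (le_trans h).
  have := NP n Nn; have := NP m Nm => hm hn.
  have gg : growth t <= growth T by rewrite growth_le// ltW.
  apply: (@le_trans _ _ (growth T * (4 * M ^+ 2 * (e n + e m) * T))).
    by rewrite ler_wpM2r// mulr_ge0// ltW.
  rewrite (_ : _ * _ = C * e n + C * e m); last by rewrite /C; ring.
  have h1 k : C * e k <= (C + 1) * e k by rewrite ler_wpM2r ?lerDl// ltW.
  by rewrite (splitr (d ^+ 2)) lerD// (le_trans (h1 _)).
have [U Uc UP] := uniform_cauchy_causal uc uC.
have U_cvg t : u n t @[n --> \oo] --> U t.
  apply/cvgrPdist_le => d d0; have [N NP] := UP t d d0.
  by exists N => // n Nn; rewrite distrC; exact: NP.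
have dqU_cvg d t : diff_quot d (u n) t @[n --> \oo] --> diff_quot d U t.
  by apply: cvgZr; apply: cvgB.
(* For a fixed pair of steps the estimate on the quotients of u_k has a right-hand side that depends
   on f only, so it passes to the limit in k. *)
have dqUC T (d : R) : 0 < d -> exists N, forall n m, (N <= n)%N -> (N <= m)%N ->
    forall t, t <= T -> `|diff_quot (e n) U t - diff_quot (e m) U t| <= d.
  move=> d0.
  have [N NP] := fC T (d ^+ 2 / (growth T + 1)) (divr_gt0 (exprn_gt0 2 d0) (ltr_wpDl (growth_ge0 T) ltr01)).
  exists N => n m Nn Nm t tT.
  have [t0|t0] := leP t 0.
    rewrite !(causal_curve_diff_quot _ Uc).2// ?subrr ?normr0 ?ltW//.
  rewrite -ler_sqr ?nnegrE ?(ltW d0)//.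
  apply: (@le_trans _ _ (growth t * prim (fun s => `|diff_quot (e n) f s - diff_quot (e m) f s| ^+ 2) T)).
    have c : `|diff_quot (e n) (u k) t - diff_quot (e m) (u k) t| ^+ 2 @[k --> \oo] -->
        `|diff_quot (e n) U t - diff_quot (e m) U t| ^+ 2.
      by apply: sq_cvg; apply: cvgB; exact: dqU_cvg.
    apply: (ler_cvg_to c (cvg_cst _)); apply: nearW => k.
    apply: (@energy_estimate_diff_quot (u k) (du k) f (fun x => P (J k x))) => //; exact: ltW.
  apply: (@le_trans _ _ (growth T * (d ^+ 2 / (growth T + 1)))).
    apply: ler_pM; [exact: growth_ge0| |by rewrite growth_le// ltW|exact: NP].
    by apply: prim_ge0 => s _; rewrite exprn_ge0.
  by rewrite mulrCA ler_piMr ?exprn_ge0 ?(ltW d0)// ler_pdivrMr ?mul1r ?lerDl// ltr_wpDl ?growth_ge0.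
have [v vc vP] := uniform_cauchy_causal (fun n => causal_curve_diff_quot (ltW (e0 n)) Uc) dqUC.
have v_cvg t : diff_quot (e n) U t @[n --> \oo] --> v t.
  apply/cvgrPdist_le => d d0; have [N NP] := vP t d d0.
  by exists N => // n Nn; rewrite distrC; exact: NP.
(* The derivative that <A U, w> should have for w in V, with P moved from U to w by
   skew-symmetry. *)
pose psi w s := ip (f s - (B (U s) + K U s)) w + ip (U s) (P w).
have psic w : causal_curve (psi w : R -> R).
  have c1 : causal_curve (fun s => f s - (B (U s) + K U s)).
    apply: causal_curveB => //; apply: causal_curveD; last exact: K_causal.
    apply: (@causal_curve_lipschitz _ _ _ _ beta) => //; last exact: B0.
    by move=> x y; rewrite -BB; exact: (ec_B_bound EC).
  have c2 := causal_curve_ipl ipP w c1; have c3 := causal_curve_ipl ipP (P w) Uc.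
  split=> [t|t t0]; first by apply: cvgD; [exact: c2.1|exact: c3.1].
  by rewrite /psi (c2.2 t t0) (c3.2 t t0) addr0.
have weak w t : V w -> ip (A (U t)) w = prim (psi w) t.
  move=> Vw; have [t0|t0] := leP t 0.
    by rewrite prim_causal// (Uc.2 t t0) A0 (ip0l ipP).
  have [M M0 MP] := PJ_bound t.
  (* d C bounds the accumulated gap between the weak equations of u_n and U: (beta + kap) |w| stems
     from the lower order terms, |P w| from u_n - U, and M |P w| from u_n - J u_n, whose norm is at
     most e_n M with e_n < d. *)
  pose C := ((beta + kap) * `|w| + (1 + M) * `|P w|) * t.
  have bk : 0 <= beta + kap by rewrite addr_ge0 ?(ec_beta EC) ?(ec_kap EC).
  have C0 : 0 <= C.
    by rewrite mulr_ge0 ?(ltW t0)// addr_ge0 ?mulr_ge0// addr_ge0.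
  apply/eqP; rewrite -subr_eq0 -normr_le0; apply/ler_addgt0Pl => d' d'0; rewrite addr0.
  have C1 : 0 < C + 1 by rewrite ltr_wpDl.
  pose d := d' / (C + 1).
  have d0 : 0 < d by rewrite divr_gt0.
  apply: (@le_trans _ _ (d * C)); last first.
    by rewrite /d mulrAC ler_pdivrMr// ler_pM2l// lerDl.
  have c : `|ip (A (u n t)) w - prim (psi w) t| @[n --> \oo] --> `|ip (A (U t)) w - prim (psi w) t|.
    apply: cvg_norm; apply: cvgB; last exact: cvg_cst.
    under eq_fun do rewrite (ec_A_sym EC); rewrite (ec_A_sym EC).
    exact: (cvg_ipl ipP).
  apply: (ler_cvg_to c (cvg_cst _)).
  have [N1 N1P] := UP t d d0.
  have [N2 _ N2P] := near_infty_natSinv_lt (PosNum d0).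
  exists (maxn N1 N2) => // n /=; rewrite geq_max => /andP[/N1P un_U /N2P/= en].
  pose g s := ip (A (u n s)) w - prim (psi w) s.
  have gD (s : R) : is_derive s 1 g (ip (A (du n s)) w - psi w s).
    exact: (is_deriveB (is_derive_ipl ipP w (is_derive_A (uD n s))) (prim_derive s (psic w))).
  have g0 : g 0 = 0 by rewrite /g (uc n).2// A0 (ip0l ipP) prim_causal// subrr.
  have := @le_norm_increment_real R g _ 0 t (d * ((beta + kap) * `|w| + (1 + M) * `|P w|)) gD.
  rewrite g0 !subr0 [`|t|]gtr0_norm// /C [d * (_ * t)]mulrA; apply => s.
  rewrite subr0 => st.
  have {}st : s <= t by apply: le_trans st; exact: ler_norm.
  have [s0|s0] := leP 0 s; last first.
    have -> : psi w s = 0 by exact: (psic w).2 (ltW s0).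
    have -> : A (du n s) = 0.
      have us r : r <= s -> u n r = 0 by move=> rs; apply: (uc n).2; rewrite (le_trans rs)// ltW.
      have := uE n s; rewrite us// (fc.2 s (ltW s0)) B0.
      have -> : K (u n) s = 0 by apply: (K_causal (uc n)).2; exact: ltW.
      have -> : P (J n 0) = 0 by have := PJB n 0 0; rewrite !subrr.
      by rewrite !addr0.
    rewrite (ip0l ipP) subrr normr0 (mulr_ge0 (ltW d0))//.
    exact: (addr_ge0 (mulr_ge0 bk (normr_ge0 _)) (mulr_ge0 (addr_ge0 ler01 M0) (normr_ge0 _))).
  have PJw : ip (P (J n (u n s))) w = - ip (J n (u n s)) (P w) by exact: (sa_skew ipP PP).
  have Jn : J n (u n s) = u n s - e n *: P (J n (u n s)) by rewrite -{2}(JE n (u n s)) addrK.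
  rewrite (_ : _ - _ = ip (u n s - U s - e n *: P (J n (u n s))) (P w) -
      ip (B (u n s - U s) + K (fun q => u n q - U q) s) w); last first.
    rewrite /psi -(uE n s) BB KB// -(_ : J n (u n s) - U s = u n s - U s - e n *: P (J n (u n s))).
      rewrite (ipBl ipP (J n (u n s))); move: PJw => /eqP; rewrite eq_sym eqr_oppLR => /eqP ->.
      by rewrite !(ipDl ipP, ipNl ipP); ring.
    by rewrite {1}Jn addrAC.
  apply: (le_trans (ler_normB _ _)); rewrite mulrDr addrC.
  have us r : r <= s -> `|u n r - U r| <= d by move=> rs; apply: un_U; exact: le_trans st.
  apply: lerD.
    apply: (le_trans (cauchy_schwarz ipP _ _)); rewrite mulrA ler_wpM2r// [leRHS]mulrC.
    apply: (@lower_order_bound (fun q => u n q - U q)); rewrite ?(ltW d0)//.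
    exact: causal_curveB.
  apply: (le_trans (cauchy_schwarz ipP _ _)); rewrite mulrA ler_wpM2r//.
  apply: (le_trans (ler_normB _ _)); rewrite mulrDr mulr1 lerD ?us//.
  rewrite normrZ ger0_norm ?(ltW (e0 n))//; apply: ler_pM; rewrite ?(ltW (e0 n)) ?(ltW en)//.
  by rewrite MP// s0.
have AUD w (t : R) : V w -> is_derive t 1 (fun s => ip (A (U s)) w) (psi w t).
  move=> Vw; rewrite (_ : (fun s => _) = prim (psi w)); first exact: prim_derive.
  by apply/funext => s; rewrite weak.
have Av w t : V w -> ip (A (v t)) w = psi w t.
  move=> Vw; have c1 := diff_quot_cvg (AUD w t Vw).
  have c2 : ip (A (diff_quot (e n) U t)) w @[n --> \oo] --> ip (A (v t)) w.
    under eq_fun do rewrite (ec_A_sym EC); rewrite (ec_A_sym EC).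
    exact: (cvg_ipl ipP).
  move: c1; rewrite (_ : (fun n => _) = (fun n => ip (A (diff_quot (e n) U t)) w)).
    by move=> c1; exact: (cvg_unique _ c2 c1).
  by apply/funext => n; rewrite /diff_quot AZ AB (ipZl ipP) (ipBl ipP).
have sol t : V (U t) /\ A (v t) + P (U t) + B (U t) + K U t = f t.
  have [/(_ _)[] ] := sa_adjoint PP (U t) (A (v t) - f t + (B (U t) + K U t)).
    move=> x Vx; have := Av x t Vx; rewrite /psi [ip (U t) _](ipC ipP) => h.
    rewrite [ip x _](ipC ipP) (ipDl ipP) (ipBl ipP) h (ipBl ipP); ring.
  move=> VU PU _; split=> //.
  have -> : P (U t) = - (A (v t) - f t + (B (U t) + K U t)) by rewrite PU opprK.
  by vector_ring ipP.
(* So far v is a limit of backward quotients along one sequence of steps. Its primitive Y makes <A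
   Y, w> and <A U, w> have the same derivative for w in V; density and coercivity give U = Y, so U
   is differentiable with derivative v. *)
have [Y Yc YD] := vector_primitive ipP vc.
have UY : U = Y.
  apply/funext => t; apply/eqP; rewrite eq_sym -subr_eq0 -normr_eq0 -sqrf_eq0.
  rewrite eq_le exprn_ge0// andbT -(pmulr_rle0 _ Cl0) (le_trans (ec_A_coercive EC _))//.
  rewrite (_ : A (Y t - U t) = 0) ?(ip0l ipP)//.
  apply: (sa_dense PP) => w Vw; rewrite AB (ipC ipP) (ipBl ipP).
  have gD (s : R) : is_derive s 1 (fun r => ip (A (Y r)) w - ip (A (U r)) w) 0.
    rewrite -(subrr (psi w s)) -{1}Av//.
    exact: (is_deriveB (is_derive_ipl ipP w (is_derive_A (YD s))) (AUD w s Vw)).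
  have := le_norm_increment_real (a := 0) (b := t) (M := 0) gD.
  rewrite (Yc.2 0)// (Uc.2 0)// subrr !subr0 mul0r => h.
  apply/eqP; rewrite -normr_le0.
  by apply: h => s _; rewrite normr0.
exists U, v; split=> // [t|t t0]; first by rewrite UY.
split.
  apply: (ler_cvg_to (sq_cvg _ _ (U_cvg t)) (cvg_cst _)); apply: nearW => n.
  exact: u_bound.
apply: (ler_cvg_to (sq_cvg _ _ (v_cvg t)) (cvg_cst _)); apply: nearW => n.
apply: (ler_cvg_to (sq_cvg _ _ (dqU_cvg (e n) t)) (cvg_cst _)); apply: nearW => k.
exact: dqu_bound.
Qed.

End abstract_evolution.

(** * Square integrable vector fields *)

Section euclidean.
Context {R : realType} {k : nat}.
Implicit Types x y z : 'cV[R]_k.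

Lemma dotC x y : dot x y = dot y x.
Proof. by apply: eq_bigr => i _; rewrite mulrC. Qed.

Lemma dotDl x y z : dot (x + y) z = dot x z + dot y z.
Proof. by rewrite -big_split/=; apply: eq_bigr => i _; rewrite !mxE mulrDl. Qed.

Lemma dotZl c x y : dot (c *: x) y = c * dot x y.
Proof. by rewrite mulr_sumr; apply: eq_bigr => i _; rewrite !mxE mulrA. Qed.

Lemma dotDr x y z : dot x (y + z) = dot x y + dot x z.
Proof. by rewrite dotC dotDl !(dotC x). Qed.

Lemma dotZr c x y : dot x (c *: y) = c * dot x y.
Proof. by rewrite dotC dotZl (dotC x). Qed.

Lemma dotNl x y : dot (- x) y = - dot x y.
Proof. by rewrite -scaleN1r dotZl mulN1r. Qed.

Lemma dotNr x y : dot x (- y) = - dot x y.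
Proof. by rewrite dotC dotNl dotC. Qed.

Lemma dot0l x : dot 0 x = 0.
Proof. by rewrite -(scale0r 0) dotZl mul0r. Qed.

Lemma dot_ge0 x : 0 <= dot x x.
Proof. by apply: sumr_ge0 => i _; rewrite -expr2 sqr_ge0. Qed.

Lemma dot_eq0 x : dot x x = 0 -> x = 0.
Proof.
move=> /eqP; rewrite psumr_eq0; last by move=> i _; rewrite -expr2 sqr_ge0.
move=> /allP x0; apply/matrixP => i j; rewrite ord1 mxE.
by have := x0 i (mem_index_enum _); rewrite -expr2 sqrf_eq0 => /eqP.
Qed.

Lemma sqr_coord_le x i : x i 0 ^+ 2 <= dot x x.
Proof.
rewrite /dot (bigD1 i)//= expr2 lerDl.
by apply: sumr_ge0 => j _; rewrite -expr2 sqr_ge0.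
Qed.

Lemma dot_le x y : 2 * `|dot x y| <= dot x x + dot y y.
Proof.
have h (a b : 'cV[R]_k) : 0 <= dot a a + 2 * dot a b + dot b b.
  have -> : dot a a + 2 * dot a b + dot b b = dot (a + b) (a + b).
    by rewrite dotDl !dotDr (dotC b a); ring.
  exact: dot_ge0.
have h1 := h x y; have := h x (- y); rewrite dotNr dotNl dotNr.
by case: (ger0P (dot x y)) => _; lra.
Qed.

Lemma dotD_le x y : dot (x + y) (x + y) <= 2 * (dot x x + dot y y).
Proof.
have := dot_le x y; have := ler_norm (dot x y).
rewrite dotDl !dotDr (dotC y x); lra.
Qed.

(** Cauchy-Schwarz on each row. The coefficient norms are entrywise maxima, and this is the origin
    of the factors k in all later operator bounds. *)
Lemma dot_mulmx_le (M : 'M[R]_k) x c : (forall i j, `|M i j| <= c) ->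
  dot (M *m x) (M *m x) <= (k%:R * c) ^+ 2 * dot x x.
Proof.
move=> Mc.
have cs i : (M *m x) i 0 ^+ 2 <= k%:R * c ^+ 2 * dot x x.
  rewrite mxE.
  have c0 : 0 <= c by apply: le_trans (Mc i i).
  have -> : \sum_j M i j * x j 0 = dot (row i M)^T x.
    by apply: eq_bigr => j _; rewrite !mxE.
  apply: (le_trans (@cauchy_schwarz_form R 'cV[R]_k (@dot R k) _ _ _ _ (row i M)^T x)).
  - exact: dotC.
  - exact: dotDl.
  - exact: dotZl.
  - exact: dot_ge0.
  rewrite ler_wpM2r ?dot_ge0//.
  apply: (@le_trans _ _ (\sum_(j < k) c ^+ 2)).
    apply: ler_sum => j _; rewrite !mxE -expr2 -[leLHS]ger0_norm ?sqr_ge0// normrX.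
    by rewrite ler_sqr ?nnegrE// Mc.
  by rewrite sumr_const card_ord mulr_natl.
apply: (@le_trans _ _ (\sum_(i < k) k%:R * c ^+ 2 * dot x x)).
  by apply: ler_sum => i _; rewrite -expr2.
by rewrite sumr_const card_ord -mulr_natl le_eqVlt; apply/orP; left; apply/eqP; ring.
Qed.

End euclidean.

Section vector_measurability.
Context {d} {T : measurableType d} {R : realType} {k : nat}.
Implicit Types u v : T -> 'cV[R]_k.

Lemma measurable_vecP u :
  measurable_fun setT u <-> forall i, measurable_fun setT (fun x => u x i 0).
Proof.
rewrite (measurable_mxP _ measurableT); split=> [h i|h i j]; first exact: h.
by rewrite ord1; exact: h.
Qed.

Lemma measurable_dot u v : measurable_fun setT u -> measurable_fun setT v ->
  measurable_fun setT (fun x => dot (u x) (v x)).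
Proof.
move=> /measurable_vecP mu /measurable_vecP mv.
by apply: measurable_sum => i; apply: measurable_funM.
Qed.

Lemma measurable_lincomb c u v : measurable_fun setT u -> measurable_fun setT v ->
  measurable_fun setT (fun x => c *: u x + v x).
Proof.
move=> /measurable_vecP mu /measurable_vecP mv; apply/measurable_vecP => i.
under eq_fun do rewrite !mxE.
by apply: measurable_funD => //; apply: measurable_funM.
Qed.

Lemma measurable_mulmx_fun (M : T -> 'M[R]_k) u : measurable_fun setT M ->
  measurable_fun setT u -> measurable_fun setT (fun x => M x *m u x).
Proof.
move=> /(measurable_mxP _ measurableT) mM /measurable_vecP mu; apply/measurable_vecP => i.
under eq_fun do rewrite mxE.
by apply: measurable_sum => j; apply: measurable_funM.
Qed.

(* a total pointwise limit, equal to the limit wherever it exists *)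
Definition vec_lim (g : nat -> T -> 'cV[R]_k) : T -> 'cV[R]_k :=
  fun x => \col_i fine (limn_esup (fun n => (g n x i 0)%:E)).

Lemma measurable_vec_lim (g : nat -> T -> 'cV[R]_k) :
  (forall n, measurable_fun setT (g n)) -> measurable_fun setT (vec_lim g).
Proof.
move=> mg; apply/measurable_vecP => i; rewrite /vec_lim; under eq_fun do rewrite mxE.
apply: measurableT_comp => //; apply: measurable_fun_limn_esup => n.
by apply/measurable_EFinP; have /measurable_vecP := mg n; exact.
Qed.

Lemma vec_limE (g : nat -> T -> 'cV[R]_k) x i l :
  g n x i 0 @[n --> \oo] --> l -> vec_lim g x i 0 = l.
Proof.
move=> gl; rewrite /vec_lim mxE.
have c : (g n x i 0)%:E @[n --> \oo] --> l%:E.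
    by apply: cvg_EFin => //; exact: nearW.
by rewrite is_cvg_limn_esupE; [rewrite (cvg_lim _ c)|apply/cvg_ex; exists l%:E].
Qed.

End vector_measurability.

Section square_integrable.
Context {d} {T : measurableType d} {R : realType} (nu : {measure set T -> \bar R}) {k : nat}.
Implicit Types u v w : T -> 'cV[R]_k.
Local Open Scope ereal_scope.

Definition sqint u := \int[nu]_x (dot (u x) (u x))%:E.

Definition isL2 u := measurable_fun setT u /\ sqint u < +oo.

Lemma sqint_ge0 u : 0 <= sqint u.
Proof. by apply: integral_ge0 => x _; rewrite lee_fin dot_ge0. Qed.

Lemma measurable_sq u : measurable_fun setT u -> measurable_fun setT (fun x => (dot (u x) (u x))%:E).
Proof. by move=> mu; apply/measurable_EFinP; exact: measurable_dot. Qed.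

Lemma isL2_fin_num u : isL2 u -> sqint u \is a fin_num.
Proof. by move=> [mu u2]; rewrite ge0_fin_numE ?sqint_ge0. Qed.

Lemma isL2_sq_integrable u : isL2 u -> nu.-integrable setT (fun x => (dot (u x) (u x))%:E).
Proof.
move=> [mu u2]; apply/integrableP; split; first exact: measurable_sq.
by under eq_integral do rewrite gee0_abs ?lee_fin ?dot_ge0//.
Qed.

Lemma sqint_ae u v : measurable_fun setT u -> measurable_fun setT v ->
  u = v %[ae nu] -> sqint u = sqint v.
Proof.
move=> mu mv uv; apply: ge0_ae_eq_integral => //; try exact: measurable_sq.
- by move=> x _; rewrite lee_fin dot_ge0.
- by move=> x _; rewrite lee_fin dot_ge0.
- by apply: filterS uv => x h _; rewrite h.
Qed.

Lemma sqint_eq0 u : measurable_fun setT u -> sqint u = 0 -> u = cst (0 : 'cV[R]_k)%R %[ae nu].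
Proof.
move=> mu u0.
have : (fun x => (dot (u x) (u x))%:E) = cst 0 %[ae nu].
  apply/(@ae_eq_integral_abs _ _ _ nu setT measurableT _ (measurable_sq mu)).
  by under eq_integral do rewrite gee0_abs ?lee_fin ?dot_ge0//.
by apply: filterS => x h _; apply: dot_eq0; have [] := h I.
Qed.

Lemma sqint0 : sqint (cst 0%R) = 0.
Proof. by rewrite /sqint; under eq_integral do rewrite dot0l; rewrite integral0. Qed.

Lemma isL20 : isL2 (cst 0%R).
Proof. by split; [exact: measurable_cst|rewrite sqint0]. Qed.

Lemma isL2_lincomb c u v : isL2 u -> isL2 v -> isL2 (fun x => c *: u x + v x)%R.
Proof.
move=> [mu u2] [mv v2]; split; first exact: measurable_lincomb.
have mU := measurable_sq mu; have mV := measurable_sq mv.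
apply: (@le_lt_trans _ _ (\int[nu]_x ((2 * c ^+ 2)%:E * (dot (u x) (u x))%:E + 2%:E * (dot (v x) (v x))%:E))).
  apply: ge0_le_integral => //.
  - by move=> x _; rewrite lee_fin dot_ge0.
  - by apply: measurable_sq; exact: measurable_lincomb.
  - by apply: emeasurable_funD; apply: measurable_funeM.
  - move=> x _; rewrite -!EFinM -EFinD lee_fin (le_trans (dotD_le _ _))//.
    by rewrite dotZl dotZr; lra.
rewrite ge0_integralD//; last 4 first.
- by move=> x _; rewrite -EFinM lee_fin mulr_ge0 ?dot_ge0// mulr_ge0// sqr_ge0.
- exact: measurable_funeM.
- by move=> x _; rewrite -EFinM lee_fin mulr_ge0 ?dot_ge0.
- exact: measurable_funeM.
have h w : (forall x, setT x -> 0 <= (dot (w x) (w x))%:E) by move=> x _; rewrite lee_fin dot_ge0.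
have c2 : (0 <= 2 * c ^+ 2)%R by rewrite mulr_ge0// sqr_ge0.
rewrite !ge0_integralZl_EFin//; try exact: h.
apply: lte_add_pinfty; apply: lte_mul_pinfty.
- by rewrite lee_fin mulr_ge0// sqr_ge0.
- by [].
- exact: u2.
- by rewrite lee_fin.
- by [].
- exact: v2.
Qed.

Lemma isL2D u v : isL2 u -> isL2 v -> isL2 (fun x => u x + v x)%R.
Proof.
move=> hu hv; have := isL2_lincomb 1 hu hv.
by under eq_fun do rewrite scale1r.
Qed.

Lemma isL2Z c u : isL2 u -> isL2 (fun x => c *: u x)%R.
Proof.
move=> hu; have := isL2_lincomb c hu isL20.
by under eq_fun do rewrite addr0.
Qed.

Lemma isL2B u v : isL2 u -> isL2 v -> isL2 (fun x => u x - v x)%R.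
Proof.
move=> hu hv; have := isL2_lincomb (-1) hv hu.
by under eq_fun do rewrite scaleN1r addrC.
Qed.

Lemma sqintZ c u : measurable_fun setT u -> sqint (fun x => c *: u x)%R = (c ^+ 2)%:E * sqint u.
Proof.
move=> mu; rewrite /sqint -ge0_integralZl_EFin ?sqr_ge0//.
- by apply: eq_integral => x _; rewrite dotZl dotZr mulrA -EFinM.
- by move=> x _; rewrite lee_fin dot_ge0.
- exact: measurable_sq.
Qed.

Lemma dot_integrable u v : isL2 u -> isL2 v -> nu.-integrable setT (fun x => (dot (u x) (v x))%:E).
Proof.
move=> hu hv.
apply: (@le_integrable _ _ _ nu setT measurableT _ (fun x => (dot (u x) (u x))%:E + (dot (v x) (v x))%:E)).
- by apply/measurable_EFinP; apply: measurable_dot; [exact: hu.1|exact: hv.1].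
- move=> x _; rewrite -EFinD !abse_EFin lee_fin [leRHS]ger0_norm ?addr_ge0 ?dot_ge0//.
  by have := dot_le (u x) (v x); have := normr_ge0 (dot (u x) (v x)); lra.
- by apply: integrableD => //; exact: isL2_sq_integrable.
Qed.

Definition dotint u v : R := (\int[nu]_x dot (u x) (v x))%R.

Lemma dotintC u v : dotint u v = dotint v u.
Proof. by rewrite /dotint; under eq_Rintegral do rewrite dotC. Qed.

Lemma dotint_lin c u v w : isL2 u -> isL2 v -> isL2 w ->
  dotint (fun x => c *: u x + v x)%R w = (c * dotint u w + dotint v w)%R.
Proof.
move=> hu hv hw; rewrite /dotint; under eq_Rintegral do rewrite dotDl dotZl.
have iu := dot_integrable hu hw; have iv := dot_integrable hv hw.
rewrite RintegralD//; first by rewrite RintegralZl.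
exact: (@integrableZl _ _ _ nu _ measurableT c _ iu).
Qed.

Lemma dotint_ae u u' v v' : measurable_fun setT u -> measurable_fun setT u' ->
  measurable_fun setT v -> measurable_fun setT v' ->
  u = u' %[ae nu] -> v = v' %[ae nu] -> dotint u v = dotint u' v'.
Proof.
move=> mu mu' mv mv' uu vv; rewrite /dotint /Rintegral; congr fine.
apply: ae_eq_integral => //.
- by apply/measurable_EFinP; exact: measurable_dot.
- by apply/measurable_EFinP; exact: measurable_dot.
- by apply: filterS2 uu vv => x h1 h2 _; rewrite h1// h2.
Qed.

Lemma dotint_sq u : dotint u u = fine (sqint u).
Proof. by []. Qed.

End square_integrable.

(** * The Hilbert space of classes *)

Lemma geometric_cauchy_cvg {R : realType} (a : nat -> R) (c : R) : 0 <= c ->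
  (forall n, `|a n.+1 - a n| <= c * 2^-1 ^+ n) ->
  exists2 l, a n @[n --> \oo] --> l & forall n, `|l - a n| <= 2 * c * 2^-1 ^+ n.
Proof.
move=> c0 ac.
have step n m : `|a (n + m)%N - a n| <= 2 * c * 2^-1 ^+ n * (1 - 2^-1 ^+ m).
  elim: m => [|m IH]; first by rewrite addn0 subrr normr0 expr0 subrr mulr0.
  rewrite addnS; apply: (le_trans (ler_distD (a (n + m)%N) _ _)).
  apply: (le_trans (lerD (ac _) IH)).
  by rewrite exprD exprS le_eqVlt; apply/orP; left; apply/eqP; field.
have step' n m : (n <= m)%N -> `|a m - a n| <= 2 * c * 2^-1 ^+ n.
  move=> /subnKC <-; apply: (le_trans (step _ _)).
  apply: ler_piMr; last by rewrite gerBl exprn_ge0// invr_ge0.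
  by rewrite mulr_ge0 ?mulr_ge0// exprn_ge0// invr_ge0.
have g0 : 2 * c * 2^-1 ^+ n @[n --> \oo] --> (0 : R).
  rewrite -[X in _ --> X](mulr0 (2 * c)); apply: cvgM; first exact: cvg_cst.
  by apply: cvg_expr; rewrite ger0_norm ?invr_ge0// invf_lt1// ltr1n.
have [l al] : exists l : R, a n @[n --> \oo] --> l.
  apply: (@cauchy_seq_cvg R R) => e e0.
  move/cvgrPdist_le : g0 => /(_ (e / 2) (divr_gt0 e0 (ltr0Sn _ _)))[N _ /(_ N (leqnn N))].
  rewrite sub0r normrN ger0_norm ?mulr_ge0 ?exprn_ge0 ?invr_ge0// => h.
  exists N => n m Nn Nm; rewrite (splitr e) (le_trans (ler_distD (a N) _ _))// lerD//.
    exact: le_trans (step' _ _ Nn) h.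
  by rewrite distrC (le_trans (step' _ _ Nm) h).
exists l => // n.
have c1 : `|a m - a n| @[m --> \oo] --> `|l - a n|.
  by apply: cvg_norm; apply: cvgB => //; exact: cvg_cst.
by apply: (ler_cvg_to c1 (cvg_cst _)); exists n => // m; exact: step'.
Qed.

(** * Completeness of square integrable fields along fast Cauchy sequences *)

Section riesz_fischer.
Context {d} {T : measurableType d} {R : realType} (nu : {measure set T -> \bar R}) {k : nat}.
Implicit Types u v w : T -> 'cV[R]_k.

(** The rate 16^-n leaves room for weights: S, the sum of 4^n |g_{n+1} - g_n|^2, is integrable,
    hence finite almost everywhere. There the increments are at most sqrt(S) 2^-n, so the sequence
    converges, and 4^-n S dominates the squared remainder up to a constant. *)
Lemma riesz_fischer (g : nat -> T -> 'cV[R]_k) (C : R) : 0 <= C ->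
  (forall n, measurable_fun setT (g n)) ->
  (forall n, (sqint nu (fun x => (g n.+1 x - g n x)%R) <= (C * 16^-1 ^+ n)%:E)%E) ->
  {ae nu, forall x, forall i, g n x i 0 @[n --> \oo] --> vec_lim g x i 0} /\
  exists2 C' : R, 0 <= C' & forall n,
    (sqint nu (fun x => (vec_lim g x - g n x)%R) <= (C' * 4^-1 ^+ n)%:E)%E.
Proof.
move=> C0 mg gC.
pose D n x : R := dot (g n.+1 x - g n x) (g n.+1 x - g n x).
have D0 n x : 0 <= D n x by exact: dot_ge0.
have mD n : measurable_fun setT (fun x => g n.+1 x - g n x).
  have := measurable_lincomb (-1) (mg n) (mg n.+1).
  by under eq_fun do rewrite scaleN1r addrC.
pose F n x : \bar R := (4 ^+ n * D n x)%:E.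
have F0 n x : (0 <= F n x)%E by rewrite lee_fin mulr_ge0 ?exprn_ge0.
have mF n : measurable_fun setT (F n).
  apply/measurable_EFinP; apply: measurable_funM => //; exact: measurable_dot.
pose S x := (\sum_(n <oo) F n x)%E.
have S0 x : (0 <= S x)%E by apply: nneseries_ge0 => n _ _; exact: F0.
have mS : measurable_fun setT S.
  by apply: ge0_emeasurable_sum => // n x _ _; exact: F0.
have FI n : (\int[nu]_x F n x <= (C * 4^-1 ^+ n)%:E)%E.
  rewrite /F; under eq_integral do rewrite EFinM.
  rewrite ge0_integralZl_EFin ?exprn_ge0//; last first.
  - by apply/measurable_EFinP; exact: measurable_dot.
  - by move=> x _; rewrite lee_fin.
  apply: (le_trans (lee_wpmul2l _ (gC n))); first by rewrite lee_fin exprn_ge0.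
  rewrite -EFinM lee_fin mulrCA -exprMn ler_wpM2l// le_eqVlt; apply/orP; left; apply/eqP.
  by congr (_ ^+ n); field.
have SI : (\int[nu]_x S x <= (2 * C)%:E)%E.
  rewrite /S integral_nneseries//.
  apply: (@le_trans _ _ (\sum_(n <oo) (C * 4^-1 ^+ n)%:E)%E).
    apply: lee_nneseries => n _; last exact: FI.
    by move=> _; apply: integral_ge0 => x _; exact: F0.
  apply: lime_le.
    apply: is_cvg_nneseries => n _ _.
    by rewrite lee_fin mulr_ge0// exprn_ge0// invr_ge0.
  apply: nearW => n; rewrite sumEFin lee_fin -mulr_sumr mulrC ler_wpM2r//.
  have : \sum_(0 <= i < n) 4^-1 ^+ i = 4 / 3 * (1 - 4^-1 ^+ n) :> R.
    elim: n => [|n IH]; first by rewrite big_geq// expr0 subrr mulr0.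
    by rewrite big_nat_recr//= IH exprS; field.
  move=> ->; have : 0 <= 4^-1 ^+ n :> R by rewrite exprn_ge0// invr_ge0.
  lra.
have Sint : nu.-integrable setT S.
  apply/integrableP; split=> //; under eq_integral do rewrite gee0_abs//.
  by apply: le_lt_trans SI _; rewrite ltry.
have key x : S x \is a fin_num -> forall i,
    g n x i 0 @[n --> \oo] --> vec_lim g x i 0 /\
    forall n, (vec_lim g x i 0 - g n x i 0) ^+ 2 <= 4 * fine (S x) * 4^-1 ^+ n.
  move=> Sx i.
  have s0 : 0 <= fine (S x) by rewrite fine_ge0.
  have DS n : D n x <= fine (S x) * 4^-1 ^+ n.
    rewrite exprVn ler_pdivlMr ?exprn_gt0// mulrC -lee_fin fineK//.
    have := @nneseries_lim_ge R (F ^~ x) xpredT 0%N n.+1 (fun m _ _ => F0 m x).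
    apply: le_trans; rewrite big_nat_recr//= leeDr//.
    by apply: sume_ge0 => m _; exact: F0.
  have ac n : `|g n.+1 x i 0 - g n x i 0| <= Num.sqrt (fine (S x)) * 2^-1 ^+ n.
    rewrite -ler_sqr ?nnegrE ?mulr_ge0 ?sqrtr_ge0 ?exprn_ge0 ?invr_ge0//.
    rewrite real_normK ?num_real// exprMn sqr_sqrtr// -exprM mulnC exprM.
    rewrite (_ : 2^-1 ^+ 2 = 4^-1 :> R); last by field.
    apply: le_trans (DS n); have := sqr_coord_le (g n.+1 x - g n x) i.
    by rewrite !mxE.
  have [l gl lP] := geometric_cauchy_cvg (sqrtr_ge0 _) ac.
  rewrite (vec_limE gl); split=> // n.
  rewrite -real_normK ?num_real//.
  apply: (@le_trans _ _ ((2 * Num.sqrt (fine (S x)) * 2^-1 ^+ n) ^+ 2)).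
    by rewrite ler_sqr ?nnegrE ?mulr_ge0 ?sqrtr_ge0 ?exprn_ge0 ?invr_ge0.
  rewrite !exprMn sqr_sqrtr// -exprM mulnC exprM.
  rewrite (_ : 2^-1 ^+ 2 = 4^-1 :> R); last by field.
  by rewrite (_ : 2 ^+ 2 = 4 :> R)//; ring.
have Sae : {ae nu, forall x, S x \is a fin_num}.
  have := integrable_ae measurableT Sint; apply: filterS => x; exact.
split; first by apply: filterS Sae => x Sx i; exact: (key x Sx i).1.
(* k coordinates, the factor 4 of [key], and the bound 2 C on the integral of S. *)
exists (k%:R * 8 * C); first by rewrite !mulr_ge0.
move=> n.
have mV := measurable_vec_lim mg.
have mVg : measurable_fun setT (fun x => vec_lim g x - g n x).
  have := measurable_lincomb (-1) (mg n) mV.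
  by under eq_fun do rewrite scaleN1r addrC.
apply: (@le_trans _ _ (\int[nu]_x ((k%:R * 4 * 4^-1 ^+ n)%:E * S x))%E).
  apply: ae_ge0_le_integral => //.
  - by move=> x _; rewrite lee_fin dot_ge0.
  - exact: measurable_sq.
  - by move=> x _; rewrite mule_ge0// lee_fin !mulr_ge0 ?exprn_ge0 ?invr_ge0.
  - exact: measurable_funeM.
  - apply: filterS Sae => x Sx _.
    rewrite -(fineK Sx) -EFinM lee_fin.
    apply: (@le_trans _ _ (\sum_(i < k) 4 * fine (S x) * 4^-1 ^+ n)).
      apply: ler_sum => i _; rewrite -expr2 mxE [X in _ + X]mxE; exact: (key x Sx i).2.
    rewrite sumr_const card_ord -mulr_natl le_eqVlt; apply/orP; left; apply/eqP; ring.
rewrite ge0_integralZl_EFin//.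
apply: (le_trans (lee_wpmul2l _ SI)).
  by rewrite lee_fin !mulr_ge0 ?exprn_ge0 ?invr_ge0.
by rewrite -EFinM lee_fin le_eqVlt; apply/orP; left; apply/eqP; ring.
Qed.

End riesz_fischer.

(** * Classes as canonical functions, with their inner product *)

Section L2space.
Context {d} {T : measurableType d} {R : realType} (nu : {measure set T -> \bar R}) (k : nat).
Implicit Types u v w : T -> 'cV[R]_k.

Definition L2_total u := if `[< isL2 nu u >] then u else cst 0.

(* one chosen function in each class of almost everywhere equal functions *)
Definition L2_canon u : T -> 'cV[R]_k :=
  xget (cst 0) [set v | isL2 nu v /\ v = L2_total u %[ae nu]].

(** A class is its chosen function, so almost everywhere equality of elements is plain equality,
    [L2_inj], and an element can be evaluated at points. The property is boolean so that its proof
    is irrelevant. *)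
Record L2space := MkL2space {
  L2fun :> T -> 'cV[R]_k;
  _ : `[< isL2 nu L2fun /\ L2_canon L2fun = L2fun >] }.

HB.instance Definition _ := [isSub for L2fun].
HB.instance Definition _ := [Choice of L2space by <:].

Lemma L2_totalP u : isL2 nu (L2_total u).
Proof. by rewrite /L2_total; case: asboolP => // _; exact: isL20. Qed.

Lemma L2_totalE u : isL2 nu u -> L2_total u = u.
Proof. by rewrite /L2_total; case: asboolP. Qed.

Lemma L2_canonP u : isL2 nu (L2_canon u) /\ L2_canon u = L2_total u %[ae nu].
Proof.
rewrite /L2_canon; case: xgetP => [v _ //|/(_ (L2_total u))[]].
by split; [exact: L2_totalP|exact: ae_eq_refl].
Qed.

Lemma L2_canon_ae u v : isL2 nu u -> isL2 nu v -> u = v %[ae nu] -> L2_canon u = L2_canon v.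
Proof.
move=> hu hv uv; rewrite /L2_canon !L2_totalE//; congr xget; apply/seteqP.
split=> w /= [hw h]; split=> //; first exact: ae_eq_trans h uv.
by apply: ae_eq_trans h _; exact: ae_eq_sym.
Qed.

Lemma L2_class_subproof u : `[< isL2 nu (L2_canon u) /\ L2_canon (L2_canon u) = L2_canon u >].
Proof.
apply/asboolP; have [h1 h2] := L2_canonP u; split=> //.
rewrite (L2_canon_ae h1 (L2_totalP u) h2).
by rewrite /L2_canon (L2_totalE (L2_totalP u)).
Qed.

(** Total: a function that is not square integrable is sent to the class of 0. *)
Definition L2class u : L2space := MkL2space (L2_class_subproof u).

Lemma L2P (x : L2space) : isL2 nu x.
Proof. by case: x => u /= /asboolP[]. Qed.

Lemma L2measurable (x : L2space) : measurable_fun setT x.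
Proof. exact: (L2P x).1. Qed.

Lemma L2class_ae u : isL2 nu u -> L2class u = u %[ae nu].
Proof. by move=> hu; have [_] := L2_canonP u; rewrite L2_totalE. Qed.

Lemma L2_inj (x y : L2space) : x = y %[ae nu] -> x = y.
Proof.
move=> xy; apply: val_inj => /=.
have hx := L2P x; have hy := L2P y.
have /asboolP[_ <-] : `[< isL2 nu x /\ L2_canon x = x >] by case: (x).
have /asboolP[_ <-] : `[< isL2 nu y /\ L2_canon y = y >] by case: (y).
exact: L2_canon_ae.
Qed.

Lemma L2class_eq u (x : L2space) : isL2 nu u -> u = x %[ae nu] -> L2class u = x.
Proof. by move=> hu ux; apply: L2_inj; apply: ae_eq_trans ux; exact: L2class_ae. Qed.

Definition L2add (x y : L2space) := L2class (fun t => x t + y t).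
Definition L2scale (c : R) (x : L2space) := L2class (fun t => c *: x t).
Definition L2opp (x : L2space) := L2scale (-1) x.
Definition L2zero := L2class (cst 0).

Lemma L2addE (x y : L2space) : {ae nu, forall t, L2add x y t = x t + y t}.
Proof.
by have := L2class_ae (isL2D (L2P x) (L2P y)); apply: filterS => t; exact.
Qed.

Lemma L2scaleE c (x : L2space) : {ae nu, forall t, L2scale c x t = c *: x t}.
Proof. by have := L2class_ae (isL2Z c (L2P x)); apply: filterS => t; exact. Qed.

Lemma L2zeroE : {ae nu, forall t, L2zero t = 0}.
Proof. by have := L2class_ae (isL20 nu (k := k)); apply: filterS => t; exact. Qed.

Lemma L2_ext (x y : L2space) : {ae nu, forall t, x t = y t} -> x = y.
Proof. by move=> h; apply: L2_inj; apply: filterS h => t h _. Qed.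

Lemma L2addA : associative L2add.
Proof.
move=> x y z; apply: L2_ext.
apply: filterS2 (filterI (L2addE x (L2add y z)) (L2addE y z))
  (filterI (L2addE (L2add x y) z) (L2addE x y)).
by move=> t [-> ->] [-> ->]; rewrite addrA.
Qed.

Lemma L2addC : commutative L2add.
Proof.
by move=> x y; rewrite /L2add; congr L2class; apply/funext => t; rewrite addrC.
Qed.

Lemma L2add0 : left_id L2zero L2add.
Proof.
move=> x; apply: L2_ext; apply: filterS2 (L2addE L2zero x) L2zeroE => t -> ->.
by rewrite add0r.
Qed.

Lemma L2addN : left_inverse L2zero L2opp L2add.
Proof.
move=> x; apply: L2_ext.
apply: filterS3 (L2addE (L2opp x) x) (L2scaleE (-1) x) L2zeroE => t -> + ->.
by rewrite /L2opp => ->; rewrite scaleN1r addNr.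
Qed.

HB.instance Definition _ := GRing.isZmodule.Build L2space L2addA L2addC L2add0 L2addN.

Lemma L2scaleA a b x : L2scale a (L2scale b x) = L2scale (a * b) x.
Proof.
apply: L2_ext.
apply: filterS3 (L2scaleE a (L2scale b x)) (L2scaleE b x) (L2scaleE (a * b) x).
by move=> t -> -> ->; rewrite scalerA.
Qed.

Lemma L2scale1 : left_id 1 L2scale.
Proof. by move=> x; apply: L2_ext; apply: filterS (L2scaleE 1 x) => t ->; rewrite scale1r. Qed.

Lemma L2scaleDr : right_distributive L2scale +%R.
Proof.
move=> c x y; apply: L2_ext.
apply: filterS3 (filterI (L2scaleE c (L2add x y)) (L2addE x y))
  (L2addE (L2scale c x) (L2scale c y)) (filterI (L2scaleE c x) (L2scaleE c y)).
by move=> t [-> ->] -> [-> ->]; rewrite scalerDr.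
Qed.

Lemma L2scaleDl x : {morph L2scale^~ x : a b / a + b}.
Proof.
move=> a b; apply: L2_ext.
apply: filterS3 (filterI (L2scaleE (a + b) x) (L2addE (L2scale a x) (L2scale b x)))
  (L2scaleE a x) (L2scaleE b x).
by move=> t [-> ->] -> ->; rewrite scalerDl.
Qed.

HB.instance Definition _ := GRing.Zmodule_isLmodule.Build R L2space
  L2scaleA L2scale1 L2scaleDr L2scaleDl.

Definition L2ip (x y : L2space) : R := dotint nu x y.

Lemma L2ipC x y : L2ip x y = L2ip y x.
Proof. exact: dotintC. Qed.

Lemma L2ipDl x y z : L2ip (x + y) z = L2ip x z + L2ip y z.
Proof.
have := dotint_lin 1 (L2P x) (L2P y) (L2P z); rewrite mul1r => <-.
apply: dotint_ae; try exact: L2measurable.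
- exact: measurable_lincomb (L2measurable x) (L2measurable y).
- by apply: filterS (L2addE x y) => t h _; rewrite scale1r.
- exact: ae_eq_refl.
Qed.

Lemma L2ipZl c x y : L2ip (c *: x) y = c * L2ip x y.
Proof.
have := dotint_lin c (L2P x) (L2P 0) (L2P y).
have -> : dotint nu (0 : L2space) y = 0.
  by have := L2ipDl 0 0 y; rewrite addr0 /L2ip; lra.
rewrite addr0 => <-; apply: dotint_ae; try exact: L2measurable.
- exact: measurable_lincomb (L2measurable x) (L2measurable 0).
- by apply: filterS2 (L2scaleE c x) L2zeroE => t h h0 _; rewrite h0 addr0.
- exact: ae_eq_refl.
Qed.

Lemma L2ip_ge0 x : 0 <= L2ip x x.
Proof. by rewrite /L2ip dotint_sq fine_ge0// sqint_ge0. Qed.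

Definition L2nrm (x : L2space) : R := Num.sqrt (L2ip x x).

Lemma L2nrm_sq x : L2nrm x ^+ 2 = L2ip x x.
Proof. by rewrite sqr_sqrtr// L2ip_ge0. Qed.

Lemma L2ip_le x y : L2ip x y <= L2nrm x * L2nrm y.
Proof.
apply: (le_trans (ler_norm _)).
rewrite -ler_sqr ?nnegrE ?mulr_ge0 ?sqrtr_ge0// real_normK ?num_real// exprMn !L2nrm_sq.
apply: cauchy_schwarz_form => [? ?|? ? ?|? ? ?|?].
- exact: L2ipC.
- exact: L2ipDl.
- exact: L2ipZl.
- exact: L2ip_ge0.
Qed.

Lemma L2nrmD x y : L2nrm (x + y) <= L2nrm x + L2nrm y.
Proof.
rewrite -ler_sqr ?nnegrE ?addr_ge0 ?sqrtr_ge0// sqrrD !L2nrm_sq.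
rewrite L2ipDl !(L2ipC _ (x + y)) !L2ipDl (L2ipC y x).
have := L2ip_le x y; lra.
Qed.

Lemma L2nrmZ c x : L2nrm (c *: x) = `|c| * L2nrm x.
Proof.
rewrite /L2nrm L2ipZl L2ipC L2ipZl mulrA -expr2 sqrtrM ?sqr_ge0// sqrtr_sqr.
by [].
Qed.

Lemma L2nrm_eq0 x : L2nrm x = 0 -> x = 0.
Proof.
move=> x0; have : L2ip x x = 0 by rewrite -L2nrm_sq x0 expr0n.
rewrite /L2ip dotint_sq => s0.
have : sqint nu x = 0%E by rewrite -(fineK (isL2_fin_num (L2P x))) s0.
move=> /(sqint_eq0 (L2measurable x)) h.
by apply: L2_ext; apply: filterS2 h L2zeroE => t h ->; rewrite h.
Qed.

HB.instance Definition _ := @Lmodule_isNormed.Build R L2space L2nrm L2nrmD L2nrmZ L2nrm_eq0.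

Lemma L2_inner_product : inner_product L2ip.
Proof.
split; [exact: L2ipC|exact: L2ipDl|exact: L2ipZl|].
by move=> x; rewrite -L2nrm_sq.
Qed.

Lemma L2norm2E (x : L2space) : (`|x| ^+ 2)%:E = sqint nu x.
Proof. by rewrite -(ipxx L2_inner_product) /L2ip dotint_sq fineK// isL2_fin_num//; exact: L2P. Qed.

Lemma L2subE (x y : L2space) : {ae nu, forall t, (x - y) t = x t - y t}.
Proof.
by apply: filterS2 (L2addE x (- y)) (L2scaleE (-1) y) => t -> h; rewrite h scaleN1r.
Qed.

Lemma L2norm_subE (x y : L2space) : (`|x - y| ^+ 2)%:E = sqint nu (fun t => x t - y t).
Proof.
rewrite L2norm2E; apply: sqint_ae; first exact: L2measurable.
- by have [] := isL2B (L2P x) (L2P y).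
- by apply: filterS (L2subE x y) => t h _.
Qed.

End L2space.

Section L2complete.
Context {d} {T : measurableType d} {R : realType} (nu : {measure set T -> \bar R}) (k : nat).
Notation H := (L2space nu k).

Lemma L2_lim_class (g : nat -> T -> 'cV[R]_k) (C : R) : 0 <= C ->
  (forall n, isL2 nu (g n)) ->
  (forall n, (sqint nu (fun x => (g n.+1 x - g n x)%R) <= (C * 16^-1 ^+ n)%:E)%E) ->
  isL2 nu (vec_lim g) /\
  L2class nu (g n) @[n --> \oo] --> L2class nu (vec_lim g).
Proof.
move=> C0 hg gC.
have [_ [C' C'0 gC']] := riesz_fischer C0 (fun n => (hg n).1) gC.
have mV := measurable_vec_lim (fun n => (hg n).1).
have hd n : isL2 nu (fun x => vec_lim g x - g n x).
  split; last by apply: le_lt_trans (gC' n) _; rewrite ltry.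
  have := measurable_lincomb (-1) (hg n).1 mV.
  by under eq_fun do rewrite scaleN1r addrC.
have hV : isL2 nu (vec_lim g).
  have := isL2D (hd 0%N) (hg 0%N).
  by under eq_fun do rewrite subrK.
split=> //; apply/cvgrPdist_le => e e0.
have g0 : C' * 4^-1 ^+ n @[n --> \oo] --> (0 : R).
  rewrite -[X in _ --> X](mulr0 C'); apply: cvgM; first exact: cvg_cst.
  by apply: cvg_expr; rewrite ger0_norm ?invr_ge0// invf_lt1// ltr1n.
move/cvgrPdist_le : g0 => /(_ _ (exprn_gt0 2 e0)); apply: filterS => n.
rewrite sub0r normrN ger0_norm; last by rewrite mulr_ge0// exprn_ge0// invr_ge0.
move=> h; rewrite -ler_sqr ?nnegrE ?(ltW e0)//; apply: le_trans h.
rewrite -lee_fin L2norm_subE; apply: le_trans (gC' n).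
rewrite le_eqVlt; apply/orP; left; apply/eqP; apply: sqint_ae.
- by have [] := isL2B (L2P (L2class nu (vec_lim g))) (L2P (L2class nu (g n))).
- by have [] := hd n.
- by apply: filterS2 (L2class_ae hV) (L2class_ae (hg n)) => x h1 h2 _; rewrite h1// h2.
Qed.

Lemma L2class_id (x : H) : L2class nu x = x.
Proof. by apply: L2class_eq; [exact: L2P|exact: ae_eq_refl]. Qed.

(** A Cauchy filter contains balls of radius 4^-n / 2. Their centres form a sequence fast enough for
    [L2_lim_class], and its limit is a limit of the filter. *)
Lemma L2space_complete (F : set_system H) : ProperFilter F -> cauchy F -> cvg F.
Proof.
move=> FF FC.
have aux (z : R) : 0 <= z -> 4^-1 * z / 2 + z / 2 <= z by lra.
have /choice[x xP] (n : nat) : exists x, F (ball x (4^-1 ^+ n / 2 : R)).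
  by apply: (cauchyP F).1 => //; rewrite divr_gt0// exprn_gt0// invr_gt0.
have near_x n y : ball (x n) (4^-1 ^+ n / 2 : R) y -> `|x n - y| < 4^-1 ^+ n / 2.
  by rewrite -ball_normE.
have xx n : `|x n.+1 - x n| <= 4^-1 ^+ n.
  have [y [/near_x h1 /near_x h2]] := filter_ex (filterI (xP n) (xP n.+1)).
  apply: (le_trans (ler_distD y _ _)).
  rewrite [in X in _ + X]distrC (le_trans (lerD (ltW h2) (ltW h1)))// exprS.
  by rewrite aux// exprn_ge0// invr_ge0.
have [] := @L2_lim_class (fun n => x n) 1 ler01.
- by move=> n; exact: L2P.
- move=> n; rewrite -L2norm_subE lee_fin mul1r.
  rewrite (_ : 16^-1 = 4^-1 ^+ 2); last by field.
  by rewrite -exprM mulnC exprM ler_sqr ?nnegrE// exprn_ge0// invr_ge0.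
move=> _; under eq_fun do rewrite L2class_id; set l := L2class _ _ => xl.
apply/cvg_ex; exists l; apply/cvgrPdist_lt => e e0.
have g0 : 4^-1 ^+ n @[n --> \oo] --> (0 : R).
  by apply: cvg_expr; rewrite ger0_norm ?invr_ge0// invf_lt1// ltr1n.
have e2 : 0 < e / 2 by rewrite divr_gt0.
move/cvgrPdist_lt : g0 => /(_ e e0)[N1 _ h1].
move/cvgrPdist_lt : xl => /(_ _ e2)[N2 _ h2].
have {}h1 := h1 (maxn N1 N2) (leq_maxl _ _).
have {}h2 := h2 (maxn N1 N2) (leq_maxr _ _).
move: h1; rewrite /= sub0r normrN ger0_norm ?exprn_ge0 ?invr_ge0// => h1.
apply: filterS (xP (maxn N1 N2)) => y /near_x yn.
apply: (le_lt_trans (ler_distD (x (maxn N1 N2)) _ _)).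
rewrite [ltRHS](splitr e); apply: ltrD; first exact: h2.
apply: (lt_trans yn).
by rewrite ltr_pM2r ?invr_gt0.
Qed.

HB.instance Definition _ := Uniform_isComplete.Build H L2space_complete.

Lemma L2class_lincomb c (u v : T -> 'cV[R]_k) : isL2 nu u -> isL2 nu v ->
  L2class nu (fun x => c *: u x + v x) = c *: L2class nu u + L2class nu v.
Proof.
move=> hu hv; apply: L2class_eq; first exact: isL2_lincomb.
apply: filterS2 (filterI (L2class_ae hu) (L2class_ae hv))
  (filterI (L2addE (L2scale c (L2class nu u)) (L2class nu v)) (L2scaleE c (L2class nu u))).
by move=> x [h1 h2] [h3 h4] _; rewrite h3 h4 h1// h2.
Qed.

Lemma L2classB (u v : T -> 'cV[R]_k) : isL2 nu u -> isL2 nu v ->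
  L2class nu (fun x => u x - v x) = L2class nu u - L2class nu v.
Proof.
move=> hu hv; rewrite [RHS]addrC -scaleN1r -L2class_lincomb//; congr L2class.
by apply/funext => x; rewrite scaleN1r addrC.
Qed.

Lemma L2class_norm2 (u : T -> 'cV[R]_k) : isL2 nu u -> (`|L2class nu u| ^+ 2)%:E = sqint nu u.
Proof.
move=> hu; rewrite L2norm2E; apply: sqint_ae; [exact: L2measurable|exact: hu.1|].
exact: L2class_ae.
Qed.

Lemma L2class_ip (u v : T -> 'cV[R]_k) : isL2 nu u -> isL2 nu v ->
  L2ip (L2class nu u) (L2class nu v) = dotint nu u v.
Proof.
move=> hu hv; apply: dotint_ae; try exact: L2measurable; try exact: L2class_ae.
  exact: hu.1.
exact: hv.1.
Qed.

Lemma L2class_inj (u v : T -> 'cV[R]_k) : isL2 nu u -> isL2 nu v ->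
  L2class nu u = L2class nu v -> u = v %[ae nu].
Proof.
move=> hu hv uv; apply: ae_eq_trans (L2class_ae hv); rewrite -uv.
by apply: ae_eq_sym; exact: L2class_ae.
Qed.

End L2complete.

(** * Jointly measurable representatives of continuous curves *)

Section joint_representative.
Context {d} {T : measurableType d} {R : realType} (nu : {measure set T -> \bar R}) (k : nat).
Notation H := (L2space nu k).

Definition jointly_measurable (w : R -> T -> 'cV[R]_k) :=
  measurable_fun [set: R * T] (fun z => w z.1 z.2).

(** Choosing a function in the class u t separately for each t gives no measurability in t; joint
    measurability is what Tonelli and the convolution need. *)
Definition represents (w : R -> T -> 'cV[R]_k) (u : R -> H) :=
  [/\ jointly_measurable w, forall t, isL2 nu (w t) & forall t, L2class nu (w t) = u t].

(* value of u at the left end of the dyadic cell of length 2^-n of t *)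
Definition dyadic_pt (n : nat) (t : R) : R := (Num.floor (t * 2 ^+ n))%:~R / 2 ^+ n.

Definition dyadic_step (u : R -> H) (n : nat) (t : R) : T -> 'cV[R]_k := u (dyadic_pt n t).

Lemma dyadic_pt_dist n t : `|dyadic_pt n t - t| <= 2^-1 ^+ n.
Proof.
have p0 : 0 < 2 ^+ n :> R by rewrite exprn_gt0.
have := floor_itv (t * 2 ^+ n); rewrite intrD => /andP[h1 h2].
have e1 : dyadic_pt n t <= t by rewrite ler_pdivrMr.
rewrite distrC ger0_norm ?subr_ge0// exprVn lerBlDr -[_^-1]mul1r -mulrDl.
by rewrite ler_pdivlMr// addrC ltW.
Qed.

Lemma dyadic_step_measurable u n : jointly_measurable (dyadic_step u n).
Proof.
apply/measurable_vecP => i _ B mB; rewrite setTI.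
pose E (z : int) := [set t : R | Num.floor (t * 2 ^+ n) = z].
have mE z : measurable (E z).
  rewrite (_ : E z = `[z%:~R / 2 ^+ n, (z + 1)%:~R / 2 ^+ n[%classic); first exact: measurable_itv.
  apply/seteqP; split=> t /=; rewrite in_itv/= ler_pdivrMr ?exprn_gt0// ltr_pdivlMr ?exprn_gt0//.
    by move=> /eqP; rewrite floor_eq.
  by move=> h; apply/eqP; rewrite floor_eq.
rewrite (_ : _ @^-1` _ = \bigcup_(z : int) (E z `*` ((fun x => (u (z%:~R / 2 ^+ n) : T -> _) x i 0) @^-1` B))).
  apply: countable_bigcupT_measurable; first exact: countableP.
  move=> z; apply: measurableX => //; rewrite -[X in measurable X]setTI.
  by have /measurable_vecP/(_ i) := L2measurable (u (z%:~R / 2 ^+ n)); exact.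
apply/seteqP; split=> [[t x]/= h|[t x] [z _ [/= <- ]]//].
by exists (Num.floor (t * 2 ^+ n)).
Qed.

Lemma jointly_measurable_lim (g : nat -> R -> T -> 'cV[R]_k) :
  (forall n, jointly_measurable (g n)) -> jointly_measurable (fun t => vec_lim (g^~ t)).
Proof.
move=> mg; have := @measurable_vec_lim _ (R * T)%type R k (fun n z => g n z.1 z.2) mg.
by [].
Qed.

Lemma joint_measurable_section (w : R -> T -> 'cV[R]_k) t :
  jointly_measurable w -> measurable_fun setT (w t).
Proof.
move=> mw; apply: (measurableT_comp mw (g := fun x => (t, x))).
exact: measurable_pair1.
Qed.

(** Step curves on dyadic cells are jointly measurable, having countably many values. The scale
    [N j] makes the error at most 4^-j for all times up to j, so at each fixed t the values converge
    almost everywhere to a function of class u t; the limit superior extends this limit measurably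
    to all (t, x). *)
Lemma causal_curve_representative (u : R -> H) : causal_curve u ->
  exists w, represents w u.
Proof.
move=> uc.
have /choice[N NP] (j : nat) : exists N : nat, forall t : R, t <= j%:R ->
    `|u (dyadic_pt N t) - u t| <= 4^-1 ^+ j.
  have [|r r0 rP] := @causal_curve_uniform _ _ u j%:R (4^-1 ^+ j) uc.
    by rewrite exprn_gt0// invr_gt0.
  have g0 : 2^-1 ^+ n @[n --> \oo] --> (0 : R).
    by apply: cvg_expr; rewrite ger0_norm ?invr_ge0// invf_lt1// ltr1n.
  move/cvgrPdist_le : g0 => /(_ r r0)[N _ /(_ N (leqnn N))].
  rewrite sub0r normrN ger0_norm ?exprn_ge0 ?invr_ge0// => Nd.
  by exists N => t tj; apply: rP => //; apply: le_trans Nd; exact: dyadic_pt_dist.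
pose g j t : T -> 'cV[R]_k := dyadic_step u (N j) t.
have mg j : jointly_measurable (g j) by exact: dyadic_step_measurable.
pose w t := vec_lim (g^~ t).
have mw : jointly_measurable w by exact: jointly_measurable_lim.
have wE t : isL2 nu (w t) /\ L2class nu (w t) = u t.
  (* From index J on, t is below the horizon and the rate holds; dropping the first J terms does not
     change the pointwise limit. *)
  pose J := (Num.truncn t).+1.
  have tJ n : t <= (n + J)%:R.
    by rewrite (le_trans (ltW (truncnS_gt t)))// ler_nat leq_addl.
  pose h n := u (dyadic_pt (N (n + J)%N) t).
  have hu n : `|h n - u t| <= 4^-1 ^+ n.
    apply: (le_trans (NP _ _ (tJ n))).
    by rewrite ler_wiXn2l ?invr_ge0// ?invf_le1 ?ler1n// leq_addr.
  have hC n : (sqint nu (fun x => (h n.+1 x - h n x)%R) <= (4 * 16^-1 ^+ n)%:E)%E.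
    rewrite -L2norm_subE lee_fin.
    rewrite (_ : 4 * _ = (2 * 4^-1 ^+ n) ^+ 2); last first.
      rewrite exprMn -exprM mulnC exprM (_ : 4^-1 ^+ 2 = 16^-1 :> R); last by field.
      by congr (_ * _); rewrite expr2 -natrM.
    rewrite ler_sqr ?nnegrE ?mulr_ge0 ?exprn_ge0 ?invr_ge0//.
    apply: (le_trans (ler_distD (u t) _ _)).
    rewrite mulr_natl mulr2n lerD//; last by rewrite distrC.
    by apply: (le_trans (hu _)); rewrite exprS ler_piMl ?exprn_ge0 ?invr_ge0// invf_le1// ler1n.
  have [ae _] := riesz_fischer (ler0n R 4) (fun n => L2measurable (h n)) hC.
  have [hV cV] := L2_lim_class (ler0n R 4) (fun n => L2P (h n)) hC.
  have wV : w t = vec_lim (fun n => h n) %[ae nu].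
    apply: filterS ae => x hx _; apply/matrixP => i j; rewrite ord1.
    apply: vec_limE; rewrite -(cvg_shiftn J).
    exact: (hx i).
  have m1 := joint_measurable_section t mw.
  have hw : isL2 nu (w t).
    by split=> //; rewrite (sqint_ae m1 hV.1 wV); exact: hV.2.
  split=> //.
  have c1 : L2class nu (h n) @[n --> \oo] --> u t.
    under eq_fun do rewrite L2class_id.
    apply/cvgrPdist_le => e e0.
    have g0 : 4^-1 ^+ n @[n --> \oo] --> (0 : R).
      by apply: cvg_expr; rewrite ger0_norm ?invr_ge0// invf_lt1// ltr1n.
    move/cvgrPdist_le : g0 => /(_ e e0); apply: filterS => n.
    rewrite sub0r normrN ger0_norm ?exprn_ge0 ?invr_ge0//.
    by apply: le_trans; rewrite distrC.
  rewrite -(cvg_unique _ cV c1)//; apply: L2class_eq => //.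
  by apply: ae_eq_trans wV _; apply: ae_eq_sym; exact: L2class_ae.
exists w; split=> // t; [exact: (wE t).1|exact: (wE t).2].
Qed.

End joint_representative.

(** * Convolution with a dominated kernel *)

Section lebesgue_isometries.
Context {R : realType}.
Notation leb := (@lebesgue_measure R).
Local Open Scope ereal_scope.

Lemma integral_isometry (phi : measurableTypeR R -> measurableTypeR R)
    (f : measurableTypeR R -> \bar R) : measurable_fun setT phi ->
  (forall A, measurable A -> pushforward leb phi A = leb A) ->
  measurable_fun setT f -> \int[leb]_s f (phi s) = \int[leb]_s f s.
Proof.
move=> mphi pphi mf.
have ge0 g : measurable_fun setT g -> (forall s, 0 <= g s) ->
    \int[leb]_s g (phi s) = \int[leb]_s g s.
  move=> mg g0.
  transitivity (\int[pushforward leb phi]_s g s).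
    by rewrite (ge0_integral_pushforward mphi)// preimage_setT.
  by apply: eq_measure_integral => A mA _; exact: pphi.
rewrite integralE [RHS]integralE; congr (_ - _).
- rewrite -[RHS]ge0//; last exact: measurable_funepos.
  by apply: eq_integral => s _; rewrite !funeposE.
- rewrite -[RHS]ge0//; last exact: measurable_funeneg.
  by apply: eq_integral => s _; rewrite !funenegE.
Qed.

Lemma measurable_reflect (t : R) : measurable_fun setT (fun s : R => (t - s)%R : measurableTypeR R).
Proof. by apply: measurable_funB; [exact: measurable_cst|exact: measurable_id]. Qed.

Lemma measurable_shift (t : R) : measurable_fun setT (fun s : R => (s - t)%R : measurableTypeR R).
Proof. by apply: measurable_funB; [exact: measurable_id|exact: measurable_cst]. Qed.

Lemma integral_reflect (t : R) (f : R -> \bar R) : measurable_fun setT f ->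
  \int[leb]_s f (t - s)%R = \int[leb]_s f s.
Proof.
move=> mf; apply: integral_isometry => //; first exact: measurable_reflect.
move=> A mA; pose phi : R -> measurableTypeR R := fun s => (t - s)%R.
pose phi_mixin := isMeasurableFun.Build _ _ _ _ phi (measurable_reflect t).
pose phi_pack : {mfun _ >-> _} := HB.pack phi phi_mixin.
apply/esym; apply: (@lebesgue_measure_unique R (pushforward leb phi_pack)) => //=.
  exact: measurable_reflect.
move=> mphi _ [[a b]] _ <-.
(* Reflection moves the closed end of the interval to the left; its length is unchanged. *)
rewrite /pushforward /= (_ : _ @^-1` _ = `[(t - b)%R, (t - a)%R[%classic); last first.
  by apply/seteqP; split=> s; rewrite /phi /= !in_itv/= => /andP[h1 h2]; apply/andP; split; move: h1 h2; lra.
rewrite !lebesgue_measure_itv/= !lte_fin ltrD2l ltrN2.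
by case: ifP => // _; rewrite -!EFinB; congr EFin; ring.
Qed.

Lemma integral_shift (t : R) (f : R -> \bar R) : measurable_fun setT f ->
  \int[leb]_s f (s - t)%R = \int[leb]_s f s.
Proof.
move=> mf; apply: integral_isometry => //; first exact: measurable_shift.
move=> A mA; pose phi : R -> measurableTypeR R := fun s => (s - t)%R.
pose phi_mixin := isMeasurableFun.Build _ _ _ _ phi (measurable_shift t).
pose phi_pack : {mfun _ >-> _} := HB.pack phi phi_mixin.
apply/esym; apply: (@lebesgue_measure_unique R (pushforward leb phi_pack)) => //=.
  exact: measurable_shift.
move=> mphi _ [[a b]] _ <-.
rewrite /pushforward /= (_ : _ @^-1` _ = `](a + t)%R, (b + t)%R]%classic); last first.
  by apply/seteqP; split=> s; rewrite /phi /= !in_itv/= => /andP[h1 h2]; apply/andP; split; move: h1 h2; lra.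
rewrite !lebesgue_measure_itv/= !lte_fin ltrD2r.
by case: ifP => // _; rewrite -!EFinB; congr EFin; ring.
Qed.

End lebesgue_isometries.

(** * A weighted Cauchy-Schwarz inequality for vector integrals *)

Section weighted_integrals.
Context {R : realType} {k : nat}.
Notation leb := (@lebesgue_measure R).
Implicit Types (M : R -> 'M[R]_k) (w : R -> 'cV[R]_k) (kap : R -> R).

Lemma dot_vint (F : R -> 'cV[R]_k) (c : 'cV[R]_k) :
  (forall i, leb.-integrable setT (fun s => (F s i 0)%:E)) ->
  leb.-integrable setT (fun s => (dot c (F s))%:E) /\ dot c (vint F) = \int[leb]_s dot c (F s).
Proof.
move=> iF.
have iFc i : leb.-integrable setT (fun s => (c i 0 * F s i 0)%:E).
  exact: (@integrableZl _ _ _ leb _ measurableT (c i 0) _ (iF i)).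
have E : (fun s => (dot c (F s))%:E) = (fun s => (\sum_(i < k) (c i 0 * F s i 0)%:E)%E).
  by apply/funext => s; rewrite /dot sumEFin.
split.
  by rewrite E; apply: integrable_sum => // i _; exact: iFc.
rewrite /Rintegral E integral_sum//.
rewrite (eq_bigr (fun i => (c i 0 * vint F i 0)%:E)); first by rewrite sumEFin.
move=> i _; rewrite mxE -(@RintegralZl _ _ _ leb)//; last exact: iF.
by rewrite /Rintegral fineK//; apply: integrable_fin_num.
Qed.

(** Young's inequality with a parameter replaces Cauchy-Schwarz for integrals: with c the integral,
    2 <c, M w> is at most lam k |c|^2 kap + (k / lam) kap |w|^2 pointwise; integrating over s gives
    2 |c|^2 on the left, and half of it is absorbed. *)
Lemma weighted_vint M w kap (K1 : R) : 0 < K1 ->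
  measurable_fun setT M -> measurable_fun setT w -> measurable_fun setT kap ->
  (forall s, 0 <= kap s) -> (forall s i j, `|M s i j| <= kap s) ->
  (\int[leb]_s (kap s)%:E <= K1%:E)%E ->
  (\int[leb]_s (kap s * dot (w s) (w s))%:E < +oo)%E ->
  (forall i, leb.-integrable setT (fun s => ((M s *m w s) i 0)%:E)) /\
  ((dot (vint (fun s => M s *m w s)) (vint (fun s => M s *m w s)))%:E <=
    (k%:R ^+ 2 * K1)%:E * \int[leb]_s (kap s * dot (w s) (w s))%:E)%E.
Proof.
have aux (D X Y : R) : 2 * D <= X + Y -> X <= D -> D <= Y by lra.
move=> K10 mM mw mk k0 Mk kK wI.
have mMw := measurable_mulmx_fun mM mw.
have Mw s := dot_mulmx_le (w s) (Mk s).
have ik : leb.-integrable setT (fun s => (kap s)%:E).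
  apply/integrableP; split; first exact/measurable_EFinP.
  under eq_integral do rewrite gee0_abs ?lee_fin//.
  by apply: le_lt_trans kK _; rewrite ltry.
have ikw : leb.-integrable setT (fun s => (kap s * dot (w s) (w s))%:E).
  apply/integrableP; split.
    by apply/measurable_EFinP; apply: measurable_funM => //; exact: measurable_dot.
  by under eq_integral do rewrite gee0_abs ?lee_fin ?mulr_ge0 ?dot_ge0//.
have iMw i : leb.-integrable setT (fun s => ((M s *m w s) i 0)%:E).
  apply: (@le_integrable _ _ _ leb setT measurableT _
    (fun s => (kap s)%:E + (k%:R ^+ 2)%:E * (kap s * dot (w s) (w s))%:E)%E).
  - by apply/measurable_EFinP; have /measurable_vecP := mMw; exact.
  - move=> s _; rewrite -EFinM -EFinD !abse_EFin lee_fin [leRHS]ger0_norm; last first.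
      by rewrite addr_ge0// !mulr_ge0 ?exprn_ge0 ?dot_ge0.
    rewrite -ler_sqr ?nnegrE//; last by rewrite addr_ge0// !mulr_ge0 ?exprn_ge0 ?dot_ge0.
    rewrite real_normK ?num_real//; apply: (le_trans (sqr_coord_le _ _)).
    apply: (le_trans (Mw s)).
    have D0 := dot_ge0 (w s); have := k0 s; have : 0 <= k%:R :> R by [].
    move: (k%:R : R) (kap s) (dot _ _) D0 => a b D D0 a0 b0.
    have h1 : 0 <= b ^+ 2 + b ^+ 2 * (a ^+ 2 * D) + (b * (a ^+ 2 * D)) ^+ 2.
      by rewrite !addr_ge0 ?sqr_ge0// mulr_ge0 ?sqr_ge0// mulr_ge0 ?sqr_ge0.
    rewrite -subr_ge0; apply: le_trans h1 _.
    by rewrite le_eqVlt; apply/orP; left; apply/eqP; ring.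
  - by apply: integrableD => //; exact: integrableZl.
split=> //.
(* For k = 0 the parameter below would not be positive; all vectors are then zero. *)
have [k00|kp] := posnP k.
  rewrite (_ : dot _ _ = 0); last first.
    by rewrite /dot big1// => i _; have := ltn_ord i; rewrite [X in (_ < X)%N]k00.
  apply: mule_ge0; first by rewrite lee_fin mulr_ge0 ?exprn_ge0// ltW.
  by apply: integral_ge0 => s _; rewrite lee_fin mulr_ge0// dot_ge0.
set c := vint _.
pose I := \int[leb]_s (kap s * dot (w s) (w s)).
have IE : (\int[leb]_s (kap s * dot (w s) (w s))%:E)%E = I%:E.
  by rewrite /I /Rintegral fineK//; apply: integrable_fin_num.
rewrite IE -EFinM lee_fin.
have [idc dcE] := dot_vint c iMw.
have kr : 0 < k%:R :> R by rewrite ltr0n.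
(* The value for which the first term of Young's inequality integrates to at most |c|^2. *)
have [lam lamE] : exists lam : R, lam = (k%:R * K1)^-1 by exists (k%:R * K1)^-1.
have lam0 : 0 < lam by rewrite lamE invr_gt0 mulr_gt0.
have pt s : 2 * dot c (M s *m w s) <=
    lam * k%:R * dot c c * kap s + k%:R / lam * (kap s * dot (w s) (w s)).
  apply: (le_trans (ler_norm _)).
  have r0 : 0 <= lam * k%:R * dot c c * kap s + k%:R / lam * (kap s * dot (w s) (w s)).
    by rewrite addr_ge0// !mulr_ge0 ?dot_ge0 ?invr_ge0 ?(ltW lam0).
  rewrite -ler_sqr ?nnegrE// real_normK ?num_real// exprMn.
  have cs : dot c (M s *m w s) ^+ 2 <= dot c c * ((k%:R * kap s) ^+ 2 * dot (w s) (w s)).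
    apply: (@le_trans _ _ (dot c c * dot (M s *m w s) (M s *m w s))); last first.
      by rewrite ler_wpM2l ?dot_ge0.
    apply: (@cauchy_schwarz_form R 'cV[R]_k (@dot R k)).
    - exact: dotC.
    - exact: dotDl.
    - exact: dotZl.
    - exact: dot_ge0.
  apply: (le_trans (ler_wpM2l _ cs)); first by rewrite sqr_ge0.
  rewrite -subr_ge0 (_ : _ - _ = (lam * k%:R * dot c c * kap s - k%:R / lam * (kap s * dot (w s) (w s))) ^+ 2).
    exact: sqr_ge0.
  by field; rewrite gt_eqF.
have ir : leb.-integrable setT (fun s =>
    (lam * k%:R * dot c c * kap s + k%:R / lam * (kap s * dot (w s) (w s)))%:E).
  under eq_fun do rewrite EFinD.
  by apply: integrableD => //; [exact: (integrableZl measurableT _ ik)|exact: (integrableZl measurableT _ ikw)].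
have : 2 * dot c c <= lam * k%:R * dot c c * (\int[leb]_s kap s) + k%:R / lam * I.
  have e1 : \int[leb]_s (lam * k%:R * dot c c * kap s) = lam * k%:R * dot c c * \int[leb]_s kap s.
    exact: RintegralZl.
  have e2 : \int[leb]_s (k%:R / lam * (kap s * dot (w s) (w s))) = k%:R / lam * I.
    exact: RintegralZl.
  have e0 : \int[leb]_s (2 * dot c (M s *m w s)) = 2 * dot c c.
    by rewrite RintegralZl// -dcE.
  have i1 : leb.-integrable setT (fun s => (lam * k%:R * dot c c * kap s)%:E).
    exact: (@integrableZl _ _ _ leb _ measurableT (lam * k%:R * dot c c) _ ik).
  have i2 : leb.-integrable setT (fun s => (k%:R / lam * (kap s * dot (w s) (w s)))%:E).
    exact: (@integrableZl _ _ _ leb _ measurableT (k%:R / lam) _ ikw).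
  rewrite -e0 -e1 -e2 -RintegralD//.
  apply: le_Rintegral => [//|||s _]; [|exact: ir|exact: pt].
  exact: (@integrableZl _ _ _ leb _ measurableT 2 _ idc).
have kI : \int[leb]_s kap s <= K1.
  by rewrite -lee_fin /Rintegral fineK//; apply: integrable_fin_num.
move=> h.
have : lam * k%:R * dot c c * (\int[leb]_s kap s) <= dot c c.
  apply: (@le_trans _ _ (lam * k%:R * dot c c * K1)).
    by rewrite ler_wpM2l// !mulr_ge0 ?dot_ge0// ltW.
  rewrite le_eqVlt; apply/orP; left; apply/eqP; rewrite lamE; field.
  by rewrite !gt_eqF.
have -> : k%:R ^+ 2 * K1 * I = k%:R / lam * I by rewrite lamE invrK; ring.
exact: aux h.
Qed.

End weighted_integrals.

Section parameter_integral.
Context {d} {S : measurableType d} {R : realType} {k : nat}.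
Notation leb := (@lebesgue_measure R).

(** Tonelli applied to the positive and negative parts of each coordinate, so that measurability
    extends to the points z where the integral diverges. *)
Lemma measurable_vint (F : S -> R -> 'cV[R]_k) :
  measurable_fun setT (fun z : R * S => F z.2 z.1) -> measurable_fun setT (fun z => vint (F z)).
Proof.
move=> mF0; apply/measurable_vecP => i; rewrite /vint; under eq_fun do rewrite mxE.
pose G (z : R * S) : \bar R := (F z.2 z.1 i 0)%:E.
have mG : measurable_fun setT G.
  by apply/measurable_EFinP; move/measurable_vecP: mF0; exact.
have mp := measurable_fun_fubini_tonelli_G (m1 := leb) (G^\+)%E (measurable_funepos mG) (fun=> funepos_ge0 _ _).
have mn := measurable_fun_fubini_tonelli_G (m1 := leb) (G^\-)%E (measurable_funeneg mG) (fun=> funeneg_ge0 _ _).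
rewrite /Rintegral; apply: measurableT_comp => //.
under eq_fun do rewrite integralE.
apply: emeasurable_funB.
- rewrite (_ : (fun x => _) = fubini_G leb (G^\+)%E); first exact: mp.
  by apply/funext => x; apply: eq_integral => s _; rewrite !funeposE.
- rewrite (_ : (fun x => _) = fubini_G leb (G^\-)%E); first exact: mn.
  by apply/funext => x; apply: eq_integral => s _; rewrite !funenegE.
Qed.

End parameter_integral.

(** * Time convolution of curves of square integrable fields *)

Section convolution.
Context {d} {T : measurableType d} {R : realType}
  (nu : {sigma_finite_measure set T -> \bar R}) (k : nat).
Context (q : R -> T -> 'M[R]_k) (kap : R -> R) (K1 : R).
Notation leb := (@lebesgue_measure R).
Notation H := (L2space nu k).
Implicit Types w : R -> T -> 'cV[R]_k.

(** The bound holds at every (t, x) rather than almost everywhere, so sections and changes of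
    variables carry no exceptional sets; [truncated_kernel] reduces q to this case. Positivity of K1
    allows division by it in [weighted_vint]. *)
Record dominated_kernel : Prop := {
  dk_joint : measurable_fun setT (fun z : R * T => q z.1 z.2);
  dk_kap_measurable : measurable_fun setT kap;
  dk_kap_ge0 : forall t, 0 <= kap t;
  dk_kap_causal : forall t, t < 0 -> kap t = 0;
  dk_bound : forall t x i j, `|q t x i j| <= kap t;
  dk_K1_gt0 : 0 < K1;
  dk_kap_int : (\int[leb]_t (kap t)%:E <= K1%:E)%E }.

Hypothesis qk : dominated_kernel.

Definition kernel_conv w (t : R) : T -> 'cV[R]_k := fun x => vint (fun s => q (t - s) x *m w s x).

Definition bounded_until w (t m : R) := forall s, s <= t -> (sqint nu (w s) <= (m ^+ 2)%:E)%E.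

Lemma measurable_kernel_section t x : measurable_fun setT (fun s : R => q (t - s) x).
Proof.
apply: (measurableT_comp (dk_joint qk) (g := fun s : R => (t - s, x))).
apply/measurable_fun_pairP; split; last exact: measurable_cst.
by apply: measurable_funB.
Qed.

Lemma measurable_kernel_prod t : measurable_fun setT (fun z : R * T => q (t - z.1) z.2).
Proof.
apply: (measurableT_comp (dk_joint qk) (g := fun z : R * T => (t - z.1, z.2))).
apply/measurable_fun_pairP; split; last exact: measurable_snd.
by apply: measurable_funB => //; exact: measurable_fst.
Qed.

Lemma measurable_kap t : measurable_fun setT (fun s : R => kap (t - s)).
Proof.
by apply: (measurableT_comp (dk_kap_measurable qk)); apply: measurable_funB.
Qed.

Lemma kap_int t : (\int[leb]_s (kap (t - s))%:E <= K1%:E)%E.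
Proof.
rewrite (integral_reflect t (f := fun s => (kap s)%:E)); first exact: (dk_kap_int qk).
by apply/measurable_EFinP; exact: (dk_kap_measurable qk).
Qed.

Lemma joint_section_time w x : jointly_measurable w -> measurable_fun setT (fun s : R => w s x).
Proof.
move=> mw; apply: (measurableT_comp mw (g := fun s : R => (s, x))).
exact: measurable_pair2.
Qed.

Lemma measurable_weight w t : jointly_measurable w ->
  measurable_fun setT (fun z : R * T => (kap (t - z.1) * dot (w z.1 z.2) (w z.1 z.2))%:E).
Proof.
move=> mw; apply/measurable_EFinP; apply: measurable_funM; last exact: measurable_dot.
exact: (measurableT_comp (measurable_kap t) measurable_fst).
Qed.

Lemma weight_ge0 w t (z : R * T) : (0 <= (kap (t - z.1) * dot (w z.1 z.2) (w z.1 z.2))%:E)%E.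
Proof. by rewrite lee_fin mulr_ge0 ?dot_ge0// (dk_kap_ge0 qk). Qed.

Lemma measurable_weight_integral w t : jointly_measurable w ->
  measurable_fun setT (fun x => \int[leb]_s (kap (t - s) * dot (w s x) (w s x))%:E)%E.
Proof.
move=> mw; exact: (measurable_fun_fubini_tonelli_G (m1 := leb) _ (measurable_weight t mw)
  (weight_ge0 w t)).
Qed.

Lemma weight_integral w t m : jointly_measurable w -> bounded_until w t m ->
  (\int[nu]_x \int[leb]_s (kap (t - s) * dot (w s x) (w s x))%:E <= (m ^+ 2 * K1)%:E)%E.
Proof.
move=> mw wm.
have /= <- := fubini_tonelli (m1 := leb) (m2 := nu) _ (measurable_weight t mw) (weight_ge0 w t).
apply: (@le_trans _ _ (\int[leb]_s ((m ^+ 2)%:E * (kap (t - s))%:E))%E); last first.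
  rewrite (ge0_integralZl_EFin leb measurableT (f1 := fun s : R => (kap (t - s))%:E)).
  - by rewrite [leRHS]EFinM lee_wpmul2l ?lee_fin ?sqr_ge0// kap_int.
  - by move=> s _; rewrite lee_fin (dk_kap_ge0 qk).
  - by apply/measurable_EFinP; exact: measurable_kap.
  - exact: sqr_ge0.
apply: ge0_le_integral => //.
- by move=> s _; apply: integral_ge0 => x _; rewrite lee_fin mulr_ge0 ?dot_ge0// (dk_kap_ge0 qk).
- exact: (measurable_fun_fubini_tonelli_F (m2 := nu) _ (measurable_weight t mw) (weight_ge0 w t)).
- by apply: measurable_funeM; apply/measurable_EFinP; exact: measurable_kap.
(* For s > t the weight vanishes; this is how a bound on the past alone suffices. *)
- move=> s _; have [st|ts] := leP s t; last first.
    rewrite (dk_kap_causal qk (t := t - s)) ?subr_lt0//.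
    by under eq_integral do rewrite mul0r; rewrite integral0 mule0.
  under eq_integral do rewrite EFinM.
  rewrite ge0_integralZl_EFin//; last first.
  + exact: (dk_kap_ge0 qk).
  + by apply: measurable_sq; exact: joint_measurable_section.
  + by move=> x _; rewrite lee_fin dot_ge0.
  by rewrite muleC lee_wpmul2r ?lee_fin ?(dk_kap_ge0 qk)// wm.
Qed.

Lemma weight_finite w t m : jointly_measurable w -> bounded_until w t m ->
  {ae nu, forall x, (\int[leb]_s (kap (t - s) * dot (w s x) (w s x))%:E < +oo)%E}.
Proof.
move=> mw wm.
have mF := measurable_weight_integral t mw.
have F0 x : (0 <= \int[leb]_s (kap (t - s) * dot (w s x) (w s x))%:E)%E.
  by apply: integral_ge0 => s _; rewrite lee_fin mulr_ge0 ?dot_ge0// (dk_kap_ge0 qk).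
have : nu.-integrable setT (fun x => \int[leb]_s (kap (t - s) * dot (w s x) (w s x))%:E)%E.
  apply/integrableP; split=> //; under eq_integral do rewrite gee0_abs//.
  by apply: le_lt_trans (weight_integral mw wm) _; rewrite ltry.
move=> /(integrable_ae measurableT); apply: filterS => x /(_ I).
by rewrite ge0_fin_numE.
Qed.

Lemma conv_integrable w t m : jointly_measurable w -> bounded_until w t m ->
  {ae nu, forall x, forall i, leb.-integrable setT (fun s => ((q (t - s) x *m w s x) i 0)%:E)}.
Proof.
move=> mw wm; apply: filterS (weight_finite mw wm) => x xI.
apply: (weighted_vint (dk_K1_gt0 qk) (measurable_kernel_section t x) (joint_section_time x mw)
  (measurable_kap t) _ _ (kap_int t) xI).1.
- by move=> s; exact: (dk_kap_ge0 qk).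
- by move=> s i j; exact: (dk_bound qk).
Qed.

Lemma measurable_conv w t : jointly_measurable w -> measurable_fun setT (kernel_conv w t).
Proof.
move=> mw; apply: (measurable_vint (F := fun x s => q (t - s) x *m w s x)).
exact: measurable_mulmx_fun (measurable_kernel_prod t) mw.
Qed.

(** Young's convolution inequality L^1 with L^oo in time, for L^2 values: [weighted_vint] at each x
    gives the factor k^2 K1, and integrating the weight over x and s gives m^2 K1. *)
Lemma conv_bound w t m : jointly_measurable w -> bounded_until w t m ->
  isL2 nu (kernel_conv w t) /\ (sqint nu (kernel_conv w t) <= ((k%:R * K1 * m) ^+ 2)%:E)%E.
Proof.
move=> mw wm.
have b : (sqint nu (kernel_conv w t) <= ((k%:R * K1 * m) ^+ 2)%:E)%E.
  have K10 := dk_K1_gt0 qk.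
  apply: (@le_trans _ _ (\int[nu]_x ((k%:R ^+ 2 * K1)%:E *
      \int[leb]_s (kap (t - s) * dot (w s x) (w s x))%:E))%E).
    have mG := measurable_weight_integral t mw.
    apply: ae_ge0_le_integral => //.
    - by move=> x _; rewrite lee_fin dot_ge0.
    - by apply: measurable_sq; exact: measurable_conv.
    - move=> x _; apply: mule_ge0; first by rewrite lee_fin mulr_ge0 ?exprn_ge0// ltW.
      by apply: integral_ge0 => s _; rewrite lee_fin mulr_ge0 ?dot_ge0// (dk_kap_ge0 qk).
    - exact: measurable_funeM.
    - apply: filterS (weight_finite mw wm) => x xI _.
      apply: (weighted_vint K10 (measurable_kernel_section t x) (joint_section_time x mw)
        (measurable_kap t) _ _ (kap_int t) xI).2.
      + by move=> s; exact: (dk_kap_ge0 qk).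
      + by move=> s i j; exact: (dk_bound qk).
  rewrite ge0_integralZl_EFin//; last first.
  - by rewrite mulr_ge0 ?exprn_ge0// ltW.
  - exact: measurable_weight_integral.
  - by move=> x _; apply: integral_ge0 => s _; exact: (weight_ge0 w t (s, x)).
  apply: (le_trans (lee_wpmul2l _ (weight_integral mw wm))).
    by rewrite lee_fin mulr_ge0 ?exprn_ge0// ltW.
  by rewrite -EFinM lee_fin le_eqVlt; apply/orP; left; apply/eqP; ring.
split=> //; split; first exact: measurable_conv.
by apply: le_lt_trans b _; rewrite ltry.
Qed.

Lemma conv_lincomb c w1 w2 t m1 m2 : jointly_measurable w1 -> jointly_measurable w2 ->
  bounded_until w1 t m1 -> bounded_until w2 t m2 ->
  kernel_conv (fun s x => c *: w1 s x + w2 s x) t = (fun x => c *: kernel_conv w1 t x + kernel_conv w2 t x) %[ae nu].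
Proof.
move=> mw1 mw2 b1 b2.
apply: filterS2 (conv_integrable mw1 b1) (conv_integrable mw2 b2) => x i1 i2 _.
apply/matrixP => i j; rewrite ord1 !mxE.
rewrite -(@RintegralZl _ _ _ leb)//; last exact: i1.
rewrite -(@RintegralD _ _ _ leb)//; last 2 first.
- exact: (@integrableZl _ _ _ leb _ measurableT c _ (i1 i)).
- exact: i2.
by apply: eq_Rintegral => s _; rewrite mulmxDr -scalemxAr !mxE.
Qed.

Lemma conv_shift w e t : jointly_measurable w ->
  kernel_conv (fun s => w (s - e)) t = kernel_conv w (t - e).
Proof.
move=> mw; apply/funext => x; apply/matrixP => i j; rewrite !mxE /Rintegral; congr fine.
rewrite -[RHS](integral_shift e); last first.
  apply/measurable_EFinP.
  have /measurable_vecP := measurable_mulmx_fun (measurable_kernel_section (t - e) x) (joint_section_time x mw).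
  exact.
by apply: eq_integral => s _; rewrite (_ : t - e - (s - e) = t - s)//; ring.
Qed.

Lemma conv_zero w t : jointly_measurable w -> (forall s, s <= t -> w s = cst 0 %[ae nu]) ->
  kernel_conv w t = cst 0 %[ae nu].
Proof.
move=> mw w0; apply: sqint_eq0; first exact: measurable_conv.
have b : bounded_until w t 0.
  move=> s st; rewrite expr0n/= (_ : sqint nu (w s) = 0%E)//.
  rewrite -(sqint0 nu (k := k)); apply: sqint_ae; last exact: w0.
    exact: joint_measurable_section.
  exact: measurable_cst.
have := (conv_bound mw b).2; rewrite mulr0 expr0n/= => h.
by apply/eqP; rewrite eq_le h sqint_ge0.
Qed.

End convolution.

(** * Convolution and multiplication as operators *)

Section joint_measurability.
Context {d} {T : measurableType d} {R : realType} {k : nat}.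
Implicit Types w : R -> T -> 'cV[R]_k.

Lemma jointly_measurable_shift w e : jointly_measurable w ->
  jointly_measurable (fun s => w (s - e)).
Proof.
move=> mw; apply: (measurableT_comp mw (g := fun z : R * T => (z.1 - e, z.2))).
apply/measurable_fun_pairP; split; last exact: measurable_snd.
by apply: measurable_funB => //; exact: measurable_fst.
Qed.

Lemma jointly_measurable_lincomb c w1 w2 : jointly_measurable w1 -> jointly_measurable w2 ->
  jointly_measurable (fun s x => c *: w1 s x + w2 s x).
Proof. exact: measurable_lincomb. Qed.

End joint_measurability.

Section convolution_operator.
Context {d} {T : measurableType d} {R : realType}
  (nu : {sigma_finite_measure set T -> \bar R}) (k : nat).
Context (q : R -> T -> 'M[R]_k) (kap : R -> R) (K1 : R).
Hypothesis qk : dominated_kernel q kap K1.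
Notation H := (L2space nu k).
Implicit Types (u v : R -> H) (w : R -> T -> 'cV[R]_k).

Definition curve_rep u : R -> T -> 'cV[R]_k := xget (fun _ _ => 0) [set w | represents w u].

Lemma curve_repP u : causal_curve u -> represents (curve_rep u) u.
Proof.
by move=> /causal_curve_representative[w wu]; apply: (xgetPex _ (P := [set w | represents w u])); exists w.
Qed.

Lemma represents_bounded w u t m : represents w u -> (forall s, s <= t -> `|u s| <= m) ->
  bounded_until nu w t m.
Proof.
move=> [mw hw wu] um s st; rewrite -L2class_norm2// wu lee_fin.
by rewrite ler_sqr ?nnegrE ?um// (le_trans _ (um _ st)).
Qed.

Lemma represents_bounded_ex w u t : causal_curve u -> represents w u ->
  exists m, bounded_until nu w t m.
Proof.
move=> uc wu; have [m _ mP] := causal_curve_bounded t uc.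
by exists m; exact: (represents_bounded wu).
Qed.

Lemma represents_lincomb c w1 w2 u1 u2 : represents w1 u1 -> represents w2 u2 ->
  represents (fun s x => c *: w1 s x + w2 s x) (fun s => c *: u1 s + u2 s).
Proof.
move=> [m1 h1 e1] [m2 h2 e2]; split=> [|t|t].
- exact: jointly_measurable_lincomb.
- exact: isL2_lincomb.
- by rewrite L2class_lincomb// e1 e2.
Qed.

Lemma represents_shift e w u : represents w u -> represents (fun s => w (s - e)) (fun s => u (s - e)).
Proof. by move=> [m h wu]; split=> [|t|t] //; exact: jointly_measurable_shift. Qed.

Definition Kop u (t : R) : H := L2class nu (kernel_conv q (curve_rep u) t).

Lemma conv_isL2 u w t : causal_curve u -> represents w u -> isL2 nu (kernel_conv q w t).
Proof.
move=> uc wu; have [m b] := represents_bounded_ex t uc wu.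
by have [mw _ _] := wu; exact: (conv_bound qk mw b).1.
Qed.

(** Two representatives of the same curve differ by a null function at each time, so by [conv_zero]
    their convolutions agree almost everywhere. Choosing [curve_rep] is therefore harmless. *)
Lemma KopE u w t : causal_curve u -> represents w u -> L2class nu (kernel_conv q w t) = Kop u t.
Proof.
move=> uc wu; have ru := curve_repP uc.
have [m1 b1] := represents_bounded_ex t uc wu.
have [m2 b2] := represents_bounded_ex t uc ru.
have [mw hw we] := wu; have [mr hr re] := ru.
have z : kernel_conv q (fun s x => -1 *: curve_rep u s x + w s x) t = cst 0 %[ae nu].
  apply: (conv_zero qk); first exact: jointly_measurable_lincomb.
  move=> s _.
  have : w s = curve_rep u s %[ae nu] by apply: L2class_inj => //; rewrite we re.
  by apply: filterS => x h _; rewrite h// scaleN1r addNr.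
have l := conv_lincomb qk (-1) mr mw b2 b1.
apply: L2class_eq; first exact: conv_isL2 wu.
have := L2class_ae (conv_isL2 t uc ru).
apply: filterS3 z l => x z l h _; rewrite /Kop h//.
by move: (z I); rewrite l// scaleN1r addrC => /eqP; rewrite subr_eq0 => /eqP.
Qed.

Lemma Kop_linear c u v t : causal_curve u -> causal_curve v ->
  Kop (fun s => c *: u s + v s) t = c *: Kop u t + Kop v t.
Proof.
move=> uc vc; have ru := curve_repP uc; have rv := curve_repP vc.
rewrite -(KopE t (causal_curveZD c uc vc) (represents_lincomb c ru rv)).
have [m1 b1] := represents_bounded_ex t uc ru.
have [m2 b2] := represents_bounded_ex t vc rv.
have [mu _ _] := ru; have [mv _ _] := rv.
rewrite -L2class_lincomb; [|exact: conv_isL2 ru|exact: conv_isL2 rv].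
have hl := isL2_lincomb c (conv_isL2 t uc ru) (conv_isL2 t vc rv).
apply: L2class_eq.
  exact: (conv_isL2 t (causal_curveZD c uc vc) (represents_lincomb c ru rv)).
apply: ae_eq_trans (conv_lincomb qk c mu mv b1 b2) _.
by apply: ae_eq_sym; exact: L2class_ae.
Qed.

Lemma Kop_bound u t m : causal_curve u -> (forall s, s <= t -> `|u s| <= m) ->
  `|Kop u t| <= k%:R * K1 * m.
Proof.
move=> uc um; have ru := curve_repP uc; have [mw _ _] := ru.
have m0 : 0 <= m by apply: le_trans (um t (lexx t)).
have [h b] := conv_bound qk mw (represents_bounded ru um).
rewrite -ler_sqr ?nnegrE//; last by rewrite !mulr_ge0// ltW// (dk_K1_gt0 qk).
by rewrite -lee_fin L2class_norm2.
Qed.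

Lemma Kop_shift u e t : causal_curve u -> 0 <= e -> Kop (fun s => u (s - e)) t = Kop u (t - e).
Proof.
move=> uc e0; have ru := curve_repP uc; have [mw _ _] := ru.
rewrite -(KopE t (causal_curve_shift e0 uc) (represents_shift e ru)).
by rewrite (conv_shift qk).
Qed.

End convolution_operator.

(** * Multiplication by essentially bounded matrix fields *)

Section multiplication_operator.
Context {d} {T : measurableType d} {R : realType} (nu : {measure set T -> \bar R}) (k : nat).
Notation H := (L2space nu k).
Implicit Types (a : T -> 'M[R]_k) (x y : H).

Definition essentially_bounded a (c : R) :=
  measurable_fun setT a /\ {ae nu, forall t, forall i j, `|a t i j| <= c}.

Lemma mulmx_isL2 a c (u : T -> 'cV[R]_k) : essentially_bounded a c -> isL2 nu u ->
  isL2 nu (fun t => a t *m u t) /\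
  (sqint nu (fun t => a t *m u t) <= ((k%:R * c) ^+ 2)%:E * sqint nu u)%E.
Proof.
move=> [ma ac] [mu u2].
have mau := measurable_mulmx_fun ma mu.
have b : (sqint nu (fun t => a t *m u t) <= ((k%:R * c) ^+ 2)%:E * sqint nu u)%E.
  rewrite /sqint -ge0_integralZl_EFin ?sqr_ge0//; last 2 first.
  - by move=> x _; rewrite lee_fin dot_ge0.
  - exact: measurable_sq.
  apply: ae_ge0_le_integral => //.
  - by move=> x _; rewrite lee_fin dot_ge0.
  - exact: measurable_sq.
  - by move=> x _; rewrite -EFinM lee_fin mulr_ge0 ?dot_ge0// sqr_ge0.
  - by apply: measurable_funeM; exact: measurable_sq.
  - by apply: filterS ac => x ac _; rewrite -EFinM lee_fin; exact: dot_mulmx_le.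
split=> //; split=> //; apply: le_lt_trans b _.
by apply: lte_mul_pinfty => //; rewrite lee_fin sqr_ge0.
Qed.

Definition mulop a x : H := L2class nu (fun t => a t *m x t).

Lemma mulop_ae a c x : essentially_bounded a c ->
  {ae nu, forall t, mulop a x t = a t *m x t}.
Proof.
move=> ac; have := L2class_ae (mulmx_isL2 ac (L2P x)).1.
by apply: filterS => t; exact.
Qed.

Lemma mulop_linear a c e x y : essentially_bounded a c ->
  mulop a (e *: x + y) = e *: mulop a x + mulop a y.
Proof.
move=> ac; rewrite /mulop -(L2class_lincomb e (mulmx_isL2 ac (L2P x)).1 (mulmx_isL2 ac (L2P y)).1).
have h := isL2_lincomb e (mulmx_isL2 ac (L2P x)).1 (mulmx_isL2 ac (L2P y)).1.
apply: L2class_eq; first exact: (mulmx_isL2 ac (L2P _)).1.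
apply: filterS3 (L2class_ae h) (L2addE (e *: x) y) (L2scaleE e x) => t -> // h1 h2 _.
by rewrite [(_ + _ : H) t]h1 [(_ *: _ : H) t]h2 mulmxDr -scalemxAr.
Qed.

Lemma mulop_bound a c x : 0 <= c -> essentially_bounded a c ->
  `|mulop a x| <= k%:R * c * `|x|.
Proof.
move=> c0 ac; have [h b] := mulmx_isL2 ac (L2P x).
have kc0 : 0 <= k%:R * c := mulr_ge0 (ler0n _ _) c0.
have r0 : 0 <= k%:R * c * `|x| := mulr_ge0 kc0 (normr_ge0 x).
suff h2 : `|mulop a x| ^+ 2 <= (k%:R * c * `|x|) ^+ 2 by rewrite -ler_sqr ?nnegrE ?r0 ?normr_ge0.
rewrite -lee_fin (L2class_norm2 h) exprMn [leRHS]EFinM L2norm2E.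
exact: b.
Qed.

Lemma mulop_ip a c x y : essentially_bounded a c ->
  L2ip (mulop a x) y = dotint nu (fun t => a t *m x t) y.
Proof.
move=> ac; have h := (mulmx_isL2 ac (L2P x)).1.
apply: dotint_ae; try exact: L2measurable; first exact: h.1.
  exact: L2class_ae.
exact: ae_eq_refl.
Qed.

Lemma mulop_sym a c x y : essentially_bounded a c -> {ae nu, forall t, (a t)^T = a t} ->
  L2ip (mulop a x) y = L2ip x (mulop a y).
Proof.
move=> ac asym; rewrite (mulop_ip _ _ ac) [RHS]L2ipC (mulop_ip _ _ ac) /dotint /Rintegral.
congr fine; have hx := (mulmx_isL2 ac (L2P x)).1; have hy := (mulmx_isL2 ac (L2P y)).1.
apply: ae_eq_integral => //.
- by apply/measurable_EFinP; apply: measurable_dot; [exact: hx.1|exact: L2measurable].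
- by apply/measurable_EFinP; apply: measurable_dot; [exact: hy.1|exact: L2measurable].
apply: filterS asym => t at_ _; congr EFin; rewrite [RHS]dotC.
have dE (u v : 'cV[R]_k) : dot u v = (u^T *m v) 0 0.
  by rewrite mxE; apply: eq_bigr => i _; rewrite mxE.
by rewrite !dE trmx_mul at_ mulmxA.
Qed.

Lemma dotint_ge0 (u v : T -> 'cV[R]_k) : measurable_fun setT u -> measurable_fun setT v ->
  {ae nu, forall t, 0 <= dot (u t) (v t)} -> 0 <= dotint nu u v.
Proof.
move=> mu mv uv; have mf : measurable_fun setT (fun t => (dot (u t) (v t))%:E).
  by apply/measurable_EFinP; exact: measurable_dot.
rewrite /dotint /Rintegral; apply: fine_ge0.
rewrite (ae_eq_integral (fun t => `|(dot (u t) (v t))%:E|%E)) ?integral_ge0//.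
- exact: measurableT_comp.
- by apply: filterS uv => t h _; rewrite gee0_abs.
Qed.

Lemma mulop_coercive a c Cl Cu x : essentially_bounded a c ->
  {ae nu, forall t, forall xi : 'cV[R]_k,
    Cl * dot xi xi <= dot xi (a t *m xi) /\ dot xi (a t *m xi) <= Cu * dot xi xi} ->
  Cl * `|x| ^+ 2 <= L2ip (mulop a x) x /\ L2ip (mulop a x) x <= Cu * `|x| ^+ 2.
Proof.
move=> ac aC; rewrite (mulop_ip _ _ ac) -(ipxx (L2_inner_product nu k)).
have hx := L2P x; have hax := (mulmx_isL2 ac hx).1.
rewrite /L2ip -subr_ge0 -(subr_ge0 (dotint _ _ _) (Cu * _)); split.
- rewrite [X in 0 <= X](_ : _ = dotint nu (fun t => - Cl *: x t + a t *m x t) x).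
    apply: dotint_ge0; first exact: measurable_lincomb hx.1 hax.1.
      exact: hx.1.
    by apply: filterS aC => t /(_ (x t))[h _]; rewrite dotDl dotZl (dotC (a t *m _)) mulNr addrC subr_ge0.
  by rewrite dotint_lin// mulNr addrC.
- have -> : Cu * dotint nu x x - dotint nu (fun t => a t *m x t) x =
      dotint nu (fun t => -1 *: (a t *m x t) + Cu *: x t) x.
    have e : dotint nu (fun t => Cu *: x t) x = Cu * dotint nu x x.
      have := dotint_lin Cu hx (isL20 nu) hx; rewrite /dotint.
      under eq_Rintegral do rewrite addr0.
      move=> ->; rewrite -[RHS]addr0; congr (_ + _).
      by under eq_Rintegral do rewrite dot0l; rewrite /Rintegral integral0.
    by rewrite dotint_lin ?e ?mulN1r 1?addrC//; exact: isL2Z.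
  apply: dotint_ge0; first by apply: measurable_lincomb; [exact: hax.1|exact: (isL2Z Cu hx).1].
    exact: hx.1.
  by apply: filterS aC => t /(_ (x t))[_ h]; rewrite dotDl !dotZl (dotC (a t *m _)) mulN1r addrC subr_ge0.
Qed.

End multiplication_operator.

(** * Restriction to the domain *)

Section restricted_measure.
Context {d} {T : measurableType d} {R : realType}.
Context (mu : {sigma_finite_measure set T -> \bar R}) (W : set T) (mW : measurable W).

(** With W absorbed into the measure, the preceding theory of functions on a whole measurable space
    applies verbatim to fields on W. *)
Definition restr_measure : set T -> \bar R := mrestr mu mW.

HB.instance Definition _ := Measure.copy restr_measure (mrestr mu mW).

Let restr_sigma_finite : sigma_finite setT restr_measure.
Proof.
have [F TF mF] := sigma_finiteT mu; exists F => // i; have [mFi Fi] := mF i; split=> //.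
by apply: le_lt_trans Fi; apply: le_measure => //; rewrite inE//; exact: measurableI.
Qed.

HB.instance Definition _ := Measure_isSigmaFinite.Build _ _ _ restr_measure restr_sigma_finite.

Definition restr : {sigma_finite_measure set T -> \bar R} := restr_measure.

Lemma ae_restr (P : T -> Prop) : {ae restr, forall x, P x} <-> {ae mu, forall x, W x -> P x}.
Proof.
split=> [[A [mA A0 PA]]|[A [mA A0 PA]]].
- exists (A `&` W); split; [exact: measurableI|by []|].
  move=> x /= h; split; last by apply: contra_notP h => nW.
  by apply: PA => /= Px; apply: h.
- exists (A `|` ~` W); split.
  + by apply: measurableU => //; exact: measurableC.
  + apply/eqP; rewrite eq_le measure_ge0 andbT /= /restr_measure /mrestr -A0.
    apply: le_measure; rewrite ?inE//.
      by apply: measurableI => //; apply: measurableU => //; exact: measurableC.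
    by move=> x [[//|]].
  + move=> x /= h; have [Wx|nW] := pselect (W x); last by right.
    by left; apply: PA => /= /(_ Wx).
Qed.

Lemma integral_restr (f : T -> \bar R) : measurable_fun setT f ->
  (\int[restr]_x f x = \int[mu]_(x in W) f x)%E.
Proof.
move=> mf; have <- : (\int[restr]_(x in W) f x = \int[mu]_(x in W) f x)%E.
  apply: eq_measure_integral => A mA AW.
  by rewrite /= /restr_measure /mrestr setIidl.
rewrite [RHS]integral_mkcond; apply: ae_eq_integral => //.
- by apply/(measurable_restrictT _ _).1 => //; exact: measurable_funTS.
- by apply/ae_restr; near=> x => Wx _; rewrite patchE mem_set.
Unshelve. all: by end_near. Qed.

End restricted_measure.

Section extension_by_zero.
Context {d} {T : measurableType d} {R : realType} {m n : nat}.
Implicit Types (u : T -> 'M[R]_(m, n)) (W : set T).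

(** A field on W is only known to be measurable on W, whereas elements of [L2space] are measurable
    on the whole space. *)
Definition extend0 W u : T -> 'M[R]_(m, n) := fun x => if x \in W then u x else 0.

Lemma extend0E W u x : W x -> extend0 W u x = u x.
Proof. by move=> Wx; rewrite /extend0 mem_set. Qed.

Lemma measurable_extend0 W u : measurable W -> measurable_fun W u ->
  measurable_fun setT (extend0 W u).
Proof.
move=> mW /(measurable_mxP _ mW) mu; apply/(measurable_mxP _ measurableT) => i j.
rewrite (_ : (fun x => _) = (fun x => u x i j) \_ W).
  by apply/(measurable_restrictT _ _).1 => //; exact: mu.
by apply/funext => x; rewrite patchE /extend0; case: ifP => // _; rewrite mxE.
Qed.

End extension_by_zero.

Section restriction_to_domain.
Context {R : realType} {d k : nat} (W : set 'rV[R]_d) (mW : measurable W).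
Notation mu := (lebesgue_rV R d).
Notation nu := (restr mu mW).
Notation H := (L2space nu k).
Notation vfield := ('rV[R]_d -> 'cV[R]_k).
Implicit Types u v w : vfield.

Definition class_on u : H := L2class nu (extend0 W u).

Lemma sqint_extend0 u : measurable_fun W u -> L2sqnorm W u = sqint nu (extend0 W u).
Proof.
move=> mu'; rewrite /sqint integral_restr; last first.
  by apply: measurable_sq; exact: measurable_extend0.
by apply: eq_integral => x /set_mem Wx; rewrite extend0E.
Qed.

Lemma isL2_extend0 u : inL2 W u -> isL2 nu (extend0 W u).
Proof.
by move=> [mu' u2]; split; [exact: measurable_extend0|rewrite -sqint_extend0].
Qed.

Lemma isL2_inL2 u : isL2 nu u -> inL2 W u.
Proof.
move=> [mu' u2]; split; first exact: measurable_funTS.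
by move: u2; rewrite /sqint integral_restr//; exact: measurable_sq.
Qed.

Lemma L2space_inL2 (x : H) : inL2 W x.
Proof. exact: isL2_inL2 (L2P x). Qed.

Lemma class_on_ae u : inL2 W u -> class_on u = u %[ae mu in W].
Proof.
move=> hu; have /ae_restr := L2class_ae (isL2_extend0 hu).
by apply: filterS => x h Wx; rewrite [LHS]h// extend0E.
Qed.

Lemma class_on_eq u (x : H) : inL2 W u -> u = x %[ae mu in W] -> class_on u = x.
Proof.
move=> hu ux; apply: L2class_eq; first exact: isL2_extend0.
by apply/ae_restr; apply: filterS ux => t h Wt _; rewrite extend0E// h.
Qed.

Lemma class_on_eqP u v : inL2 W u -> inL2 W v ->
  class_on u = class_on v <-> u = v %[ae mu in W].
Proof.
move=> hu hv; split=> [e|uv].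
  by apply: ae_eq_trans (ae_eq_sym (class_on_ae hu)) _; rewrite e; exact: class_on_ae.
by apply: class_on_eq => //; apply: ae_eq_trans uv _; apply: ae_eq_sym; exact: class_on_ae.
Qed.

Lemma class_on_id (x : H) : class_on x = x.
Proof. by apply: class_on_eq; [exact: L2space_inL2|exact: ae_eq_refl]. Qed.

Lemma class_on_norm2 u : inL2 W u -> (`|class_on u| ^+ 2)%:E = L2sqnorm W u.
Proof.
by move=> hu; rewrite L2class_norm2 ?sqint_extend0//; [exact: hu.1|exact: isL2_extend0].
Qed.

Lemma class_on_norm u : inL2 W u -> L2norm W u = `|class_on u|.
Proof. by move=> hu; rewrite /L2norm -class_on_norm2//= sqrtr_sqr normr_id. Qed.

Lemma class_on_ip u v : inL2 W u -> inL2 W v -> L2dot W u v = L2ip (class_on u) (class_on v).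
Proof.
move=> hu hv; rewrite L2class_ip; try exact: isL2_extend0.
rewrite /L2dot /dotint /Rintegral integral_restr; last first.
  by apply/measurable_EFinP; apply: measurable_dot; [exact: (isL2_extend0 hu).1|exact: (isL2_extend0 hv).1].
by congr fine; apply: eq_integral => x /set_mem Wx; rewrite !extend0E.
Qed.

Lemma extend0_lincomb c u v :
  extend0 W (c \*: u \+ v) = (fun x => c *: extend0 W u x + extend0 W v x).
Proof. by apply/funext => x; rewrite /extend0; case: ifP => // _; rewrite scaler0 addr0. Qed.

Lemma inL2_lincomb c u v : inL2 W u -> inL2 W v -> inL2 W (c \*: u \+ v).
Proof.
move=> hu hv; have := isL2_inL2 (isL2_lincomb c (isL2_extend0 hu) (isL2_extend0 hv)).
rewrite -extend0_lincomb => -[h1 h2]; split.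
  apply: eq_measurable_fun h1 => x /set_mem Wx; by rewrite extend0E.
rewrite (_ : L2sqnorm W _ = L2sqnorm W (extend0 W (c \*: u \+ v)))//.
by apply: eq_integral => x /set_mem Wx; rewrite extend0E.
Qed.

Lemma class_on_lincomb c u v : inL2 W u -> inL2 W v ->
  class_on (c \*: u \+ v) = c *: class_on u + class_on v.
Proof.
by move=> hu hv; rewrite /class_on extend0_lincomb L2class_lincomb//; exact: isL2_extend0.
Qed.

Lemma subE u v : u \- v = -1 \*: v \+ u.
Proof. by apply/funext => x; rewrite /= scaleN1r addrC. Qed.

Lemma inL2B u v : inL2 W u -> inL2 W v -> inL2 W (u \- v).
Proof. by move=> hu hv; rewrite subE; exact: inL2_lincomb. Qed.

Lemma class_onB u v : inL2 W u -> inL2 W v -> class_on (u \- v) = class_on u - class_on v.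
Proof. by move=> hu hv; rewrite subE class_on_lincomb// scaleN1r addrC. Qed.

Section skew_adjoint_transfer.
Context (V : set vfield) (P : vfield -> vfield) (skewP : skew_adjoint W V P).

Definition domain_class : set H := [set x : H | V x].

(** P is evaluated on the canonical function of the class. By [skew_adjoint_ae] neither membership
    in V nor the class of the image depends on that choice, see [op_classE]. *)
Definition op_class (x : H) : H := class_on (P x).

Lemma domain_ae u v : V u -> measurable_fun W v -> u = v %[ae mu in W] ->
  V v /\ class_on (P u) = class_on (P v).
Proof.
move=> Vu mv uv; have [Vv Pv] := skew_adjoint_ae skewP Vu mv uv; split=> //.
by apply/class_on_eqP => //; [case: (skew_adjoint_L2 skewP Vu)|case: (skew_adjoint_L2 skewP Vv)].
Qed.

Lemma op_classE u : V u -> domain_class (class_on u) /\ op_class (class_on u) = class_on (P u).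
Proof.
move=> Vu; have [hu _] := skew_adjoint_L2 skewP Vu.
have [] := domain_ae Vu (L2space_inL2 (class_on u)).1.
  by apply: ae_eq_sym; exact: class_on_ae.
by move=> h e; split.
Qed.

Lemma domain_class_on u : inL2 W u -> domain_class (class_on u) -> V u.
Proof.
move=> hu hV; have [] // := domain_ae hV hu.1; exact: class_on_ae.
Qed.

Lemma op_class_skew_adjoint : skew_adjoint_op (@L2ip _ _ _ nu k) domain_class op_class.
Proof.
have hL2 := skew_adjoint_L2 skewP.
have [V0 Vlin] := skew_adjoint_subspace skewP.
split.
- apply: (domain_ae V0 (L2space_inL2 (0 : H)).1 _).1.
  have /ae_restr := L2zeroE nu k; apply: filterS => x h' Wx; exact/esym/h'.
- move=> c x y Vx Vy.
  have Vxy := Vlin c _ _ Vx Vy.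
  have := op_classE Vxy; rewrite class_on_lincomb; try exact: L2space_inL2.
  rewrite !class_on_id => -[h ->]; split=> //.
  rewrite -class_on_lincomb; try exact: (hL2 _ _).2.
  apply/class_on_eqP; [exact: (hL2 _ Vxy).2| |exact: (skew_adjoint_linear skewP)].
  by apply: inL2_lincomb; exact: (hL2 _ _).2.
- move=> v w.
  have [h1 h2] := skew_adjointE skewP (L2space_inL2 v) (L2space_inL2 w).
  split=> [h|[Vv ->] u Vu].
    have [|Vv wv] := h1.
      move=> u Vu; have [Vu' Pu'] := op_classE Vu; have [h3 h4] := hL2 _ Vu.
      by rewrite !class_on_ip ?class_on_id; try exact: L2space_inL2; rewrite // -Pu'; exact: h.
    split=> //; rewrite -[w]class_on_id -scaleN1r.
    have h3 := (hL2 _ Vv).2; apply: class_on_eq; first exact: L2space_inL2.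
    have /ae_restr := L2scaleE (-1) (op_class v).
    apply: filterS3 wv (class_on_ae h3) => x e1 e2 e3 Wx.
    by rewrite [RHS]e3// e1//= -e2// scaleN1r.
  have h3 := (hL2 _ Vv).2.
  have [_ h] := (skew_adjointE skewP (L2space_inL2 v) (L2space_inL2 (- op_class v))).
  have := h _ u Vu; rewrite !class_on_ip ?class_on_id; try exact: L2space_inL2; last exact: (hL2 _ Vu).2.
  apply; split=> //.
  have /ae_restr := L2scaleE (-1) (op_class v).
  apply: filterS2 (class_on_ae h3) => x e2 e3 Wx.
  by rewrite [LHS]e3//= -e2// scaleN1r.
(* For v in V within e of w, orthogonality gives |w|^2 = <w - v, w> <= e |w|. *)
- move=> w h; apply/normr0_eq0/eqP; rewrite eq_le normr_ge0 andbT.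
  apply/ler_addgt0Pr => e e0; rewrite add0r.
  have [v Vv we] := skew_adjoint_dense skewP (L2space_inL2 w) e0.
  have hv := (hL2 _ Vv).1; have hw := L2space_inL2 w.
  move: we; rewrite class_on_norm; last exact: inL2B.
  rewrite class_onB// class_on_id => we.
  have ipP := L2_inner_product nu k.
  have : `|w| ^+ 2 <= e * `|w|.
    rewrite -(ipxx ipP); have -> : L2ip w w = L2ip (w - class_on v) w.
      by rewrite (ipBl ipP) (h (class_on v)) ?subr0//; exact: (op_classE Vv).1.
    apply: (le_trans (ip_le ipP _ _)); rewrite ler_wpM2r//; exact: ltW.
  have [-> _|w0] := eqVneq `|w| 0; first exact: ltW.
  by rewrite expr2 ler_pM2r// lt_neqAle eq_sym w0 normr_ge0.
Qed.

End skew_adjoint_transfer.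

End restriction_to_domain.

(** * Essential bounds and truncated kernels *)

#[global] Instance ae_lebesgue_filter (R : realType) :
  Filter (nbhs (almost_everywhere (@lebesgue_measure R))).
Proof. exact: (ae_filter_ringOfSetsType (@lebesgue_measure R)). Qed.

Section null_sections.
Context {d1 d2} {T1 : measurableType d1} {T2 : measurableType d2} {R : realType}.
Context (m1 : {sigma_finite_measure set T1 -> \bar R}) (m2 : {sigma_finite_measure set T2 -> \bar R}).

(** The hypothesis makes one iterated integral of the indicator of A vanish; by Tonelli the other
    one vanishes too, hence so do its inner integrals almost everywhere. *)
Lemma ae_swap (A : set (T1 * T2)) : measurable A ->
  {ae m1, forall s, {ae m2, forall x, ~ A (s, x)}} ->
  {ae m2, forall x, {ae m1, forall s, ~ A (s, x)}}.
Proof.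
move=> mA A0; pose F z : \bar R := (\1_A z)%:E.
have mF : measurable_fun setT F by apply/measurable_EFinP; exact: measurable_indic.
have F0 z : (0 <= F z)%E by rewrite lee_fin.
have mFs s : measurable_fun setT (fun x => F (s, x)).
  by apply: measurableT_comp mF _; exact: measurable_pair1.
have mFx x : measurable_fun setT (fun s => F (s, x)).
  by apply: measurableT_comp mF _; exact: measurable_pair2.
have mFF := measurable_fun_fubini_tonelli_F (m2 := m2) F mF F0.
have mFG := measurable_fun_fubini_tonelli_G (m1 := m1) F mF F0.
have : (\int[m2]_x \int[m1]_s F (s, x) = 0)%E.
  rewrite -fubini_tonelli//.
  rewrite (ae_eq_integral (cst 0%E)) ?integral0//.
  apply: filterS A0 => s sA _; rewrite (ae_eq_integral (cst 0%E)) ?integral0//.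
  by apply: filterS sA => x xA _; rewrite /F indicE memNset.
move=> e; have : ae_eq m2 setT (fun x => \int[m1]_s F (s, x))%E (cst 0%E).
  apply/(ae_eq_integral_abs m2 measurableT mFG).
  by rewrite -[RHS]e; apply: eq_integral => x _; rewrite gee0_abs// integral_ge0.
apply: filterS => x /(_ I) /= x0.
have : ae_eq m1 setT (fun s => F (s, x)) (cst 0%E).
  apply/(ae_eq_integral_abs m1 measurableT (mFx x)).
  by rewrite -[RHS]x0; apply: eq_integral => s _; rewrite gee0_abs.
apply: filterS => s /(_ I) /= + As.
by rewrite /F indicE mem_set// => -[] /eqP; rewrite oner_eq0.
Qed.

End null_sections.

Lemma ae_reflect {R : realType} (P : R -> Prop) (t : R) :
  {ae @lebesgue_measure R, forall s, P s} -> {ae @lebesgue_measure R, forall s, P (t - s)}.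
Proof.
move=> [A [mA A0 PA]].
have mt : measurable ((fun s => t - s) @^-1` A).
  rewrite -[X in measurable X]setTI.
  by apply: measurable_funB => //; exact: measurable_cst.
have I B : measurable B -> @lebesgue_measure R B = (\int[@lebesgue_measure R]_s (\1_B s)%:E)%E.
  by move=> mB; rewrite integral_indic// setIT.
exists ((fun s => t - s) @^-1` A); split=> //; last by move=> s /= h; exact: PA.
rewrite -A0 !I// -[RHS](integral_reflect t)//.
by apply/measurable_EFinP; exact: measurable_indic.
Qed.

Section matrix_norm.
Context {R : realType} {m n : nat}.
Implicit Types M : 'M[R]_(m, n).

Lemma le_mx_norm M i j : `|M i j| <= `|M|.
Proof. by rewrite [leRHS]mx_normrE (le_bigmax 0 (fun ij => `|M ij.1 ij.2|) (i, j)). Qed.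

Lemma measurable_mx_norm {d} {T : measurableType d} (f : T -> 'M[R]_(m, n)) :
  measurable_fun setT f -> measurable_fun setT (fun x => `|f x|).
Proof.
move=> /(measurable_mxP _ measurableT) mf.
rewrite (_ : (fun x => _) = fun x => \big[Num.max/0]_ij `|f x ij.1 ij.2|); last first.
  by apply/funext => x; rewrite [LHS]mx_normrE.
have h (s : seq ('I_m * 'I_n)) :
    measurable_fun setT (fun x => \big[Num.max/0]_(ij <- s) `|f x ij.1 ij.2|).
  elim: s => [|ij s IH]; first by under eq_fun do rewrite big_nil; exact: measurable_cst.
  under eq_fun do rewrite big_cons; apply: measurable_maxr => //.
  by apply: measurableT_comp => //; exact: mf.
exact: h.
Qed.

End matrix_norm.

Section essential_bounds.
Context {R : realType} {d k : nat} (W : set 'rV[R]_d).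
Notation mu := (lebesgue_rV R d).

(** The unit cube has measure 1, also in dimension 0. Positive total mass makes the essential
    supremum of the constant 0 equal to 0, whence [Linfnorm_ge0]. *)
Lemma lebesgue_rV_gt0 : (0 < mu [set: 'rV[R]_d])%E.
Proof.
pose A (i : 'I_d) : set R := [set` `[0%R, 1%R]].
have mA i : measurable (A i) by exact: measurable_itv.
have mbox : measurable [set x : 'rV[R]_d | forall i, A i (x 0 i)].
  have -> : [set x : 'rV[R]_d | forall i, A i (x 0 i)] =
      \bigcap_(i in [set: 'I_d]) (fun x : 'rV[R]_d => x 0 i) @^-1` A i.
    by apply/seteqP; split => x h i; [move=> _|]; apply: h.
  apply: fin_bigcap_measurable => // i _; rewrite -[X in measurable X]setTI.
  have /measurable_mxP h := @measurable_id _ 'rV[R]_d setT.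
  by apply: (h measurableT 0 i).
apply: (@lt_le_trans _ _ (mu [set x | forall i, A i (x 0 i)])); last first.
  by apply: le_measure => //; rewrite inE.
rewrite (lebesgue_rV_box mA) big1// => i _.
by rewrite lebesgue_measure_itv/= lte_fin ltr01 oppr0 adde0.
Qed.

Lemma Linfnorm_ge0 (A : 'rV[R]_d -> 'M[R]_k) : (0 <= Linfnorm W A)%E.
Proof.
rewrite -[X in (X <= _)%E](ess_sup_cst (mu := mu) 0%E lebesgue_rV_gt0).
by apply: le_ess_sup; near=> x; rewrite lee_fin mulr_ge0.
Unshelve. all: by end_near. Qed.

Lemma Linfnorm_ae (A : 'rV[R]_d -> 'M[R]_k) :
  {ae mu, forall x, W x -> forall i j, (`|A x i j|%:E <= Linfnorm W A)%E}.
Proof.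
have := ess_sup_ge mu (fun x => (`|A x| * \1_W x)%:E).
apply: filterS => x h Wx i j; apply: le_trans h.
by rewrite indicE mem_set// mulr1 lee_fin le_mx_norm.
Qed.

Lemma inLinf_essentially_bounded (mW : measurable W) (A : 'rV[R]_d -> 'M[R]_k) c :
  inLinf W A -> (Linfnorm W A <= c%:E)%E -> 0 <= c ->
  essentially_bounded (restr mu mW) (extend0 W A) c.
Proof.
move=> [mA _] Ac c0; split; first exact: measurable_extend0.
apply/ae_restr; apply: filterS (Linfnorm_ae A) => x h Wx i j.
by rewrite extend0E// -lee_fin; exact: le_trans (h Wx i j) Ac.
Qed.

End essential_bounds.

(** * From almost everywhere bounds on q to a dominated kernel *)

Section kernel_truncation.
Context {R : realType} {d k : nat} (W : set 'rV[R]_d) (mW : measurable W).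
Notation mu := (lebesgue_rV R d).
Notation nu := (restr mu mW).
Notation leb := (@lebesgue_measure R).
Context (q : R -> 'rV[R]_d -> 'M[R]_k).
Hypothesis mq : measurable_fun ([set: R] `*` W) (fun z : R * 'rV[R]_d => q z.1 z.2).

Lemma extend0_prod (z : R * 'rV[R]_d) :
  extend0 W (q z.1) z.2 = extend0 ([set: R] `*` W) (fun z => q z.1 z.2) z.
Proof.
rewrite /extend0; congr (if _ then _ else _).
by apply/idP/idP => [/set_mem Wx|/set_mem[_ Wx]]; apply/mem_set.
Qed.

Lemma measurable_extend0_kernel :
  measurable_fun setT (fun z : R * 'rV[R]_d => extend0 W (q z.1) z.2).
Proof.
rewrite (_ : (fun z => _) = extend0 ([set: R] `*` W) (fun z : R * 'rV[R]_d => q z.1 z.2)).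
  by apply: measurable_extend0 => //; exact: measurableX.
by apply/funext => z; rewrite extend0_prod.
Qed.

(** The norm of q t exceeds r exactly when the t-section of {|q| > r} has positive measure, and
    measures of sections of a measurable set depend measurably on t. *)
Lemma measurable_Linfnorm : measurable_fun setT (fun t => Linfnorm W (q t)).
Proof.
pose g (z : R * 'rV[R]_d) : \bar R := `|extend0 W (q z.1) z.2|%:E.
have mg : measurable_fun setT g.
  by apply/measurable_EFinP; apply: measurable_mx_norm; exact: measurable_extend0_kernel.
have gE t x : g (t, x) = (`|q t x| * \1_W x)%:E.
  rewrite /g /= /extend0 indicE; case: ifP => _; first by rewrite mulr1.
  by rewrite mulr0 normr0.
apply: (measurability _ (ErealGenOInfty.measurableE R)) => // _ [_ [r ->] <-].
pose A := [set z | (r%:E < g z)%E].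
have mA : measurable A by rewrite -[A]setTI; exact: emeasurable_fun_o_infty.
have mphi := measurable_fun_xsection mu mA.
rewrite (_ : setT `&` _ = setT `&` [set t | (0 < mu (xsection A t))%E]).
  exact: emeasurable_fun_o_infty.
congr (_ `&` _); apply/seteqP; split => t /=; rewrite in_itv/= andbT; last first.
  move=> h; rewrite ltNge; apply/negP => /ess_supP[B [mB B0 AB]].
  move: h; rewrite ltNge => /negP; apply; rewrite -B0; apply: le_measure; rewrite ?inE//.
    exact: measurable_xsection.
  move=> x; rewrite /xsection/= => /set_mem rx; apply: AB => /=; apply/negP.
  by rewrite -ltNge -gE.
move=> h; rewrite lt0e measure_ge0 andbT; apply/eqP => A0.
move: h; rewrite ltNge => /negP; apply; apply/ess_supP.
exists (xsection A t); split=> //; first exact: measurable_xsection.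
move=> x /= /negP; rewrite -ltNge -gE => h.
by rewrite /xsection/=; apply/mem_set.
Qed.

(** Infinite values of the norm, possible only for a null set of times once q is in L^1, become 0
    through [fine]; negative times are discarded outright. *)
Definition kernel_norm (t : R) : R := if 0 <= t then fine (Linfnorm W (q t)) else 0.

(** The points where both properties of q, causality and the bound by its norm in x, hold literally.
    Setting q to 0 elsewhere changes it, for almost every t, only on a null set of x in W:
    [truncated_kernel_ae]. *)
Definition truncation_set : set (R * 'rV[R]_d) :=
  [set z | [/\ 0 <= z.1, W z.2 & forall i j, `|extend0 W (q z.1) z.2 i j| <= kernel_norm z.1]].

Definition truncated_kernel (t : R) (x : 'rV[R]_d) : 'M[R]_k :=
  extend0 truncation_set (fun z => extend0 W (q z.1) z.2) (t, x).

Lemma measurable_kernel_norm : measurable_fun setT kernel_norm.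
Proof.
apply: measurable_fun_if => //.
- by apply: measurable_fun_ler => //; exact: measurable_cst.
- by apply: measurable_funTS; apply: measurableT_comp => //; exact: measurable_Linfnorm.
Qed.

Lemma kernel_norm_ge0 t : 0 <= kernel_norm t.
Proof. by rewrite /kernel_norm; case: ifP => // _; rewrite fine_ge0// Linfnorm_ge0. Qed.

Lemma measurable_truncation_set : measurable truncation_set.
Proof.
have mE i j : measurable [set z : R * 'rV[R]_d | `|extend0 W (q z.1) z.2 i j| <= kernel_norm z.1].
  rewrite -[X in measurable X]setTI; apply: measurable_fun_le => //.
    apply: measurableT_comp => //.
    by have /(measurable_mxP _ measurableT) := measurable_extend0_kernel; exact.
  exact: (measurableT_comp measurable_kernel_norm measurable_fst).
rewrite (_ : truncation_set = (`[0%R, +oo[%classic `*` W) `&`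
    \bigcap_(ij in [set: 'I_k * 'I_k]) [set z : R * 'rV[R]_d |
      `|extend0 W (q z.1) z.2 ij.1 ij.2| <= kernel_norm z.1]); last first.
  apply/seteqP; split=> z; first by move=> [h1 h2 h3]; split; [split=> //=; rewrite in_itv/= h1|move=> ij _; exact: h3].
  move=> [[/=]]; rewrite in_itv/= andbT => h1 h2 h3; split=> // i j.
  exact: (h3 (i, j)).
apply: measurableI; first exact: measurableX.
by apply: fin_bigcap_measurable => // ij _; exact: mE.
Qed.

Lemma measurable_truncated_kernel :
  measurable_fun setT (fun z : R * 'rV[R]_d => truncated_kernel z.1 z.2).
Proof.
rewrite (_ : (fun z => _) = extend0 truncation_set
    (fun z : R * 'rV[R]_d => extend0 W (q z.1) z.2)); last first.
  by apply/funext => -[t x].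
apply: measurable_extend0; first exact: measurable_truncation_set.
by apply: measurable_funTS; exact: measurable_extend0_kernel.
Qed.

Lemma truncated_kernel_dominated Bq K1 : 0 < K1 -> Bq <= K1 ->
  (L1Linfnorm W q <= Bq%:E)%E -> dominated_kernel truncated_kernel kernel_norm K1.
Proof.
move=> K10 BK qB; split=> //.
- exact: measurable_truncated_kernel.
- exact: measurable_kernel_norm.
- exact: kernel_norm_ge0.
- by move=> t t0; rewrite /kernel_norm leNgt t0.
- move=> t x i j; rewrite /truncated_kernel {1}/extend0; case: ifP => [/set_mem[_ _]|_]; first exact.
  by rewrite mxE normr0 kernel_norm_ge0.
- apply: (@le_trans _ _ Bq%:E); last by rewrite lee_fin.
  apply: le_trans qB; apply: ge0_le_integral => //.
  + by move=> t _; rewrite lee_fin kernel_norm_ge0.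
  + by apply/measurable_EFinP; exact: measurable_kernel_norm.
  + exact: measurable_Linfnorm.
  + move=> t _; rewrite /kernel_norm; case: ifP => _; last exact: Linfnorm_ge0.
    case: (Linfnorm W (q t)) (Linfnorm_ge0 W (q t)) => [r|_|] //=.
Qed.

Lemma truncated_kernel_ae : (L1Linfnorm W q < +oo)%E ->
  {ae leb, forall t, t < 0 -> q t = cst 0 %[ae mu in W]} ->
  {ae leb, forall t, {ae mu, forall x, W x -> truncated_kernel t x = q t x}}.
Proof.
move=> qoo q0.
have : leb.-integrable setT (fun t => Linfnorm W (q t)).
  apply/integrableP; split; first exact: measurable_Linfnorm.
  by under eq_integral do rewrite gee0_abs ?Linfnorm_ge0//.
move=> /(integrable_ae measurableT) qi; near=> t.
have q0t : t < 0 -> q t = cst 0 %[ae mu in W] by near: t.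
have qf : Linfnorm W (q t) \is a fin_num by near: t; apply: filterS qi => t /(_ I).
have [t0|t0] := ltP t 0.
  apply: filterS (q0t t0) => x h Wx; rewrite h// /truncated_kernel /extend0; case: ifP => // _.
  by rewrite mem_set//= h.
apply: filterS (Linfnorm_ae W (q t)) => x h Wx.
rewrite /truncated_kernel /extend0 mem_set/= ?mem_set//; split=> //= i j.
by rewrite extend0E// /kernel_norm t0 -lee_fin fineK// h.
Unshelve. all: by end_near. Qed.

Lemma measurable_joint_extend0 (u : R -> 'rV[R]_d -> 'cV[R]_k) : joint_measurable W u ->
  jointly_measurable (fun s => extend0 W (u s)).
Proof.
move=> mu'; rewrite /jointly_measurable.
rewrite (_ : (fun z => _) = extend0 ([set: R] `*` W) (fun z : R * 'rV[R]_d => u z.1 z.2)).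
  by apply: measurable_extend0 => //; exact: measurableX.
apply/funext => z; rewrite /extend0; congr (if _ then _ else _).
by apply/idP/idP => [/set_mem Wx|/set_mem[_ Wx]]; apply/mem_set.
Qed.

(** The kernels agree for almost every time and then almost every x; the convolution at x needs the
    opposite order, supplied by [ae_swap]. The exceptional set is that of a measurable function
    being positive, hence measurable. *)
Lemma time_conv_truncated (u : R -> 'rV[R]_d -> 'cV[R]_k) t : joint_measurable W u ->
  (L1Linfnorm W q < +oo)%E ->
  {ae leb, forall t, t < 0 -> q t = cst 0 %[ae mu in W]} ->
  {ae mu, forall x, W x ->
    time_conv q u t x = kernel_conv truncated_kernel (fun s => extend0 W (u s)) t x}.
Proof.
move=> mu' qoo q0.
have ae1 := ae_reflect t (truncated_kernel_ae qoo q0).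
have mqt : measurable_fun setT (fun z : R * 'rV[R]_d => extend0 W (q (t - z.1)) z.2).
  apply: (measurableT_comp measurable_extend0_kernel (g := fun z : R * 'rV[R]_d => (t - z.1, z.2))).
  apply/measurable_fun_pairP; split; last exact: measurable_snd.
  by apply: measurable_funB => //; exact: measurable_fst.
have mTt : measurable_fun setT (fun z : R * 'rV[R]_d => truncated_kernel (t - z.1) z.2).
  apply: (measurableT_comp measurable_truncated_kernel (g := fun z : R * 'rV[R]_d => (t - z.1, z.2))).
  apply/measurable_fun_pairP; split; last exact: measurable_snd.
  by apply: measurable_funB => //; exact: measurable_fst.
pose D z : 'M[R]_k := extend0 W (q (t - z.1)) z.2 - truncated_kernel (t - z.1) z.2.
have mD : measurable_fun setT (fun z : R * 'rV[R]_d => `|D z|).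
  apply: measurable_mx_norm; apply/(measurable_mxP _ measurableT) => i j.
  under eq_fun do rewrite !mxE; apply: measurable_funB.
    by move/(measurable_mxP _ measurableT): mqt; exact.
  by move/(measurable_mxP _ measurableT): mTt; exact.
pose A := ~` [set z : R * 'rV[R]_d | `|D z| <= 0].
have mA : measurable A.
  apply: measurableC; rewrite -[X in measurable X]setTI.
  by apply: measurable_fun_le => //; exact: measurable_cst.
have /ae_restr h : {ae nu, forall x, {ae leb, forall s, ~ A (s, x)}}.
  apply: (@ae_swap _ _ _ _ R leb nu A mA).
  apply: filterS ae1 => s h; apply/ae_restr; apply: filterS h => x h Wx.
  by rewrite /A /D/= extend0E// h// subrr normr0.
have mu0 := measurable_joint_extend0 mu'.
apply: filterS h => x h Wx; apply/matrixP => i j; rewrite ord1 !mxE /Rintegral; congr fine.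
have E : (fun s => q (t - s) x *m u s x) =
    fun s => extend0 W (q (t - s)) x *m extend0 W (u s) x.
  by apply/funext => s; rewrite !extend0E.
have m1 := measurable_mulmx_fun (measurableT_comp mqt (measurable_pair2 x))
  (measurableT_comp mu0 (measurable_pair2 x)).
have m2 := measurable_mulmx_fun (measurableT_comp mTt (measurable_pair2 x))
  (measurableT_comp mu0 (measurable_pair2 x)).
under eq_integral do rewrite -[q _ _ *m _]/((fun s => q (t - s) x *m u s x) _) E.
apply: ae_eq_integral => //.
- by apply/measurable_EFinP; move/measurable_vecP: m1; exact.
- by apply/measurable_EFinP; move/measurable_vecP: m2; exact.
apply: filterS (h Wx) => s /contrapT /=; rewrite normr_le0 subr_eq0 => /eqP /= e _.
by rewrite e.
Qed.

End kernel_truncation.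

(** * Smooth windows *)

Section pointwise_derivatives.
Context {R : realType}.
Implicit Types (f g : R -> R).

Lemma is_derive_mulr f g (x df dg : R) : is_derive x 1 f df -> is_derive x 1 g dg ->
  is_derive x 1 (fun y => f y * g y) (f x * dg + g x * df).
Proof. by move=> fD gD; have := is_deriveM fD gD. Qed.

Lemma is_derive_expr f m (x df : R) : is_derive x 1 f df ->
  is_derive x 1 (fun y => f y ^+ m) (m%:R * f x ^+ m.-1 * df).
Proof.
move=> fD; have := is_deriveX m fD.
by rewrite (_ : f ^+ m = fun y => f y ^+ m)//; apply/funext => y; rewrite fctE.
Qed.

End pointwise_derivatives.

Section bump_function.
Context {R : realType}.
Implicit Types (p : {poly R}) (m : nat) (x t : R).

Definition bump_arg x : R := (x * (1 - x))^-1.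

(* p(x) z^m exp(-z) on ]0, 1[ with z = 1 / (x (1 - x)): a class of functions
   closed under differentiation *)
Definition bump p m x : R :=
  if 0 < x < 1 then p.[x] * (bump_arg x ^+ m * expR (- bump_arg x)) else 0.

(** With y = x (1 - x) and z = 1 / y one has z' = - z^2 (1 - 2 x). Factoring z^(m+2) exp(-z) out of
    the derivative of p z^m exp(-z) leaves this polynomial. *)
Definition bump_deriv p m : {poly R} :=
  p^`() * ('X * (1 - 'X)) ^+ 2 - (m%:R *: (p * (1 - 'X *+ 2) * ('X * (1 - 'X))))
  + p * (1 - 'X *+ 2).

Lemma bump_out p m x : ~~ (0 < x < 1) -> bump p m x = 0.
Proof. by rewrite /bump => /negbTE ->. Qed.

(** exp z is at least z^(m+2) / (m+2)!, so z^m exp(-z) is at most (m+2)! z^-2. Quadratic decay at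
    the end points is what differentiability with derivative 0 there requires. *)
Lemma bump_decay p m : exists2 C, 0 <= C &
  forall x, 0 < x < 1 -> `|bump p m x| <= C * (x * (1 - x)) ^+ 2.
Proof.
have [c c01 cM] : exists2 c, c \in `[0:R, 1] & forall t, t \in `[0:R, 1] -> `|p.[t]| <= `|p.[c]|.
  apply: EVT_max => //; apply: continuous_subspaceT => t.
  by apply: cvg_norm; exact: continuous_horner.
exists (`|p.[c]| * m.+2`!%:R); first by rewrite mulr_ge0.
move=> x x01; rewrite /bump x01; have /andP[x0 x1] := x01.
have y0 : 0 < x * (1 - x) by rewrite mulr_gt0// subr_gt0.
have z0 : 0 < bump_arg x by rewrite invr_gt0.
rewrite normrM -mulrA; apply: ler_pM => //.
  by apply: cM; rewrite in_itv/= !ltW.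
rewrite ger0_norm ?mulr_ge0 ?exprn_ge0 ?expR_ge0 ?(ltW z0)//.
have e := expR_ge1Dxn m.+1 (ltW z0).
have -> : x * (1 - x) = (bump_arg x)^-1 by rewrite invrK.
rewrite -(ler_pM2r (exprn_gt0 2 z0)) -[leRHS]mulrA -exprMn mulVf ?gt_eqF// expr1n mulr1.
rewrite mulrAC -exprD addn2 expRN ler_pdivrMr ?expR_gt0//.
have f0 : 0 < m.+2`!%:R :> R by rewrite ltr0n fact_gt0.
rewrite -ler_pdivrMl// mulrC; apply: le_trans e.
by rewrite lerDr.
Qed.

(** For x in ]0, 1[ and x0 outside, x (1 - x) <= |x - x0|, so the function is O(|x - x0|^2) near
    x0. *)
Lemma bump_derive_out p m x0 : ~~ (0 < x0 < 1) -> is_derive x0 1 (bump p m) 0.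
Proof.
move=> x0o; have [C C0 CP] := bump_decay p m.
have b x : `|bump p m x| <= C * `|x - x0| ^+ 2.
  have [x01|xo] := boolP (0 < x < 1); last by rewrite bump_out// normr0 mulr_ge0// sqr_ge0.
  apply: (le_trans (CP _ x01)); rewrite ler_wpM2l// ler_sqr ?nnegrE//; last first.
    by move/andP: x01 => [? ?]; rewrite mulr_ge0 ?subr_ge0 ?ltW.
  move/andP: x01 => [h1 h2].
  have [x00|x00] := leP x0 0.
    rewrite ger0_norm; last by lra.
    apply: (@le_trans _ _ x); last by rewrite lerDl oppr_ge0.
    by rewrite ger_pMr// gerBl ltW.
  have x01 : 1 <= x0 by rewrite leNgt; move: x0o; rewrite x00.
  rewrite distrC ger0_norm; last by lra.
  apply: (@le_trans _ _ (1 - x)); last by rewrite lerD2r.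
  by rewrite ger_pMl ?subr_gt0// ltW.
apply/is_derive_cvgP; apply/cvgrPdist_le => e e0.
have C1 : 0 < C + 1 by rewrite ltr_wpDl.
near=> h.
have h0 : h != 0 by near: h; exact: nbhs_dnbhs_neq.
rewrite sub0r normrN (bump_out _ _ x0o) subr0 /GRing.scale/= normrM normfV.
rewrite ler_pdivrMl ?normr_gt0//.
apply: (le_trans (b _)); rewrite [x0 + h]addrC addrK expr2 mulrA mulrC ler_wpM2l//.
apply: (@le_trans _ _ ((C + 1) * `|h|)); first by rewrite ler_wpM2r// lerDl.
rewrite -ler_pdivlMl// mulrC.
near: h; apply: dnbhs0_le.
by rewrite divr_gt0.
Unshelve. all: by end_near. Qed.

Lemma bump_derive p m x : is_derive x 1 (bump p m) (bump (bump_deriv p m) m.+2 x).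
Proof.
have [x01|xo] := boolP (0 < x < 1); last by rewrite (bump_out _ _ xo); exact: bump_derive_out.
have /andP[x0 x1] := x01.
have y0 : x * (1 - x) != 0 by rewrite gt_eqF// mulr_gt0// subr_gt0.
apply: (@near_eq_is_derive _ _ _ (fun x => p.[x] * (bump_arg x ^+ m * expR (- bump_arg x)))).
  near=> t; rewrite /bump ifT//; apply/andP; split; near: t.
    exact: lt_nbhsr.
  exact: lt_nbhsl.
have dy : is_derive x 1 (fun x : R => x * (1 - x)) (1 - x *+ 2).
  have d1 : is_derive x 1 (fun x : R => 1 - x) (0 - 1).
    by apply: is_deriveB.
  have d0 : is_derive x 1 (fun x : R => x) 1 by exact: is_derive_id.
  apply: (is_derive_eq (is_derive_mulr d0 d1)).
  by rewrite mulr1 sub0r mulrN1 mulr2n opprD addrCA.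
have dz : is_derive x 1 bump_arg (- bump_arg x ^+ 2 * (1 - x *+ 2)).
  have := is_deriveV (f := fun x => x * (1 - x)) y0 dy; rewrite /GRing.scale/= -exprVn.
  by [].
have de : is_derive x 1 (fun x => expR (- bump_arg x))
    (expR (- bump_arg x) * - (- bump_arg x ^+ 2 * (1 - x *+ 2))).
  have dn : is_derive x 1 (fun x => - bump_arg x) (- (- bump_arg x ^+ 2 * (1 - x *+ 2))).
    exact: is_deriveN.
  exact: (is_derive1_comp (g := fun x => - bump_arg x) (is_derive_expR (- bump_arg x)) dn).
have dm : is_derive x 1 (fun x => bump_arg x ^+ m)
    (m%:R * bump_arg x ^+ m.-1 * (- bump_arg x ^+ 2 * (1 - x *+ 2))).
  exact: is_derive_expr.
apply: (is_derive_eq (is_derive_mulr (is_derive_poly p x) (is_derive_mulr dm de))).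
have -> : bump (bump_deriv p m) m.+2 x = (p^`().[x] * (x * (1 - x)) ^+ 2 -
    m%:R * (p.[x] * (1 - x *+ 2) * (x * (1 - x))) + p.[x] * (1 - x *+ 2)) *
    (bump_arg x ^+ m.+2 * expR (- bump_arg x)).
  by rewrite /bump x01 /bump_deriv !hornerE/=; congr (_ * _); ring.
have zE : x * (1 - x) = (bump_arg x)^-1 by rewrite invrK.
have z0 : bump_arg x != 0 by rewrite invr_eq0.
rewrite zE; move: (bump_arg x) z0 (expR _) p^`().[x] p.[x] => z z0 E p' q.
by case: m {dm} => [|m]; rewrite /= ?expr0 ?exprS; field.
Unshelve. all: by end_near. Qed.

Lemma bump_causal p m : causal_curve (bump p m).
Proof.
split=> [x|t t0]; first exact: is_derive_continuous (bump_derive p m x).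
by rewrite bump_out// ltNge t0.
Qed.

Lemma bump_ge0 x : 0 <= bump 1 0 x.
Proof. by rewrite /bump; case: ifP => // _; rewrite hornerC expr0 !mul1r expR_ge0. Qed.

Definition bump_mass : R := prim (bump 1 0) 1.

Lemma prim_bump_derive (t : R) : is_derive t 1 (prim (bump 1 0)) (bump 1 0 t).
Proof. exact: prim_derive (bump_causal _ _). Qed.

Lemma prim_bump_mono (x y : R) : x <= y -> prim (bump 1 0) x <= prim (bump 1 0) y.
Proof.
move=> xy; rewrite -subr_ge0.
have := le_increment xy (fun t : R => is_derive_cst (0 : R) t 1) prim_bump_derive.
by rewrite subrr; apply=> s _; exact: bump_ge0.
Qed.

Lemma prim_bump_const (x : R) : 1 <= x -> prim (bump 1 0) x = bump_mass.
Proof.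
move=> x1; apply/eqP; rewrite eq_le (prim_bump_mono x1) andbT -subr_le0.
have := le_increment x1 prim_bump_derive (fun t : R => is_derive_cst (0 : R) t 1).
rewrite subrr; apply=> s /andP[s1 _]; rewrite bump_out//.
by rewrite (ltNge s) s1 andbF.
Qed.

Lemma prim_bump_ge0 (x : R) : 0 <= prim (bump 1 0) x.
Proof. by apply: prim_ge0 => s _; exact: bump_ge0. Qed.

(** If the mass were 0, the monotone primitive would vanish on the left of 1, so its derivative at
    1/2 would be 0, whereas it is a positive exponential. *)
Lemma bump_mass_gt0 : 0 < bump_mass.
Proof.
rewrite lt_neqAle prim_bump_ge0 andbT; apply/eqP => m0.
have h2 : 0 < (2^-1 : R) < 1 by apply/andP; split; lra.
have p0 (x : R) : x < 1 -> prim (bump 1 0) x = 0.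
  move=> x1; apply/eqP; rewrite eq_le prim_bump_ge0 andbT m0.
  by apply: prim_bump_mono; exact: ltW.
have d0 : is_derive (2^-1 : R) 1 (prim (bump 1 0)) 0.
  apply: (@near_eq_is_derive _ _ _ (cst 0)); near=> x.
  rewrite p0//; near: x; apply: lt_nbhsl.
  by have /andP[] := h2.
have [_ e1] := d0; have [_ e2] := prim_bump_derive 2^-1.
have : bump 1 0 2^-1 = 0 by rewrite -e2 e1.
rewrite /bump h2 hornerC expr0 !mul1r => /eqP.
by rewrite expR_eq0.
Unshelve. all: by end_near. Qed.

Definition smooth_step t : R := prim (bump 1 0) t / bump_mass.
Definition mollifier t : R := bump 1 0 t / bump_mass.

Lemma smooth_step_derive (t : R) : is_derive t 1 smooth_step (mollifier t).
Proof.
have := is_derive_mulr (prim_bump_derive t) (is_derive_cst (bump_mass^-1) t 1).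
by rewrite mulr0 add0r mulrC.
Qed.

Lemma smooth_step0 t : t <= 0 -> smooth_step t = 0.
Proof. by move=> t0; rewrite /smooth_step prim_causal ?mul0r//; exact: bump_causal. Qed.

Lemma smooth_step1 t : 1 <= t -> smooth_step t = 1.
Proof. by move=> t1; rewrite /smooth_step prim_bump_const// divff// gt_eqF// bump_mass_gt0. Qed.

Lemma smooth_step_bound t : 0 <= smooth_step t <= 1.
Proof.
rewrite /smooth_step divr_ge0 ?prim_bump_ge0 ?(ltW bump_mass_gt0)//= ler_pdivrMr ?bump_mass_gt0// mul1r.
have [t1|t1] := leP 1 t; first by rewrite prim_bump_const.
by apply: prim_bump_mono; exact: ltW.
Qed.

Lemma mollifier_ge0 t : 0 <= mollifier t.
Proof. by rewrite divr_ge0 ?bump_ge0 ?(ltW bump_mass_gt0). Qed.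

Lemma mollifier_causal : causal_curve mollifier.
Proof.
have := causal_curveZ bump_mass^-1 (bump_causal 1 0).
by rewrite (_ : (fun s => _) = mollifier)//; apply/funext => s; rewrite /mollifier mulrC.
Qed.

Lemma mollifier_out t : 1 <= t -> mollifier t = 0.
Proof. by move=> t1; rewrite /mollifier bump_out ?mul0r// (ltNge t) t1 andbF. Qed.

(** Lets an average over the near future of s be written as a convolution with a causal kernel
    evaluated at s + 1/n, see [mollified_error]. *)
Lemma mollifier_sym t : mollifier (1 - t) = mollifier t.
Proof.
rewrite /mollifier /bump /bump_arg subr_gt0 ltrBlDr ltrDl andbC !hornerC.
by rewrite (_ : (1 - t) * (1 - (1 - t)) = t * (1 - t))//; ring.
Qed.

Lemma is_derive_affine (g : R -> R) (dg n s r : R) : is_derive (n * (r - s)) 1 g dg ->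
  is_derive r 1 (fun r => g (n * (r - s))) (dg * n).
Proof.
move=> gD.
have d1 : is_derive r 1 (fun r : R => n * (r - s)) n.
  have d0 : is_derive r 1 (fun r : R => r - s) (1 - 0) by apply: is_deriveB.
  have := is_deriveZ n d0; rewrite subr0 /GRing.scale/= mulr1.
  by [].
exact: (is_derive1_comp (g := fun r : R => n * (r - s)) gD d1).
Qed.

(** Combinations of two rescaled bumps, with arbitrary polynomials and exponents, are stable under
    differentiation; the derivative of [step_window] is of this form, which makes that function
    smooth. *)
Lemma derive1n_bump (n s t a b : R) p m p' m' (j : nat) :
  exists a' b' q l q' l', derive1n j (fun r => a * bump p m (n * (r - s)) + b * bump p' m' (n * (r - t)))
    = fun r => a' * bump q l (n * (r - s)) + b' * bump q' l' (n * (r - t)).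
Proof.
elim: j => [|j [a' [b' [q [l [q' [l' IH]]]]]]]; first by exists a, b, p, m, p', m'.
exists (a' * n), (b' * n), (bump_deriv q l), l.+2, (bump_deriv q' l'), l'.+2.
rewrite /= IH; apply/funext => r; rewrite derive1E.
have d1 := is_derive_affine (bump_derive q l (n * (r - s))).
have d2 := is_derive_affine (bump_derive q' l' (n * (r - t))).
have [_ ->] := is_deriveD (is_deriveZ a' d1) (is_deriveZ b' d2).
by rewrite /GRing.scale/=; ring.
Qed.

(** A smooth substitute for the indicator of ]s, t], to which it converges as n grows. Its
    derivative is a mollifier just after s minus one just after t, so using it as test function
    compares averages of the curve near s and near t. *)
Definition step_window (n s t r : R) : R := smooth_step (n * (r - s)) - smooth_step (n * (r - t)).

Lemma step_window_derive (n s t r : R) : is_derive r 1 (step_window n s t)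
  (n * mollifier (n * (r - s)) - n * mollifier (n * (r - t))).
Proof.
have d1 := is_derive_affine (smooth_step_derive (n * (r - s))).
have d2 := is_derive_affine (smooth_step_derive (n * (r - t))).
by have := is_deriveB d1 d2; rewrite !(mulrC n (mollifier _)).
Qed.

Lemma step_window_test (n s t : R) : 0 < n -> test_function (step_window n s t).
Proof.
move=> n0; split.
  case=> [|j] r /=; first by have [] := step_window_derive n s t r.
  rewrite -[derive1 _]/(derive1n j.+1 (step_window n s t)) derive1Sn.
  have -> : derive1 (step_window n s t) = fun r => (n / bump_mass) * bump 1 0 (n * (r - s)) +
      (- (n / bump_mass)) * bump 1 0 (n * (r - t)).
    apply/funext => x; rewrite derive1E; have [_ ->] := step_window_derive n s t x.
    by rewrite /mollifier; ring.
  have [a [b [q [l [q' [l' ->]]]]]] := derive1n_bump n s t (n / bump_mass) (- (n / bump_mass)) 1 0 1 0 j.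
  have d1 := is_derive_affine (bump_derive q l (n * (r - s))).
  have d2 := is_derive_affine (bump_derive q' l' (n * (r - t))).
  by have [] := is_deriveD (is_deriveZ a d1) (is_deriveZ b d2).
have aux1 (A v x y : R) : A + v < y -> x <= A -> v <= y - x by lra.
have aux2 (A v x y : R) : 0 < v -> A + v < - y -> - x <= A -> y - x <= 0 by lra.
exists (`|s| + `|t| + n^-1) => r rM; rewrite /step_window.
have ni0 : 0 < n^-1 by rewrite invr_gt0.
have [r0|r0] := leP 0 r.
  rewrite (ger0_norm r0) in rM.
  have h (x : R) : x <= `|s| + `|t| -> 1 <= n * (r - x).
    by move=> hx; rewrite -ler_pdivrMl// mulr1; exact: aux1 rM hx.
  rewrite !smooth_step1 ?subrr//; apply: h.
    by apply: (le_trans (ler_norm t)); rewrite lerDr.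
  by apply: (le_trans (ler_norm s)); rewrite lerDl.
rewrite (ltr0_norm r0) in rM.
have h (x : R) : - x <= `|s| + `|t| -> n * (r - x) <= 0.
  by move=> hx; rewrite pmulr_rle0//; exact: aux2 ni0 rM hx.
rewrite !smooth_step0 ?subrr//; apply: h.
  by apply: (le_trans (ler_norm _)); rewrite normrN lerDr.
by apply: (le_trans (ler_norm _)); rewrite normrN lerDl.
Qed.

End bump_function.

(** * The increments of a weakly differentiable curve *)

Lemma dot_cvg {R : realType} {k : nat} (g : nat -> 'cV[R]_k) (h : 'cV[R]_k) :
  (forall i, g n i 0 @[n --> \oo] --> h i 0) -> dot (g n) (g n) @[n --> \oo] --> dot h h.
Proof.
move=> gh; rewrite /dot; elim: (index_enum _) => [|i s IH].
  by under eq_fun do rewrite big_nil; rewrite big_nil; exact: cvg_cst.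
under eq_fun do rewrite big_cons; rewrite big_cons.
by apply: cvgD IH; apply: cvgM; exact: gh.
Qed.

Section limn_einf.
Context {R : realType}.

Lemma limn_einf_ge0 (a : nat -> \bar R) : (forall n, (0 <= a n)%E) -> (0 <= limn_einf a)%E.
Proof.
move=> a0; rewrite limn_einf_lim; apply: lime_ge; first exact: is_cvg_einfs.
by near=> n; apply: le_ereal_inf_tmp => _ [m nm <-].
Unshelve. all: by end_near. Qed.

Lemma measurable_limn_einf {d} {S : measurableType d} (a : nat -> S -> \bar R) :
  (forall n, measurable_fun setT (a n)) -> measurable_fun setT (fun x => limn_einf (a ^~ x)).
Proof.
move=> ma; rewrite (_ : (fun x => _) = fun x => - limn_esup (fun n => - a n x))%E.
  apply: measurableT_comp => //; apply: measurable_fun_limn_esup => n.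
  exact: measurableT_comp.
apply/funext => x; rewrite -limn_einfN; congr limn_einf; apply/funext => n /=.
by rewrite oppeK.
Qed.

End limn_einf.

Section fatou_square.
Context {d} {T : measurableType d} {R : realType} (nu : {measure set T -> \bar R}) {k : nat}.

Lemma sqint_fatou (g : nat -> T -> 'cV[R]_k) (h : T -> 'cV[R]_k) :
  (forall n, measurable_fun setT (g n)) -> measurable_fun setT h ->
  {ae nu, forall x, forall i, g n x i 0 @[n --> \oo] --> h x i 0} ->
  (sqint nu h <= limn_einf (fun n => sqint nu (g n)))%E.
Proof.
move=> mg mh gh.
have mg2 n : measurable_fun setT (fun x => (dot (g n x) (g n x))%:E) by exact: measurable_sq.
apply: le_trans (@fatou _ _ _ nu setT measurableT _ mg2 _); last first.
  by move=> n x _; rewrite lee_fin dot_ge0.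
apply: ae_ge0_le_integral => //.
- by move=> x _; rewrite lee_fin dot_ge0.
- exact: measurable_sq.
- by move=> x _; apply: limn_einf_ge0 => n; rewrite lee_fin dot_ge0.
- exact: measurable_limn_einf.
- apply: filterS gh => x gx _.
  have : (dot (g n x) (g n x))%:E @[n --> \oo] --> (dot (h x) (h x))%:E.
    by apply: cvg_EFin; [near=> n|exact: dot_cvg].
  by move=> /cvg_limn_einf_sup[-> _].
Unshelve. all: by end_near. Qed.

End fatou_square.

(** * Rescaled mollifiers of unit mass *)

Section mollified_curve.
Context {R : realType}.
Notation leb := (@lebesgue_measure R).

Definition mollifier_at (n t : R) : R := n * mollifier (n * t).

Lemma mollifier_at_ge0 n t : 0 <= n -> 0 <= mollifier_at n t.
Proof. by move=> n0; rewrite mulr_ge0 ?mollifier_ge0. Qed.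

Lemma mollifier_at_causal n : 0 < n -> causal_curve (mollifier_at n).
Proof.
move=> n0; apply: (causal_curveZ n); split=> [t|t t0]; last first.
  by rewrite mollifier_causal.2// pmulr_rle0.
apply: (@continuous_comp _ _ _ (fun t : R => n * t) mollifier); last exact: mollifier_causal.1.
by apply: cvgM; [exact: cvg_cst|exact: cvg_id].
Qed.

Lemma mollifier_at_out n t : 0 < n -> n^-1 <= t -> mollifier_at n t = 0.
Proof. by move=> n0 nt; rewrite /mollifier_at mollifier_out ?mulr0// -ler_pdivrMl// mulr1. Qed.

Lemma prim_mollifier_at n t : 0 < n -> prim (mollifier_at n) t = smooth_step (n * t).
Proof.
move=> n0; have gc := mollifier_at_causal n0.
have d1 (s : R) : is_derive s 1 (prim (mollifier_at n)) (mollifier_at n s) by exact: prim_derive.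
have d2 (s : R) : is_derive s 1 (fun s => smooth_step (n * s)) (mollifier_at n s).
  have := is_derive_affine (smooth_step_derive (n * (s - 0))).
  by rewrite /mollifier_at mulrC; under eq_fun do rewrite subr0; rewrite subr0.
have [t0|/ltW t0] := leP t 0.
  by rewrite prim_causal// smooth_step0// pmulr_rle0.
have e0 : prim (mollifier_at n) 0 = smooth_step (n * 0) by rewrite prim_causal// smooth_step0// mulr0.
apply/eqP; rewrite eq_le; apply/andP; split.
  have := le_increment t0 d1 d2; rewrite e0 lerD2r; exact.
by have := le_increment t0 d2 d1; rewrite e0 lerD2r; exact.
Qed.

Lemma mollifier_at_mass n : 0 < n -> (\int[leb]_t (mollifier_at n t)%:E = 1)%E.
Proof.
move=> n0; have i := causal_integrable n^-1 (mollifier_at_causal n0).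
have := prim_mollifier_at n^-1 n0; rewrite divff ?gt_eqF// smooth_step1// => e.
have -> : (1 = (prim (mollifier_at n) n^-1)%:E)%E by rewrite e.
rewrite /prim /Rintegral fineK; last exact: integrable_fin_num.
rewrite [RHS]integral_mkcond; apply: eq_integral => t _.
rewrite patchE mem_setE in_itv/=; case: leP => // nt.
by rewrite mollifier_at_out// ltW.
Qed.

End mollified_curve.

Section step_window_limit.
Context {R : realType}.
Notation leb := (@lebesgue_measure R).

Lemma step_window_bound (n s t r : R) : `|step_window n s t r| <= 1.
Proof.
have /andP[a0 a1] := smooth_step_bound (n * (r - s)).
have /andP[b0 b1] := smooth_step_bound (n * (r - t)).
rewrite /step_window ler_norml; move: (smooth_step _) (smooth_step _) a0 a1 b0 b1 => a b.
by move=> a0 a1 b0 b1; apply/andP; split; lra.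
Qed.

Lemma step_window_out (n s t r : R) : 1 <= n -> s <= t -> ~~ (s < r <= t + 1) ->
  step_window n s t r = 0.
Proof.
move=> n1 st; have n0 : 0 < n by exact: lt_le_trans n1.
rewrite negb_and -leNgt -ltNge /step_window => /orP[rs|rt].
  by rewrite !smooth_step0 ?subrr// pmulr_rle0// subr_le0// (le_trans rs).
have h x : x <= t -> 1 <= n * (r - x).
  move=> xt; rewrite -[leLHS]mulr1; apply: ler_pM => //.
  by rewrite lerBrDr addrC (le_trans _ (ltW rt))// lerD2r.
by rewrite !smooth_step1 ?subrr ?h.
Qed.

Lemma step_window_cvg (s t r : R) : s < t ->
  step_window n.+1%:R s t r @[n --> \oo] --> (\1_`]s, t] r : R).
Proof.
move=> st; apply: cvg_near_cst.
have big x : x < r -> \forall n \near \oo, 1 <= n.+1%:R * (r - x).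
  move=> xr; near=> n; rewrite -ler_pdivrMr ?subr_gt0// mul1r.
  apply: (@le_trans _ _ n%:R); last by rewrite ler_nat.
  by near: n; exact: nbhs_infty_ger.
have small x n : r <= x -> n.+1%:R * (r - x) <= 0.
  by move=> rx; rewrite pmulr_rle0// subr_le0.
rewrite indicE mem_setE in_itv/= /step_window.
have [rs|sr] := leP r s.
  by near=> n; rewrite !smooth_step0 ?subrr ?small// (le_trans rs)// ltW.
have [rt|tr] := leP r t.
  near=> n; rewrite (smooth_step0 (small _ _ rt)) subr0 smooth_step1//.
  by near: n; exact: big.
near=> n; rewrite !smooth_step1 ?subrr//; near: n; exact: big.
Unshelve. all: by end_near. Qed.

Lemma step_window_continuous (n s t : R) : continuous (step_window n s t).
Proof. by move=> r; exact: is_derive_continuous (step_window_derive n s t r). Qed.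

Lemma step_window_integral (g : R -> R) (s t : R) : s < t ->
  leb.-integrable setT (EFin \o g) ->
  \int[leb]_r (step_window n.+1%:R s t r * g r) @[n --> \oo] -->
    \int[leb]_r ((\1_`]s, t] r : R) * g r).
Proof.
move=> st gi.
have mg : measurable_fun setT g by apply/measurable_EFinP; exact: measurable_int gi.
have [] := @dominated_convergence _ _ _ leb setT measurableT
  (fun n r => (step_window n.+1%:R s t r * g r)%:E) (fun r => ((\1_`]s, t] r : R) * g r)%:E)
  (fun r => `|(g r)%:E|%E).
- move=> n; apply/measurable_EFinP; apply: measurable_funM => //.
  by apply: continuous_measurable_fun; exact: step_window_continuous.
- by apply/measurable_EFinP; apply: measurable_funM.
- apply: aeW => r _; apply: cvg_EFin; first exact: nearW.
  by apply: cvgM; [exact: step_window_cvg|exact: cvg_cst].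
- exact: (integrable_abse gi).
- apply: aeW => r n _; rewrite /= lee_fin normrM ler_piMl//; exact: step_window_bound.
move=> i1 _ h; rewrite /Rintegral; apply: fine_cvg.
by rewrite fineK//; exact: integrable_fin_num.
Qed.

End step_window_limit.

(** * Averages of a curve after a given time *)

Section curve_increments.
Context {d} {T : measurableType d} {R : realType}
  (nu : {sigma_finite_measure set T -> \bar R}) (k : nat).
Notation leb := (@lebesgue_measure R).
Notation H := (L2space nu k).
Context (w w' : R -> T -> 'cV[R]_k) (F : R -> H).
Hypothesis (wF : represents w F) (Fc : causal_curve F).

Lemma L2class_norm_diff s t : sqint nu (fun x => w t x - w s x) = (`|F t - F s| ^+ 2)%:E.
Proof.
have [mw hw we] := wF.
by rewrite -L2class_norm2 ?L2classB ?we//; exact: isL2B.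
Qed.

(** Viewed as a scalar matrix kernel of mass 1, the mollifier falls under the convolution estimates
    already proved. *)
Lemma mollifier_dominated n : 0 < n ->
  dominated_kernel (fun (t : R) (_ : T) => (mollifier_at n t)%:M : 'M[R]_k) (mollifier_at n) 1.
Proof.
move=> n0; have n0' := ltW n0; have mm : measurable_fun setT (mollifier_at n).
  by apply: continuous_measurable_fun; exact: (mollifier_at_causal n0).1.
split=> //.
- apply/(measurable_mxP _ measurableT) => i j; under eq_fun do rewrite !mxE.
  under eq_fun do rewrite -mulr_natr.
  apply: measurable_funM; last exact: measurable_cst.
  exact: (measurableT_comp mm measurable_fst).
- by move=> t; exact: mollifier_at_ge0.
- by move=> t /ltW t0; rewrite (mollifier_at_causal n0).2.
- move=> t _ i j; rewrite mxE; case: eqP => _; rewrite ?mulr1n ?mulr0n ?normr0 ?mollifier_at_ge0//.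
  by rewrite ger0_norm ?mollifier_at_ge0.
- by rewrite mollifier_at_mass.
Qed.

Lemma mollifier_shift_integrable n s : 0 < n ->
  leb.-integrable setT (fun r => (mollifier_at n (r - s))%:E) /\
  \int[leb]_r mollifier_at n (r - s) = 1.
Proof.
move=> n0; have n0' := ltW n0.
have mm : measurable_fun setT (fun t => (mollifier_at n t)%:E).
  apply/measurable_EFinP; apply: continuous_measurable_fun.
  exact: (mollifier_at_causal n0).1.
have e := integral_shift s mm; rewrite mollifier_at_mass// in e.
split; last by rewrite /Rintegral e.
apply/integrableP; split.
  by apply: (measurableT_comp mm); apply: measurable_funB.
under eq_integral do rewrite gee0_abs ?lee_fin ?mollifier_at_ge0//.
by rewrite e ltry.
Qed.

Definition mollified n s x := vint (fun r => mollifier_at n (r - s) *: w r x).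

Lemma measurable_mollified (n s : R) : 0 < n -> measurable_fun setT (mollified n s).
Proof.
move=> n0; have [mw _ _] := wF.
apply: measurable_vint; apply/measurable_vecP => j; under eq_fun do rewrite mxE.
apply: measurable_funM; last by move/measurable_vecP: mw; exact.
apply: (measurableT_comp (f := mollifier_at n)) => //.
  by apply: continuous_measurable_fun; exact: (mollifier_at_causal n0).1.
by apply: measurable_funB => //; exact: measurable_fst.
Qed.

(** By unit mass the error is the average of w r - w s over [s, s + 1/n]. By symmetry of the
    mollifier it is also the convolution, at time s + 1/n, of this difference cut off to the
    interval, so [conv_bound] applies with the oscillation m of F. *)
Lemma mollified_error n s m : 0 < n -> 0 <= m ->
  (forall r, s <= r <= s + n^-1 -> `|F r - F s| <= m) ->
  {ae nu, forall x, forall i, leb.-integrable setT (fun r => ((mollifier_at n (r - s) *: w r x) i 0)%:E)} /\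
  (sqint nu (fun x => mollified n s x - w s x)%R <= ((k%:R * 1 * m) ^+ 2)%:E)%E.
Proof.
move=> n0 m0 Fm; have [mw hw we] := wF; have qk := mollifier_dominated n0.
have n0' := ltW n0; have ni : n * n^-1 = 1 by rewrite divff// gt_eqF.
pose I := `[s, s + n^-1]%classic `*` [set: T].
pose w1 r x := extend0 I (fun z => w z.1 z.2 - w s z.2) (r, x) : 'cV[R]_k.
have mw1 : jointly_measurable w1.
  rewrite /jointly_measurable (_ : (fun z => _) = extend0 I (fun z : R * T => w z.1 z.2 - w s z.2)); last first.
    by apply/funext => -[].
  apply: measurable_extend0; first exact: measurableX.
  apply: measurable_funTS; apply/(measurable_vecP) => i; under eq_fun do rewrite !mxE.
  apply: measurable_funB; first by move/measurable_vecP: mw; exact.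
  by move: (hw s) => [/measurable_vecP h _]; exact: (measurableT_comp (h i) measurable_snd).
have w1in r x : s <= r <= s + n^-1 -> w1 r x = w r x - w s x.
  by move=> rI; rewrite /w1 extend0E//; split=> //=; rewrite in_itv.
have w1out r x : ~~ (s <= r <= s + n^-1) -> w1 r x = 0.
  by move=> rI; rewrite /w1 /extend0 memNset// => -[/=]; rewrite in_itv/= (negbTE rI).
have b : bounded_until nu w1 (s + n^-1) m.
  move=> r _; have [rI|rI] := boolP (s <= r <= s + n^-1).
    rewrite (_ : w1 r = fun x => w r x - w s x); last by apply/funext => x; exact: w1in.
    by rewrite L2class_norm_diff lee_fin ler_sqr ?nnegrE// Fm.
  rewrite (_ : w1 r = cst 0); last by apply/funext => x; exact: w1out.
  by rewrite sqint0 lee_fin sqr_ge0.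
have E r x : (mollifier_at n (s + n^-1 - r))%:M *m w1 r x = mollifier_at n (r - s) *: (w r x - w s x).
  have -> : mollifier_at n (s + n^-1 - r) = mollifier_at n (r - s).
    rewrite /mollifier_at -mollifier_sym; congr (_ * mollifier _).
    by rewrite !mulrBr mulrDr ni; ring.
  rewrite mul_scalar_mx; have [rI|rI] := boolP (s <= r <= s + n^-1); first by rewrite w1in.
  suff -> : mollifier_at n (r - s) = 0 by rewrite !scale0r.
  move: rI; rewrite negb_and -!ltNge => /orP[rs|rs].
    by rewrite (mollifier_at_causal n0).2// subr_le0 ltW.
  by rewrite mollifier_at_out// lerBrDl ltW.
have [ki k1] := mollifier_shift_integrable s n0.
have iw1 := conv_integrable qk mw1 b.
have key x i : leb.-integrable setT (fun r => ((mollifier_at n (r - s) *: (w r x - w s x)) i 0)%:E) ->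
    leb.-integrable setT (fun r => ((mollifier_at n (r - s) *: w r x) i 0)%:E) /\
    (mollified n s x - w s x) i 0 = \int[leb]_r (mollifier_at n (r - s) *: (w r x - w s x)) i 0.
  move=> h1; have h2 : leb.-integrable setT (fun r => (w s x i 0 * mollifier_at n (r - s))%:E).
    exact: (@integrableZl _ _ _ leb _ measurableT _ _ ki).
  have eqw r : (mollifier_at n (r - s) *: w r x) i 0 =
      (mollifier_at n (r - s) *: (w r x - w s x)) i 0 + w s x i 0 * mollifier_at n (r - s).
    by rewrite !mxE; ring.
  split.
    rewrite (_ : (fun r => _) = (fun r => ((mollifier_at n (r - s) *: (w r x - w s x)) i 0)%:E +
        (w s x i 0 * mollifier_at n (r - s))%:E)%E); first exact: integrableD.
    by apply/funext => r; rewrite eqw EFinD.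
  rewrite !mxE; under eq_Rintegral do rewrite eqw.
  by rewrite RintegralD// RintegralZl// k1 mulr1 addrK.
split.
  by apply: filterS iw1 => x h i; apply: (key x i _).1; have := h i; under eq_fun do rewrite E.
apply: le_trans (conv_bound qk mw1 b).2.
rewrite le_eqVlt; apply/orP; left; apply/eqP; apply: sqint_ae.
- apply/measurable_vecP => i; under eq_fun do rewrite !mxE; apply: measurable_funB.
    have := measurable_mollified s n0.
    move=> /measurable_vecP /(_ i); rewrite /mollified /vint.
    by under eq_fun do rewrite mxE.
  by move: (hw s) => [/measurable_vecP h _]; exact: h.
- exact: (measurable_conv qk _ mw1).
apply: filterS iw1 => x h _; apply/matrixP => i j; rewrite ord1 (key x i _).2; last first.
  by have := h i; under eq_fun do rewrite E.
by rewrite [RHS]mxE; apply: eq_Rintegral => r _; rewrite E.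
Qed.

Hypothesis mw' : jointly_measurable w'.

Definition window (a b : R) r x : 'cV[R]_k := (\1_`]a, b] r : R) *: w' r x.

Lemma measurable_window a b : jointly_measurable (window a b).
Proof.
apply/measurable_vecP => i; under eq_fun do rewrite mxE.
apply: measurable_funM; last by move/measurable_vecP: mw'; exact.
have mi : measurable_fun setT (\1_`]a, b] : R -> R) by exact: measurable_indic.
exact: (measurableT_comp mi measurable_fst).
Qed.

Lemma window_sq a b r x : (dot (window a b r x) (window a b r x))%:E =
  ((fun r => (dot (w' r x) (w' r x))%:E) \_ `]a, b]) r.
Proof.
rewrite patchE /window indicE; case: ifP => _; first by rewrite scale1r.
by rewrite scale0r dot0l.
Qed.

Lemma sqint_window a b r : sqint nu (window a b r) = ((fun r => sqint nu (w' r)) \_ `]a, b]) r.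
Proof.
rewrite patchE; case: ifP => rI.
  by apply: eq_integral => x _; rewrite window_sq patchE rI.
by rewrite -[RHS](integral0 nu setT); apply: eq_integral => x _; rewrite window_sq patchE rI.
Qed.

(** Tonelli gives square integrability in time for almost every x; on a bounded interval
    integrability follows from |y| <= 1 + y^2. *)
Lemma window_integrable a b : (\int[leb]_(r in `]a, b]) sqint nu (w' r) < +oo)%E ->
  {ae nu, forall x, (\int[leb]_r (dot (window a b r x) (window a b r x))%:E < +oo)%E /\
    forall i, leb.-integrable setT (fun r => (window a b r x i 0)%:E)}.
Proof.
move=> fin; have mG := measurable_sq (measurable_window a b).
have G0 z : (0 <= (dot (window a b z.1 z.2) (window a b z.1 z.2))%:E)%E by rewrite lee_fin dot_ge0.
have := fubini_tonelli (m1 := leb) (m2 := nu) _ mG G0.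
have -> : (\int[leb]_r \int[nu]_x (dot (window a b (r, x).1 (r, x).2) (window a b (r, x).1 (r, x).2))%:E =
    \int[leb]_(r in `]a, b]) sqint nu (w' r))%E.
  by rewrite [RHS]integral_mkcond; apply: eq_integral => r _; rewrite -sqint_window.
move=> /= e; have mI := measurable_fun_fubini_tonelli_G (m1 := leb) _ mG G0.
have : nu.-integrable setT (fun x => \int[leb]_r (dot (window a b r x) (window a b r x))%:E)%E.
  have J0 x : (0 <= \int[leb]_r (dot (window a b r x) (window a b r x))%:E)%E.
    by apply: integral_ge0 => r _; rewrite lee_fin dot_ge0.
  apply/integrableP; split; first exact: mI.
  by under eq_integral do rewrite gee0_abs//; rewrite -e.
move=> /(integrable_ae measurableT); apply: filterS => x /(_ I) xf.
have xoo : (\int[leb]_r (dot (window a b r x) (window a b r x))%:E < +oo)%E.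
  by move: xf; rewrite ge0_fin_numE// integral_ge0// => r _; rewrite lee_fin dot_ge0.
split=> // i.
have msec : measurable_fun setT (fun r => window a b r x).
  exact: (measurableT_comp (measurable_window a b) (measurable_pair2 x)).
apply: (@le_integrable _ _ _ leb setT measurableT _
  (fun r => (\1_`]a, b] r : R)%:E + (dot (window a b r x) (window a b r x))%:E)%E).
- by apply/measurable_EFinP; move/measurable_vecP: msec; exact.
- move=> r _; rewrite -EFinD /= lee_fin [leRHS]ger0_norm; last by rewrite addr_ge0 ?dot_ge0.
  have := sqr_coord_le (window a b r x) i.
  rewrite /window; rewrite indicE; case: (_ \in _); last by rewrite scale0r !mxE normr0 dot0l addr0.
  rewrite scale1r => h; apply: le_trans (lerD (lexx 1) h).
  rewrite -(real_normK (num_real (w' r x i 0))).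
  move: `|_| (normr_ge0 (w' r x i 0)) => y y0; nra.
- apply: integrableD => //.
    exact: integrable_indic_itv.
  apply/integrableP; split; first exact: measurable_sq.
  by under eq_integral do rewrite gee0_abs ?lee_fin ?dot_ge0//.
Qed.

End curve_increments.

(** * The fundamental theorem of calculus for the weak time derivative *)

Section increment_formula.
Context {d} {T : measurableType d} {R : realType}
  (nu : {sigma_finite_measure set T -> \bar R}) (k : nat).
Notation leb := (@lebesgue_measure R).
Notation H := (L2space nu k).
Context (w w' : R -> T -> 'cV[R]_k) (F : R -> H).
Hypothesis (wF : represents w F) (Fc : causal_curve F).
Hypothesis mw' : jointly_measurable w'.
Hypothesis w'_loc : forall a b : R, (\int[leb]_(r in `]a, b]) sqint nu (w' r) < +oo)%E.
Hypothesis weak : forall phi, test_function phi ->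
  {ae nu, forall x, vint (fun t => derive1 phi t *: w t x) = - vint (fun t => phi t *: w' t x)}.

Lemma vint_eq (f g : R -> 'cV[R]_k) : f =1 g -> vint f = vint g.
Proof. by move=> fg; congr vint; exact/funext. Qed.

Lemma mollified_difference (n s t : R) : 0 < n -> s <= t ->
  {ae nu, forall x, mollified w n s x - mollified w n t x = - vint (fun r => step_window n s t r *: w' r x)}.
Proof.
move=> n0 st; have [M M0 MP] := causal_curve_bounded (t + n^-1) Fc.
have bnd (s' : R) : s' <= t -> forall r, s' <= r <= s' + n^-1 -> `|F r - F s'| <= M + M.
  move=> s't r /andP[_ rs]; apply: (le_trans (ler_normB _ _)); apply: lerD; apply: MP.
    by apply: (le_trans rs); rewrite lerD2r.
  by rewrite (le_trans s't)// lerDl invr_ge0 ltW.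
have M2 : 0 <= M + M by exact: addr_ge0.
have [i1 _] := mollified_error wF n0 M2 (bnd s st).
have [i2 _] := mollified_error wF n0 M2 (bnd t (lexx t)).
apply: filterS3 i1 i2 (weak (step_window_test s t n0)) => x i1 i2 <-.
apply/matrixP => i j; rewrite ord1 !mxE -RintegralB//; last 2 first.
- exact: i1.
- exact: i2.
apply: eq_Rintegral => r _; rewrite derive1E; have [_ ->] := step_window_derive n s t r.
by rewrite !mxE mulrBl.
Qed.

Lemma step_window_vint_cvg (s t : R) : s < t ->
  {ae nu, forall x, forall i, vint (fun r => step_window n.+1%:R s t r *: w' r x) i 0 @[n --> \oo] -->
    vint (fun r => (\1_`]s, t] r : R) *: w' r x) i 0}.
Proof.
move=> st; apply: filterS (window_integrable mw' (w'_loc s (t + 1))) => x [_ gi] i.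
have := step_window_integral st (gi i).
have e1 n : vint (fun r => step_window n.+1%:R s t r *: w' r x) i 0 =
    \int[leb]_r (step_window n.+1%:R s t r * window w' s (t + 1) r x i 0).
  rewrite mxE; apply: eq_Rintegral => r _; rewrite !mxE indicE mem_setE in_itv/=.
  have [rI|rI] := boolP (s < r <= t + 1); first by rewrite mul1r.
  by rewrite step_window_out// ?mul0r//; [rewrite ler1n|exact: ltW].
have -> : vint (fun r => (\1_`]s, t] r : R) *: w' r x) i 0 =
    \int[leb]_r ((\1_`]s, t] r : R) * window w' s (t + 1) r x i 0).
  rewrite mxE; apply: eq_Rintegral => r _; rewrite !mxE !indicE !mem_setE !in_itv/=.
  have [/andP[sr rt]|rI] := boolP (s < r <= t); last by rewrite !mul0r.
  by rewrite sr (le_trans rt) ?mul1r// lerDl.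
by under [X in _ -> X @ _ --> _]eq_fun do rewrite e1.
Qed.

(** The formula is known for mollified values. As n grows, the integral side converges almost
    everywhere by dominated convergence, but the mollified values converge only in L^2; Fatou's
    lemma reconciles the two modes. *)
Lemma increment_formula (s t : R) : s < t ->
  {ae nu, forall x, w t x - w s x = vint (fun r => (\1_`]s, t] r : R) *: w' r x)}.
Proof.
move=> st; have [mw hw _] := wF.
have aux (x y z v : 'cV[R]_k) : x - y - (z - v) = x - z - (y - v).
  by rewrite !opprB addrACA [RHS]addrACA (addrC (- y)).
pose e n : R := n.+1%:R; have e0 n : 0 < e n by [].
pose err (s : R) n x := mollified w (e n) s x - w s x.
have merr s' n : measurable_fun setT (err s' n).
  rewrite (_ : err s' n = fun x => -1 *: w s' x + mollified w (e n) s' x).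
    by apply: measurable_lincomb; [exact: (hw s').1|exact: measurable_mollified].
  by apply/funext => x; rewrite scaleN1r addrC.
have err_cvg (s' a : R) : 0 < a -> \forall n \near \oo, isL2 nu (err s' n) /\ (sqint nu (err s' n) <= a%:E)%E.
  move=> a0.
  have k1 : 0 < k%:R * 1 + 1 :> R by rewrite mulr1 ltr_wpDl.
  have m0 : 0 < Num.sqrt a / (k%:R * 1 + 1) by rewrite divr_gt0// sqrtr_gt0.
  have [dl dl0 dP] := causal_curve_uniform s' Fc m0.
  near=> n; suff h : (sqint nu (err s' n) <= a%:E)%E.
    by split=> //; split=> //; apply: le_lt_trans h _; rewrite ltry.
  have [|_ h] := mollified_error wF (e0 n) (ltW m0) (s := s') _.
    move=> r /andP[r1 r2]; apply: dP => //; rewrite ger0_norm ?subr_ge0// lerBlDl.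
    apply: (le_trans r2); rewrite lerD2l; near: n.
    have [N NP] : exists N : nat, dl^-1 <= N%:R.
      by exists (Num.truncn dl^-1).+1; apply: ltW; exact: truncnS_gt.
    exists N => // n /= Nn; rewrite /e -[leRHS]invrK lef_pV2 ?posrE ?invr_gt0//.
    by apply: (le_trans NP); rewrite ler_nat ltnW// ltnS.
  apply: le_trans h _; rewrite lee_fin -[leRHS](sqr_sqrtr (ltW a0)).
  have km0 : 0 <= k%:R * 1 * (Num.sqrt a / (k%:R * 1 + 1)).
    by rewrite mulr_ge0 ?mulr1// ltW// mulr1 in m0 *.
  have km1 : k%:R * 1 * (Num.sqrt a / (k%:R * 1 + 1)) <= Num.sqrt a.
    rewrite mulrA ler_pdivrMr// mulrC ler_wpM2l ?sqrtr_ge0//.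
    by rewrite lerDl.
  by rewrite ler_sqr ?nnegrE ?sqrtr_ge0.
(* g tends to 0 in L^2 by continuity of F, and almost everywhere to h, the defect of the claimed
   formula; by Fatou the norm of h is 0. *)
pose g n x := err s n x - err t n x.
pose h x := - vint (fun r => (\1_`]s, t] r : R) *: w' r x) - (w s x - w t x).
have mI : measurable_fun setT (fun x => vint (fun r => (\1_`]s, t] r : R) *: w' r x)).
  apply: measurable_vint; apply/measurable_vecP => i; under eq_fun do rewrite mxE.
  have mi : measurable_fun setT (\1_`]s, t] : R -> R) by exact: measurable_indic.
  apply: measurable_funM; last by move/measurable_vecP: mw'; exact.
  exact: (measurableT_comp mi measurable_fst).
have mh : measurable_fun setT h.
  rewrite (_ : h = fun x => -1 *: (-1 *: w t x + w s x) +
      (-1 *: vint (fun r => (\1_`]s, t] r : R) *: w' r x) + 0)).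
    apply: measurable_lincomb; first by apply: measurable_lincomb; [exact: (hw t).1|exact: (hw s).1].
    by apply: measurable_lincomb => //; exact: measurable_cst.
  by apply/funext => x; rewrite /h !scaleN1r addr0 addrC (addrC (w s x)).
have mg n : measurable_fun setT (g n).
  rewrite (_ : g n = fun x => -1 *: err t n x + err s n x); first exact: measurable_lincomb.
  by apply/funext => x; rewrite scaleN1r addrC.
have gh : {ae nu, forall x, forall i, g n x i 0 @[n --> \oo] --> h x i 0}.
  have /ae_foralln a1 n := mollified_difference (e0 n) (ltW st).
  apply: filterS2 a1 (step_window_vint_cvg st) => x a1 a2 i.
  have gE n : g n x i 0 = - vint (fun r => step_window (e n) s t r *: w' r x) i 0 - (w s x - w t x) i 0.
    have -> : g n x = (mollified w (e n) s x - mollified w (e n) t x) - (w s x - w t x).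
      exact: aux.
    by rewrite a1 [LHS]mxE [in LHS]mxE [X in _ + X]mxE.
  under eq_fun do rewrite gE.
  have -> : h x i 0 = - vint (fun r => (\1_`]s, t] r : R) *: w' r x) i 0 - (w s x - w t x) i 0.
    by rewrite /h !mxE.
  by apply: cvgB; [apply: cvgN; exact: a2|exact: cvg_cst].
have h0 : sqint nu h = 0%E.
  apply/eqP; rewrite eq_le sqint_ge0 andbT; apply/lee_addgt0Pr => a a0; rewrite add0e.
  apply: le_trans (sqint_fatou mg mh gh) _.
  rewrite limn_einf_lim; apply: lime_le; first exact: is_cvg_einfs.
  have a4 : 0 < a / 4 by rewrite divr_gt0.
  near=> n.
  have [] : isL2 nu (err s n) /\ (sqint nu (err s n) <= (a / 4)%:E)%E by near: n; exact: err_cvg.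
  move=> l1 b1.
  have [] : isL2 nu (err t n) /\ (sqint nu (err t n) <= (a / 4)%:E)%E by near: n; exact: err_cvg.
  move=> l2 b2.
  apply: (@le_trans _ _ (sqint nu (g n))); first by apply: ereal_inf_lbound; exists n => //=.
  apply: (@le_trans _ _ (\int[nu]_x (2%:E * ((dot (err s n x) (err s n x))%:E + (dot (err t n x) (err t n x))%:E)))%E).
    apply: ge0_le_integral => //.
    - by move=> x _; rewrite lee_fin dot_ge0.
    - exact: measurable_sq.
    - by apply: measurable_funeM; apply: emeasurable_funD; exact: measurable_sq.
    - move=> x _; rewrite -EFinD -EFinM lee_fin.
      by have := dotD_le (err s n x) (- err t n x); rewrite (dotNl (err t n x)) dotNr opprK.
  rewrite ge0_integralZl_EFin//; last 2 first.
  - by move=> x _; rewrite adde_ge0// lee_fin dot_ge0.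
  - by apply: emeasurable_funD; exact: measurable_sq.
  rewrite ge0_integralD//; try exact: measurable_sq; try by move=> x _; rewrite lee_fin dot_ge0.
  apply: (@le_trans _ _ (2%:E * ((a / 4)%:E + (a / 4)%:E))%E).
    by rewrite lee_wpmul2l// leeD.
  by rewrite -EFinD -EFinM lee_fin le_eqVlt; apply/orP; left; apply/eqP; field.
have := sqint_eq0 mh h0; apply: filterS => x /(_ I)/eqP; rewrite /h subr_eq0 => /eqP hx.
by rewrite -[RHS]opprK hx opprB.
Unshelve. all: by end_near. Qed.

End increment_formula.

(** * Averages and difference quotients *)

Section box_average.
Context {R : realType}.
Notation leb := (@lebesgue_measure R).

(** As a function of s - r it averages over ]s - e, s], the interval of a backward difference
    quotient. *)
Definition box (e t : R) : R := e^-1 * \1_`[0, e[ t.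

Lemma box_ge0 e t : 0 < e -> 0 <= box e t.
Proof. by move=> e0; rewrite mulr_ge0// invr_ge0 ltW. Qed.

Lemma measurable_box e : measurable_fun setT (box e).
Proof. by apply: measurable_funM => //; exact: measurable_indic. Qed.

Lemma box_le e t : 0 < e -> box e t <= e^-1.
Proof.
by move=> e0; rewrite /box -[leRHS]mulr1 ler_wpM2l ?invr_ge0 ?(ltW e0).
Qed.

Lemma box_itv e s r : box e (s - r) = e^-1 * \1_`]s - e, s] r.
Proof.
rewrite /box !indicE !mem_setE !in_itv/=; congr (_ * (nat_of_bool _)%:R).
by rewrite subr_ge0 ltrBlDl -ltrBlDr andbC.
Qed.

Lemma box_mass e : 0 < e -> (\int[leb]_t (box e t)%:E = 1)%E.
Proof.
move=> e0; rewrite /box; under eq_integral do rewrite EFinM.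
rewrite ge0_integralZl_EFin ?invr_ge0 ?(ltW e0)//; last first.
  by apply/measurable_EFinP; exact: measurable_indic.
rewrite integral_indic// setIT [X in (_ * X)%E](_ : _ = e%:E).
  by rewrite -EFinM mulVf// gt_eqF.
by rewrite [LHS]lebesgue_measure_itv/= lte_fin e0 oppr0 adde0.
Qed.

Lemma box_mass_reflect e s : 0 < e -> (\int[leb]_r (box e (s - r))%:E = 1)%E.
Proof.
move=> e0; rewrite -[RHS](box_mass e0) -[RHS](integral_reflect s)//.
by apply/measurable_EFinP; exact: measurable_box.
Qed.

Lemma box_mass_shift e r : 0 < e -> (\int[leb]_s (box e (s - r))%:E = 1)%E.
Proof.
move=> e0; rewrite -[RHS](box_mass e0) -[RHS](integral_shift r)//.
by apply/measurable_EFinP; exact: measurable_box.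
Qed.

Lemma measurable_box_reflect e (s : R) : measurable_fun setT (fun r : R => box e (s - r)).
Proof. by apply: (measurableT_comp (measurable_box e)); apply: measurable_funB. Qed.

Lemma box_product_integrable e s (g : R -> R) : 0 < e -> leb.-integrable setT (EFin \o g) ->
  leb.-integrable setT (fun r => (box e (s - r) * g r)%:E).
Proof.
move=> e0 gi; apply: (@le_integrable _ _ _ leb setT measurableT _ (fun r => (e^-1 * g r)%:E)) => //.
- apply/measurable_EFinP; apply: measurable_funM; first exact: measurable_box_reflect.
  by apply/measurable_EFinP; exact: measurable_int gi.
- move=> r _; rewrite /= lee_fin normrM [leRHS]normrM ler_wpM2r// [leLHS]ger0_norm ?box_ge0//.
  by rewrite (le_trans (box_le _ e0))// ler_norm.
- have gi' : leb.-integrable setT (fun r => (g r)%:E) by exact: gi.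
  exact: (@integrableZl _ _ _ leb _ measurableT e^-1 _ gi').
Qed.

(** With a the average of g, expand the nonnegative integral of [box] times |g - a|^2 and use that
    [box] has mass 1. *)
Lemma box_jensen k e s (g : R -> 'cV[R]_k) : 0 < e -> measurable_fun setT g ->
  (forall i, leb.-integrable setT (fun r => (g r i 0)%:E)) ->
  (\int[leb]_r (dot (g r) (g r))%:E < +oo)%E ->
  ((dot (vint (fun r => box e (s - r) *: g r)) (vint (fun r => box e (s - r) *: g r)))%:E <=
   \int[leb]_r (box e (s - r) * dot (g r) (g r))%:E)%E.
Proof.
move=> e0 mg gi g2.
have [a aE] : exists a, a = vint (fun r => box e (s - r) *: g r) by exists (vint (fun r => box e (s - r) *: g r)).
have i1 i : leb.-integrable setT (fun r => ((box e (s - r) *: g r) i 0)%:E).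
  under eq_fun do rewrite mxE; exact: (box_product_integrable s e0 (gi i)).
have i2 : leb.-integrable setT (fun r => (dot (g r) (g r))%:E).
  apply/integrableP; split; first exact: measurable_sq.
  by under eq_integral do rewrite gee0_abs ?lee_fin ?dot_ge0//.
have i3 : leb.-integrable setT (fun r => (box e (s - r) * dot (g r) (g r))%:E).
  exact: (box_product_integrable s e0 i2).
have i4 : leb.-integrable setT (fun r => (box e (s - r))%:E).
  apply/integrableP; split; first by apply/measurable_EFinP; exact: measurable_box_reflect.
  by under eq_integral do rewrite gee0_abs ?lee_fin ?box_ge0//; rewrite box_mass_reflect// ltry.
have [i5 e5] := dot_vint a i1.
rewrite -aE -[leRHS]fineK; last exact: (integrable_fin_num measurableT i3).
rewrite lee_fin.
have i6 : leb.-integrable setT (fun r => (2 * dot a (box e (s - r) *: g r))%:E).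
  exact: (@integrableZl _ _ _ leb _ measurableT 2 _ i5).
have i7 : leb.-integrable setT (fun r => (- dot a a * box e (s - r))%:E).
  exact: (@integrableZl _ _ _ leb _ measurableT _ _ i4).
have i8 : leb.-integrable setT (fun r => (2 * dot a (box e (s - r) *: g r) + - dot a a * box e (s - r))%:E).
  by under eq_fun do rewrite EFinD; exact: integrableD.
have : \int[leb]_r (2 * dot a (box e (s - r) *: g r) + - dot a a * box e (s - r)) <=
    \int[leb]_r (box e (s - r) * dot (g r) (g r)).
  apply: le_Rintegral => // r _; rewrite -subr_ge0 dotZr.
  have -> : box e (s - r) * dot (g r) (g r) -
      (2 * (box e (s - r) * dot a (g r)) + - dot a a * box e (s - r)) =
      box e (s - r) * dot (g r - a) (g r - a).
    rewrite dotDl !dotDr !dotNl !dotNr (dotC (g r) a).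
    by move: (dot a a) (dot a (g r)) (dot (g r) (g r)) (box _ _) => x y z b; ring.
  by rewrite mulr_ge0 ?dot_ge0// box_ge0.
have E1 : \int[leb]_r (2 * dot a (box e (s - r) *: g r)) = 2 * dot a a.
  by rewrite RintegralZl// -e5 -aE.
have E2 : \int[leb]_r (- dot a a * box e (s - r)) = - dot a a.
  by rewrite RintegralZl// /Rintegral box_mass_reflect//= mulr1.
rewrite RintegralD// E1 E2.
by rewrite mulr_natl mulr2n addrK.
Qed.

(** At a Lebesgue point the primitive of g is differentiable with derivative g s, and the averages
    are its backward difference quotients. *)
Lemma box_average_cvg (g : R -> R) : leb.-integrable setT (EFin \o g) ->
  {ae leb, forall s, \int[leb]_r (box n.+1%:R^-1 (s - r) * g r) @[n --> \oo] --> g s}.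
Proof.
move=> gi.
have gl : locally_integrable setT g.
  split; first by apply/measurable_EFinP; exact: measurable_int gi.
    exact: openT.
  move=> K _ cK; have /integrableP[_ h] : leb.-integrable K (EFin \o g).
    by apply: integrableS gi => //; exact: compact_measurable.
  exact: h.
apply: filterS (lebesgue_differentiation gl) => s sl.
have su : s < s + 1 by rewrite ltrDl.
have gS (a b : itv_bound R) : leb.-integrable [set` Interval a b] (EFin \o g).
  exact: integrableS gi.
have [dF eF] := @FTC1_lebesgue_pt R g -oo%O s (s + 1) su (gS _ _) (ltNyr _) sl.
pose Phi y := \int[leb]_(r in `]-oo, y]) g r.
have : is_derive (s : R) 1 Phi (g s).
  by apply: DeriveDef; rewrite -?derive1E.
move=> /diff_quot_cvg; rewrite /diff_quot.
set a := (X in X @ _ --> _ -> _); set b := (X in _ -> X @ _ --> _).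
suff -> : a = b by [].
apply/funext => n; rewrite /a /b; set e : R := n.+1%:R^-1.
have e0 : 0 < e by rewrite invr_gt0.
rewrite Rintegral_itvB//; last first.
  by rewrite bnd_simp gerBl ltW.
under [in RHS]eq_Rintegral do rewrite box_itv -mulrA.
rewrite RintegralZl//; last first.
  apply: (@le_integrable _ _ _ leb setT measurableT _ (EFin \o g)) => //.
    apply/measurable_EFinP; apply: measurable_funM; first exact: measurable_indic.
    by apply/measurable_EFinP; exact: measurable_int gi.
  by move=> r _; rewrite /= lee_fin normrM indicE; case: (_ \in _); rewrite ?normr1 ?mul1r// normr0 mul0r.
rewrite /GRing.scale/=; congr (_ * _).
rewrite /Rintegral integral_mkcond; congr fine; apply: eq_integral => r _.
by rewrite patchE indicE; case: ifP => _; rewrite ?mul1r ?mul0r.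
Qed.

End box_average.

(** * Square integrals over time and space *)

Section iterated_square_integral.
Context {d} {T : measurableType d} {R : realType}
  (nu : {sigma_finite_measure set T -> \bar R}) {k : nat}.
Notation leb := (@lebesgue_measure R).
Implicit Types (g h u v : R -> T -> 'cV[R]_k).

Definition dsqint h : \bar R := (\int[leb]_s sqint nu (h s))%E.

Lemma dsqint_ge0 h : (0 <= dsqint h)%E.
Proof. by apply: integral_ge0 => s _; exact: sqint_ge0. Qed.

Let mz h : jointly_measurable h ->
  measurable_fun setT (fun z : R * T => (dot (h z.1 z.2) (h z.1 z.2))%:E).
Proof. exact: measurable_sq. Qed.

Let z0 h (z : R * T) : (0 <= (dot (h z.1 z.2) (h z.1 z.2))%:E)%E.
Proof. by rewrite lee_fin dot_ge0. Qed.

Lemma measurable_sqint h : jointly_measurable h -> measurable_fun setT (fun s => sqint nu (h s)).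
Proof. by move=> mh; exact: (measurable_fun_fubini_tonelli_F (m2 := nu) _ (mz mh) (z0 h)). Qed.

Lemma measurable_sqint_time h : jointly_measurable h ->
  measurable_fun setT (fun x => sqint leb (fun s => h s x)).
Proof. by move=> mh; exact: (measurable_fun_fubini_tonelli_G (m1 := leb) _ (mz mh) (z0 h)). Qed.

Lemma dsqint_swap h : jointly_measurable h -> dsqint h = (\int[nu]_x sqint leb (fun s => h s x))%E.
Proof. by move=> mh; exact: (fubini_tonelli (m1 := leb) (m2 := nu) _ (mz mh) (z0 h)). Qed.

Lemma measurable_time_section h x : jointly_measurable h -> measurable_fun setT (fun s : R => h s x).
Proof. by move=> mh; exact: (measurableT_comp mh (measurable_pair2 x)). Qed.

Lemma dsqint_fatou (g : nat -> R -> T -> 'cV[R]_k) h :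
  (forall n, jointly_measurable (g n)) -> jointly_measurable h ->
  {ae nu, forall x, {ae leb, forall s, forall i, g n s x i 0 @[n --> \oo] --> h s x i 0}} ->
  (dsqint h <= limn_einf (fun n => dsqint (g n)))%E.
Proof.
move=> mg mh gh; rewrite dsqint_swap//.
rewrite (_ : (fun n => dsqint (g n)) = fun n => (\int[nu]_x sqint leb (fun s => g n s x))%E); last first.
  by apply/funext => n; rewrite dsqint_swap.
apply: le_trans (@fatou _ _ _ nu setT measurableT (fun n x => sqint leb (fun s => g n s x)) _ _); last 2 first.
- by move=> n; exact: measurable_sqint_time.
- by move=> n x _; exact: sqint_ge0.
apply: ae_ge0_le_integral => //.
- by move=> x _; exact: sqint_ge0.
- exact: measurable_sqint_time.
- by move=> x _; apply: limn_einf_ge0 => n; exact: sqint_ge0.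
- by apply: measurable_limn_einf => n; exact: measurable_sqint_time.
apply: filterS gh => x gx _; apply: sqint_fatou gx.
- by move=> n; exact: measurable_time_section.
- exact: measurable_time_section.
Qed.

Lemma dsqint_parallelogram u v : jointly_measurable u -> jointly_measurable v ->
  (dsqint (fun s x => u s x - v s x)%R + dsqint (fun s x => u s x + v s x)%R =
   2%:E * dsqint u + 2%:E * dsqint v)%E.
Proof.
move=> mu mv.
have mp : jointly_measurable (fun s x => u s x + v s x).
  by have := measurable_lincomb 1 mu mv; under eq_fun do rewrite scale1r.
have mm : jointly_measurable (fun s x => u s x - v s x).
  by have := measurable_lincomb (-1) mv mu; under eq_fun do rewrite scaleN1r addrC.
have ms (s : R) (w : R -> T -> 'cV[R]_k) : jointly_measurable w -> measurable_fun setT (fun x => (dot (w s x) (w s x))%:E).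
  by move=> mw; apply: measurable_sq; exact: joint_measurable_section.
rewrite /dsqint -!ge0_integralZl_EFin//; try exact: measurable_sqint; try by move=> s _; exact: sqint_ge0.
rewrite -!ge0_integralD//; try exact: measurable_sqint; try by move=> s _; exact: sqint_ge0.
- apply: eq_integral => s _; rewrite /sqint.
  rewrite -!ge0_integralZl_EFin//; try exact: ms; try by move=> x _; rewrite lee_fin dot_ge0.
  rewrite -!ge0_integralD//; try (by move=> x _; rewrite ?mule_ge0// lee_fin dot_ge0);
    try exact: ms; try (by apply: measurable_funeM; exact: ms); try exact: (ms s _ mp); try exact: (ms s _ mm).
  apply: eq_integral => x _; rewrite -!EFinM -!EFinD; congr EFin.
  by rewrite !dotDl !dotDr !dotNl !dotNr (dotC (v s x)); ring.
- by move=> s _; rewrite mule_ge0// sqint_ge0.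
- by apply: measurable_funeM; exact: measurable_sqint.
- by move=> s _; rewrite mule_ge0// sqint_ge0.
- by apply: measurable_funeM; exact: measurable_sqint.
Qed.

Lemma dsqintZ c h : jointly_measurable h ->
  dsqint (fun s x => c *: h s x) = ((c ^+ 2)%:E * dsqint h)%E.
Proof.
move=> mh; rewrite /dsqint -ge0_integralZl_EFin ?sqr_ge0//; last 2 first.
- by move=> s _; exact: sqint_ge0.
- exact: measurable_sqint.
by apply: eq_integral => s _; rewrite sqintZ//; exact: joint_measurable_section.
Qed.

(** Almost everywhere convergence and norms not exceeding the limit norm imply strong convergence.
    With c the square integral of h, the parallelogram identity bounds that of g_n - h by 4 c minus
    that of g_n + h, whose lower limit is at least 4 c by Fatou. *)
Lemma dsqint_cvg (g : nat -> R -> T -> 'cV[R]_k) h (e : R) :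
  (forall n, jointly_measurable (g n)) -> jointly_measurable h ->
  (dsqint h < +oo)%E -> (forall n, (dsqint (g n) <= dsqint h)%E) ->
  {ae nu, forall x, {ae leb, forall s, forall i, g n s x i 0 @[n --> \oo] --> h s x i 0}} ->
  0 < e -> exists N, forall n, (N <= n)%N -> (dsqint (fun s x => g n s x - h s x)%R <= e%:E)%E.
Proof.
move=> mg mh hoo gle gh e0.
have [c cE] : exists c, dsqint h = c%:E.
  by exists (fine (dsqint h)); rewrite fineK// ge0_fin_numE// dsqint_ge0.
pose a n := dsqint (fun s x => g n s x + h s x).
have h4 : ((4 * c)%:E <= limn_einf a)%E.
  have -> : ((4 * c)%:E = dsqint (fun s x => 2 *: h s x))%E.
    by rewrite dsqintZ// cE -EFinM; congr EFin; ring.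
  apply: dsqint_fatou.
  - by move=> n; have := measurable_lincomb 1 (mg n) mh; under eq_fun do rewrite scale1r.
  - by have := measurable_lincomb 1 mh mh; under eq_fun do rewrite scale1r -mulr2n -scaler_nat.
  - apply: filterS gh => x gx; apply: filterS gx => s gx i.
    under eq_fun do rewrite mxE; rewrite mxE mulr_natl mulr2n.
    by apply: cvgD; [exact: gx|exact: cvg_cst].
have [N NP] : exists N, ((4 * c - e)%:E < einfs a N)%E.
  apply: contrapT => /forallNP aN.
  have : (limn_einf a <= (4 * c - e)%:E)%E.
    rewrite limn_einf_lim; apply: lime_le; first exact: is_cvg_einfs.
    by near=> n; rewrite leNgt; apply/negP; exact: aN.
  by move=> /(le_trans h4); rewrite lee_fin lerDl oppr_ge0 leNgt e0.
exists N => n Nn.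
have an : ((4 * c - e)%:E <= a n)%E.
  by apply: le_trans (ltW NP) _; apply: ereal_inf_lbound; exists n.
have p := dsqint_parallelogram (mg n) mh.
have gn := gle n; rewrite cE in gn p.
have g0 := dsqint_ge0 (g n).
have d0 := dsqint_ge0 (fun s x => g n s x - h s x).
have a0 := dsqint_ge0 (fun s x => g n s x + h s x).
rewrite -/(a n) in p a0.
move: p gn an g0 d0 a0.
case: (dsqint (g n)) => [y| |] //; case: (dsqint _) => [x| |] //; case: (a n) => [z| |] //=.
rewrite -!EFinM -!EFinD !lee_fin => -[p] gn an g0 d0 a0.
lra.
Unshelve. all: by end_near. Qed.

End iterated_square_integral.

(** * Square mean convergence of the difference quotients of the data *)

Section difference_quotients.
Context {d} {T : measurableType d} {R : realType}
  (nu : {sigma_finite_measure set T -> \bar R}) (k : nat).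
Notation leb := (@lebesgue_measure R).
Notation H := (L2space nu k).
Context (w w' : R -> T -> 'cV[R]_k) (F : R -> H).
Hypothesis (wF : represents w F) (Fc : causal_curve F).
Hypothesis mw' : jointly_measurable w'.
Hypothesis w'_loc : forall a b : R, (\int[leb]_(r in `]a, b]) sqint nu (w' r) < +oo)%E.
Hypothesis weak : forall phi, test_function phi ->
  {ae nu, forall x, vint (fun t => derive1 phi t *: w t x) = - vint (fun t => phi t *: w' t x)}.
Context (T0 : R).
Let G := window w' 0 T0.
Let mG : jointly_measurable G := measurable_window mw' 0 T0.

Lemma dsqint_window : dsqint nu G = (\int[leb]_(r in `]0%R, T0]) sqint nu (w' r))%E.
Proof.
by rewrite /dsqint [RHS]integral_mkcond; apply: eq_integral => r _; rewrite sqint_window.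
Qed.

Definition average e s x := vint (fun r => box e (s - r) *: G r x).

Lemma measurable_average e : jointly_measurable (average e).
Proof.
rewrite /jointly_measurable /average.
apply: (measurable_vint (F := fun (z : R * T) r => box e (z.1 - r) *: G r z.2)).
apply/measurable_vecP => i; under eq_fun do rewrite mxE.
apply: measurable_funM.
  apply: (measurableT_comp (measurable_box e) (g := fun z : R * (R * T) => z.2.1 - z.1)).
  apply: measurable_funB; last exact: measurable_fst.
  exact: (measurableT_comp measurable_fst measurable_snd).
move/measurable_vecP: mG => /(_ i) h.
apply: (measurableT_comp h (g := fun z : R * (R * T) => (z.1, z.2.2))).
apply/measurable_fun_pairP; split; first exact: measurable_fst.
exact: (measurableT_comp measurable_snd measurable_snd).
Qed.

Lemma sqint_average_le e s : 0 < e ->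
  (sqint nu (average e s) <= \int[leb]_r ((box e (s - r))%:E * sqint nu (G r)))%E.
Proof.
move=> e0.
have mK : measurable_fun setT (fun z : R * T => (box e (s - z.1) * dot (G z.1 z.2) (G z.1 z.2))%:E).
  apply/measurable_EFinP; apply: measurable_funM; last exact: measurable_dot.
  exact: (measurableT_comp (measurable_box_reflect e s) measurable_fst).
have K0 (z : R * T) : (0 <= (box e (s - z.1) * dot (G z.1 z.2) (G z.1 z.2))%:E)%E.
  by rewrite lee_fin mulr_ge0 ?dot_ge0// box_ge0.
have e1 : (\int[leb]_r ((box e (s - r))%:E * sqint nu (G r)) =
    \int[leb]_r \int[nu]_x (box e (s - r) * dot (G r x) (G r x))%:E)%E.
  apply: eq_integral => r _; rewrite -ge0_integralZl_EFin//.
  - by move=> x _; rewrite lee_fin dot_ge0.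
  - by apply: measurable_sq; exact: joint_measurable_section.
  - exact: box_ge0.
rewrite e1 (fubini_tonelli (m1 := leb) (m2 := nu) _ mK K0).
have ms : measurable_fun setT (average e s) by exact: joint_measurable_section (measurable_average e).
apply: ae_ge0_le_integral => //.
- by move=> x _; rewrite lee_fin dot_ge0.
- exact: measurable_sq.
- by move=> x _; apply: integral_ge0 => r _; exact: (K0 (r, x)).
- exact: (measurable_fun_fubini_tonelli_G (m1 := leb) _ mK K0).
apply: filterS (window_integrable mw' (w'_loc 0 T0)) => x [xf xi] _.
apply: box_jensen => //; exact: measurable_time_section.
Qed.

(** Jensen's inequality at fixed s, then Tonelli: for each r the weights [box e (s - r)] integrate
    to 1 in s. *)
Lemma dsqint_average_le e : 0 < e -> (dsqint nu (average e) <= dsqint nu G)%E.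
Proof.
move=> e0.
have mpsi := measurable_sqint nu mG.
have mK : measurable_fun setT (fun z : R * R => ((box e (z.1 - z.2))%:E * sqint nu (G z.2))%E).
  apply: emeasurable_funM; last exact: (measurableT_comp mpsi measurable_snd).
  apply/measurable_EFinP; apply: (measurableT_comp (measurable_box e)).
  by apply: measurable_funB; [exact: measurable_fst|exact: measurable_snd].
have K0 (z : R * R) : (0 <= (box e (z.1 - z.2))%:E * sqint nu (G z.2))%E.
  by rewrite mule_ge0 ?sqint_ge0// lee_fin box_ge0.
apply: (@le_trans _ _ (\int[leb]_s \int[leb]_r ((box e (s - r))%:E * sqint nu (G r)))%E).
  apply: ge0_le_integral => //.
  - by move=> s _; exact: sqint_ge0.
  - by apply: measurable_sqint; exact: measurable_average.
  - exact: (measurable_fun_fubini_tonelli_F (m2 := leb) _ mK K0).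
  - by move=> s _; exact: sqint_average_le.
rewrite (fubini_tonelli (m1 := leb) (m2 := leb) _ mK K0).
rewrite le_eqVlt; apply/orP; left; apply/eqP; apply: eq_integral => r _ /=.
rewrite ge0_integralZr//.
- by rewrite box_mass_shift// mul1e.
- by apply/measurable_EFinP; apply: (measurableT_comp (measurable_box e)); exact: measurable_funB.
- by move=> s _; rewrite lee_fin box_ge0.
- exact: sqint_ge0.
Qed.

Lemma curve_ae0 t : t <= 0 -> {ae nu, forall x, w t x = 0}.
Proof.
move=> t0; have [_ hw we] := wF.
have : w t = cst 0 %[ae nu].
  apply: L2class_inj => //; first exact: isL20.
  by rewrite we Fc.2.
by apply: filterS => x; exact.
Qed.

(** The increment formula on ]a, s], where a clips s - e at 0. The curve vanishes up to time 0, and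
    the derivative in the average is restricted to ]0, T0], so both sides ignore the part of the
    interval before 0. *)
Lemma difference_quotient_average e s : 0 < e -> 0 < s <= T0 ->
  {ae nu, forall x, e^-1 *: (w s x - w (s - e) x) = average e s x}.
Proof.
move=> e0 /andP[s0 sT]; pose a := Num.max (s - e) 0.
have as_ : a < s by rewrite gt_max s0 andbT gtrBl.
have wa : {ae nu, forall x, w (s - e) x = w a x}.
  have [es|/ltW es] := leP 0 (s - e).
    by rewrite /a max_l//; exact: aeW.
  rewrite /a max_r//.
  by apply: filterS2 (curve_ae0 es) (curve_ae0 (lexx 0)) => x -> ->.
apply: filterS3 wa (increment_formula wF Fc mw' w'_loc weak as_)
  (window_integrable mw' (w'_loc a s)) => x -> -> [_ xi].
apply/matrixP => i j; rewrite ord1 mxE ![vint _ _ _]mxE -RintegralZl//; last exact: xi.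
apply: eq_Rintegral => r _; rewrite box_itv /G /window !mxE !mulrA; congr (_ * _).
rewrite -mulrA; congr (_ * _); rewrite !indicE !mem_setE !in_itv/= /a gt_max.
have [rs|_] := leP r s; last by rewrite !andbF mul0r.
by rewrite !andbT (le_trans rs sT) andbT -mulnb natrM.
Qed.

Definition cutoff (v : R -> T -> 'cV[R]_k) s x : 'cV[R]_k := (\1_`]0, T0] s : R) *: v s x.

Lemma measurable_cutoff v : jointly_measurable v -> jointly_measurable (cutoff v).
Proof.
move=> mv; apply/measurable_vecP => i; under eq_fun do rewrite mxE.
apply: measurable_funM; last by move/measurable_vecP: mv; exact.
have mi : measurable_fun setT (\1_`]0, T0] : R -> R) by exact: measurable_indic.
exact: (measurableT_comp mi measurable_fst).
Qed.

Definition difference_quotient e s x := e^-1 *: (w s x - w (s - e) x).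

Lemma represents_difference_quotient e : represents (difference_quotient e) (diff_quot e F).
Proof.
split.
- have := measurable_lincomb e^-1 (measurable_lincomb (-1) (jointly_measurable_shift e (let: And3 m _ _ := wF in m)) (let: And3 m _ _ := wF in m)) (measurable_cst (0 : 'cV[R]_k)).
  by rewrite /jointly_measurable /difference_quotient; under eq_fun do rewrite addr0 scaleN1r addrC.
- move=> t; have [_ hw _] := wF.
  by apply: isL2Z; apply: isL2B.
- move=> t; have [_ hw we] := wF.
  have := L2class_lincomb e^-1 (isL2B (hw t) (hw (t - e))) (isL20 nu (k := k)).
  rewrite L2classB// !we.
  rewrite /diff_quot (_ : L2class nu (cst 0) = 0)// addr0 => <-.
  by congr L2class; apply/funext => x; rewrite addr0.
Qed.

Lemma dsqint_cutoff v (U : R -> H) : represents v U -> causal_curve U ->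
  dsqint nu (cutoff v) = (prim (fun s => `|U s| ^+ 2) T0)%:E.
Proof.
move=> [mv hv ve] Uc; have i := causal_integrable T0 (causal_curve_norm2 Uc).
rewrite /prim /Rintegral fineK; last exact: integrable_fin_num.
rewrite /dsqint [RHS]integral_mkcond; apply: eq_integral => s _.
rewrite patchE mem_setE in_itv/= /cutoff indicE mem_setE in_itv/=.
have [s0|s0] := leP s 0.
  rewrite Uc.2// normr0 expr0n/=.
  have -> : (fun x => false%:R *: v s x) = cst 0 by apply/funext => x; rewrite scale0r.
  by rewrite sqint0; case: ifP.
case: leP => sT /=.
  rewrite (_ : (fun x => true%:R *: v s x) = v s); last by apply/funext => x; rewrite scale1r.
  by rewrite -L2class_norm2// ve.
by rewrite (_ : (fun x => false%:R *: v s x) = cst 0) ?sqint0//; apply/funext => x; rewrite scale0r.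
Qed.

Lemma cutoff_average e s : 0 < e ->
  {ae nu, forall x, cutoff (difference_quotient e) s x = cutoff (average e) s x}.
Proof.
move=> e0; rewrite /cutoff indicE mem_setE in_itv/=.
have [sI|_] := boolP (0 < s <= T0); last by apply: aeW => x; rewrite !scale0r.
by apply: filterS (difference_quotient_average e0 sI) => x h; rewrite !scale1r -h.
Qed.

Lemma dsqint_difference_quotient_le e : 0 < e ->
  (dsqint nu (cutoff (difference_quotient e)) <= dsqint nu G)%E.
Proof.
move=> e0; apply: le_trans (dsqint_average_le e0).
have [mv _ _] := represents_difference_quotient e.
have ma := measurable_average e.
apply: ge0_le_integral => //.
- by move=> s _; exact: sqint_ge0.
- by apply: measurable_sqint; exact: measurable_cutoff.
- exact: measurable_sqint.
move=> s _.
rewrite (@sqint_ae _ _ _ _ _ _ (cutoff (average e) s)); last 3 first.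
- by apply: joint_measurable_section; exact: measurable_cutoff.
- by apply: joint_measurable_section; exact: measurable_cutoff.
- by apply: filterS (cutoff_average s e0) => x h _.
apply: ge0_le_integral => //.
- by move=> x _; rewrite lee_fin dot_ge0.
- by apply: measurable_sq; apply: joint_measurable_section; exact: measurable_cutoff.
- by apply: measurable_sq; exact: joint_measurable_section.
move=> x _; rewrite lee_fin /cutoff indicE; case: (_ \in _); first by rewrite scale1r.
by rewrite scale0r dot0l dot_ge0.
Qed.

Lemma difference_quotient_cvg : {ae nu, forall x, {ae leb, forall s, forall i,
  cutoff (difference_quotient n.+1%:R^-1) s x i 0 @[n --> \oo] --> G s x i 0}}.
Proof.
have eq_sec : {ae nu, forall x, forall n, {ae leb, forall s,
    cutoff (difference_quotient n.+1%:R^-1) s x = cutoff (average n.+1%:R^-1) s x}}.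
  apply: ae_foralln => n; have e0 : 0 < n.+1%:R^-1 :> R by rewrite invr_gt0.
  have [mv _ _] := represents_difference_quotient n.+1%:R^-1.
  have m1 := measurable_cutoff mv.
  have m2 := measurable_cutoff (measurable_average n.+1%:R^-1).
  pose D (z : R * T) := cutoff (difference_quotient n.+1%:R^-1) z.1 z.2 - cutoff (average n.+1%:R^-1) z.1 z.2.
  have mD : measurable_fun setT (fun z => `|D z|).
    apply: measurable_mx_norm; have := measurable_lincomb (-1) m2 m1.
    by under eq_fun do rewrite scaleN1r addrC.
  pose A := ~` [set z | `|D z| <= 0].
  have mA : measurable A.
    apply: measurableC; rewrite -[X in measurable X]setTI.
    by apply: measurable_fun_le => //; exact: measurable_cst.
  have : {ae nu, forall x, {ae leb, forall s, ~ A (s, x)}}.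
    apply: (@ae_swap _ _ _ _ R leb nu A mA); apply: aeW => s.
    by apply: filterS (cutoff_average s e0) => x h; rewrite /A /D/= h subrr normr0.
  apply: filterS => x; apply: filterS => s /contrapT /=.
  by rewrite normr_le0 subr_eq0 => /eqP.
apply: filterS2 eq_sec (window_integrable mw' (w'_loc 0 T0)) => x e1 [_ xi].
have e2 : {ae leb, forall s, forall n,
    cutoff (difference_quotient n.+1%:R^-1) s x = cutoff (average n.+1%:R^-1) s x}.
  exact: ae_foralln.
have e3 : {ae leb, forall s, forall i : 'I_k, 
    \int[leb]_r (box n.+1%:R^-1 (s - r) * G r x i 0) @[n --> \oo] --> G s x i 0}.
  (* The finitely many coordinates are indexed by naturals with a proof of m < k, so that the
     countable intersection of full sets applies. *)
  have h3 : {ae leb, forall s, forall (m : nat) (mk : (m < k)%N),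
      \int[leb]_r (box n.+1%:R^-1 (s - r) * G r x (Ordinal mk) 0) @[n --> \oo] -->
        G s x (Ordinal mk) 0}.
    apply: ae_foralln => m; have [km|km] : (k <= m)%N \/ (m < k)%N by apply/orP; rewrite leqNgt orNb.
      by apply: aeW => s mk; move: (leq_trans mk km); rewrite ltnn.
    apply: filterS (box_average_cvg (xi (Ordinal km))) => s h mk'.
    by rewrite (bool_irrelevance mk' km).
  by apply: filterS h3 => s h3 [m mk]; exact: h3.
apply: filterS2 e2 e3 => s e2 e3 i.
under eq_fun do rewrite e2.
have [sI|sI] := boolP (0 < s <= T0); last first.
  rewrite /G /window /cutoff indicE mem_setE in_itv/= (negbTE sI) scale0r mxE.
  by under eq_fun do rewrite scale0r mxE; exact: cvg_cst.
rewrite /cutoff indicE mem_setE in_itv/= sI.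
under eq_fun do rewrite scale1r mxE.
rewrite (_ : (fun n : nat => _) = fun n : nat => \int[leb]_r (box n.+1%:R^-1 (s - r) * G r x i 0)); first exact: e3.
by apply/funext => n; apply: eq_Rintegral => r _; rewrite mxE.
Qed.

Lemma difference_quotient_bound e : 0 < e ->
  ((prim (fun s => `|diff_quot e F s| ^+ 2) T0)%:E <= \int[leb]_(r in `]0%R, T0]) sqint nu (w' r))%E.
Proof.
move=> e0; rewrite -dsqint_window.
rewrite -(dsqint_cutoff (represents_difference_quotient e) (causal_curve_diff_quot (ltW e0) Fc)).
exact: dsqint_difference_quotient_le.
Qed.

Lemma difference_quotient_cauchy (a : R) : 0 < a ->
  exists N, forall n m, (N <= n)%N -> (N <= m)%N ->
    prim (fun s => `|diff_quot n.+1%:R^-1 F s - diff_quot m.+1%:R^-1 F s| ^+ 2) T0 <= a.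
Proof.
move=> a0; have a4 : 0 < a / 4 by rewrite divr_gt0.
pose v n := difference_quotient n.+1%:R^-1.
have v0 n : 0 < n.+1%:R^-1 :> R by rewrite invr_gt0.
have rv n : represents (v n) (diff_quot n.+1%:R^-1 F) by exact: represents_difference_quotient.
have mv n : jointly_measurable (cutoff (v n)).
  by apply: measurable_cutoff; case: (rv n).
have Goo : (dsqint nu G < +oo)%E by rewrite dsqint_window.
have [N NP] := dsqint_cvg mv mG Goo (fun n => dsqint_difference_quotient_le (v0 n))
  difference_quotient_cvg a4.
exists N => n m Nn Nm.
have rnm := represents_lincomb (-1) (rv m) (rv n).
have cnm : causal_curve (fun s => -1 *: diff_quot m.+1%:R^-1 F s + diff_quot n.+1%:R^-1 F s).
  by apply: causal_curveZD; apply: causal_curve_diff_quot => //; exact: ltW.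
have -> : (fun s => `|diff_quot n.+1%:R^-1 F s - diff_quot m.+1%:R^-1 F s| ^+ 2) =
    (fun s => `|-1 *: diff_quot m.+1%:R^-1 F s + diff_quot n.+1%:R^-1 F s| ^+ 2).
  by apply/funext => s; rewrite scaleN1r addrC.
rewrite -lee_fin -(dsqint_cutoff rnm cnm).
pose u n s x := cutoff (v n) s x - G s x.
have mu n' : jointly_measurable (u n').
  by have := measurable_lincomb (-1) mG (mv n'); under eq_fun do rewrite scaleN1r addrC.
have -> : cutoff (fun s x => -1 *: v m s x + v n s x) = (fun s x => u n s x - u m s x).
  apply/funext => s; apply/funext => x; apply/matrixP => i j.
  by rewrite /u /cutoff !mxE; ring.
apply: (@le_trans _ _ (2%:E * dsqint nu (u n) + 2%:E * dsqint nu (u m))%E).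
  by rewrite -dsqint_parallelogram// leeDl// dsqint_ge0.
apply: (@le_trans _ _ (2%:E * (a / 4)%:E + 2%:E * (a / 4)%:E)%E).
  by apply: leeD; rewrite lee_wpmul2l//; apply: NP.
by rewrite -!EFinM -EFinD lee_fin le_eqVlt; apply/orP; left; apply/eqP; field.
Qed.

End difference_quotients.

(** * The equation on the domain *)

Lemma le_growth {R : realType} (Cl beta kap s t : R) : 0 < Cl -> 0 <= beta -> 0 <= kap ->
  0 <= s -> s <= t -> 0 <= growth Cl beta kap s /\ growth Cl beta kap s <= growth Cl beta kap t.
Proof.
move=> Cl0 b0 k0 s0 st; split.
  by rewrite mulr_ge0 ?expR_ge0// divr_ge0// ltW.
rewrite ler_wpM2l ?divr_ge0 ?(ltW Cl0)// ler_expR ler_wpM2l//.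
  by rewrite mulr_ge0// addr_ge0// divr_ge0 ?(ltW Cl0)// addr_ge0// mulr_ge0// addr_ge0.
by rewrite !ger0_norm// (le_trans s0).
Qed.

(** * Translation between curves of fields and curves of classes *)

Section curves_on_domain.
Context {R : realType} {d k : nat} (W : set 'rV[R]_d) (mW : measurable W).
Notation mu := (lebesgue_rV R d).
Notation nu := (restr mu mW).
Notation H := (L2space nu k).
Notation vfield := ('rV[R]_d -> 'cV[R]_k).
Notation class := (@class_on R d k W mW).
Implicit Types v : R -> vfield.

(** The given causality concerns t < 0 only; the value at 0 is obtained by continuity from the
    left. *)
Lemma class_causal_curve v : is_C0 W v -> is_causal W v -> causal_curve (fun t => class (v t)).
Proof.
move=> [_ hv cv] v0.
have c : continuous (fun t => class (v t)).
  move=> t; apply/cvgrPdist_le => e e0.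
  move/cvgrPdist_le : (cv t) => /(_ e e0); apply: filterS => s.
  rewrite sub0r normrN (class_on_norm mW); last exact: inL2B.
  by rewrite class_onB// normr_id distrC.
have z t : t < 0 -> class (v t) = 0.
  move=> t0; apply: class_on_eq => //; apply: ae_eq_trans (v0 _ t0) _.
  by have /ae_restr := L2zeroE nu k; apply: filterS => x h Wx; exact/esym/h.
split=> // t; rewrite le_eqVlt => /predU1P[->|]; last exact: z.
apply/normr0_eq0/eqP; rewrite eq_le normr_ge0 andbT; apply/ler_addgt0Pr => e e0.
rewrite add0r; move/cvgrPdist_le : (c 0) => /(_ e e0)[dl /= dl0 dP].
have dl2 : 0 < dl / 2 by rewrite divr_gt0.
have h : ball_ Num.norm (0 : R) dl (- (dl / 2)).
  by rewrite /ball_/= sub0r opprK gtr0_norm// ltr_pdivrMr// ltr_pMr// ltr1n.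
by have := dP _ h; rewrite (z (- (dl / 2))) ?subr0// oppr_lt0.
Qed.

Lemma represents_extend0 v : joint_measurable W v -> (forall t, inL2 W (v t)) ->
  represents (fun t => extend0 W (v t)) (fun t => class (v t)).
Proof.
move=> mv hv; split=> [|t|t] //; first exact: measurable_joint_extend0.
exact: isL2_extend0.
Qed.

Lemma class_scale c (u : vfield) : inL2 W u -> inL2 W (c \*: u) /\ class (c \*: u) = c *: class u.
Proof.
move=> hu; have -> : c \*: u = (c - 1) \*: u \+ u.
  by apply/funext => x /=; rewrite scalerBl scale1r subrK.
split; first exact: (inL2_lincomb mW (c - 1) hu hu).
by rewrite (class_on_lincomb mW (c - 1) hu hu) scalerBl scale1r subrK.
Qed.

Lemma class_derivative v v' : (forall t, inL2 W (v t)) -> (forall t, inL2 W (v' t)) ->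
  is_time_derivative W v v' <->
  forall t : R, is_derive t 1 (fun t => class (v t)) (class (v' t)).
Proof.
move=> hv hv'.
have E t h : L2norm W (h^-1 \*: (v (t + h) \- v t) \- v' t) =
    `|h^-1 *: (class (v (t + h)) - class (v t)) - class (v' t)|.
  have hd := inL2B mW (hv (t + h)) (hv t); have [hz ez] := class_scale h^-1 hd.
  by rewrite (class_on_norm mW (inL2B mW hz (hv' t))) (class_onB mW hz (hv' t)) ez
    (class_onB mW (hv (t + h)) (hv t)).
split=> [D t|D t].
  apply/is_derive_cvgP/cvgrPdist_le => e e0.
  move/cvgrPdist_le : (D t) => /(_ e e0); apply: filterS => h.
  by rewrite sub0r normrN E normr_id distrC.
apply/cvgrPdist_le => e e0.
have /is_derive_cvgP/cvgrPdist_le/(_ e e0) := D t; apply: filterS => h.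
by rewrite sub0r normrN E normr_id distrC.
Qed.

Lemma class_continuous v : joint_measurable W v -> (forall t, inL2 W (v t)) ->
  continuous (fun t => class (v t)) -> is_C0 W v.
Proof.
move=> mv hv cv; split=> // t; apply/cvgrPdist_le => e e0.
move/cvgrPdist_le : (cv t) => /(_ e e0); apply: filterS => s.
rewrite sub0r normrN (class_on_norm mW); last exact: inL2B.
by rewrite class_onB// normr_id distrC.
Qed.

Lemma class_of_representative (w : R -> vfield) (u : R -> H) : represents w u ->
  [/\ joint_measurable W w, forall t, inL2 W (w t) & forall t, class (w t) = u t].
Proof.
move=> [mw hw wu]; split=> [|t|t].
- exact: measurable_funTS.
- exact: isL2_inL2 (hw t).
- apply: class_on_eq; first exact: isL2_inL2 (hw t).
  have /ae_restr := L2class_ae (hw t); rewrite wu.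
  by apply: filterS => x h Wx; rewrite -h.
Qed.

End curves_on_domain.

Section equation_on_domain.
Context {R : realType} {d k : nat} (W : set 'rV[R]_d) (mW : measurable W).
Notation mu := (lebesgue_rV R d).
Notation nu := (restr mu mW).
Notation leb := (@lebesgue_measure R).
Notation H := (L2space nu k).
Notation vfield := ('rV[R]_d -> 'cV[R]_k).
Notation class := (@class_on R d k W mW).
Context (V : set vfield) (P : vfield -> vfield) (skewP : skew_adjoint W V P).
Context (Cl Cu Bb Bq : R) (Cl_gt0 : 0 < Cl) (a b : 'rV[R]_d -> 'M[R]_k) (q : R -> 'rV[R]_d -> 'M[R]_k).
Hypotheses (aL : inLinf W a) (asym : symmetric_ae W a) (acoer : coercive_bounds W Cl Cu a).
Hypotheses (bL : inLinf W b) (bB : (Linfnorm W b <= Bb%:E)%E).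
Hypotheses (qL : inL1Linf W q).
Hypothesis q0 : {ae leb, forall t, t < 0 -> q t = cst 0 %[ae mu in W]}.
Hypothesis qB : (L1Linfnorm W q <= Bq%:E)%E.

(** The given bound is an arbitrary real, while [evolution_coefficients] wants a nonnegative one. *)
Definition bound_b : R := Num.max Bb 0.
(** The summand 1 makes it positive, as the convolution estimate requires. *)
Definition bound_q : R := Num.max Bq 0 + 1.
(** Serves only to know that multiplication by a preserves L^2. It depends on a and enters no
    estimate; the norm of [op_a] is controlled by Cu through [A_bound]. *)
Definition bound_a : R := fine (Linfnorm W a).
Definition op_a (x : H) : H := mulop (extend0 W a) x.
Definition op_b (x : H) : H := mulop (extend0 W b) x.
Definition op_q (u : R -> H) : R -> H := Kop (truncated_kernel W q) u.

Lemma bound_b_ge0 : 0 <= bound_b. Proof. by rewrite le_max lexx orbT. Qed.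

Lemma bound_q_gt0 : 0 < bound_q.
Proof. by rewrite ltr_wpDl// le_max lexx orbT. Qed.

Lemma bound_a_ge0 : 0 <= bound_a. Proof. by rewrite fine_ge0// Linfnorm_ge0. Qed.

Lemma a_bounded : essentially_bounded nu (extend0 W a) bound_a.
Proof.
apply: inLinf_essentially_bounded => //; last exact: bound_a_ge0.
by rewrite fineK// ge0_fin_numE ?Linfnorm_ge0//; case: aL.
Qed.

Lemma b_bounded : essentially_bounded nu (extend0 W b) bound_b.
Proof.
apply: inLinf_essentially_bounded => //; last exact: bound_b_ge0.
by apply: le_trans bB _; rewrite lee_fin le_max lexx.
Qed.

Lemma q_dominated : dominated_kernel (truncated_kernel W q) (kernel_norm W q) bound_q.
Proof.
apply: (truncated_kernel_dominated mW (L1Linf_joint qL) bound_q_gt0 _ qB).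
by rewrite /bound_q (@le_trans _ _ (Num.max Bq 0))// ?le_max ?lexx// lerDl.
Qed.

Lemma coefficients : evolution_coefficients (@L2ip _ _ _ nu k) op_a op_b op_q
  Cl Cu (k%:R * bound_b) (k%:R * bound_q).
Proof.
have ab := a_bounded; have bb := b_bounded; have qd := q_dominated.
have ac : {ae nu, forall t, forall xi : 'cV[R]_k,
    Cl * dot xi xi <= dot xi (extend0 W a t *m xi) /\ dot xi (extend0 W a t *m xi) <= Cu * dot xi xi}.
  by apply/ae_restr; apply: filterS acoer => x h Wx xi; rewrite extend0E//; exact: h.
have asy : {ae nu, forall t, (extend0 W a t)^T = extend0 W a t}.
  by apply/ae_restr; apply: filterS asym => x h Wx; rewrite extend0E//; exact: h.
split.
- exact: Cl_gt0.
- by rewrite mulr_ge0// bound_b_ge0.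
- by rewrite mulr_ge0// ltW// bound_q_gt0.
- by move=> c x y; exact: mulop_linear ab.
- by move=> x y; exact: mulop_sym ab asy.
- by move=> x; case: (mulop_coercive x ab ac).
- by move=> x; case: (mulop_coercive x ab ac).
- by move=> c x y; exact: mulop_linear bb.
- by move=> x; exact: mulop_bound bound_b_ge0 bb.
- by move=> c u v t; exact: (Kop_linear qd).
- by move=> u t m; exact: (Kop_bound qd).
- by move=> u e t; exact: (Kop_shift qd).
Qed.

(** The canonical function of the left-hand class is almost everywhere the pointwise expression of
    the equation; the convolution term passes through the truncated kernel and is independent of the
    representative by [KopE]. *)
Lemma equation_class (v v' : R -> vfield) (g : vfield) (t : R) :
  joint_measurable W v -> (forall t, inL2 W (v t)) -> causal_curve (fun t => class (v t)) ->
  inL2 W (v' t) -> V (v t) -> inL2 W g ->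
  op_a (class (v' t)) + op_class P (class (v t)) + op_b (class (v t)) +
    op_q (fun s => class (v s)) t = class g <->
  {ae mu, forall x, W x ->
    a x *m v' t x + P (v t) x + b x *m v t x + time_conv q v t x = g x}.
Proof.
move=> mv hv vc hv' Vv hg.
have qoo : (L1Linfnorm W q < +oo)%E by apply: le_lt_trans qB _; rewrite ltry.
have rv := represents_extend0 mW mv hv.
have [_ PE] := op_classE mW skewP Vv.
have E : {ae mu, forall x, W x -> (op_a (class (v' t)) + op_class P (class (v t)) +
    op_b (class (v t)) + op_q (fun s => class (v s)) t : H) x =
    a x *m v' t x + P (v t) x + b x *m v t x + time_conv q v t x}.
  have /ae_restr e1 := L2addE (op_a (class (v' t)) + op_class P (class (v t)) + op_b (class (v t)))
    (op_q (fun s => class (v s)) t).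
  have /ae_restr e2 := L2addE (op_a (class (v' t)) + op_class P (class (v t))) (op_b (class (v t))).
  have /ae_restr e3 := L2addE (op_a (class (v' t))) (op_class P (class (v t))).
  have /ae_restr e4 := mulop_ae (class (v' t)) a_bounded.
  have /ae_restr e5 := mulop_ae (class (v t)) b_bounded.
  have e6 := class_on_ae mW hv'; have e7 := class_on_ae mW (hv t).
  have e8 := class_on_ae mW (skew_adjoint_L2 skewP Vv).2.
  have e9 := time_conv_truncated mW (L1Linf_joint qL) t mv qoo q0.
  have /ae_restr e10 := L2class_ae (conv_isL2 q_dominated t vc rv).
  rewrite (KopE q_dominated t vc rv) in e10.
  apply: filterS2 (filterI (filterI (filterI e1 e2) (filterI e3 e4)) (filterI e5 e6))
    (filterI (filterI e7 e8) (filterI e9 e10)) => x.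
  move=> [[[h1 h2] [h3 h4]] [h5 h6]] [[h7 h8] [h9 h10]] Wx.
  rewrite [LHS](h1 Wx) [X in X + _](h2 Wx) [X in X + _ + _](h3 Wx) PE (h8 Wx).
  rewrite [X in X + _ + _ + _](h4 Wx) [X in _ + X + _](h5 Wx) (h6 Wx) (h7 Wx) (h9 Wx).
  by rewrite !(extend0E _ Wx) [X in _ + X](h10 Wx I).
split=> [e|e].
  apply: filterS2 E (class_on_ae mW hg) => x h1 h2 Wx.
  by rewrite -h1// e h2.
apply/esym; apply: class_on_eq => //.
by apply: filterS2 E e => x h1 h2 Wx; rewrite h1// h2.
Qed.

End equation_on_domain.

(** * The data as a causal curve, and its bounds *)

Section data_on_domain.
Context {R : realType} {d k : nat} (W : set 'rV[R]_d) (mW : measurable W).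
Notation mu := (lebesgue_rV R d).
Notation nu := (restr mu mW).
Notation leb := (@lebesgue_measure R).
Notation H := (L2space nu k).
Notation vfield := ('rV[R]_d -> 'cV[R]_k).
Notation class := (@class_on R d k W mW).
Context (f f' : R -> vfield) (fH1 : inH1loc W f f') (f0 : is_causal W f).

Definition class_curve (v : R -> vfield) (t : R) : H := class (v t).
Definition extension (v : R -> vfield) (t : R) : vfield := extend0 W (v t).

Lemma L2sqnorm_extension v t : joint_measurable W v -> L2sqnorm W (v t) = sqint nu (extension v t).
Proof.
move=> mv; have me := joint_measurable_section t (measurable_joint_extend0 mW mv).
rewrite -sqint_extend0//.
have : measurable_fun W (extend0 W (v t)) by exact: measurable_funTS.
by apply: eq_measurable_fun => x /set_mem Wx; rewrite extend0E.
Qed.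

Definition data_integral (t : R) : \bar R :=
  (\int[leb]_(tau in `[0%R, t]) (L2sqnorm W (f tau) + L2sqnorm W (f' tau)))%E.

Let mf : joint_measurable W f. Proof. by case: fH1 => -[]. Qed.
Let mf' : joint_measurable W f'. Proof. by case: fH1 => _ -[]. Qed.
Let je : jointly_measurable (extension f). Proof. exact: measurable_joint_extend0. Qed.
Let je' : jointly_measurable (extension f'). Proof. exact: measurable_joint_extend0. Qed.
Let ms : measurable_fun setT (fun t => sqint nu (extension f t)). Proof. exact: measurable_sqint. Qed.
Let ms' : measurable_fun setT (fun t => sqint nu (extension f' t)). Proof. exact: measurable_sqint. Qed.

Lemma data_causal : causal_curve (class_curve f).
Proof. by apply: class_causal_curve f0; case: fH1. Qed.

Lemma data_represents : represents (extension f) (class_curve f).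
Proof. by apply: represents_extend0 => //; case: fH1 => _ _ _ []. Qed.

Lemma inL2loc_finite v (a b : R) : inL2loc W v ->
  (\int[leb]_(r in `[a, b]) sqint nu (extension v r) < +oo)%E.
Proof.
move=> [mv vT]; pose T := Num.max `|a| `|b|.
apply: le_lt_trans (vT T).
under [X in (_ <= X)%E]eq_integral do rewrite (L2sqnorm_extension _ mv).
apply: ge0_subset_integral => //.
- apply: measurable_funTS; apply: measurable_sqint; exact: measurable_joint_extend0.
- by move=> x _; exact: sqint_ge0.
move=> x /=; rewrite !in_itv/= => /andP[ax xb]; apply/andP; split.
  rewrite lerNl (@le_trans _ _ (- a)) ?lerN2//.
  by rewrite (le_trans (ler_norm _))// normrN le_max lexx.
by rewrite (le_trans xb)// (le_trans (ler_norm _))// le_max lexx orbT.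
Qed.

Lemma data_derivative_loc (a b : R) : (\int[leb]_(r in `]a, b]) sqint nu (extension f' r) < +oo)%E.
Proof.
have := @inL2loc_finite f' a b; case: fH1 => _ h _ _ /(_ h); apply: le_lt_trans.
apply: ge0_subset_integral => //.
- exact: measurable_funTS.
- by move=> x _; exact: sqint_ge0.
- by move=> x /=; rewrite !in_itv/= => /andP[/ltW -> ->].
Qed.

Lemma data_weak phi : test_function phi -> {ae nu, forall x,
  vint (fun t => derive1 phi t *: extension f t x) = - vint (fun t => phi t *: extension f' t x)}.
Proof.
move=> tphi; apply/ae_restr; have [_ _ wd _] := fH1.
apply: filterS (wd _ tphi) => x h Wx; rewrite /extension.
rewrite (@vint_eq _ _ _ (fun t => derive1 phi t *: f t x)); last by move=> t; rewrite extend0E.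
by rewrite h//; congr (- _); apply: vint_eq => t; rewrite extend0E.
Qed.

Lemma data_integralE t : data_integral t =
  (\int[leb]_(r in `[0%R, t]) (sqint nu (extension f r) + sqint nu (extension f' r)))%E.
Proof. by apply: eq_integral => r _; rewrite !L2sqnorm_extension. Qed.

Lemma data_integral_fin t : exists2 i, 0 <= i & data_integral t = i%:E.
Proof.
have i0 : (0 <= data_integral t)%E.
  by rewrite data_integralE integral_ge0// => r _; rewrite adde_ge0 ?sqint_ge0.
exists (fine (data_integral t)); first exact: fine_ge0.
rewrite fineK// ge0_fin_numE// data_integralE ge0_integralD//.
- have [h1 h2 _ _] := fH1.
  by apply: lte_add_pinfty; exact: inL2loc_finite.
- by move=> r _; exact: sqint_ge0.
- exact: measurable_funTS.
- by move=> r _; exact: sqint_ge0.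
- exact: measurable_funTS.
Qed.

Lemma le_data_integral t :
  (\int[leb]_(r in `]0%R, t]) sqint nu (extension f' r) <= data_integral t)%E.
Proof.
rewrite data_integralE.
apply: (@le_trans _ _ (\int[leb]_(r in `[0%R, t]) sqint nu (extension f' r))%E).
  apply: ge0_subset_integral => //.
  - exact: measurable_funTS.
  - by move=> x _; exact: sqint_ge0.
  - by move=> x /=; rewrite !in_itv/= => /andP[/ltW -> ->].
apply: ge0_le_integral => //.
- by move=> x _; exact: sqint_ge0.
- exact: measurable_funTS.
- by apply: emeasurable_funD; exact: measurable_funTS.
- by move=> r _; rewrite leeDr// sqint_ge0.
Qed.

Lemma le_data_integral_mono s t : s <= t -> (data_integral s <= data_integral t)%E.
Proof.
move=> st; rewrite !data_integralE; apply: ge0_subset_integral => //.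
- by apply: emeasurable_funD; exact: measurable_funTS.
- by move=> r _; rewrite adde_ge0 ?sqint_ge0.
- by move=> r /=; rewrite !in_itv/= => /andP[-> /le_trans]; apply.
Qed.

Lemma prim_data_le t : ((prim (fun s => `|class_curve f s| ^+ 2) t)%:E <= data_integral t)%E.
Proof.
have fc := data_causal; have [_ hf ef] := data_represents.
have i := causal_integrable t (causal_curve_norm2 fc).
rewrite /prim /Rintegral fineK; last exact: integrable_fin_num.
have n2 s : (`|class_curve f s| ^+ 2)%:E = sqint nu (extension f s) by rewrite -ef L2class_norm2.
have -> : (\int[leb]_(s in `]-oo, t]) (`|class_curve f s| ^+ 2)%:E =
    \int[leb]_(s in `]-oo, t]) sqint nu (extension f s))%E.
  by apply: eq_integral => s _; exact: n2.
rewrite data_integralE integral_mkcond [leRHS]integral_mkcond.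
apply: ge0_le_integral => //.
- by move=> s _; rewrite patchE; case: ifP => //= _; exact: sqint_ge0.
- apply/(measurable_restrictT _ _).1 => //.
  exact: measurable_funTS.
- apply/(measurable_restrictT _ _).1 => //.
  by apply: emeasurable_funD; exact: measurable_funTS.
- move=> s _; rewrite !patchE !mem_setE !in_itv/=.
  have [s0|s0] := leP 0 s.
    by rewrite /=; case: ifP => // _; rewrite leeDl// sqint_ge0.
  by rewrite /= -n2 fc.2 ?(ltW s0)// normr0 expr0n/=; case: ifP.
Qed.

(** Since f vanishes at 0, its quotient of step t at time t is f(t) / t, an average of f' over ]0,
    t]; Jensen and the bound 1 / t on the weight finish. The pointwise size of f is needed to bound
    P u at time t. *)
Lemma data_norm_le t i : 0 <= t -> data_integral t = i%:E -> `|class_curve f t| ^+ 2 <= t * i.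
Proof.
move=> + iE; rewrite le_eqVlt => /predU1P[<-|t0].
  by rewrite data_causal.2// normr0 expr0n/= mul0r.
have fc := data_causal; have wf := data_represents.
have tI : 0 < t <= t by rewrite t0 lexx.
have avg := difference_quotient_average wf fc je' data_derivative_loc data_weak t0 tI.
have [md hd ed] := represents_difference_quotient wf t.
have : ((`|diff_quot t (class_curve f) t| ^+ 2)%:E <= (t^-1 * i)%:E)%E.
  rewrite -ed L2class_norm2//.
  have ma := measurable_average je' t t.
  rewrite (@sqint_ae _ _ _ _ _ _ (average (extension f') t t t)); last 3 first.
  - exact: joint_measurable_section.
  - exact: joint_measurable_section.
  - by apply: filterS avg => x h _.
  apply: (le_trans (sqint_average_le je' data_derivative_loc t t t0)).
  apply: (@le_trans _ _ (\int[leb]_r (t^-1%:E * sqint nu (window (extension f') 0 t r)))%E).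
    have mw := measurable_sqint nu (measurable_window je' 0 t).
    apply: ge0_le_integral => //.
    - by move=> r _; rewrite mule_ge0 ?sqint_ge0// lee_fin box_ge0.
    - by apply: emeasurable_funM => //; apply/measurable_EFinP; exact: measurable_box_reflect.
    - exact: measurable_funeM.
    - by move=> r _; rewrite lee_wpmul2r ?sqint_ge0// lee_fin box_le.
  rewrite ge0_integralZl_EFin//; last 3 first.
  - by move=> r _; exact: sqint_ge0.
  - exact: (measurable_sqint nu (measurable_window je' 0 t)).
  - by rewrite invr_ge0 ltW.
  rewrite [leRHS]EFinM -iE lee_wpmul2l ?lee_fin ?invr_ge0 ?(ltW t0)//.
  by apply: le_trans (le_data_integral t); rewrite -(dsqint_window nu (extension f') t).
rewrite lee_fin /diff_quot subrr (fc.2 0)// subr0 normrZ exprMn ger0_norm ?invr_ge0 ?(ltW t0)//.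
rewrite exprVn ler_pdivrMl ?exprn_gt0// => /le_trans; apply.
by rewrite le_eqVlt; apply/orP; left; apply/eqP; field; rewrite gt_eqF.
Qed.

End data_on_domain.

(** The first term bounds |u'|^2. The second, with c the constant comparing the norm of V to the
    graph norm, bounds c^2 (|u|^2 + |P u|^2), where the equation writes P u as a sum of four terms;
    this explains the 4. The last term t makes the function strictly increasing. *)
Definition solution_constant {R : realType} (Cl Cu beta kap c t : R) : R :=
  growth Cl beta kap t + c ^+ 2 * (growth Cl beta kap t +
    4 * (t + (Cu ^+ 2 + beta ^+ 2 + kap ^+ 2) * growth Cl beta kap t)) + t.

Section solution_constant_bounds.
Context {R : realType}.
Implicit Types (Cl Cu beta kap c t E i u du f m p N : R).

Lemma solution_constant_lt Cl Cu beta kap c s t : 0 < Cl -> 0 <= beta -> 0 <= kap ->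
  0 <= s -> s < t -> solution_constant Cl Cu beta kap c s < solution_constant Cl Cu beta kap c t.
Proof.
move=> Cl0 b0 k0 s0 st; have [E0 Ele] := le_growth Cl0 b0 k0 s0 (ltW st).
rewrite /solution_constant; apply: ler_ltD => //; apply: lerD => //.
rewrite ler_wpM2l ?sqr_ge0//; apply: lerD => //.
rewrite ler_wpM2l//; apply: lerD; first exact: ltW.
by rewrite ler_wpM2l// !addr_ge0 ?sqr_ge0.
Qed.

Lemma solution_constant_ge0 Cl Cu beta kap c t : 0 < Cl -> 0 <= beta -> 0 <= kap ->
  0 <= t -> 0 <= solution_constant Cl Cu beta kap c t.
Proof.
move=> Cl0 b0 k0 t0; have [E0 _] := le_growth Cl0 b0 k0 t0 (lexx t).
rewrite /solution_constant !addr_ge0// mulr_ge0 ?sqr_ge0// addr_ge0// mulr_ge0// addr_ge0//.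
by rewrite mulr_ge0// !addr_ge0 ?sqr_ge0.
Qed.

Lemma solution_constant_bound Cl Cu beta kap c t i u du f m p N :
  0 <= t -> 0 <= i -> 0 <= p ->
  u ^+ 2 <= growth Cl beta kap t * i -> du ^+ 2 <= growth Cl beta kap t * i ->
  m ^+ 2 <= growth Cl beta kap t * i -> f ^+ 2 <= t * i ->
  p <= f + Cu * du + beta * u + kap * m -> N ^+ 2 <= c ^+ 2 * (u ^+ 2 + p ^+ 2) ->
  du ^+ 2 + N ^+ 2 <= solution_constant Cl Cu beta kap c t * i.
Proof.
rewrite /solution_constant; move: (growth Cl beta kap t) => E.
move=> t0 i0 p0 uE duE mE fE pE NE.
have sq4 (x y z w : R) : (x + y + z + w) ^+ 2 <= 4 * (x ^+ 2 + y ^+ 2 + z ^+ 2 + w ^+ 2).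
  have := sqr_ge0 (x - y); have := sqr_ge0 (x - z); have := sqr_ge0 (x - w).
  have := sqr_ge0 (y - z); have := sqr_ge0 (y - w); have := sqr_ge0 (z - w).
  by nra.
have p2 : p ^+ 2 <= 4 * (t * i + Cu ^+ 2 * (E * i) + beta ^+ 2 * (E * i) + kap ^+ 2 * (E * i)).
  apply: (@le_trans _ _ ((f + Cu * du + beta * u + kap * m) ^+ 2)).
    by rewrite ler_sqr ?nnegrE// (le_trans p0).
  apply: (le_trans (sq4 _ _ _ _)); rewrite ler_wpM2l//.
  by rewrite !exprMn; do !apply: lerD => //; rewrite ler_wpM2l ?sqr_ge0.
apply: (@le_trans _ _ (E * i + c ^+ 2 * (E * i +
    4 * (t * i + Cu ^+ 2 * (E * i) + beta ^+ 2 * (E * i) + kap ^+ 2 * (E * i))))).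
  apply: lerD => //; apply: (le_trans NE); rewrite ler_wpM2l ?sqr_ge0//.
  exact: lerD.
rewrite -subr_ge0; apply: (@le_trans _ _ (t * i)); first exact: mulr_ge0.
by rewrite le_eqVlt; apply/orP; left; apply/eqP; ring.
Qed.

Lemma le_of_sqr_le c x y N : 0 <= c -> 0 <= x -> 0 <= y ->
  N ^+ 2 <= c ^+ 2 * (x ^+ 2 + y ^+ 2) -> N <= c * (x + y).
Proof.
move=> c0 x0 y0 h; have s0 : 0 <= c * (x + y) by rewrite mulr_ge0// addr_ge0.
have [N0|/ltW N0] := leP 0 N; last exact: le_trans N0 s0.
rewrite -ler_sqr ?nnegrE//; apply: (le_trans h); rewrite exprMn ler_wpM2l ?sqr_ge0//.
by rewrite sqrrD -addrA [leRHS]addrCA lerDr mulrn_wge0// mulr_ge0.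
Qed.

End solution_constant_bounds.

Lemma subr_sum4 {M : zmodType} (x y z t x' y' z' t' : M) : x + y + z + t = x' + y' + z' + t' ->
  x - x' + (y - y') + (z - z') + (t - t') = 0.
Proof. by move=> e; rewrite (addrACA x) -opprD (addrACA (x + y)) -opprD (addrACA (x + y + z)) -opprD e subrr. Qed.

Lemma isolate_summand {M : zmodType} (x y z t s : M) : x + y + z + t = s -> y = s - x - z - t.
Proof. by move=> <-; apply/eqP; rewrite eq_sym !subr_eq (addrC _ x) !addrA addrAC. Qed.

(** * Existence, uniqueness and the estimate on the domain *)

Section solution.
Context {R : realType} {d k : nat} (W : set 'rV[R]_d) (mW : measurable W).
Notation mu := (lebesgue_rV R d).
Notation nu := (restr mu mW).
Notation leb := (@lebesgue_measure R).
Notation H := (L2space nu k).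
Notation vfield := ('rV[R]_d -> 'cV[R]_k).
Notation class := (@class_on R d k W mW).
Context (V : set vfield) (P : vfield -> vfield) (skewP : skew_adjoint W V P).
Context (N : vfield -> R) (c1 c2 : R).
Hypotheses (c1_gt0 : 0 < c1) (c2_gt0 : 0 < c2).
Hypothesis normN : forall v, V v -> c1 * graph_norm W P v <= N v /\ N v <= c2 * graph_norm W P v.
Context (Cl Cu Bb Bq : R) (Cl_gt0 : 0 < Cl) (a b : 'rV[R]_d -> 'M[R]_k) (q : R -> 'rV[R]_d -> 'M[R]_k).
Hypotheses (aL : inLinf W a) (asym : symmetric_ae W a) (acoer : coercive_bounds W Cl Cu a).
Hypotheses (bL : inLinf W b) (bB : (Linfnorm W b <= Bb%:E)%E).
Hypotheses (qL : inL1Linf W q).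
Hypothesis q0 : {ae leb, forall t, t < 0 -> q t = cst 0 %[ae mu in W]}.
Hypothesis qB : (L1Linfnorm W q <= Bq%:E)%E.
Context (f f' : R -> vfield) (fH1 : inH1loc W f f') (f0 : is_causal W f).

Local Notation beta := (k%:R * bound_b Bb).
Local Notation kap := (k%:R * bound_q Bq).

Let EC : evolution_coefficients (@L2ip _ _ _ nu k) (op_a a) (op_b b) (op_q q) Cl Cu beta kap.
Proof. exact: coefficients. Qed.

Let ipP : inner_product (@L2ip _ _ _ nu k).
Proof. exact: L2_inner_product. Qed.

Let PP : skew_adjoint_op (@L2ip _ _ _ nu k) (@domain_class R d k W mW V) (@op_class _ _ _ W mW P).
Proof. exact: op_class_skew_adjoint. Qed.

Lemma V_class_norm v : V v -> 0 <= N v /\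
  N v ^+ 2 <= c2 ^+ 2 * (`|class v| ^+ 2 + `|op_class P (class v)| ^+ 2).
Proof.
move=> Vv; have [n1 n2] := normN Vv; have [h1 h2] := skew_adjoint_L2 skewP Vv.
have [_ oE] := op_classE mW skewP Vv.
have gE : graph_norm W P v ^+ 2 = `|class v| ^+ 2 + `|op_class P (class v)| ^+ 2.
  rewrite /graph_norm sqr_sqrtr; last by rewrite addr_ge0 ?sqr_ge0.
  by rewrite (class_on_norm mW h1) (class_on_norm mW h2) oE.
have g0 : 0 <= graph_norm W P v by exact: sqrtr_ge0.
have N0 : 0 <= N v by apply: le_trans n1; rewrite mulr_ge0// ltW.
by split=> //; rewrite -gE -exprMn ler_sqr ?nnegrE// mulr_ge0// ltW.
Qed.

Lemma V_difference v1 v2 : V v1 -> V v2 -> V (v1 \- v2) /\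
  N (v1 \- v2) <= c2 * (`|class v1 - class v2| + `|op_class P (class v1) - op_class P (class v2)|).
Proof.
move=> V1 V2; have [V0 Vlin] := skew_adjoint_subspace skewP.
have [h1 _] := skew_adjoint_L2 skewP V1; have [h2 _] := skew_adjoint_L2 skewP V2.
have V12 : V (v1 \- v2) by rewrite subE; exact: Vlin.
split=> //; have [N0 N2] := V_class_norm V12.
have [D1 _] := op_classE mW skewP V1; have [D2 _] := op_classE mW skewP V2.
have [_ oB] := saB PP D1 D2.
apply: (le_of_sqr_le (ltW c2_gt0) (normr_ge0 _) (normr_ge0 _)); apply: (le_trans N2).
rewrite (class_onB mW h1 h2) oB; exact: lexx.
Qed.

Lemma solution_class v v' : causal_solution W V P N a b q f v v' ->
  [/\ causal_curve (class_curve mW v), forall t : R, is_derive t 1 (class_curve mW v) (class (v' t)),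
      forall t, domain_class V (class (v t)) &
      forall t, op_a a (class (v' t)) + op_class P (class (v t)) + op_b b (class (v t)) +
        op_q q (class_curve mW v) t = class (f t)].
Proof.
move=> [[cv cv' dv] Vv _ v0 eqv].
have [mv hv _] := cv; have [_ hv' _] := cv'.
have vc : causal_curve (class_curve mW v) by exact: class_causal_curve.
split=> //; first exact/(class_derivative mW hv hv').
  by move=> t; have [] := op_classE mW skewP (Vv t).
move=> t; have hf : inL2 W (f t) by case: fH1 => _ _ _ [].
exact/(equation_class skewP aL bL bB qL q0 qB mv hv vc (hv' t) (Vv t) hf).
Qed.

(** The difference of two solutions satisfies the equation with zero data, and P contributes nothing
    to its energy by skew-symmetry; the energy estimate bounds it by the primitive of 0. *)
Lemma solution_unique v v' u u' : causal_solution W V P N a b q f v v' ->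
  causal_solution W V P N a b q f u u' -> forall t, v t = u t %[ae mu in W].
Proof.
move=> sv su t.
have [vc vD vV vE] := solution_class sv; have [uc uD uV uE] := solution_class su.
have z2 : causal_curve (fun=> 0 : H) by exact: causal_curve_cst0.
have dc := causal_curveB vc uc.
have := @energy_estimate _ _ _ ipP _ _ _ _ _ _ _ EC
  (fun t => class_curve mW v t - class_curve mW u t) (fun t => class (v' t) - class (u' t))
  (fun=> 0) (fun t => op_class P (class (v t) - class (u t))) t dc z2.
have D (s : R) : is_derive s 1 (fun t => class_curve mW v t - class_curve mW u t)
    (class (v' s) - class (u' s)).
  exact: is_deriveB.
move=> /(_ D) h.
have Vd s : domain_class V (class (v s) - class (u s)) by case: (saB PP (vV s) (uV s)).
have : `|class_curve mW v t - class_curve mW u t| ^+ 2 <=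
    growth Cl beta kap t * prim (fun s => `|(0 : H)| ^+ 2) t.
  apply: h => //.
    by move=> s; rewrite (sa_skew0 ipP PP (Vd s)).
  move=> s; rewrite (AB EC) (BB EC) (KB EC)//.
  have [_ ->] := saB PP (vV s) (uV s).
  by apply: subr_sum4; rewrite [LHS](vE s) [RHS](uE s).
have -> : prim (fun s : R => `|(0 : H)| ^+ 2) t = 0.
  by rewrite /prim; under eq_Rintegral do rewrite normr0 expr0n/=; rewrite /Rintegral integral0.
rewrite mulr0 => e; have : `|class_curve mW v t - class_curve mW u t| ^+ 2 == 0.
  by rewrite eq_le e sqr_ge0.
rewrite sqrf_eq0 normr_eq0 subr_eq0 => /eqP.
have [[cv _ _] _ _ _ _] := sv; have [[cu _ _] _ _ _ _] := su.
have [_ hv _] := cv; have [_ hu _] := cu.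
by move=> /(class_on_eqP mW (hv t) (hu t)).
Qed.

Lemma solution_exists : exists u u' : R -> vfield, causal_solution W V P N a b q f u u' /\
  forall t, 0 <= t -> ((L2norm W (u' t) ^+ 2 + N (u t) ^+ 2)%:E <=
    (solution_constant Cl Cu beta kap c2 t)%:E * data_integral W f f' t)%E.
Proof.
have fc := data_causal mW fH1 f0; have wf := data_represents mW fH1.
have loc := data_derivative_loc mW fH1; have weak := data_weak mW fH1.
have mf' : joint_measurable W f' by case: fH1 => _ [].
have je' : jointly_measurable (extension W f') by exact: measurable_joint_extend0.
pose Phi T := fine (\int[leb]_(r in `]0%R, T]) sqint nu (extension W f' r))%E.
have H1 T e : 0 <= T -> 0 < e ->
    prim (fun s => `|diff_quot e (class_curve mW f) s| ^+ 2) T <= Phi T.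
  move=> T0 e0; rewrite -lee_fin [leRHS]fineK; last first.
    by rewrite ge0_fin_numE ?integral_ge0// => r _; exact: sqint_ge0.
  exact: (difference_quotient_bound wf fc je' loc weak T e0).
have H2 T e : 0 < e -> exists M, forall n m, (M <= n)%N -> (M <= m)%N ->
    prim (fun s => `|diff_quot n.+1%:R^-1 (class_curve mW f) s -
      diff_quot m.+1%:R^-1 (class_curve mW f) s| ^+ 2) T <= e.
  by move=> e0; exact: (difference_quotient_cauchy wf fc je' loc weak T e0).
have [u [du [uc duc uD uE ub]]] := abstract_existence ipP PP EC fc H1 H2.
have [w wu] := causal_curve_representative uc.
have [w' wdu] := causal_curve_representative duc.
have [mw hw cw] := class_of_representative wu.
have [mw' hw' cw'] := class_of_representative wdu.
have cwf : (fun t => class (w t)) = u by apply/funext.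
have cwf' : (fun t => class (w' t)) = du by apply/funext.
have Vw t : V (w t) by apply: (domain_class_on skewP (hw t)); rewrite cw; case: (uE t).
(* Solving for P u shows that it is continuous in time, all other terms being so; with continuity of
   u this is continuity in the graph norm, hence in V. *)
have opE t : op_class P (u t) = class_curve mW f t - op_a a (du t) - op_b b (u t) - op_q q u t.
  by apply: isolate_summand; have [_ e] := uE t; exact: e.
have ac : causal_curve (fun t => op_a a (du t)).
  apply: (causal_curve_lipschitz (C := Cu)) => //; last exact: (A0 EC).
  by move=> x y; rewrite -(AB EC); exact: (A_bound ipP EC).
have bc : causal_curve (fun t => op_b b (u t)).
  apply: (causal_curve_lipschitz (C := beta)) => //; last exact: (B0 EC).
  by move=> x y; rewrite -(BB EC); exact: (ec_B_bound EC).
have qc : causal_curve (op_q q u) by exact: (K_causal EC).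
have opc : causal_curve (fun t => op_class P (u t)).
  rewrite (_ : (fun t => _) = fun t => class_curve mW f t - op_a a (du t) - op_b b (u t) - op_q q u t).
    by apply: causal_curveB => //; apply: causal_curveB => //; exact: causal_curveB.
  by apply/funext => t; exact: opE.
exists w, w'; split.
  split=> //.
  - split.
    + by apply: (class_continuous (mW := mW)) => //; rewrite cwf; exact: uc.1.
    + by apply: (class_continuous (mW := mW)) => //; rewrite cwf'; exact: duc.1.
    + by apply/(class_derivative mW hw hw') => t; rewrite cwf cw'; exact: uD.
  - move=> t; apply/cvgrPdist_le => e e0.
    have e2 : 0 < e / (c2 * 2) by rewrite divr_gt0// mulr_gt0.
    have /cvgrPdist_le/(_ _ e2) n1 := uc.1 t; have /cvgrPdist_le/(_ _ e2) n2 := opc.1 t.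
    apply: filterS2 n1 n2 => s n1 n2.
    have [Vd Nd] := V_difference (Vw s) (Vw t); have [N0 _] := V_class_norm Vd.
    rewrite sub0r normrN ger0_norm//; apply: (le_trans Nd).
    rewrite !cw (distrC (u s)) (distrC (op_class P (u s))) mulrC -ler_pdivlMr//.
    apply: (le_trans (lerD n1 n2)); rewrite le_eqVlt; apply/orP; left; apply/eqP.
    by field; rewrite gt_eqF.
  - move=> t t0; apply/(class_on_eqP mW) => //.
      have := isL2_inL2 (mW := mW) (isL20 nu (k := k)); exact.
    rewrite cw uc.2 ?(ltW t0)//; apply/esym; apply: class_on_eq.
      have := isL2_inL2 (mW := mW) (isL20 nu (k := k)); exact.
    by have /ae_restr := L2zeroE nu k; apply: filterS => x h Wx; exact/esym/h.
  - move=> t; have hf : inL2 W (f t) by case: fH1 => _ _ _ [].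
    have wc : causal_curve (fun t => class (w t)) by rewrite cwf.
    apply/(equation_class skewP aL bL bB qL q0 qB mw hw wc (hw' t) (Vw t) hf).
    by rewrite cwf cw cw'; case: (uE t).
move=> t t0; have [i i0 iE] := data_integral_fin mW fH1 t.
rewrite iE -EFinM lee_fin (class_on_norm mW (hw' t)) cw'.
have [N0 NE] := V_class_norm (Vw t); rewrite cw in NE.
have beta0 : 0 <= beta by rewrite mulr_ge0 ?bound_b_ge0.
have kap0 : 0 <= kap by rewrite mulr_ge0 ?(ltW (bound_q_gt0 _)).
have Phi_le : Phi t <= i.
  rewrite -lee_fin -iE [leLHS]fineK; first exact: le_data_integral.
  by rewrite ge0_fin_numE ?integral_ge0// => r _; exact: sqint_ge0.
have prim_le s : s <= t -> prim (fun s => `|class_curve mW f s| ^+ 2) s <= i.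
  move=> st; rewrite -lee_fin -iE; apply: le_trans (prim_data_le mW fH1 f0 s) _.
  exact: le_data_integral_mono.
have E0 s : 0 <= s -> s <= t -> 0 <= growth Cl beta kap s /\ growth Cl beta kap s <= growth Cl beta kap t.
  exact: le_growth.
have [Et0 _] := E0 t t0 (lexx t).
have us s : s <= t -> `|u s| ^+ 2 <= growth Cl beta kap t * i.
  move=> st; have [s0|s0] := leP s 0; first by rewrite uc.2// normr0 expr0n/= mulr_ge0.
  have [h _] := ub s (ltW s0); apply: (le_trans h).
  have [E1 E2] := E0 s (ltW s0) st; apply: ler_pM => //; last exact: prim_le.
  by apply: prim_ge0 => r _; exact: sqr_ge0.
(* A bound for u on the whole past of t, as required by the memory term. *)
pose m := Num.sqrt (growth Cl beta kap t * i).
have m2 : m ^+ 2 = growth Cl beta kap t * i by rewrite sqr_sqrtr// mulr_ge0.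
have m0 : 0 <= m by exact: sqrtr_ge0.
have um s : s <= t -> `|u s| <= m by move=> st; rewrite -ler_sqr ?nnegrE// m2 us.
apply: (solution_constant_bound (u := `|u t|) (f := `|class_curve mW f t|) (m := m)
  (p := `|op_class P (u t)|) t0 i0) => //.
- exact: us.
- have [_ h] := ub t t0; apply: (le_trans h); exact: ler_wpM2l.
- by rewrite m2.
- exact: (data_norm_le mW fH1 f0 t0 iE).
- rewrite opE; apply: (le_trans (ler_normB _ _)); apply: lerD; last exact: (ec_K_bound EC).
  apply: (le_trans (ler_normB _ _)); apply: lerD; last exact: (ec_B_bound EC).
  by apply: (le_trans (ler_normB _ _)); rewrite lerD2l; exact: (A_bound ipP EC).
Qed.

End solution.

(** C is chosen before a, b, q and f, so it depends on them only through Cl, Cu, Bb and Bq; besides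
    these it involves k and the constant [c2] comparing N to the graph norm. *)
Theorem theorem1 (R : realType) (d k : nat) (W : set 'rV[R]_d)
    (p : 'I_d -> 'M[R]_k) (D V : set ('rV[R]_d -> 'cV[R]_k))
    (P : ('rV[R]_d -> 'cV[R]_k) -> ('rV[R]_d -> 'cV[R]_k))
    (N : ('rV[R]_d -> 'cV[R]_k) -> R)
    (domW : is_domain W)
    (psym : forall j, (p j)^T = p j)
    (initD : initial_domain W p D)
    (skewP : skew_adjoint W V P)
    (extP : extends_pnabla W p D V P)
    (normN : V_norm W V P N)
    (Cl Cu Bb Bq : R) (Cl_gt0 : 0 < Cl) (Cl_le_Cu : Cl <= Cu) :
  exists C : R -> R,
    [/\ forall t, 0 <= t -> 0 <= C t,
        forall s t, 0 <= s -> s < t -> C s < C t &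
        forall (a b : 'rV[R]_d -> 'M[R]_k) (q : R -> 'rV[R]_d -> 'M[R]_k)
               (f f' : R -> 'rV[R]_d -> 'cV[R]_k),
          inLinf W a -> symmetric_ae W a -> coercive_bounds W Cl Cu a ->
          inLinf W b -> (Linfnorm W b <= Bb%:E)%E ->
          inL1Linf W q -> {ae @lebesgue_measure R, forall t, symmetric_ae W (q t)} ->
          {ae @lebesgue_measure R, forall t, t < 0 ->
            q t = cst 0 %[ae lebesgue_rV R d in W]} ->
          (L1Linfnorm W q <= Bq%:E)%E ->
          inH1loc W f f' -> is_causal W f ->
          exists u u' : R -> 'rV[R]_d -> 'cV[R]_k,
            [/\ causal_solution W V P N a b q f u u',
                forall v v', causal_solution W V P N a b q f v v' ->
                  forall t, v t = u t %[ae lebesgue_rV R d in W] &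
                forall t, 0 <= t ->
                  ((L2norm W (u' t) ^+ 2 + N (u t) ^+ 2)%:E <=
                   (C t)%:E * \int[@lebesgue_measure R]_(tau in `[0%R, t])
                     (L2sqnorm W (f tau) + L2sqnorm W (f' tau)))%E]].
Proof.
have [mW _ _ _] := domW.
have [c1 [c2 [c10 c20 cN]]] := V_norm_equiv normN.
have beta0 : 0 <= k%:R * bound_b Bb by rewrite mulr_ge0 ?bound_b_ge0.
have kap0 : 0 <= k%:R * bound_q Bq by rewrite mulr_ge0 ?(ltW (bound_q_gt0 _)).
exists (solution_constant Cl Cu (k%:R * bound_b Bb) (k%:R * bound_q Bq) c2); split.
- by move=> t; exact: solution_constant_ge0.
- by move=> s t; exact: solution_constant_lt.
move=> a b q f f' aL asym acoer bL bB qL _ q0 qB fH1 f0.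
have [u [u' [su ub]]] := solution_exists mW skewP c10 c20 cN Cl_gt0 aL asym acoer bL bB qL q0 qB fH1 f0.
exists u, u'; split=> // v v' sv.
exact: (solution_unique mW skewP Cl_gt0 aL asym acoer bL bB qL q0 qB fH1 sv su).
Qed.
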